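(* Let $n\ge2$. For every $s\in\mathbb R$ and for every $t>-n/2$, the stability estimate $$ \|f\|^2_{H^s_t(\mathbb R^n;\mathbb C^n)}\le 2a_n\Big(\sum_{i=1}^n\|\Xi_i(I^0f)\|^2_{H^{s+1/2}_{t+1/2}(T\mathbb S^{n-1})}+\|I^0f\|^2_{H^{s+1/2}_{t+1/2}(T\mathbb S^{n-1})}+\|I^1f\|^2_{H^{s+3/2}_{t+3/2}(T\mathbb S^{n-1})}\Big) $$ holds for all $f\in H^s_t(\mathbb R^n;\mathbb C^n)$, where $a_n=\dfrac{\Gamma((n-1)/2)}{2\pi^{(n-1)/2}}$.
   Context: Upper and lower indices are not distinguished; $\mathrm i$ is the imaginary unit; $\langle\cdot,\cdot\rangle$ is the dot product on $\mathbb R^n$. $T\mathbb S^{n-1}=\{(x,\xi)\in\mathbb R^n\times\mathbb R^n: |\xi|=1,\ \langle x,\xi\rangle=0\}$ is the tangent bundle of the unit sphere, and $\mathcal S(T\mathbb S^{n-1})$ is the Schwartz space of this vector bundle over $\mathbb S^{n-1}$. For a vector field $f=(f_i)\in\mathcal S(\mathbb R^n;\mathbb C^n)$ and $k=0,1,\dots$, the momentum ray transform $I^kf\in\mathcal S(T\mathbb S^{n-1})$ is $(I^kf)(x,\xi)=\int_{-\infty}^\infty \tau^k\sum_i f_i(x+\tau\xi)\xi^i\,d\tau$. Operators $\Xi_i$ ($1\le i\le n$): on $\mathbb R^n\times(\mathbb R^n\setminus\{0\})$ put $\tilde\Xi_i=\frac{\partial}{\partial\xi^i}-x_i\sum_p\xi^p\frac{\partial}{\partial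 x^p}-\xi_i\sum_p\xi^p\frac{\partial}{\partial\xi^p}$. At points of $T\mathbb S^{n-1}$ these vector fields are tangent to $T\mathbb S^{n-1}$; their restrictions $\Xi_i$ are smooth vector fields on $T\mathbb S^{n-1}$, regarded as first order differential operators. Fourier transforms: $\widehat f(y)=(2\pi)^{-n/2}\int_{\mathbb R^n}e^{-\mathrm i\langle y,x\rangle}f(x)\,dx$ on $\mathbb R^n$; for $\varphi\in\mathcal S(T\mathbb S^{n-1})$, $\widehat\varphi(y,\xi)=(2\pi)^{-(n-1)/2}\int_{\xi^\perp}e^{-\mathrm i\langle y,x\rangle}\varphi(x,\xi)\,dx$ for $(y,\xi)\in T\mathbb S^{n-1}$, where $\xi^\perp$ is the hyperplane orthogonal to $\xi$. Spaces: $H^s_t(\mathbb R^n)$ ($s\in\mathbb R$, $t>-n/2$) is the completion of $\mathcal S(\mathbb R^n)$ in the norm $\|f\|^2_{H^s_t(\mathbb R^n)}=\int_{\mathbb R^n}|y|^{2t}(1+|y|^2)^{s-t}|\widehat f(y)|^2\,dy$; for vector fields $\|f\|^2_{H^s_t(\mathbb R^n;\mathbb C^n)}=\sum_i\|f_i\|^2_{H^s_t(\mathbb R^n)}$. $H^s_t(T\mathbb S^{n-1})$ ($s\in\mathbb R$, $t>-(n-1)/2$) is the completion of $\mathcal S(T\mathbb S^{n-1})$ in the norm $\|\varphi\|^2_{H^s_t(T\mathbb S^{n-1})}=\frac1{2\pi}\int_{\mathbb S^{n-1}}\int_{\xi^\perp}|y|^{2t}(1+|y|^2)^{s-t}|\widehat\varphi(y,\xi)|^2\,dy\,d\xi$,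 with $d\xi$ the standard volume form on $\mathbb S^{n-1}$; $(\cdot,\cdot)_{H^s_t(T\mathbb S^{n-1})}$ is the corresponding inner product. Extension of $f\mapsto(I^0f,I^1f)$ from Schwartz fields to $H^s_t(\mathbb R^n;\mathbb C^n)$: let $Z$ be the operator defined by $\widehat{Z\varphi}(y,\xi)=\sum_i\frac{y^i}{|y|}(\Xi_i\widehat\varphi)(y,\xi)$ (here $\Xi_i$ acts in the variables $(y,\xi)$), and let $\mathcal H^{1,s}_t(T\mathbb S^{n-1})$ be the completion of $\mathcal S(T\mathbb S^{n-1})\oplus\mathcal S(T\mathbb S^{n-1})$ in the norm $$ \|(\varphi,\psi)\|^2=a_n\Big[\sum_{i=1}^n\|\Xi_i\varphi\|^2_{H^{s+1/2}_{t+1/2}(T\mathbb S^{n-1})}+\|\varphi\|^2_{H^{s+1/2}_{t+1/2}(T\mathbb S^{n-1})}+\|\psi\|^2_{H^{s+3/2}_{t+3/2}(T\mathbb S^{n-1})}+2\,\mathrm{Re}\,(\mathrm i Z\varphi,\psi)_{H^{s+1}_{t+1}(T\mathbb S^{n-1})}\Big]. $$ The map $f\mapsto(I^0f,I^1f)$ on $\mathcal S(\mathbb R^n;\mathbb C^n)$ extends to a linear isometric embedding $H^s_t(\mathbb R^n;\mathbb C^n)\to\mathcal H^{1,s}_t(T\mathbb S^{n-1})$. *)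

(* Defs.v *)
From HB Require Import structures.
From mathcomp Require Import all_boot all_order all_algebra.
From mathcomp Require Import complex.
From mathcomp Require Import all_classical all_reals all_analysis.

Set Implicit Arguments.
Unset Strict Implicit.
Unset Printing Implicit Defensive.

Import Order.TTheory GRing.Theory Num.Theory.
Import numFieldNormedType.Exports.

Local Open Scope classical_set_scope.
Local Open Scope ring_scope.
Local Open Scope complex_scope.

(* Lebesgue measure on R^n, carried by n.-tuple R, whose sigma-algebra is the
   product one; it is built by iterating the product measure. *)
Section LebesgueTuple.
Variable R : realType.
Local Notation T := (measurableTypeR R).

Definition cons_tuple n (p : T * n.-tuple T) : n.+1.-tuple T :=
  [the n.+1.-tuple T of p.1 :: p.2].

Lemma measurable_cons_tuple n : measurable_fun setT (@cons_tuple n).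
Proof. exact: measurable_cons. Qed.

Section step.
Variables (n : nat) (m : {sigma_finite_measure set (n.-tuple T) -> \bar R}).

Definition cons_measure : set (n.+1.-tuple T) -> \bar R :=
  pushforward ((@lebesgue_measure R) \x m)%E (@cons_tuple n).

Let pre (A : set (n.+1.-tuple T)) :
  measurable A -> measurable (@cons_tuple n @^-1` A).
Proof.
by move=> mA; rewrite -[X in measurable X]setTI; exact: measurable_cons_tuple.
Qed.

Let cons_measure0 : cons_measure set0 = 0%E.
Proof. by rewrite /cons_measure /pushforward preimage_set0 measure0. Qed.

Let cons_measure_ge0 A : (0 <= cons_measure A)%E.
Proof. by rewrite /cons_measure /pushforward; apply: measure_ge0. Qed.

Let cons_measure_sigma_additive : semi_sigma_additive cons_measure.
Proof.
move=> F mF tF mUF; rewrite /cons_measure /pushforward preimage_bigcup.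
apply: measure_semi_sigma_additive => [k||]; first exact: pre.
- apply/trivIsetP => /= i j _ _ ij; rewrite -preimage_setI.
  by move/trivIsetP : tF => /(_ _ _ _ _ ij) ->//; rewrite preimage_set0.
- by rewrite -preimage_bigcup; exact: pre.
Qed.

HB.instance Definition _ := isMeasure.Build _ _ _ cons_measure
  cons_measure0 cons_measure_ge0 cons_measure_sigma_additive.

Lemma cons_measure_sigma_finite : sigma_finite setT cons_measure.
Proof.
have /sigma_finiteP[G [TG ndG Goo]] := sigma_finiteT (@lebesgue_measure R).
have /sigma_finiteP[H [TH ndH Hoo]] := sigma_finiteT m.
pose g (u : n.+1.-tuple T) : T * n.-tuple T :=
  (thead u, [tuple of behead u]).
have mg : measurable_fun setT g.
  apply/measurable_fun_pairP; split; first exact: measurable_tnth.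
  exact: measurable_behead.
have gK : cancel (@cons_tuple n) g.
  by move=> [a v]; rewrite /g /cons_tuple/=; congr pair; apply: val_inj.
exists (fun k => g @^-1` (G k `*` H k)).
  apply/seteqP; split => // u _.
  have [i _ Gi] : (\bigcup_i G i) (g u).1 by rewrite -TG.
  have [j _ Hj] : (\bigcup_i H i) (g u).2 by rewrite -TH.
  exists (maxn i j) => //; split.
    by move: Gi; exact/subsetPset/ndG/leq_maxl.
  by move: Hj; exact/subsetPset/ndH/leq_maxr.
move=> k; have [mG ltG] := Goo k; have [mH ltH] := Hoo k.
split; first by rewrite -[X in measurable X]setTI; apply: mg => //; exact: measurableX.
rewrite /cons_measure /pushforward -comp_preimage.
suff -> : (g \o @cons_tuple n) @^-1` (G k `*` H k) = G k `*` H k.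
  by rewrite product_measure1E// lte_mul_pinfty// ge0_fin_numE.
suff -> : g \o @cons_tuple n = id by [].
by apply/funext.
Qed.

HB.instance Definition _ :=
  Measure_isSigmaFinite.Build _ _ _ cons_measure cons_measure_sigma_finite.

End step.

Fixpoint lebesgue_tuple n : {sigma_finite_measure set (n.-tuple T) -> \bar R} :=
  match n with
  | 0 => \d_([tuple] : 0.-tuple T)
  | k.+1 => cons_measure (lebesgue_tuple k)
  end.
End LebesgueTuple.

(* Completion of the subspace D of V in the seminorm N, as the set of the
   equivalence classes of N-Cauchy sequences of elements of D; a class is a set
   of sequences.  The embedding of D maps x to the class of the constant
   sequence x. *)
Section Completion.
Variables (R : realType) (V : zmodType) (D : set V) (N : V -> R).

Definition cauchy_seq (u : nat -> V) : Prop :=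
  (forall k, D (u k)) /\
  forall e, 0 < e ->
    exists K, forall j k, (K <= j)%N -> (K <= k)%N -> N (u j - u k) < e.

Definition class_of_seq (u : nat -> V) : set (nat -> V) :=
  [set w | cauchy_seq w /\ (fun k => N (w k - u k)) @ \oo --> 0].

Definition completion : set (set (nat -> V)) :=
  [set c | exists2 u, cauchy_seq u & c = class_of_seq u].

Definition completion_norm (c : set (nat -> V)) : R :=
  get [set l | exists2 u, c u & (N \o u) @ \oo --> l].

End Completion.

(* Image of a class c of sequences under the extension by continuity of T,
   the target being the completion of D in the seminorm N. *)
Definition completion_map (R : realType) (V W : zmodType) (D : set W)
    (N : W -> R) (T : V -> W) (c : set (nat -> V)) : set (nat -> W) :=
  \bigcup_(u in c) class_of_seq D N (T \o u).

Local Notation Re := complex.Re.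
Local Notation Im := complex.Im.

Section Smooth.
Variables (R : realType) (V : normedModType R).

Definition iter_derive (vs : seq V) (f : V -> R) : V -> R :=
  foldr (fun v g => 'D_v g) f vs.

(* C^oo on an open set U: all iterated directional derivatives exist and are
   continuous on U. *)
Definition smooth_on (U : set V) (f : V -> R) : Prop :=
  forall vs x, U x ->
    {for x, continuous (iter_derive vs f)} /\
    forall v, derivable (iter_derive vs f) x v.

Definition cderive (v : V) (f : V -> R[i]) (x : V) : R[i] :=
  'D_v (fun z => Re (f z)) x +i* 'D_v (fun z => Im (f z)) x.

End Smooth.

Section Integrals.
Variable R : realType.
Local Notation C := R[i].

Definition cintegral d (T : measurableType d)
    (mu : {measure set T -> \bar R}) (f : T -> C) : C :=
  (\int[mu]_x Re (f x)) +i* (\int[mu]_x Im (f x)).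

Definition expi (a : R) : C := cos a +i* sin a.

Definition Gamma (z : R) : R :=
  \int[@lebesgue_measure R]_(x in `]0, +oo[) (x `^ (z - 1) * expR (- x)).

Variable n : nat.
Local Notation E := 'rV[R]_n.

Definition dotp (x y : E) : R := \sum_i x 0 i * y 0 i.

(* Euclidean norm; the norm `|x| of the library on 'rV[R]_n is the sup norm *)
Definition enorm (x : E) : R := Num.sqrt (dotp x x).

Definition basis_vec (i : 'I_n) : E := delta_mx 0 i.

Definition vec_of m (x : m.-tuple R) : 'rV[R]_m := \row_i tnth x i.

(* The rows form an orthonormal basis of the hyperplane orthogonal to xi
   (when |xi| = 1). *)
Definition hyperplane_frame (xi : E) : 'M[R]_(n.-1, n) :=
  xget 0 [set B | B *m B^T = 1%:M /\ B *m xi^T = 0].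

Definition hyperplane_point (xi : E) (u : n.-1.-tuple R) : E :=
  vec_of u *m hyperplane_frame xi.

(* The volume of the unit sphere is given by cones:
   sigma(A) = n * Leb {r xi | 0 < r <= 1, xi in A}. *)
Definition sphere_integral (g : E -> \bar R) : \bar R :=
  (n%:R%:E * \int[lebesgue_tuple R n]_(x in
     [set x : n.-tuple R | (0 < enorm (vec_of x) <= 1)%R])
       g ((enorm (vec_of x))^-1 *: vec_of x)%R)%E.

(* Integral over the tangent bundle of the sphere, d xi-integral of the
   integrals over the fibres. *)
Definition bundle_integral (G : E * E -> R) : \bar R :=
  sphere_integral (fun xi =>
    (\int[lebesgue_tuple R n.-1]_u (G (hyperplane_point xi u, xi))%:E)%E).

Definition bundle_cintegral (G : E * E -> C) : C :=
  fine (bundle_integral (fun p => Re (G p)))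
  +i* fine (bundle_integral (fun p => Im (G p))).

(* |y|^(2t) (1 + |y|^2)^(s-t) *)
Definition weight (s t : R) (y : E) : R :=
  enorm y `^ (2 * t) * (1 + enorm y ^+ 2) `^ (s - t).

End Integrals.

Section EuclideanSpace.
Variables (R : realType) (n : nat).
Local Notation C := R[i].
Local Notation E := 'rV[R]_n.

Definition rapidly_decreasing (f : E -> R) : Prop :=
  smooth_on setT f /\
  forall N vs, exists M, forall x,
    (1 + enorm x) ^+ N * `|iter_derive vs f x| <= M.

Definition schwartz : set (E -> C) :=
  [set f | rapidly_decreasing (fun x => Re (f x)) /\
           rapidly_decreasing (fun x => Im (f x))].

Definition schwartz_field : set ('I_n -> E -> C) :=
  [set f | forall i, schwartz (f i)].

Definition fourier (f : E -> C) (y : E) : C :=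
  ((2 * pi) `^ (- (n%:R / 2)))%:C *
  cintegral (lebesgue_tuple R n)
    (fun x => expi (- dotp y (vec_of x)) * f (vec_of x)).

Definition sobolev_normsq (s t : R) (f : E -> C) : R :=
  \int[lebesgue_tuple R n]_x
    (weight s t (vec_of x) * Re (fourier f (vec_of x) * (fourier f (vec_of x))^*)).

(* H^s_t(R^n; C^n) *)
Definition field_norm (s t : R) (f : 'I_n -> E -> C) : R :=
  Num.sqrt (\sum_i sobolev_normsq s t (f i)).

Definition field_space (s t : R) : set (set (nat -> 'I_n -> E -> C)) :=
  completion schwartz_field (field_norm s t).

Definition field_space_norm (s t : R) (f : set (nat -> 'I_n -> E -> C)) : R :=
  completion_norm (field_norm s t) f.

Definition ray_transform (k : nat) (f : 'I_n -> E -> C) (p : E * E) : C :=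
  cintegral (@lebesgue_measure R) (fun tau =>
    (tau ^+ k)%:C * \sum_i f i (p.1 + tau *: p.2) * (p.2 0 i)%:C).

End EuclideanSpace.

(* Functions on the tangent bundle of the unit sphere are represented by
   functions on R^n * R^n of which only the values on that bundle matter. *)
Section TangentBundle.
Variables (R : realType) (n : nat).
Local Notation C := R[i].
Local Notation E := 'rV[R]_n.

Definition bundle : set (E * E) :=
  [set p | enorm p.2 = 1 /\ dotp p.1 p.2 = 0].

(* Smooth retraction of R^n * (R^n \ 0) onto the bundle: g is smooth on the
   bundle iff g \o retract is smooth on R^n * (R^n \ 0). *)
Definition retract (p : E * E) : E * E :=
  (p.1 - (dotp p.1 p.2 / dotp p.2 p.2) *: p.2, (enorm p.2)^-1 *: p.2).

Definition bundle_rapidly_decreasing (g : E * E -> R) : Prop :=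
  smooth_on [set p | p.2 != 0] (g \o retract) /\
  forall N vs, exists M, forall p, bundle p ->
    (1 + enorm p.1) ^+ N * `|iter_derive vs (g \o retract) p| <= M.

Definition bundle_schwartz : set (E * E -> C) :=
  [set phi | bundle_rapidly_decreasing (fun p => Re (phi p)) /\
             bundle_rapidly_decreasing (fun p => Im (phi p))].

Definition dx (i : 'I_n) (phi : E * E -> C) : E * E -> C :=
  cderive (basis_vec R i, 0) phi.

Definition dxi (i : 'I_n) (phi : E * E -> C) : E * E -> C :=
  cderive (0, basis_vec R i) phi.

Definition tXi (i : 'I_n) (Phi : E * E -> C) (p : E * E) : C :=
  dxi i Phi p
  - (p.1 0 i)%:C * \sum_j (p.2 0 j)%:C * dx j Phi p
  - (p.2 0 i)%:C * \sum_j (p.2 0 j)%:C * dxi j Phi p.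

(* tXi i being tangent to the bundle, its restriction is computed on any smooth
   extension of phi. *)
Definition Xi (i : 'I_n) (phi : E * E -> C) : E * E -> C :=
  tXi i (phi \o retract).

Definition bundle_fourier (phi : E * E -> C) (p : E * E) : C :=
  ((2 * pi) `^ (- ((n%:R - 1) / 2)))%:C *
  cintegral (lebesgue_tuple R n.-1) (fun u =>
    expi (- dotp p.1 (hyperplane_point p.2 u)) *
    phi (hyperplane_point p.2 u, p.2)).

(* inner product of H^s_t on the bundle, in terms of the Fourier transforms
   F and G of its arguments *)
Definition fourier_ip (s t : R) (F G : E * E -> C) : C :=
  ((2 * pi)^-1)%:C *
  bundle_cintegral (fun p => (weight s t p.1)%:C * (F p * (G p)^*)).

Definition bundle_normsq (s t : R) (phi : E * E -> C) : R :=
  Re (fourier_ip s t (bundle_fourier phi) (bundle_fourier phi)).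

Definition bundle_norm (s t : R) (phi : E * E -> C) : R :=
  Num.sqrt (bundle_normsq s t phi).

Definition bundle_cauchy (s t : R) : set (nat -> E * E -> C) :=
  cauchy_seq bundle_schwartz (bundle_norm s t).

(* norm, in the completion, of the limit of a Cauchy sequence *)
Definition bundle_limit_norm (s t : R) (u : nat -> E * E -> C) : R :=
  completion_norm (bundle_norm s t)
    (class_of_seq bundle_schwartz (bundle_norm s t) u).

(* Fourier transform of Z phi *)
Definition Z_fourier (phi : E * E -> C) (p : E * E) : C :=
  \sum_i (p.1 0 i / enorm p.1)%:C * Xi i (bundle_fourier phi) p.

End TangentBundle.

Section PairSpace.
Variables (R : realType) (n : nat).
Local Notation C := R[i].
Local Notation E := 'rV[R]_n.
Local Notation F := (E * E -> C).

Definition a_const : R :=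
  Gamma ((n%:R - 1) / 2) / (2 * pi `^ ((n%:R - 1) / 2)).

Definition schwartz_pair : set (F * F) :=
  [set w | bundle_schwartz w.1 /\ bundle_schwartz w.2].

Definition pair_normsq (s t : R) (w : F * F) : R :=
  a_const *
  (\sum_i bundle_normsq (s + 1 / 2) (t + 1 / 2) (Xi i w.1)
   + bundle_normsq (s + 1 / 2) (t + 1 / 2) w.1
   + bundle_normsq (s + 3 / 2) (t + 3 / 2) w.2
   + 2 * Re (fourier_ip (s + 1) (t + 1)
               (fun p => 'i%C * Z_fourier w.1 p) (bundle_fourier w.2))).

Definition pair_norm (s t : R) (w : F * F) : R :=
  Num.sqrt (pair_normsq s t w).

(* extension by continuity of f |-> (I^0 f, I^1 f) *)
Definition ray_pair_ext (s t : R) (f : set (nat -> 'I_n -> E -> C)) :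
    set (nat -> F * F) :=
  completion_map schwartz_pair (pair_norm s t)
    (fun g => (ray_transform 0 g, ray_transform 1 g)) f.

(* sum_i |Xi_i phi|^2 + |phi|^2 + |psi|^2 for an element c of the completion of
   the space of Schwartz pairs (phi, psi).  The operator
   (phi, psi) |-> ((Xi_i phi)_i, phi, psi) is unbounded for pair_norm and is
   extended to c by closure: c is approximated by Schwartz pairs w whose images
   are Cauchy, and the norms of the limits are taken.  The sum is +oo when
   there is no such w, that is, when c is outside the domain of the closure. *)
Definition stability_sum (s t : R) (c : set (nat -> F * F)) : \bar R :=
  ereal_inf
    [set (\sum_i bundle_limit_norm (s + 1 / 2) (t + 1 / 2)
                   (fun k => Xi i (w k).1) ^+ 2
          + bundle_limit_norm (s + 1 / 2) (t + 1 / 2) (fun k => (w k).1) ^+ 2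
          + bundle_limit_norm (s + 3 / 2) (t + 3 / 2) (fun k => (w k).2) ^+ 2)%:E
    | w in [set w | [/\ c w,
        forall i, bundle_cauchy (s + 1 / 2) (t + 1 / 2) (fun k => Xi i (w k).1),
        bundle_cauchy (s + 1 / 2) (t + 1 / 2) (fun k => (w k).1) &
        bundle_cauchy (s + 3 / 2) (t + 3 / 2) (fun k => (w k).2)]]].

End PairSpace.

(* Main.v *)
(* On Schwartz fields f -> (I^0 f, I^1 f) is an isometry for the norm of the
   context.  On each fibre, the Fourier transforms of I^0 f and I^1 f are full
   Fourier transforms of f by Fubini, so that, up to a constant,
   (Xi_i I^0 f)^ - i y_i (I^1 f)^ and (I^0 f)^ are the components of f^ tangential
   and normal to the sphere.  The cross term 2 Re (i Z phi, psi) is exactly what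
   turns the sum of the three squared norms into the squared norm of these
   components, and the integral over the bundle of a function of y alone is a
   multiple of its integral against dy / |y|.  The cross term is at most the sum
   of the squares, whence the factor 2, and the estimate passes to Cauchy
   sequences by the triangle inequality.

   That Xi_i commutes with the fibrewise Fourier transform requires
   differentiating an integral whose domain, the hyperplane orthogonal to xi,
   moves with xi: smearing it with a Gaussian in the direction xi yields an
   integral over the whole space, where one differentiates under the integral
   sign, and the terms that are odd in the direction xi cancel by reflection. *)
From HB Require Import structures.
Require Import Defs.
From mathcomp Require Import all_boot all_order all_algebra.
From mathcomp Require Import complex.
From mathcomp Require Import all_classical all_reals all_analysis.
From mathcomp Require Import measurable_realfun.
From mathcomp Require Import ring lra.

Set Implicit Arguments.
Unset Strict Implicit.
Unset Printing Implicit Defensive.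

Import Order.TTheory GRing.Theory Num.Theory.
Import numFieldNormedType.Exports.

Local Open Scope classical_set_scope.
Local Open Scope ring_scope.

(** All analysis is done with real functions. The real and imaginary parts of a Fourier transform
    are sums of integrals against cos(<y,x> - th); with the phase th as a parameter, an integration
    by parts is the quarter turn th -> th + pi/2, and sine and cosine never need separate treatment.

    The constant a_n is the inverse of the area of the unit sphere of dimension n - 2, the set of
    the directions xi orthogonal to a given y.

    The pairs (I^0 f, I^1 f) are not shown to be Schwartz. They are placed in a larger class,
    [good_pair], closed under differences, which also contains the Schwartz pairs whose derivatives
    Xi_i phi are Schwartz. On this class the norm of the pair space is a weighted L^2 norm of
    finitely many functions depending linearly on the pair; this yields positivity and the triangle
    inequality, which the defining formula with its cross term does not show.

    The frame of a hyperplane is an arbitrary choice without regularity in xi, so fibre integrals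
    become integrals over the whole space before measurability or derivatives in xi are studied. *)

Definition rv_display : measure_display.
Proof. exact: default_measure_display. Qed.

(** * Lebesgue measure on row vectors *)

Section RowMeasurable.
Context {R : realType} {n : nat}.

(** The sigma-algebra put on row vectors is the one generated by the coordinates: that of tuples,
    carried to a type with matrices and a topology. *)
Let coors : 'I_n -> 'rV[R]_n -> measurableTypeR R := fun i x => x 0 i.

Let rv_set0 : g_sigma_preimage coors set0.
Proof. exact: sigma_algebra0. Qed.

Let rv_setC A : g_sigma_preimage coors A -> g_sigma_preimage coors (~` A).
Proof. exact: sigma_algebraC. Qed.

Let rv_bigcup (F : _^nat) : (forall i, g_sigma_preimage coors (F i)) ->
  g_sigma_preimage coors (\bigcup_i (F i)).
Proof. exact: sigma_algebra_bigcup. Qed.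

HB.instance Definition _ := @isMeasurable.Build rv_display
  'rV[R]_n (g_sigma_preimage coors) rv_set0 rv_setC rv_bigcup.

Lemma measurable_coord (i : 'I_n) :
  measurable_fun [set: 'rV[R]_n] (fun x : 'rV[R]_n => x 0 i).
Proof.
move=> _ Y mY; rewrite setTI; apply: sub_sigma_algebra => /=.
rewrite -bigcup_seq/=; exists i => /=; first by rewrite mem_index_enum.
by exists Y => //; rewrite setTI.
Qed.

Lemma measurable_rvP d (T : measurableType d) (f : T -> 'rV[R]_n) :
  measurable_fun setT f <->
  forall i, measurable_fun setT (fun x => f x 0 i).
Proof.
apply: (@iff_trans _ (g_sigma_preimage
    (fun i => coors i \o f) `<=` measurable)).
  rewrite g_sigma_preimage_comp; split=> [mf A [/= C preC <-]|prefS].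
    exact: mf.
  by move=> _ A mA; apply: prefS; exists A.
split=> [tnthfS i|mf].
- move=> _ A mA.
  apply: tnthfS; apply: sub_sigma_algebra.
  rewrite -bigcup_seq/=; exists i => /=; first by rewrite mem_index_enum.
  by exists A.
- apply: smallest_sub; first exact: sigma_algebra_measurable.
  rewrite -bigcup_seq; apply: bigcup_sub => i Ii.
  by move=> A [B mB <-]; exact: mf.
Qed.

End RowMeasurable.

Section RowMeasurableFun.
Context {R : realType} d (T : measurableType d).

Lemma measurable_rv_coord n (f : T -> 'rV[R]_n) i :
  measurable_fun setT f -> measurable_fun setT (fun x => f x 0 i).
Proof. by move/measurable_rvP. Qed.

Lemma measurable_rvD n (f g : T -> 'rV[R]_n) :
  measurable_fun setT f -> measurable_fun setT g ->
  measurable_fun setT (fun x => f x + g x).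
Proof.
move=> mf mg; apply/measurable_rvP => i.
under eq_fun do rewrite mxE.
by apply: measurable_funD; exact: measurable_rv_coord.
Qed.

Lemma measurable_rvZ n (k : T -> R) (f : T -> 'rV[R]_n) :
  measurable_fun setT k -> measurable_fun setT f ->
  measurable_fun setT (fun x => k x *: f x).
Proof.
move=> mf mg; apply/measurable_rvP => i.
under eq_fun do rewrite mxE.
by apply: measurable_funM => //; exact: measurable_rv_coord.
Qed.

Lemma measurable_rvN n (f : T -> 'rV[R]_n) :
  measurable_fun setT f -> measurable_fun setT (fun x => - f x).
Proof.
move=> mf; under eq_fun do rewrite -scaleN1r.
exact: measurable_rvZ.
Qed.

Lemma measurable_rvB n (f g : T -> 'rV[R]_n) :
  measurable_fun setT f -> measurable_fun setT g ->
  measurable_fun setT (fun x => f x - g x).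
Proof.
by move=> mf mg; apply: measurable_rvD => //; exact: measurable_rvN.
Qed.

Lemma measurable_rv_mulmx n m (f : T -> 'rV[R]_n) (A : 'M[R]_(n, m)) :
  measurable_fun setT f -> measurable_fun setT (fun x => f x *m A).
Proof.
move=> mf; apply/measurable_rvP => i.
under eq_fun do rewrite mxE.
apply: measurable_sum => j.
by apply: measurable_funM => //; exact: measurable_rv_coord.
Qed.

Lemma measurable_dotp n (f g : T -> 'rV[R]_n) :
  measurable_fun setT f -> measurable_fun setT g ->
  measurable_fun setT (fun x => dotp (f x) (g x)).
Proof.
move=> mf mg; apply: measurable_sum => j.
by apply: measurable_funM => //; exact: measurable_rv_coord.
Qed.

Lemma measurable_sqrt_fun (f : T -> R) :
  measurable_fun setT f -> measurable_fun setT (fun x => Num.sqrt (f x)).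
Proof.
move=> mf.
have ms : measurable_fun [set: R] (fun x : R => Num.sqrt x).
  by apply: continuous_measurable_fun; exact: sqrt_continuous.
exact: (measurableT_comp ms mf).
Qed.

Lemma measurable_enorm n (f : T -> 'rV[R]_n) :
  measurable_fun setT f -> measurable_fun setT (fun x => enorm (f x)).
Proof. by move=> mf; apply: measurable_sqrt_fun; exact: measurable_dotp. Qed.

Lemma measurable_invr_fun (f : T -> R) :
  measurable_fun setT f -> measurable_fun setT (fun x => (f x)^-1).
Proof.
move=> mf.
have mi : measurable_fun [set: R] (@GRing.inv R).
  (* The inverse is continuous off 0, and any function is measurable on the single point 0. *)
  have -> : [set: R] = [set x | x != 0] `|` [set 0].
    apply/seteqP; split => // x _ /=.
    by have [->|] := eqVneq x 0; [right|left].
  have mU : measurable [set x : R | x != 0].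
    have -> : [set x : R | x != 0] = ~` [set 0].
      by apply/seteqP; split => x /=; [move/eqP|move/eqP].
    by apply: measurableC.
  apply/measurable_funU => //; split.
    apply: open_continuous_measurable_fun.
      have -> : [set x : R | x != 0] = ~` [set 0].
        by apply/seteqP; split => x /=; [move/eqP|move/eqP].
      by apply: closed_openC; exact: closed_eq.
    by move=> x; rewrite inE/= => x0; exact: inv_continuous.
  exact: measurable_fun_set1.
exact: (measurableT_comp mi mf).
Qed.

End RowMeasurableFun.

Section VecOf.
Context {R : realType} {n : nat}.
Local Notation T := (measurableTypeR R).

Definition tuple_of_rv (x : 'rV[R]_n) : n.-tuple T := [tuple x 0 i | i < n].

Definition rv_of_tuple (x : n.-tuple T) : 'rV[R]_n := vec_of (x : n.-tuple R).

Lemma rv_of_tupleK : cancel rv_of_tuple tuple_of_rv.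
Proof. by move=> x; apply: eq_from_tnth => i; rewrite tnth_mktuple mxE. Qed.

Lemma measurable_rv_of_tuple : measurable_fun setT rv_of_tuple.
Proof.
apply/measurable_rvP => i.
under eq_fun do rewrite mxE.
exact: measurable_tnth.
Qed.

Lemma measurable_tuple_of_rv : measurable_fun setT tuple_of_rv.
Proof.
apply/measurable_fun_tnthP => i.
have -> : @tnth n T ^~ i \o tuple_of_rv = (fun x : 'rV[R]_n => x 0 i).
  by apply/funext => x /=; rewrite tnth_mktuple.
exact: measurable_coord.
Qed.

End VecOf.

(** * Open sets and continuous functions are measurable *)

Section OpenMeasurable.
Context {R : realType} {m n : nat}.

Lemma rational_rv_approx k (x : 'rV[R]_k) (e : R) : 0 < e ->
  exists q : 'rV[rat]_k, ball (map_mx (ratr : rat -> R) q) e x.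
Proof.
move=> e0.
have H (i : 'I_k) : exists q : rat, `|ratr q - x 0 i| < e.
  have [|q] := @rat_in_itvoo R (x 0 i - e) (x 0 i + e); first by lra.
  by rewrite in_itv/= => /andP[? ?]; exists q; rewrite ltr_norml; lra.
have [q Hq] := choice H.
exists (\row_i q i); split => // i j.
by rewrite !mxE (ord1 i) /ball/=.
Qed.

Lemma measurable_rv_ball k (c : 'rV[R]_k) e : measurable (ball c e).
Proof.
have [e0|e0] := ltP 0 e; last first.
  rewrite (_ : ball c e = set0); first exact: measurable0.
  by apply/seteqP; split => // x [] /(le_lt_trans e0); rewrite ltxx.
rewrite (_ : ball c e = \bigcap_(i in [set` 'I_k]) [set x | ball (c 0 i) e (x 0 i)]).
  apply: fin_bigcap_measurable; first exact: finite_finset.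
  move=> i _; rewrite -[X in measurable X]setTI.
  have := @measurable_coord R k i; apply => //.
  exact: measurable_ball.
apply/seteqP; split => [x [_ H] i _ /=|x H]; first exact: H.
by split => // i j; rewrite (ord1 i); exact: H.
Qed.

(** The products of balls with rational centres and radius 1/(k+1) form a countable base. [B']
    replaces by the empty set those not contained in [U], so that the union runs over a fixed
    countable type. *)
Lemma open_measurable_rv2 (U : set ('rV[R]_m * 'rV[R]_n)) :
  open U -> measurable U.
Proof.
move=> oU.
pose B (a : 'rV[rat]_m * 'rV[rat]_n * nat) : set ('rV[R]_m * 'rV[R]_n) :=
  ball (map_mx (ratr : rat -> R) a.1.1) (a.2.+1%:R^-1) `*`
  ball (map_mx (ratr : rat -> R) a.1.2) (a.2.+1%:R^-1).
pose B' a := if `[< B a `<=` U >] then B a else set0.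
rewrite (_ : U = \bigcup_a B' a).
  apply: countable_bigcupT_measurable => [|a]; first exact: countableP.
  rewrite /B'; case: ifP => _ //.
  by apply: measurableX; exact: measurable_rv_ball.
apply/seteqP; split => [p Up|p [a _]]; last first.
  by rewrite /B'; case: asboolP => // H; exact: H.
have /nbhs_ballP[e /= e0 eU] : nbhs p U by exact: open_nbhs_nbhs.
have [k Hk] : exists k : nat, k.+1%:R^-1 < e / 2 :> R.
  have e20 : 0 < e / 2 by rewrite divr_gt0.
  by have [k _ /(_ k (leqnn k))] := near_infty_natSinv_lt (PosNum e20); exists k.
have k0 : 0 < k.+1%:R^-1 :> R by rewrite invr_gt0.
have [q1 H1] := rational_rv_approx p.1 k0.
have [q2 H2] := rational_rv_approx p.2 k0.
exists (q1, q2, k) => //; rewrite /B'; case: asboolP => [_|]; first by split.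
case; move=> z [/= z1 z2]; apply: eU; split => /=.
  by apply: (@ball_splitr _ _ (map_mx (ratr : rat -> R) q1)); apply: le_ball (ltW Hk) _ _.
by apply: (@ball_splitr _ _ (map_mx (ratr : rat -> R) q2)); apply: le_ball (ltW Hk) _ _.
Qed.

Lemma continuous_on_measurable_rv2 (D : set ('rV[R]_m * 'rV[R]_n))
    (f : 'rV[R]_m * 'rV[R]_n -> R) : open D ->
  (forall x, D x -> {for x, continuous f}) -> measurable_fun D f.
Proof.
move=> oD cf mD; apply: (measurability _ (RGenOpens.measurableE R)) => //.
move=> _ [_ [a [b ->]] <-].
apply: open_measurable_rv2.
rewrite openE => x [Dx /= fx].
apply: filterI; first exact: open_nbhs_nbhs.
by apply: cf => //; exact: open_nbhs_nbhs.
Qed.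

End OpenMeasurable.

Lemma continuous_measurable_rv {R : realType} {n} (f : 'rV[R]_n -> R) :
  continuous f -> measurable_fun setT f.
Proof.
move=> cf.
(* A dummy factor R^0 brings this under the statement for products. *)
have mg : measurable_fun setT (fun p : 'rV[R]_n * 'rV[R]_0 => f p.1).
  apply: continuous_on_measurable_rv2; first exact: openT.
  by move=> x _; apply: continuous_comp; [exact: cvg_fst|exact: cf].
have mh : measurable_fun setT (fun x : 'rV[R]_n => (x, 0 : 'rV[R]_0)).
  exact: pair2_measurable.
exact: (measurableT_comp mg mh).
Qed.

Section Leb.
Context (R : realType) (n : nat).
Local Notation T := (measurableTypeR R).

(** Lebesgue measure moved from tuples to row vectors, where translations and matrices act;
    [integral_leb] translates the integrals back. *)
Definition leb : set 'rV[R]_n -> \bar R :=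
  pushforward (lebesgue_tuple R n) rv_of_tuple.

Let leb0 : leb set0 = 0%E.
Proof. by rewrite /leb /pushforward preimage_set0 measure0. Qed.

Let leb_ge0 A : (0 <= leb A)%E.
Proof. by rewrite /leb /pushforward. Qed.

Let pre (A : set 'rV[R]_n) : measurable A ->
  measurable (rv_of_tuple @^-1` A : set (n.-tuple T)).
Proof.
by move=> mA; rewrite -[X in measurable X]setTI; exact: measurable_rv_of_tuple.
Qed.

Let leb_sigma_additive : semi_sigma_additive leb.
Proof.
move=> F mF tF mUF; rewrite /leb /pushforward preimage_bigcup.
apply: measure_semi_sigma_additive => [k||]; first exact: pre.
- apply/trivIsetP => /= i j _ _ ij; rewrite -preimage_setI.
  by move/trivIsetP : tF => /(_ _ _ _ _ ij) ->//; rewrite preimage_set0.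
- by rewrite -preimage_bigcup; exact: pre.
Qed.

HB.instance Definition _ := isMeasure.Build _ _ _ leb
  leb0 leb_ge0 leb_sigma_additive.

Lemma leb_sigma_finite : sigma_finite setT leb.
Proof.
have [F TF Foo] := sigma_finiteT (lebesgue_tuple R n).
exists (fun k => tuple_of_rv @^-1` F k).
  apply/seteqP; split => // u _.
  have [i _ Fi] : (\bigcup_i F i) (tuple_of_rv u) by rewrite -TF.
  by exists i.
move=> k; have [mF ltF] := Foo k; split.
  by rewrite -[X in measurable X]setTI; exact: measurable_tuple_of_rv.
rewrite /leb /pushforward -comp_preimage.
rewrite (_ : tuple_of_rv \o rv_of_tuple = id)//.
by apply/funext => x /=; rewrite rv_of_tupleK.
Qed.

HB.instance Definition _ :=
  Measure_isSigmaFinite.Build _ _ _ leb leb_sigma_finite.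

Local Open Scope ereal_scope.

Lemma ge0_integral_leb (f : 'rV[R]_n -> \bar R) : measurable_fun setT f ->
  (forall x, 0 <= f x) ->
  \int[leb]_x f x = \int[lebesgue_tuple R n]_x f (vec_of x).
Proof.
move=> mf f0.
rewrite -[RHS](@ge0_integral_pushforward _ _ _ _ _ _ measurable_rv_of_tuple
  (lebesgue_tuple R n) setT f)//.
Qed.

Lemma integral_leb (f : 'rV[R]_n -> \bar R) : measurable_fun setT f ->
  \int[leb]_x f x = \int[lebesgue_tuple R n]_x f (vec_of x).
Proof.
move=> mf; rewrite integralE [RHS]integralE; congr (_ - _).
  rewrite ge0_integral_leb//; last exact: measurable_funepos.
  by apply: eq_integral => x _; rewrite !funeposE.
rewrite ge0_integral_leb//; last exact: measurable_funeneg.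
by apply: eq_integral => x _; rewrite !funenegE.
Qed.

End Leb.

Arguments leb R n : clear implicits.

#[global] Opaque leb.

(** * Affine changes of variable on the line *)

Section Lebesgue1.
Context {R : realType}.
Local Notation mu := (@lebesgue_measure R).
Local Open Scope ereal_scope.

(** The image of Lebesgue measure by a translation gives half-open intervals their length, and this
    characterises Lebesgue measure. Dilations are treated alike, with the factor k absorbed into the
    measure. *)
Lemma ge0_integral_shift1 (f : R -> \bar R) (c : R) :
  measurable_fun setT f -> (forall x, 0 <= f x) ->
  \int[mu]_x f (x + c)%R = \int[mu]_x f x.
Proof.
move=> mf f0.
have mphi : measurable_fun setT
    ((fun x : R => (x + c)%R) : measurableTypeR R -> measurableTypeR R).
  exact: measurable_funD.
rewrite -[LHS](@ge0_integral_pushforward _ _ _ _ _ _ mphi mu setT f)//.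
apply: eq_measure_integral => //= A mA _.
apply/esym/lebesgue_measure_unique => //= _ [[a b]] _ <-.
rewrite /pushforward (_ : _ @^-1` _ = `](a - c)%R, (b - c)%R]%classic); last first.
  by apply/seteqP; split => x /=; rewrite !in_itv/=; lra.
rewrite !lebesgue_measure_itv/= !lte_fin ltrD2r.
by case: ifP => // _; rewrite -!EFinB; congr (_%:E); lra.
Qed.

Lemma ge0_integral_opp1 (f : R -> \bar R) :
  measurable_fun setT f -> (forall x, 0 <= f x) ->
  \int[mu]_x f (- x)%R = \int[mu]_x f x.
Proof.
move=> mf f0.
have mphi : measurable_fun setT
    (-%R : measurableTypeR R -> measurableTypeR R) by [].
rewrite -[LHS](@ge0_integral_pushforward _ _ _ _ _ _ mphi mu setT f)//.
by apply: eq_measure_integral => //= A mA _; exact: lebesgue_measureN.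
Qed.

Let ge0_integral_scale1_pos (f : R -> \bar R) (k : R) : (0 < k)%R ->
  measurable_fun setT f -> (forall x, 0 <= f x) ->
  k%:E * \int[mu]_x f (k * x)%R = \int[mu]_x f x.
Proof.
move=> k0 mf f0.
have mphi : measurable_fun setT
    ((fun x : R => (k * x)%R) : measurableTypeR R -> measurableTypeR R).
  exact: measurable_funM.
have kge0 : (0 <= k)%R by exact: ltW.
rewrite -(@ge0_integral_pushforward _ _ _ _ _ _ mphi mu setT f)//.
pose nu := measure_function_pushforward__canonical__measure_function_Measure mu mphi.
transitivity (\int[mscale (NngNum kge0) nu]_x f x).
  by rewrite (@ge0_integral_mscale _ _ _ nu).
apply: eq_measure_integral => //= A mA _.
apply/esym/lebesgue_measure_unique => //= _ [[a b]] _ <-.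
rewrite /mscale/= /pushforward.
rewrite (_ : _ @^-1` _ = `](a / k)%R, (b / k)%R]%classic); last first.
  apply/seteqP; split => x /=; rewrite !in_itv/= ltr_pdivrMr// ler_pdivlMr//.
    by rewrite (mulrC x).
  by rewrite (mulrC x).
rewrite !lebesgue_measure_itv/= !lte_fin ltr_pM2r ?invr_gt0//.
case: ifP => // _; last by rewrite mule0.
rewrite -!EFinB -EFinM; congr (_%:E); field; lra.
Qed.

Lemma ge0_integral_scale1 (f : R -> \bar R) (k : R) : (k != 0)%R ->
  measurable_fun setT f -> (forall x, 0 <= f x) ->
  `|k|%:E * \int[mu]_x f (k * x)%R = \int[mu]_x f x.
Proof.
move=> k0 mf f0.
have [kp|kn] := ltP 0%R k; first by rewrite gtr0_norm// ge0_integral_scale1_pos.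
have {k0}kn : (k < 0)%R by rewrite lt_neqAle k0.
rewrite ltr0_norm// -[RHS](@ge0_integral_scale1_pos _ (- k)%R) ?oppr_gt0//.
congr (_ * _).
rewrite -[LHS]ge0_integral_opp1//.
- by apply: eq_integral => x _; rewrite mulrN mulNr.
- by apply: (measurableT_comp mf); exact: measurable_funM.
Qed.

Lemma ge0_integral_affine1 (f : R -> \bar R) (k c : R) : (k != 0)%R ->
  measurable_fun setT f -> (forall x, 0 <= f x) ->
  `|k|%:E * \int[mu]_x f (k * x + c)%R = \int[mu]_x f x.
Proof.
move=> k0 mf f0.
rewrite (@ge0_integral_scale1 (fun x => f (x + c)%R)) ?ge0_integral_shift1//.
by apply: (measurableT_comp mf); exact: measurable_funD.
Qed.

End Lebesgue1.

Section ConsRv.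
Context {R : realType} {n : nat}.

Definition cons_rv (a : R) (v : 'rV[R]_n) : 'rV[R]_n.+1 :=
  \row_i (if unlift ord0 i is Some j then v 0 j else a).

Lemma cons_rv0 a v : cons_rv a v 0 ord0 = a.
Proof. by rewrite mxE unlift_none. Qed.

Lemma cons_rvS a v j : cons_rv a v 0 (lift ord0 j) = v 0 j.
Proof. by rewrite mxE liftK. Qed.

Lemma cons_rvD a v b w : cons_rv (a + b) (v + w) = cons_rv a v + cons_rv b w.
Proof. by apply/rowP => i; rewrite !mxE; case: unliftP => // j _; rewrite mxE. Qed.

Lemma cons_rvZ k a v : cons_rv (k * a) (k *: v) = k *: cons_rv a v.
Proof. by apply/rowP => i; rewrite !mxE; case: unliftP => // j _; rewrite mxE. Qed.

Lemma cons_rvK (x : 'rV[R]_n.+1) : cons_rv (x 0 0) (\row_j x 0 (lift ord0 j)) = x.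
Proof.
by apply/rowP => i; rewrite !mxE; case: unliftP => [j ->|->]; rewrite ?mxE.
Qed.

Lemma dotp_cons a v b w : dotp (cons_rv a v) (cons_rv b w) = a * b + dotp v w.
Proof.
rewrite /dotp big_ord_recl !cons_rv0; congr (_ + _).
by apply: eq_bigr => i _; rewrite !cons_rvS.
Qed.

Lemma measurable_cons_rv d (T : measurableType d) (a : T -> R) (v : T -> 'rV[R]_n) :
  measurable_fun setT a -> measurable_fun setT v ->
  measurable_fun setT (fun x => cons_rv (a x) (v x)).
Proof.
move=> ma mv; apply/measurable_rvP => i; under eq_fun do rewrite mxE.
case: unlift => // j; exact: measurable_rv_coord.
Qed.

Local Open Scope ereal_scope.

(** Tonelli's theorem for one step of the iterated product that defines the measure. The inductions
    on the dimension rest on it. *)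
Lemma ge0_integral_leb_cons (f : 'rV[R]_n.+1 -> \bar R) :
  measurable_fun setT f -> (forall x, 0 <= f x) ->
  \int[leb R n.+1]_x f x =
  \int[@lebesgue_measure R]_a \int[leb R n]_v f (cons_rv a v).
Proof.
move=> mf f0; rewrite ge0_integral_leb//.
have mg : measurable_fun setT
    (fun x : n.+1.-tuple (measurableTypeR R) => f (rv_of_tuple x)).
  exact: (measurableT_comp mf (@measurable_rv_of_tuple _ _)).
have cE a (v : n.-tuple (measurableTypeR R)) :
    rv_of_tuple (Defs.cons_tuple (a, v)) = cons_rv a (rv_of_tuple v).
  apply/rowP => i; rewrite !mxE; case: unliftP => [j ->|->]; last by [].
  by rewrite mxE tnthS.
rewrite [LHS](@ge0_integral_pushforward _ _ _ _ _ _
  (@Defs.measurable_cons_tuple R n) _ setT (f \o rv_of_tuple))//;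
  last by move=> y _; exact: f0.
rewrite preimage_setT fubini_tonelli1//=; last first.
  exact: (measurableT_comp mg (@Defs.measurable_cons_tuple R n)).
apply: eq_integral => a _; rewrite /fubini_F.
under eq_integral do rewrite /= cE.
rewrite ge0_integral_leb//.
by apply: (measurableT_comp mf); apply: measurable_cons_rv.
Qed.

End ConsRv.

Lemma measurable_fst_comp d d1 d2 (T : measurableType d) (T1 : measurableType d1)
    (T2 : measurableType d2) (f : T -> T1 * T2) :
  measurable_fun setT f -> measurable_fun setT (fun x => (f x).1).
Proof. exact: measurableT_comp. Qed.

Lemma measurable_snd_comp d d1 d2 (T : measurableType d) (T1 : measurableType d1)
    (T2 : measurableType d2) (f : T -> T1 * T2) :
  measurable_fun setT f -> measurable_fun setT (fun x => (f x).2).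
Proof. exact: measurableT_comp. Qed.

Ltac measurability := repeat first
  [ by [] | assumption | exact: measurable_id | exact: measurable_cst
  | exact: measurable_fst | exact: measurable_snd
  | apply: measurable_rvB | apply: measurable_rvD
  | apply: measurable_rvN | apply: measurable_rvZ | apply: measurable_rv_mulmx
  | apply: measurable_dotp | apply: measurable_enorm | apply: measurable_cons_rv
  | apply: measurable_rv_coord
  | apply: measurable_invr_fun | apply: measurable_sqrt_fun
  | apply: measurable_funX
  | apply: measurable_funB | apply: measurable_funD | apply: measurable_funM
  | apply: measurable_funN
  | apply: (measurableT_comp (@measurable_expR _))
  | apply: (measurableT_comp (@EFin_measurable _ setT))
  | apply: measurable_fst_comp | apply: measurable_snd_comp
  | apply: measurable_fun_pair ].

(** * The Euclidean inner product *)

Section DotProduct.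
Context {R : realType} {n : nat}.
Implicit Types (x y z : 'rV[R]_n) (k : R).

Lemma dotpC x y : dotp x y = dotp y x.
Proof. by apply: eq_bigr => i _; rewrite mulrC. Qed.

Lemma dotpE x y : dotp x y = (x *m y^T) 0 0.
Proof. by rewrite mxE; apply: eq_bigr => i _; rewrite mxE. Qed.

Lemma dotpDl x y z : dotp (x + y) z = dotp x z + dotp y z.
Proof. by rewrite !dotpE mulmxDl mxE. Qed.

Lemma dotpDr x y z : dotp z (x + y) = dotp z x + dotp z y.
Proof. by rewrite !(dotpC z) dotpDl. Qed.

Lemma dotpZl k x y : dotp (k *: x) y = k * dotp x y.
Proof. by rewrite !dotpE -scalemxAl mxE. Qed.

Lemma dotpZr k x y : dotp x (k *: y) = k * dotp x y.
Proof. by rewrite !(dotpC x) dotpZl. Qed.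

Lemma dotpNl x y : dotp (- x) y = - dotp x y.
Proof. by rewrite -scaleN1r dotpZl mulN1r. Qed.

Lemma dotpNr x y : dotp x (- y) = - dotp x y.
Proof. by rewrite !(dotpC x) dotpNl. Qed.

Lemma dotpBl x y z : dotp (x - y) z = dotp x z - dotp y z.
Proof. by rewrite dotpDl dotpNl. Qed.

Lemma dotpBr x y z : dotp z (x - y) = dotp z x - dotp z y.
Proof. by rewrite dotpDr dotpNr. Qed.

Lemma dotp0l x : dotp 0 x = 0.
Proof. by rewrite -(scale0r 0) dotpZl mul0r. Qed.

Lemma dotp0r x : dotp x 0 = 0.
Proof. by rewrite dotpC dotp0l. Qed.

Lemma dotp_ge0 x : 0 <= dotp x x.
Proof. by apply: sumr_ge0 => i _; rewrite -expr2 sqr_ge0. Qed.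

Lemma dotp_eq0 x : (dotp x x == 0) = (x == 0).
Proof.
apply/eqP/eqP => [|->]; last by rewrite dotp0l.
move=> H; apply/rowP => i; rewrite mxE; apply/eqP.
have /eqP := H; rewrite psumr_eq0; last by move=> j _; rewrite -expr2 sqr_ge0.
by move=> /allP/(_ i); rewrite mem_index_enum => /(_ isT)/=; rewrite mulf_eq0 orbb.
Qed.

Lemma enorm_sqr x : enorm x ^+ 2 = dotp x x.
Proof. by rewrite sqr_sqrtr ?dotp_ge0. Qed.

Lemma enorm_ge0 x : 0 <= enorm x.
Proof. exact: sqrtr_ge0. Qed.

Lemma enorm_eq0 x : (enorm x == 0) = (x == 0).
Proof. by rewrite -dotp_eq0 -enorm_sqr sqrf_eq0. Qed.

Lemma enorm_gt0 x : (0 < enorm x) = (x != 0).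
Proof. by rewrite lt_neqAle enorm_ge0 andbT eq_sym enorm_eq0. Qed.

Lemma enorm0 : enorm (0 : 'rV[R]_n) = 0.
Proof. by apply/eqP; rewrite enorm_eq0. Qed.

Lemma enormZ k x : enorm (k *: x) = `|k| * enorm x.
Proof.
by rewrite /enorm dotpZl dotpZr mulrA -expr2 sqrtrM ?sqr_ge0// sqrtr_sqr.
Qed.

Lemma enorm1_dotp x : enorm x = 1 -> dotp x x = 1.
Proof. by move=> x1; rewrite -enorm_sqr x1 expr1n. Qed.

(** Cauchy-Schwarz: the squared norm of <y,y> x - <x,y> y is <y,y> times the difference of the two
    sides. *)
Lemma dotp_sqr_le x y : dotp x y ^+ 2 <= dotp x x * dotp y y.
Proof.
have [->|y0] := eqVneq y 0; first by rewrite !dotp0r expr2 !mulr0.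
have yy : 0 < dotp y y by rewrite lt_neqAle eq_sym dotp_eq0 y0 dotp_ge0.
have := dotp_ge0 (dotp y y *: x - dotp x y *: y).
rewrite dotpBl !dotpBr !dotpZl !dotpZr (dotpC y x) => H.
rewrite -subr_ge0 -(pmulr_rge0 _ yy); nra.
Qed.

Lemma normr_dotp_le x y : `|dotp x y| <= enorm x * enorm y.
Proof.
rewrite -[leLHS]sqrtr_sqr /enorm -sqrtrM ?dotp_ge0//.
by rewrite ler_sqrt ?mulr_ge0 ?dotp_ge0// dotp_sqr_le.
Qed.

Lemma normr_coord_le x i : `|x 0 i| <= enorm x.
Proof.
rewrite -sqrtr_sqr ler_sqrt ?dotp_ge0// /dotp (bigD1 i)//= expr2.
by rewrite lerDl sumr_ge0// => j _; rewrite -expr2 sqr_ge0.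
Qed.

Lemma enormD x y : enorm (x + y) <= enorm x + enorm y.
Proof.
rewrite -(@ler_pXn2r _ 2) ?nnegrE ?addr_ge0 ?enorm_ge0//.
rewrite sqrrD !enorm_sqr dotpDl !dotpDr (dotpC y x).
have := le_trans (ler_norm _) (normr_dotp_le x y); lra.
Qed.

Lemma enormN x : enorm (- x) = enorm x.
Proof. by rewrite -scaleN1r enormZ normrN1 mul1r. Qed.

End DotProduct.

Lemma dotp_mulmxl (R : realType) m n (x : 'rV[R]_m) (A : 'M[R]_(m, n)) (y : 'rV[R]_n) :
  dotp (x *m A) y = dotp x (y *m A^T).
Proof. by rewrite !dotpE trmx_mul trmxK mulmxA. Qed.

(** * Invariance of Lebesgue measure under translations, dilations and rotations *)

Section LebInvariance.
Context {R : realType}.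
Local Notation mu := (@lebesgue_measure R).
Local Open Scope ereal_scope.

Lemma fubini_tonelli_leb m n (F : 'rV[R]_m -> 'rV[R]_n -> \bar R) :
  measurable_fun setT (fun p : 'rV[R]_m * 'rV[R]_n => F p.1 p.2) ->
  (forall x y, 0 <= F x y) ->
  \int[leb R m]_x \int[leb R n]_y F x y = \int[leb R n]_y \int[leb R m]_x F x y.
Proof. by move=> mF F0; exact: (fubini_tonelli (fun p => F p.1 p.2)). Qed.

Lemma fubini_tonelli_leb1 n (F : R -> 'rV[R]_n -> \bar R) :
  measurable_fun setT (fun p : R * 'rV[R]_n => F p.1 p.2) ->
  (forall x y, 0 <= F x y) ->
  \int[mu]_x \int[leb R n]_y F x y = \int[leb R n]_y \int[mu]_x F x y.
Proof.
move=> mF F0.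
exact: (@fubini_tonelli _ _ (measurableTypeR R) _ _ mu (leb R n) (fun p => F p.1 p.2)).
Qed.

Lemma measurable_fubini_leb1 n (F : R -> 'rV[R]_n -> \bar R) :
  measurable_fun setT (fun p : R * 'rV[R]_n => F p.1 p.2) ->
  (forall x y, 0 <= F x y) ->
  measurable_fun setT (fun x => \int[leb R n]_y F x y).
Proof.
move=> mF F0.
exact: (@measurable_fun_fubini_tonelli_F _ _ (measurableTypeR R) _ _ (leb R n) (fun p => F p.1 p.2)).
Qed.

Lemma ge0_integral_leb0 (f : 'rV[R]_0 -> \bar R) : measurable_fun setT f ->
  (forall x, 0 <= f x) -> \int[leb R 0]_x f x = f 0%R.
Proof.
move=> mf f0; rewrite ge0_integral_leb//= integral_dirac//.
  by rewrite diracE in_setT mul1e; congr f; exact: thinmx0.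
exact: (measurableT_comp mf (@measurable_rv_of_tuple _ _)).
Qed.

Lemma ge0_integral_leb_shift n (f : 'rV[R]_n -> \bar R) (c : 'rV[R]_n) :
  measurable_fun setT f -> (forall x, 0 <= f x) ->
  \int[leb R n]_x f (x + c)%R = \int[leb R n]_x f x.
Proof.
elim: n f c => [f c mf f0|n IH f c mf f0].
  by apply: eq_integral => x _; congr f; rewrite !thinmx0.
have mfc : measurable_fun setT (fun x : 'rV[R]_n.+1 => f (x + c)%R).
  by apply: (measurableT_comp mf); measurability.
rewrite ge0_integral_leb_cons; [|exact: mfc|by move=> x; exact: f0].
rewrite [RHS]ge0_integral_leb_cons; [|exact: mf|exact: f0].
rewrite -[RHS](@ge0_integral_shift1 _ _ (c 0 0)%R); last 2 first.
- apply: (@measurable_fubini_leb1 _ (fun a v => f (cons_rv a v))) => //.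
  by apply: (measurableT_comp mf); measurability.
- by move=> a; exact: integral_ge0.
apply: eq_integral => a _.
rewrite -[RHS](IH _ (\row_j c 0 (lift ord0 j))%R)//; last first.
  by apply: (measurableT_comp mf); measurability.
by apply: eq_integral => v _; rewrite -{1}(cons_rvK c) -cons_rvD.
Qed.

Lemma ge0_integral_leb_scale n (f : 'rV[R]_n -> \bar R) (k : R) : (k != 0)%R ->
  measurable_fun setT f -> (forall x, 0 <= f x) ->
  (`|k| ^+ n)%:E * \int[leb R n]_x f (k *: x)%R = \int[leb R n]_x f x.
Proof.
move=> k0; elim: n f => [f mf f0|n IH f mf f0].
  by rewrite expr0 mul1e; apply: eq_integral => x _; congr f; rewrite !thinmx0.
have mfc : measurable_fun setT (fun x : 'rV[R]_n.+1 => f (k *: x)%R).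
  by apply: (measurableT_comp mf); measurability.
have mF : measurable_fun setT
    (fun p : measurableTypeR R * 'rV[R]_n => f (cons_rv p.1 p.2)).
  by apply: (measurableT_comp mf); measurability.
rewrite ge0_integral_leb_cons; [|exact: mfc|by move=> x; exact: f0].
rewrite [RHS]ge0_integral_leb_cons; [|exact: mf|exact: f0].
rewrite -[RHS](@ge0_integral_scale1 _ _ k); last 3 first.
- exact: k0.
- by apply: (@measurable_fubini_leb1 _ (fun a v => f (cons_rv a v))) => //.
- by move=> a; exact: integral_ge0.
rewrite exprS EFinM -muleA; congr (_ * _).
rewrite -ge0_integralZl_EFin//; last 2 first.
- by move=> a _; exact: integral_ge0.
- apply: (@measurable_fubini_leb1 _ (fun a v => f (k *: cons_rv a v)%R)) => //.
  by apply: (measurableT_comp mf); measurability.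
apply: eq_integral => a _; rewrite -[RHS]IH//; last first.
  by apply: (measurableT_comp mf); measurability.
congr (_ * _); apply: eq_integral => v _; by rewrite -cons_rvZ.
Qed.

(** The Gaussian factors over the coordinates. The value serves twice: as the finite positive
    constant in the proof of rotation invariance, and in polar coordinates, where it brings in the
    Gamma function. *)
Lemma gauss_integral_leb n :
  \int[leb R n]_x (expR (- dotp x x))%:E = (Num.sqrt pi ^+ n)%:E.
Proof.
have mg k : measurable_fun setT (fun x : 'rV[R]_k => (expR (- dotp x x))%:E).
  by measurability.
elim: n => [|n IH]; first by rewrite ge0_integral_leb0// dotp0l oppr0 expR0.
rewrite ge0_integral_leb_cons//.
have E (a : R) : \int[leb R n]_v (expR (- dotp (cons_rv a v) (cons_rv a v)))%:E =
    (expR (- (a * a)))%:E * (Num.sqrt pi ^+ n)%:E.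
  rewrite -IH -ge0_integralZl_EFin ?expR_ge0//; last exact: mg.
  by apply: eq_integral => v _; rewrite dotp_cons opprD expRD EFinM.
transitivity (\int[mu]_a ((expR (- (a * a)))%:E * (Num.sqrt pi ^+ n)%:E)).
  by apply: eq_integral => a _; exact: E.
rewrite /= ge0_integralZr//; last by measurability.
by rewrite exprS EFinM -integralT_gauss.
Qed.

Lemma eqe_mulfinI (r : R) (x y : \bar R) : (0 < r)%R ->
  r%:E * x = r%:E * y -> x = y.
Proof.
move=> r0 H; have := congr1 (fun z => (r^-1)%:E * z) H.
by rewrite !muleA -!EFinM mulVf ?gt_eqF// !mul1e.
Qed.

(* Two translation-invariant measures are proportional; the constant is found
   by testing on a function that is invariant under the rotation. *)
Let rot_invariance n (f g : 'rV[R]_n -> \bar R) (O : 'M[R]_n) r :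
  O *m O^T = 1%:M ->
  measurable_fun setT f -> (forall x, 0 <= f x) ->
  measurable_fun setT g -> (forall x, 0 <= g x) ->
  (forall x, g (- x)%R = g x) -> (forall x, g (x *m O^T) = g x) ->
  (0 < r)%R -> \int[leb R n]_x g x = r%:E ->
  \int[leb R n]_x f (x *m O) = \int[leb R n]_x f x.
Proof.
move=> OO mf f0 mg g0 gN gO r0 Ig.
have OO' : O^T *m O = 1%:M by exact: mulmx1C.
apply: (@eqe_mulfinI r) => //; rewrite -Ig.
have mfO : measurable_fun setT (fun y => f (y *m O)).
  by apply: (measurableT_comp mf); measurability.
have If0 h : (forall x, 0 <= h x) -> 0 <= \int[leb R n]_x h x.
  by move=> ?; exact: integral_ge0.
(* The double integral of g(x) f(yO + x) is computed twice. In y first, the translation by xO^T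
   removes x from f. After replacing x by x - yO the integrand is g(x - yO) f(x); as g(x - yO) = g(y
   - xO^T), integrating in y first now removes x from g. *)
transitivity (\int[leb R n]_x \int[leb R n]_y (g x * f (y *m O + x)%R)).
  rewrite -ge0_integralZr//; last exact: If0.
  apply: eq_integral => x _.
  rewrite ge0_integralZl//; last first.
    by apply: (measurableT_comp mf); measurability.
  congr (_ * _).
  rewrite -(@ge0_integral_leb_shift _ _ (x *m O^T))//.
  by apply: eq_integral => y _; rewrite mulmxDl -mulmxA OO' mulmx1.
rewrite fubini_tonelli_leb; last 2 first.
- apply: emeasurable_funM; first by apply: (measurableT_comp mg); measurability.
  by apply: (measurableT_comp mf); measurability.
- by move=> x y; rewrite mule_ge0.
transitivity (\int[leb R n]_y \int[leb R n]_x (g (x - y *m O)%R * f x)).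
  apply: eq_integral => y _.
  rewrite -[RHS](@ge0_integral_leb_shift _ _ (y *m O)); last 2 first.
  - apply: emeasurable_funM => //.
    by apply: (measurableT_comp mg); measurability.
  - by move=> x; rewrite mule_ge0.
  by apply: eq_integral => x _; rewrite addrK addrC.
rewrite fubini_tonelli_leb; last 2 first.
- apply: emeasurable_funM; first by apply: (measurableT_comp mg); measurability.
  by apply: (measurableT_comp mf); measurability.
- by move=> x y; rewrite mule_ge0.
rewrite -ge0_integralZl//; last exact: If0.
apply: eq_integral => x _.
rewrite ge0_integralZr//; last first.
  by apply: (measurableT_comp mg); measurability.
congr (_ * _).
rewrite -[RHS](@ge0_integral_leb_shift _ _ (- (x *m O^T))); [|exact: mg|exact: g0].
apply: eq_integral => y _; rewrite -gO -gN.
by rewrite mulmxBl -mulmxA OO mulmx1 opprB.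
Qed.

(** The Gaussian is even and rotation invariant, with a finite positive integral: it is a suitable
    test function. *)
Lemma ge0_integral_leb_rot n (f : 'rV[R]_n -> \bar R) (O : 'M[R]_n) :
  O *m O^T = 1%:M ->
  measurable_fun setT f -> (forall x, 0 <= f x) ->
  \int[leb R n]_x f (x *m O) = \int[leb R n]_x f x.
Proof.
move=> OO mf f0.
apply: (rot_invariance OO mf f0 _ _ _ _ _ (gauss_integral_leb n)).
- by measurability.
- by move=> x; rewrite lee_fin expR_ge0.
- by move=> x; rewrite dotpNl dotpNr opprK.
- move=> x; rewrite dotp_mulmxl trmxK -mulmxA.
  by have /mulmx1C -> := OO; rewrite mulmx1.
- by rewrite exprn_gt0// sqrtr_gt0 pi_gt0.
Qed.

End LebInvariance.

(** * Integration over hyperplanes *)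

Section Frame.
Context {R : realType} {m : nat}.
Local Notation E := 'rV[R]_m.+1.
Local Notation mu := (@lebesgue_measure R).

Lemma row_dotp p q k (A : 'M[R]_(p, k)) (B : 'M[R]_(q, k)) i j :
  (A *m B^T) i j = dotp (row i A) (row j B).
Proof. by rewrite mxE; apply: eq_bigr => l _; rewrite !mxE. Qed.

(* Householder reflection exchanging xi and the first basis vector. *)
Lemma orthogonal_completion (xi : E) : enorm xi = 1 ->
  exists H : 'M[R]_m.+1, H *m H^T = 1%:M /\ row 0 H = xi.
Proof.
move=> /enorm1_dotp xi1.
pose e0 : E := delta_mx 0 0.
have e0E : dotp e0 e0 = 1 by rewrite dotpE trmx_delta mul_delta_mx mxE eqxx.
have [->|xie0] := eqVneq xi e0.
  by exists 1%:M; rewrite trmx1 mulmx1 row1.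
pose v := xi - e0.
have v0 : dotp v v != 0 by rewrite dotp_eq0 subr_eq0.
pose c := 2 / dotp v v.
have vv : v *m v^T = (dotp v v)%:M by rewrite [LHS]mx11_scalar -dotpE.
exists (1%:M - c *: (v^T *m v)); split.
  have -> : (1%:M - c *: (v^T *m v))^T = 1%:M - c *: (v^T *m v).
    by rewrite raddfB/= trmx1 linearZ/= trmx_mul trmxK.
  set P := v^T *m v.
  have PP : P *m P = dotp v v *: P.
    by rewrite /P mulmxA -(mulmxA v^T) vv mul_mx_scalar -scalemxAl.
  have cP : (c *: P) *m (c *: P) = (c * c * dotp v v) *: P.
    by rewrite -scalemxAl -scalemxAr PP !scalerA.
  rewrite mulmxBl mul1mx mulmxBr (mulmx1 (c *: P)) cP.
  have -> : c * c * dotp v v = c + c by rewrite /c; field.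
  by rewrite scalerDl opprB addrK subrK.
rewrite rowE -/e0 mulmxBr mulmx1 -scalemxAr mulmxA.
have -> : e0 *m v^T = (dotp e0 v)%:M by rewrite [LHS]mx11_scalar -dotpE.
rewrite mul_scalar_mx scalerA.
have -> : c * dotp e0 v = - 1.
  have Ev : dotp v v = 2 - 2 * dotp e0 xi.
    by rewrite /v dotpBl !dotpBr xi1 e0E (dotpC xi); ring.
  have Ee : dotp e0 v = dotp e0 xi - 1 by rewrite /v dotpBr e0E.
  by move: v0; rewrite /c Ee Ev => ?; field; lra.
by rewrite scaleN1r opprK /v addrC subrK.
Qed.

(** [hyperplane_frame] is a choice, and says something only once a frame is known to exist: the rows
    other than the first of an orthogonal matrix with first row xi form one. *)
Lemma hyperplane_frameP (xi : E) : enorm xi = 1 ->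
  hyperplane_frame xi *m (hyperplane_frame xi)^T = 1%:M /\
  hyperplane_frame xi *m xi^T = 0.
Proof.
move=> xi1; have [H [HH H0]] := orthogonal_completion xi1.
pose B : 'M[R]_(m, m.+1) := \matrix_(i, j) H (lift ord0 i) j.
have rB i : row i B = row (lift ord0 i) H by apply/rowP => j; rewrite !mxE.
apply: (@xgetPex _ 0 [set B : 'M[R]_(m, m.+1) | B *m B^T = 1%:M /\ B *m xi^T = 0]).
exists B; split.
  apply/matrixP => i j; rewrite row_dotp !rB -row_dotp HH !mxE.
  by rewrite (inj_eq (@lift_inj _ _)).
apply/matrixP => i j; rewrite row_dotp rB (ord1 j) -H0.
rewrite (_ : row 0 (row 0 H) = row 0 H); last by apply/rowP => k; rewrite !mxE.
by rewrite -row_dotp HH !mxE.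
Qed.

Definition hplane (xi : E) (u : 'rV[R]_m) : E := u *m hyperplane_frame xi.

Lemma hyperplane_pointE (xi : E) (u : m.-tuple R) :
  hyperplane_point xi u = hplane xi (vec_of u).
Proof. by []. Qed.

Lemma hplane_orth (xi : E) u : enorm xi = 1 -> dotp (hplane xi u) xi = 0.
Proof.
move=> /hyperplane_frameP[_ H].
by rewrite dotpE -mulmxA H mulmx0 mxE.
Qed.

Lemma dotp_hplane (xi : E) u w : enorm xi = 1 ->
  dotp (hplane xi u) (hplane xi w) = dotp u w.
Proof.
by move=> /hyperplane_frameP[H _]; rewrite dotp_mulmxl -mulmxA H mulmx1.
Qed.

Lemma enorm_hplane (xi : E) u : enorm xi = 1 -> enorm (hplane xi u) = enorm u.
Proof. by move=> xi1; rewrite /enorm dotp_hplane. Qed.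

Lemma hplaneD (xi : E) u w : hplane xi (u + w) = hplane xi u + hplane xi w.
Proof. exact: mulmxDl. Qed.

Lemma hplaneZ (xi : E) k u : hplane xi (k *: u) = k *: hplane xi u.
Proof. by rewrite /hplane scalemxAl. Qed.

Lemma measurable_hplane (xi : E) d (T : measurableType d) (u : T -> 'rV[R]_m) :
  measurable_fun setT u -> measurable_fun setT (fun x => hplane xi (u x)).
Proof. exact: measurable_rv_mulmx. Qed.

Definition frame_mx (xi : E) : 'M[R]_m.+1 := \matrix_(i, j)
  (if unlift ord0 i is Some k then hyperplane_frame xi k j else xi 0 j).

Lemma frame_mxE (xi : E) a u : cons_rv a u *m frame_mx xi = hplane xi u + a *: xi.
Proof.
apply/rowP => j; rewrite !mxE big_ord_recl cons_rv0 !mxE unlift_none addrC.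
by congr (_ + _); apply: eq_bigr => i _; rewrite cons_rvS !mxE liftK.
Qed.

Lemma frame_mx_orth (xi : E) : enorm xi = 1 -> frame_mx xi *m (frame_mx xi)^T = 1%:M.
Proof.
move=> xi1; have [BB Bx] := hyperplane_frameP xi1.
have r0 : row ord0 (frame_mx xi) = xi.
  by apply/rowP => j; rewrite !mxE unlift_none.
have rS i : row (lift ord0 i) (frame_mx xi) = row i (hyperplane_frame xi).
  by apply/rowP => j; rewrite !mxE liftK.
have rx i : dotp (row i (hyperplane_frame xi)) xi = 0.
  have /matrixP/(_ i 0) := Bx; rewrite row_dotp [RHS]mxE => <-; congr dotp.
  by apply/rowP => k; rewrite !mxE.
apply/matrixP => i j; rewrite row_dotp !mxE.
case: (unliftP ord0 i) => [k ->|->]; case: (unliftP ord0 j) => [l ->|->].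
- by rewrite !rS -row_dotp BB mxE (inj_eq (@lift_inj _ _)).
- by rewrite rS r0 rx.
- by rewrite rS r0 dotpC rx.
- by rewrite r0 enorm1_dotp.
Qed.

Lemma hplane_surj (xi x : E) : enorm xi = 1 ->
  exists u, x = hplane xi u + dotp x xi *: xi.
Proof.
move=> xi1; have OO := frame_mx_orth xi1.
have := mulmx1C OO => OO'.
pose y := x *m (frame_mx xi)^T.
have xE : x = hplane xi (\row_j y 0 (lift ord0 j)) + y 0 0 *: xi.
  by rewrite -frame_mxE cons_rvK -mulmxA OO' mulmx1.
exists (\row_j y 0 (lift ord0 j)).
have -> : dotp x xi = y 0 0.
  by rewrite xE dotpDl hplane_orth// dotpZl enorm1_dotp// mulr1 add0r.
exact: xE.
Qed.

Lemma hplane_surj0 (xi x : E) : enorm xi = 1 -> dotp x xi = 0 ->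
  exists u, x = hplane xi u.
Proof.
move=> xi1 x0; have [u] := hplane_surj x xi1.
by rewrite x0 scale0r addr0; exists u.
Qed.

Local Open Scope ereal_scope.

(** Rotation invariance for [frame_mx xi], then Tonelli: a is the coordinate along xi, u those of
    the hyperplane. *)
Lemma ge0_integral_frame (xi : E) (h : E -> \bar R) : enorm xi = 1%R ->
  measurable_fun setT h -> (forall x, 0 <= h x) ->
  \int[leb R m.+1]_x h x =
  \int[mu]_a \int[leb R m]_u h (hplane xi u + a *: xi)%R.
Proof.
move=> xi1 mh h0.
rewrite -(ge0_integral_leb_rot (frame_mx_orth xi1))//.
rewrite ge0_integral_leb_cons//; last first.
  by apply: (measurableT_comp mh); measurability.
by do 2!(apply: eq_integral => ? _); rewrite frame_mxE.
Qed.

(* Averages the hyperplane integral over the translates a xi, 0 <= a <= 1, so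
   that it becomes an integral over the whole space where the choice of a frame
   plays no role. *)
Lemma ge0_integral_smear (xi v : E) (k : E -> \bar R) :
  enorm xi = 1%R -> dotp v xi = 1%R ->
  measurable_fun setT k -> (forall x, 0 <= k x) ->
  \int[leb R m]_u k (hplane xi u) =
  \int[leb R m.+1]_x
    (k (x - dotp x xi *: v)%R * (\1_(`[0, 1]%classic) (dotp x xi))%:E).
Proof.
move=> xi1 vxi mk k0.
have mi : measurable_fun setT (fun x : R => (\1_(`[0, 1]%classic) x : R)%:E).
  by apply/measurable_EFinP; exact: measurable_indic.
rewrite (ge0_integral_frame xi1); last 2 first.
- apply: emeasurable_funM; first by apply: (measurableT_comp mk); measurability.
  by apply: (measurableT_comp mi); measurability.
- by move=> x; rewrite mule_ge0// lee_fin.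
(* Removing the multiple of v instead of that of xi shears the hyperplanes: at height a the argument
   is moved by a(xi - v), a vector of the hyperplane, and the integral over u does not change. The
   freedom in v lets one project along the first axis. *)
have [w vE] : exists w, (xi - v)%R = hplane xi w.
  by apply: hplane_surj0 => //; rewrite dotpBl vxi enorm1_dotp// subrr.
have E a : \int[leb R m]_u (k (hplane xi u + a *: xi -
       dotp (hplane xi u + a *: xi) xi *: v)%R *
     (\1_(`[0, 1]%classic) (dotp (hplane xi u + a *: xi) xi))%:E) =
     (\int[leb R m]_u k (hplane xi u)) * (\1_(`[0, 1]%classic) a)%:E.
  rewrite -(@ge0_integral_leb_shift _ _ (fun u => k (hplane xi u)) (a *: w))//;
    last by apply: (measurableT_comp mk); exact: measurable_hplane.
  rewrite -ge0_integralZr//; last first.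
  - by apply: (measurableT_comp mk); apply: measurable_hplane; measurability.
  apply: eq_integral => u _.
  rewrite dotpDl hplane_orth// dotpZl enorm1_dotp// add0r mulr1.
  by rewrite -addrA -scalerBr vE hplaneD hplaneZ.
apply/esym; transitivity (\int[mu]_a
    ((\int[leb R m]_u k (hplane xi u)) * (\1_(`[0, 1]%classic) a)%:E)).
  by apply: eq_integral => a _; exact: E.
rewrite ge0_integralZl//; last by apply: integral_ge0.
rewrite integral_indic// setIT. by rewrite /= lebesgue_measure_itv/= lte_fin ltr01 sube0 mule1.
Qed.

End Frame.

(** * Spheres, hyperplanes and radial integration *)

Section MultiplicativeHaar.
Context {R : realType}.
Local Notation mu := (@lebesgue_measure R).

Lemma measurable_bool_natr d (T : measurableType d) (b : T -> bool) :
  measurable_fun setT b -> measurable_fun setT (fun x => (b x)%:R : R).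
Proof.
move=> mb; have mT : measurable [set x | b x].
  by rewrite -[X in measurable X]setTI; exact: (mb measurableT [set true]).
rewrite (_ : (fun x => _) = (\1_[set x | b x] : T -> R)).
  exact: measurable_indic.
by apply/funext => x; rewrite indicE; congr ((_ : bool)%:R); apply/idP/idP; rewrite inE.
Qed.

Lemma integral_restrict_bool d (T : measurableType d)
    (m : {measure set T -> \bar R}) (D : set T) (f : T -> \bar R) :
  (\int[m]_(x in D) f x = \int[m]_x (f x * ((x \in D)%:R : R)%:E))%E.
Proof.
rewrite integral_mkcond; apply: eq_integral => x _.
by rewrite patchE; case: (x \in D); rewrite ?mule1 ?mule0.
Qed.

Let hinv (r : R) : R := (0 < r)%R%:R / r.

Let measurable_hinv : measurable_fun setT hinv.
Proof.
apply: measurable_funM; last by measurability.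
by apply: measurable_bool_natr; apply: measurable_fun_ltr.
Qed.

Let hinv_ge0 r : 0 <= hinv r.
Proof. by rewrite /hinv; case: ltP => // r0; rewrite ?mul0r// mul1r invr_ge0 ltW. Qed.

Local Open Scope ereal_scope.

Let I2 (f : R -> \bar R) := \int[mu]_x f (expR x).

Let mexp (h : R -> \bar R) : measurable_fun setT h ->
  measurable_fun setT (fun x : R => h (expR x)).
Proof. by move=> mh; apply: (measurableT_comp mh); measurability. Qed.

(* Uniqueness of the Haar measure of the multiplicative group: any measure on
   the positive reals that is invariant under scalings, here the image by rho of
   p M, is proportional to dr / r, here the image by exp of the Lebesgue
   measure. *)
Lemma log_haar d (T : measurableType d)
    (M : {sigma_finite_measure set T -> \bar R}) (rho p : T -> R)
    (f g : R -> \bar R) :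
  measurable_fun setT rho -> measurable_fun setT p -> (forall t, 0 <= p t)%R ->
  (forall t, p t != 0 -> 0 < rho t)%R ->
  (forall F c, (0 < c)%R -> measurable_fun setT F -> (forall x, 0 <= F x) ->
    \int[M]_t (F (c * rho t)%R * (p t)%:E) = \int[M]_t (F (rho t) * (p t)%:E)) ->
  measurable_fun setT f -> (forall x, 0 <= f x) ->
  measurable_fun setT g -> (forall x, 0 <= g x) ->
  \int[M]_t (f (rho t) * (p t)%:E) * \int[mu]_x g (expR x) =
  \int[M]_t (g (rho t) * (p t)%:E) * \int[mu]_x f (expR x).
Proof.
move=> mrho mp p0 prho scal mf f0 mg g0.
have I20 h : (forall x, 0 <= h x) -> 0 <= I2 h.
  by move=> h0; exact: integral_ge0.
have swap (F : T -> R -> \bar R) :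
    measurable_fun setT (fun p : T * R => F p.1 p.2) ->
    (forall x y, 0 <= F x y) ->
    \int[M]_x \int[mu]_y F x y = \int[mu]_y \int[M]_x F x y.
  move=> mF F0.
  exact: (@fubini_tonelli _ _ T (measurableTypeR R) _ M mu (fun p => F p.1 p.2)).
have mmul (h : R -> \bar R) : measurable_fun setT h ->
    measurable_fun setT (fun t => h (rho t) * (p t)%:E).
  move=> mh; apply: emeasurable_funM; last exact/measurable_EFinP.
  exact: (measurableT_comp mh).
have mrho1 : measurable_fun setT (fun q : T * R => rho q.1).
  by apply: (measurableT_comp mrho); measurability.
have m1 : measurable_fun setT
    (fun q : T * R => f (rho q.1) * (p q.1)%:E * g (rho q.1 * expR q.2)%R).
  apply: emeasurable_funM.
    by apply: (measurableT_comp (mmul _ mf)); measurability.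
  by apply: (measurableT_comp mg); measurability.
have m2 : measurable_fun setT
    (fun q : T * R => f (rho q.1 * expR (- q.2))%R * g (rho q.1) * (p q.1)%:E).
  apply: emeasurable_funM.
    apply: emeasurable_funM; first by apply: (measurableT_comp mf); measurability.
    by apply: (measurableT_comp mg); measurability.
  by apply/measurable_EFinP; apply: (measurableT_comp mp); measurability.
(* Both sides equal the integral of f(rho t) g(e^x rho t) p(t) in t and x. In x, the factor rho t is
   a translation by ln(rho t). For fixed x, invariance under the dilation by e^x moves the
   exponential from g to f, after which a reflection and a translation in x finish. *)
transitivity (\int[M]_t \int[mu]_x (f (rho t) * (p t)%:E * g (rho t * expR x)%R)).
  rewrite -ge0_integralZr; last 4 first.
  - by [].
  - exact: mmul.
  - by move=> x _; rewrite mule_ge0// lee_fin.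
  - exact: I20.
  apply: eq_integral => t _; have [pt0|/prho r0] := eqVneq (p t) 0%R.
    rewrite pt0 mule0 mul0e.
    by under eq_integral do rewrite mul0e; rewrite integral0.
  rewrite ge0_integralZl; last 4 first.
  - by [].
  - by apply: (measurableT_comp mg); measurability.
  - by move=> x _; exact: g0.
  - by rewrite mule_ge0// lee_fin.
  congr (_ * _); rewrite -(@ge0_integral_shift1 _ _ (ln (rho t))); last 2 first.
  - exact: mexp.
  - by move=> x; exact: g0.
  by apply: eq_integral => x _; rewrite expRD [expR (ln _)]lnK// mulrC.
rewrite swap; last 2 first.
- exact: m1.
- by move=> x y; rewrite !mule_ge0// lee_fin.
transitivity (\int[mu]_x \int[M]_t
    (f (rho t * expR (- x))%R * g (rho t) * (p t)%:E)).
  apply: eq_integral => x _.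
  rewrite -[RHS](scal (fun r => f (r * expR (- x))%R * g r) (expR x)).
  - apply: eq_integral => t _; rewrite (mulrC (expR x)) -mulrA -expRD subrr expR0.
    by rewrite mulr1 -muleA (muleC (p t)%:E) muleA.
  - exact: expR_gt0.
  - apply: emeasurable_funM; first by apply: (measurableT_comp mf); measurability.
    exact: mg.
  - by move=> r; rewrite mule_ge0.
rewrite -swap; last 2 first.
- exact: m2.
- by move=> r x; rewrite !mule_ge0// lee_fin.
rewrite -ge0_integralZr; last 4 first.
- by [].
- exact: mmul.
- by move=> x _; rewrite mule_ge0// lee_fin.
- exact: I20.
apply: eq_integral => t _; have [pt0|/prho r0] := eqVneq (p t) 0%R.
  rewrite pt0 mule0 mul0e.
  by under eq_integral do rewrite mule0; rewrite integral0.
have -> : \int[mu]_x f (expR x) = \int[mu]_x f (rho t * expR (- x))%R.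
  rewrite (@ge0_integral_opp1 _ (fun x => f (rho t * expR x)%R)); last 2 first.
  - by apply: (measurableT_comp mf); measurability.
  - by move=> x; exact: f0.
  rewrite -(@ge0_integral_shift1 _ _ (ln (rho t))); last 2 first.
  - exact: mexp.
  - by move=> x; exact: f0.
  by apply: eq_integral => x _; rewrite expRD [expR (ln _)]lnK// mulrC.
rewrite -[RHS]ge0_integralZl; last 4 first.
- by [].
- by apply: (measurableT_comp mf); measurability.
- by move=> x _; exact: f0.
- by rewrite mule_ge0// lee_fin.
by apply: eq_integral => x _; rewrite -muleA muleC.
Qed.

Let I1 (f : R -> \bar R) := \int[mu]_r (f r * (hinv r)%:E).

Let mmul (f : R -> \bar R) : measurable_fun setT f ->
  measurable_fun setT (fun r => f r * (hinv r)%:E).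
Proof. by move=> mf; apply: emeasurable_funM => //; apply/measurable_EFinP. Qed.

Let I1_scale (f : R -> \bar R) (c : R) : (0 < c)%R ->
  measurable_fun setT f -> (forall x, 0 <= f x) ->
  \int[mu]_r (f (c * r)%R * (hinv r)%:E) = I1 f.
Proof.
move=> c0 mf f0; rewrite /I1 -[RHS](@ge0_integral_scale1 _ _ c); last 3 first.
- by rewrite gt_eqF.
- exact: mmul.
- by move=> x; rewrite mule_ge0// lee_fin.
rewrite -ge0_integralZl_EFin; last 4 first.
- by [].
- by move=> x _; rewrite mule_ge0// lee_fin.
- by apply: (measurableT_comp (mmul mf)); measurability.
- by [].
apply: eq_integral => r _; rewrite muleCA -EFinM; congr (_ * _%:E).
rewrite /hinv pmulr_rgt0// gtr0_norm//.
have [->|r0] := eqVneq r 0%R; first by rewrite !(mulr0, invr0).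
by field; rewrite r0 gt_eqF.
Qed.

Let I12 (f g : R -> \bar R) :
  measurable_fun setT f -> (forall x, 0 <= f x) ->
  measurable_fun setT g -> (forall x, 0 <= g x) ->
  I1 f * I2 g = I1 g * I2 f.
Proof.
apply: (@log_haar _ (measurableTypeR R) mu (fun r => r) hinv) => //.
- by move=> t; rewrite /hinv; case: ltP => //; rewrite mul0r eqxx.
Qed.

(** A reference function with integral 1 both for dr/r and, composed with exp, for dx: it shows that
    the constant of proportionality is 1. *)
Let ref (r : R) : R := r * ((0 < r) && (r <= 1))%R%:R.

Let measurable_ref : measurable_fun setT ref.
Proof.
apply: measurable_funM => //; apply: measurable_bool_natr.
by apply: measurable_and; [exact: measurable_fun_ltr|exact: measurable_fun_ler].
Qed.

Let ref_ge0 r : (0 <= ref r)%R.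
Proof. by rewrite /ref; case: ltP => //= r0; rewrite ?mulr0// mulr_ge0// ltW. Qed.

Let I1_ref : I1 (EFin \o ref) = 1.
Proof.
transitivity (\int[mu]_(r in `]0%R, 1%R]) (1 : \bar R)); last first.
  by rewrite integral_cst//= lebesgue_measure_itv/= lte_fin ltr01 sube0 mul1e.
rewrite integral_restrict_bool; apply: eq_integral => r _.
rewrite mul1e -EFinM mem_setE in_itv/=; congr (_%:E).
rewrite /ref /hinv; have [r0|r0]/= := ltP 0%R r; last by rewrite mul0r mulr0.
by rewrite mulrAC mul1r divff ?gt_eqF// mul1r.
Qed.

(** After x -> -x, the integrand times k is the density of the exponential law of parameter k, of
    total mass 1. *)
Lemma ge0_integral_expRM (k : R) : (0 < k)%R ->
  \int[mu]_x (expR (k * x) * (x <= 0)%R%:R)%:E = (k^-1)%:E.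
Proof.
move=> k0; rewrite -[LHS]ge0_integral_opp1; last 2 first.
- apply/measurable_EFinP; apply: measurable_funM; first by measurability.
  by apply: measurable_bool_natr; apply: measurable_fun_ler.
- by move=> x; rewrite lee_fin mulr_ge0 ?expR_ge0.
apply: (@eqe_mulfinI _ k) => //.
rewrite -EFinM divff ?gt_eqF// -(integral_exponential_pdf k0).
rewrite -ge0_integralZl_EFin; last 4 first.
- by [].
- by move=> x _; rewrite lee_fin mulr_ge0 ?expR_ge0.
- apply/measurable_EFinP; apply: measurable_funM; first by measurability.
  by apply: measurable_bool_natr; apply: measurable_fun_ler => //; measurability.
- exact: ltW.
apply: eq_integral => x _; rewrite -EFinM oppr_le0; congr (_%:E).
rewrite /exponential_pdf patchE mem_setE in_itv/= andbT.
by case: ifP => _; rewrite ?mulr1 ?mulr0// mulrN mulNr.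
Qed.

Let I2_ref : I2 (EFin \o ref) = 1.
Proof.
rewrite -[RHS]/((1 : R)%:E) -[1%R]invr1 -ge0_integral_expRM//.
apply: eq_integral => x _ /=.
by rewrite /ref expR_gt0/= mul1r -[X in (_ <= X)%R]expR0 ler_expR.
Qed.

(** The substitution r = e^x, as an instance of uniqueness of the invariant measure; the constant is
    fixed by [ref]. *)
Lemma ge0_integral_log (f : R -> \bar R) :
  measurable_fun setT f -> (forall x, 0 <= f x) ->
  \int[mu]_r (f r * ((0 < r)%R%:R / r)%:E) = \int[mu]_x f (expR x).
Proof.
move=> mf f0.
have := @I12 f (EFin \o ref) mf f0.
rewrite I1_ref I2_ref mule1 mul1e; apply; first exact/measurable_EFinP.
by move=> x; rewrite /= lee_fin.
Qed.

(** In the variable x = ln r, the map r -> c/r is the reflection x -> ln c - x. *)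
Let inversion (f : R -> \bar R) (c : R) : (0 < c)%R ->
  measurable_fun setT f -> (forall x, 0 <= f x) ->
  \int[mu]_r (f (c / r)%R * ((0 < r)%R%:R / r)%:E) =
  \int[mu]_r (f r * ((0 < r)%R%:R / r)%:E).
Proof.
move=> c0 mf f0.
have mge (h : R -> \bar R) : measurable_fun setT h -> measurable_fun setT (fun x : R => h (expR x)).
  by move=> mh; apply: (measurableT_comp mh); measurability.
rewrite ge0_integral_log; last 2 first.
- by apply: (measurableT_comp mf); measurability.
- by move=> x; exact: f0.
rewrite ge0_integral_log//.
rewrite -[RHS](@ge0_integral_shift1 _ _ (ln c)); last 2 first.
- exact: mge.
- by move=> x; exact: f0.
rewrite -[RHS]ge0_integral_opp1; last 2 first.
- by apply: (measurableT_comp mf); measurability.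
- by move=> x; exact: f0.
by apply: eq_integral => x _; rewrite expRD lnK// mulrC expRN.
Qed.

Let split_sign (f : R -> \bar R) :
  measurable_fun setT f -> (forall x, 0 <= f x) ->
  \int[mu]_r (f r * (`|r|^-1)%:E) =
  \int[mu]_r (f r * (hinv r)%:E) + \int[mu]_r (f (- r)%R * (hinv r)%:E).
Proof.
move=> mf f0.
have mN : measurable_fun setT (fun r : R => f (- r)%R * (hinv r)%:E).
  apply: emeasurable_funM; first by apply: (measurableT_comp mf); measurability.
  exact/measurable_EFinP.
have mN' : measurable_fun setT (fun r : R => f r * (hinv (- r))%:E).
  apply: emeasurable_funM => //.
  by apply/measurable_EFinP; apply: (measurableT_comp measurable_hinv); measurability.
rewrite -[X in _ + X]ge0_integral_opp1; last 2 first.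
- exact: mN.
- by move=> x; rewrite mule_ge0// lee_fin.
under [X in _ + X]eq_integral do rewrite opprK.
rewrite -ge0_integralD; last 5 first.
- by [].
- by move=> x _; rewrite mule_ge0// lee_fin.
- exact: mmul.
- by move=> x _; rewrite mule_ge0// lee_fin.
- exact: mN'.
apply: eq_integral => r _.
rewrite -ge0_muleDr; last 2 first.
- by rewrite lee_fin.
- by rewrite lee_fin.
rewrite -EFinD; congr (_ * _%:E).
rewrite /hinv oppr_gt0; case: ltgtP => [r0|r0|<-].
- by rewrite gtr0_norm// mul0r addr0 mul1r.
- by rewrite ltr0_norm// mul0r add0r mul1r.
- by rewrite !mul0r normr0 invr0 addr0.
Qed.

(** Each half-line is an instance of [inversion]; a negative q exchanges them, hence the splitting
    by sign. The symmetry of the relation <y,z> = 0 will come down to this invariance. *)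
Lemma ge0_integral_inversion (f : R -> \bar R) (q : R) : (q != 0)%R ->
  measurable_fun setT f -> (forall x, 0 <= f x) ->
  \int[mu]_r (f (q / r)%R * (`|r|^-1)%:E) = \int[mu]_r (f r * (`|r|^-1)%:E).
Proof.
move=> q0 mf f0.
have mfN : measurable_fun setT (fun x : R => f (- x)%R).
  by apply: (measurableT_comp mf); measurability.
rewrite (@split_sign (fun r => f (q / r)%R)); last 2 first.
- by apply: (measurableT_comp mf); measurability.
- by move=> x; exact: f0.
rewrite split_sign//.
have [qn|qp|/eqP] := ltgtP q 0%R; last by rewrite (negbTE q0).
- rewrite addeC -(@inversion f (- q)%R)//; last by rewrite oppr_gt0.
  congr (_ + _).
    by apply: eq_integral => x _; rewrite invrN mulrN mulNr.
  rewrite -(@inversion (fun x => f (- x)%R) (- q)%R)//; last by rewrite oppr_gt0.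
  by apply: eq_integral => x _; rewrite mulNr opprK.
- rewrite -(@inversion f q)//; congr (_ + _).
  rewrite -(@inversion (fun x => f (- x)%R) q)//.
  by apply: eq_integral => x _; rewrite invrN mulrN.
Qed.

End MultiplicativeHaar.

Section NullSets.
Context {R : realType}.
Local Notation mu := (@lebesgue_measure R).
Local Open Scope ereal_scope.

Lemma ge0_eq_integral_off d (T : measurableType d)
    (M : {measure set T -> \bar R}) (N : set T) (f g : T -> \bar R) :
  measurable N -> M N = 0 ->
  measurable_fun setT f -> (forall x, 0 <= f x) ->
  measurable_fun setT g -> (forall x, 0 <= g x) ->
  (forall x, ~ N x -> f x = g x) -> \int[M]_x f x = \int[M]_x g x.
Proof.
move=> mN N0 mf f0 mg g0 fg.
rewrite (@ge0_negligible_integral _ _ _ M setT N f)//.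
rewrite (@ge0_negligible_integral _ _ _ M setT N g)//.
by apply: eq_integral => x /set_mem[_]; exact: fg.
Qed.

Let int_eq0 (K : \bar R) : 0 <= K ->
  \int[mu]_a ((a == 0)%:R%:E * K) = 0.
Proof.
move=> K0.
have mE : measurable_fun setT (fun a : R => ((a == 0)%:R : R)%:E * K).
  apply: emeasurable_funM => //.
  by apply/measurable_EFinP; apply: measurable_bool_natr; exact: measurable_fun_eqr.
rewrite (@ge0_eq_integral_off _ _ mu [set 0%R] _ (cst 0))//.
- by rewrite integral0.
- exact: lebesgue_measure_set1.
- by move=> x; rewrite mule_ge0// lee_fin.
- by move=> x /= /eqP/negbTE ->; rewrite mul0e.
Qed.

(** In coordinates adapted to w the hyperplane is a = 0, where a runs over the line. *)
Lemma leb_hyperplane_null m (w : 'rV[R]_m) : w != 0%R ->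
  measurable [set z | dotp w z = 0%R] /\ leb R m [set z | dotp w z = 0%R] = 0.
Proof.
case: m w => [w|m w w0]; first by rewrite (thinmx0 w) eqxx.
have mN : measurable [set z | dotp w z = 0%R].
  have : measurable_fun setT (fun z => dotp w z) by measurability.
  by move=> /(_ measurableT [set 0%R] (measurable_set1 _)); rewrite setTI.
split => //.
rewrite -[X in leb R m.+1 X]setIT -integral_indic//.
pose xi := ((enorm w)^-1 *: w)%R.
have wn : (0 < enorm w)%R by rewrite enorm_gt0.
have xi1 : enorm xi = 1%R.
  by rewrite enormZ ger0_norm ?invr_ge0 ?enorm_ge0// mulVf// gt_eqF.
have wE : w = (enorm w *: xi)%R by rewrite scalerA divff ?gt_eqF// scale1r.
rewrite (ge0_integral_frame xi1); last 2 first.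
- by apply/measurable_EFinP; exact: measurable_indic.
- by move=> x; rewrite lee_fin.
(* The mass K of the other coordinates may be +oo; off the null set a = 0 the integrand is 0 * K =
   0. *)
rewrite -[RHS](int_eq0 (K := leb R m setT))//.
apply: eq_integral => a _.
rewrite -integral_cst//; apply: eq_integral => u _; rewrite indicE.
congr ((_ : bool)%:R)%:E.
have E : dotp w (hplane xi u + a *: xi)%R = (enorm w * a)%R.
  rewrite [in dotp w _]wE dotpZl dotpDr dotpC hplane_orth// dotpZr enorm1_dotp//.
  by rewrite add0r mulr1.
apply/idP/eqP => [|a0]; last by rewrite inE/= E a0 mulr0.
by rewrite inE/= E => /eqP; rewrite mulf_eq0 gt_eqF//= => /eqP.
Qed.

Lemma leb_set0_null m : measurable [set 0%R : 'rV[R]_m.+1] /\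
  leb R m.+1 [set 0%R] = 0.
Proof.
have e0 : delta_mx ord0 ord0 != 0%R :> 'rV[R]_m.+1.
  apply/eqP => /matrixP/(_ ord0 ord0); rewrite !mxE !eqxx => /eqP.
  by rewrite oner_eq0.
have [mN N0] := leb_hyperplane_null e0.
have m0 : measurable [set 0%R : 'rV[R]_m.+1].
  rewrite (_ : [set _] = [set x | enorm x = 0%R]); last first.
    by apply/seteqP; split => x /= => [->|/eqP]; rewrite ?enorm0// enorm_eq0 => /eqP.
  have : measurable_fun setT (fun z : 'rV[R]_m.+1 => enorm z) by measurability.
  by move=> /(_ measurableT [set 0%R] (measurable_set1 _)); rewrite setTI.
split => //; apply/eqP; rewrite -measure_le0 -N0.
by apply: le_measure; rewrite ?inE// => x -> /=; rewrite dotp0r.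
Qed.

End NullSets.

(** The value of [Gamma] before its conversion to a real, which would send an infinite integral to
    0: finiteness can thus be proved rather than presupposed. *)
Definition gamma_integral {R : realType} (z : R) : \bar R :=
  (\int[@lebesgue_measure R]_(x in [set` `]0%R, +oo[%R]) (x `^ (z - 1) * expR (- x))%:E)%E.

(** * Polar coordinates and the area of the sphere *)

Section Radial.
Context {R : realType} (m : nat).
Local Notation mu := (@lebesgue_measure R).
Local Open Scope ereal_scope.

(** The density |u|^(-(m+1)) makes Lebesgue measure on R^(m+1) invariant under dilations, as
    [log_haar] requires. *)
Let p (u : 'rV[R]_m.+1) : R := ((enorm u)^-1 ^+ m.+1)%R.

(** Equal to the area of the unit sphere of R^(m+1) divided by m + 2, since the integral of r * r^m
    over [0, 1] is 1/(m+2). This moment stands for the area because the measure of the sphere is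
    defined by cones in dimension m + 2. *)
Definition ball_moment : \bar R :=
  \int[leb R m.+1]_u (enorm u * (enorm u <= 1)%R%:R)%:E.

Let measurable_le1 d (T : measurableType d) (f : T -> R) :
  measurable_fun setT f -> measurable_fun setT (fun x => (f x <= 1)%R%:R : R).
Proof.
by move=> mf; apply: measurable_bool_natr; apply: measurable_fun_ler.
Qed.

(** The substitution r = e^(2x): half-integral powers of r become powers of e^x, as in polar
    coordinates. *)
Let gammaE : gamma_integral (m.+1%:R / 2) =
  2%:E * \int[mu]_x (expR x ^+ m.+1 * expR (- (expR x ^+ 2)))%:E.
Proof.
rewrite /gamma_integral integral_restrict_bool.
have mf : measurable_fun setT
    (fun r : R => (r `^ (m.+1%:R / 2) * expR (- r))%:E).
  apply/measurable_EFinP; apply: measurable_funM; last by measurability.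
  exact: measurable_powR.
have f0 (r : R) : 0 <= (r `^ (m.+1%:R / 2) * expR (- r))%:E.
  by rewrite lee_fin mulr_ge0 ?powR_ge0 ?expR_ge0.
transitivity (\int[mu]_r ((r `^ (m.+1%:R / 2) * expR (- r))%:E *
    ((0 < r)%R%:R / r)%:E)).
  apply: eq_integral => r _; rewrite -!EFinM mem_setE in_itv/= andbT.
  congr (_%:E); have [r0|r0] := ltP 0%R r; last by rewrite mul0r !mulr0.
  rewrite mulr1 mul1r powRD; last by rewrite (gt_eqF r0)/= implybT.
  by rewrite powR_inv1 ?ltW// mulrAC.
rewrite ge0_integral_log//.
rewrite -(@ge0_integral_scale1 _ _ 2); last 3 first.
- by [].
- by apply: (measurableT_comp mf); measurability.
- by move=> x; exact: f0.
rewrite (ger0_norm (ler0n R 2)); congr (_ * _); apply: eq_integral => x _.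
congr ((_ * expR (- _))%:E).
  by rewrite /powR gt_eqF ?expR_gt0// expRK -expRM_natl; congr expR; field.
by rewrite mulr2n mulrDl mul1r expRD expr2.
Qed.

Let measurable_p : measurable_fun setT p.
Proof. by rewrite /p; measurability. Qed.

Let p_ge0 u : (0 <= p u)%R.
Proof. by rewrite exprn_ge0// invr_ge0 enorm_ge0. Qed.

Let p_neq0 u : p u != 0%R -> (0 < enorm u)%R.
Proof.
by rewrite enorm_gt0; apply: contra => /eqP ->; rewrite /p enorm0 invr0 expr0n.
Qed.

Let p_scale (F : R -> \bar R) (c : R) : (0 < c)%R ->
  measurable_fun setT F -> (forall x, 0 <= F x) ->
  \int[leb R m.+1]_t (F (c * enorm t)%R * (p t)%:E) =
  \int[leb R m.+1]_t (F (enorm t) * (p t)%:E).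
Proof.
move=> c0 mF F0.
have mFe : measurable_fun setT (fun t : 'rV[R]_m.+1 => F (enorm t) * (p t)%:E).
  apply: emeasurable_funM; first by apply: (measurableT_comp mF); measurability.
  exact/measurable_EFinP.
have pos : forall t : 'rV[R]_m.+1, 0 <= F (enorm t) * (p t)%:E.
  by move=> t; rewrite mule_ge0// lee_fin.
rewrite -[RHS](@ge0_integral_leb_scale _ _ _ c); last 3 first.
- by rewrite gt_eqF.
- exact: mFe.
- exact: pos.
rewrite -ge0_integralZl_EFin; last 4 first.
- by [].
- by move=> t _; exact: pos.
- by apply: (measurableT_comp mFe); measurability.
- exact: exprn_ge0.
apply: eq_integral => t _; rewrite enormZ (gtr0_norm c0) muleCA -EFinM.
congr (_ * (_)%:E); rewrite /p enormZ (gtr0_norm c0) invfM exprMn mulrA -exprMn.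
by rewrite divff ?gt_eqF// expr1n mul1r.
Qed.

(** Both sides define, as functionals of F, dilation invariant measures up to the power of r, so
    [log_haar] leaves only a constant to find. It is read off at g(r) = r^(m+2) on r <= 1: the left
    side is then [ball_moment] and the integral over x is 1/(m+2). *)
Lemma ge0_integral_radial (F : R -> \bar R) :
  measurable_fun setT F -> (forall r, 0 <= F r) ->
  \int[leb R m.+1]_u F (enorm u) =
  m.+2%:R%:E * (ball_moment * \int[mu]_x (F (expR x) * (expR x ^+ m.+1)%:E)).
Proof.
move=> mF F0.
pose f (r : R) : \bar R := F r * (`|r| ^+ m.+1)%:E.
pose g (r : R) : \bar R := (`|r| ^+ m.+2 * (r <= 1)%R%:R)%:E.
have mn n : measurable_fun setT (fun r : R => (`|r| ^+ n)%R).
  by apply: measurable_funX.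
have mf : measurable_fun setT f.
  by apply: emeasurable_funM => //; apply/measurable_EFinP.
have mg : measurable_fun setT g.
  by apply/measurable_EFinP; apply: measurable_funM => //; exact: measurable_le1.
have f0 r : 0 <= f r by rewrite mule_ge0// lee_fin exprn_ge0.
have g0 r : 0 <= g r by rewrite lee_fin mulr_ge0 ?exprn_ge0.
have menorm : measurable_fun setT (fun u : 'rV[R]_m.+1 => enorm u).
  by measurability.
have := log_haar menorm measurable_p p_ge0 p_neq0 p_scale mf f0 mg g0.
have [m0 N0] := @leb_set0_null R m.
have -> : \int[leb R m.+1]_t (f (enorm t) * (p t)%:E) =
    \int[leb R m.+1]_u F (enorm u).
  apply: (ge0_eq_integral_off m0 N0).
  - apply: emeasurable_funM; first exact: (measurableT_comp mf).
    exact/measurable_EFinP.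
  - by move=> u; rewrite mule_ge0// lee_fin.
  - exact: (measurableT_comp mF).
  - by move=> u; exact: F0.
  - move=> u /eqP u0; rewrite /f ger0_norm ?enorm_ge0// -muleA -EFinM.
    by rewrite /p -exprMn divff ?enorm_eq0// expr1n mule1.
have -> : \int[leb R m.+1]_t (g (enorm t) * (p t)%:E) = ball_moment.
  apply: eq_integral => u _; rewrite /g ger0_norm ?enorm_ge0// -EFinM mulrAC.
  have [->|u0] := eqVneq u 0%R; first by rewrite enorm0 expr0n !mul0r.
  by rewrite exprS /p -(mulrA (enorm u)) -exprMn divff ?enorm_eq0// expr1n mulr1.
have -> : \int[mu]_x g (expR x) = (m.+2%:R^-1)%:E.
  rewrite -ge0_integral_expRM//; apply: eq_integral => x _.
  rewrite /g ger0_norm ?expR_ge0// -expRM_natl.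
  by rewrite -[X in (_ <= X)%R]expR0 ler_expR.
rewrite (_ : \int[mu]_x f (expR x) =
    \int[mu]_x (F (expR x) * (expR x ^+ m.+1)%:E)); last first.
  by apply: eq_integral => x _; rewrite /f ger0_norm ?expR_ge0.
move=> <-; rewrite muleCA -EFinM divff ?mule1//.
Qed.

(** The Gaussian integral of R^(m+1) in polar coordinates. It says that the area of the unit sphere
    of R^(m+1) times Gamma((m+1)/2) is 2 pi^((m+1)/2); with m + 2 = n, the area is 1/a_n. *)
Lemma ball_moment_gamma :
  m.+2%:R%:E * (ball_moment * gamma_integral (m.+1%:R / 2)) =
  (2 * Num.sqrt pi ^+ m.+1)%:E.
Proof.
rewrite gammaE (muleCA ball_moment) (muleCA m.+2%:R%:E) EFinM; congr (_ * _).
rewrite -gauss_integral_leb.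
have mF : measurable_fun setT (fun r : R => (expR (- r ^+ 2))%:E) by measurability.
under [RHS]eq_integral do rewrite -enorm_sqr.
rewrite (ge0_integral_radial mF); last by move=> r; rewrite lee_fin expR_ge0.
by do 2![congr (_ * _)]; apply: eq_integral => x _; rewrite -EFinM mulrC.
Qed.

End Radial.

(** * Pairs of orthogonal vectors, integrated in either order *)

Section Duality.
Context {R : realType}.
Local Notation mu := (@lebesgue_measure R).
Local Open Scope ereal_scope.

Lemma measurable_integral_param d (T : measurableType d) d2 (T2 : measurableType d2)
    (M : {sigma_finite_measure set T2 -> \bar R}) (F : T -> T2 -> \bar R) :
  measurable_fun setT (fun p : T * T2 => F p.1 p.2) ->
  (forall x y, 0 <= F x y) ->
  measurable_fun setT (fun x => \int[M]_y F x y).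
Proof.
by move=> mF F0; exact: (measurable_fun_fubini_tonelli_F (m2 := M) (fun p => F p.1 p.2)).
Qed.

Definition tail_rv m (x : 'rV[R]_m.+1) : 'rV[R]_m := (\row_j x ord0 (lift ord0 j))%R.

Lemma cons_tail m (x : 'rV[R]_m.+1) : cons_rv (x ord0 ord0) (tail_rv x) = x.
Proof. exact: cons_rvK. Qed.

Lemma tail_cons m (a : R) (v : 'rV[R]_m) : tail_rv (cons_rv a v) = v.
Proof. by apply/rowP => j; rewrite mxE cons_rvS. Qed.

Lemma measurable_tail_rv m d (T : measurableType d) (f : T -> 'rV[R]_m.+1) :
  measurable_fun setT f -> measurable_fun setT (fun x => tail_rv (f x)).
Proof.
move=> mf; apply/measurable_rvP => i; under eq_fun do rewrite mxE.
exact: measurable_rv_coord.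
Qed.

Definition normalize n (z : 'rV[R]_n) : 'rV[R]_n := ((enorm z)^-1 *: z)%R.

Lemma enorm_normalize n (z : 'rV[R]_n) : z != 0%R -> enorm (normalize z) = 1%R.
Proof.
move=> z0; rewrite enormZ ger0_norm ?invr_ge0 ?enorm_ge0// mulVf//.
by rewrite enorm_eq0.
Qed.

Lemma measurable_normalize n d (T : measurableType d) (f : T -> 'rV[R]_n) :
  measurable_fun setT f -> measurable_fun setT (fun x => normalize (f x)).
Proof. by move=> mf; rewrite /normalize; measurability. Qed.

Section graph.
Context {m : nat}.
Local Notation E := 'rV[R]_m.+1.

(** The hyperplane is a graph over its last m coordinates v, with Jacobian 1/|xi_0|. This comes from
    smearing with the vector e_0 / xi_0, along which the projection keeps v: the smearing variable
    then runs over a b + <w, tail xi> in [0, 1], an interval of length 1/|a| in b. *)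
Lemma ge0_integral_graph (xi : E) (k : E -> \bar R) :
  enorm xi = 1%R -> xi ord0 ord0 != 0%R ->
  measurable_fun setT k -> (forall x, 0 <= k x) ->
  \int[leb R m]_u k (hplane xi u) =
  (`|xi ord0 ord0|^-1)%:E *
  \int[leb R m]_v k (cons_rv (- (dotp v (tail_rv xi) / xi ord0 ord0))%R v).
Proof.
move=> xi1 a0 mk k0; set a := xi ord0 ord0 in a0 *.
have xiE : xi = cons_rv a (tail_rv xi) by rewrite cons_tail.
pose v : E := cons_rv a^-1%R 0%R.
have vxi : dotp v xi = 1%R by rewrite xiE dotp_cons dotp0l addr0 mulVf.
have mi : measurable_fun setT (fun x : R => (\1_(`[0%R, 1%R]%classic) x : R)%:E).
  by apply/measurable_EFinP; exact: measurable_indic.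
have mF : measurable_fun setT (fun x : E => k (x - dotp x xi *: v)%R *
     (\1_(`[0%R, 1%R]%classic) (dotp x xi))%:E).
  apply: emeasurable_funM; first by apply: (measurableT_comp mk); measurability.
  by apply: (measurableT_comp mi); measurability.
have F0 : forall x : E, 0 <= k (x - dotp x xi *: v)%R *
     (\1_(`[0%R, 1%R]%classic) (dotp x xi))%:E.
  by move=> x; rewrite mule_ge0// lee_fin.
rewrite (ge0_integral_smear xi1 vxi mk k0) ge0_integral_leb_cons; last 2 first.
- exact: mF.
- exact: F0.
pose G (w : 'rV[R]_m) := k (cons_rv (- (dotp w (tail_rv xi) / a))%R w).
have mG : measurable_fun setT G.
  apply: (measurableT_comp mk); apply: measurable_cons_rv; last by measurability.
  by apply: measurable_funN; measurability.
pose H (b : R) (w : 'rV[R]_m) := G w *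
  (\1_(`[0%R, 1%R]%classic) (a * b + dotp w (tail_rv xi))%R)%:E.
have mH : measurable_fun setT (fun p : R * 'rV[R]_m => H p.1 p.2).
  apply: emeasurable_funM; first by apply: (measurableT_comp mG); measurability.
  by apply: (measurableT_comp mi); measurability.
have G0 w : 0 <= G w by exact: k0.
have H0 b w : 0 <= H b w by rewrite mule_ge0// lee_fin.
transitivity (\int[mu]_b \int[leb R m]_w H b w).
  apply: eq_integral => b _; apply: eq_integral => w _.
  have -> : dotp (cons_rv b w) xi = (a * b + dotp w (tail_rv xi))%R.
    by rewrite [in LHS]xiE dotp_cons mulrC.
  rewrite /H /G; congr (k _ * _); apply/rowP => i; rewrite !mxE.
  case: unliftP => [j _|_]; first by rewrite mxE mulr0 subr0.
  by field.
rewrite (fubini_tonelli_leb1 mH H0).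
rewrite -[RHS]ge0_integralZl_EFin; last 4 first.
- by [].
- by move=> w _; exact: G0.
- exact: mG.
- by rewrite invr_ge0.
apply: eq_integral => w _.
rewrite ge0_integralZl; last 4 first.
- by [].
- by apply: (measurableT_comp mi); measurability.
- by move=> b _; rewrite lee_fin.
- exact: G0.
rewrite muleC; congr (_ * _).
apply: (@eqe_mulfinI _ `|a|); first by rewrite normr_gt0.
rewrite (@ge0_integral_affine1 _ (fun r : R => (\1_(`[0%R, 1%R]%classic) r : R)%:E)); last 3 first.
- exact: a0.
- exact: mi.
- by move=> r; rewrite lee_fin.
rewrite integral_indic// setIT /= lebesgue_measure_itv/= lte_fin ltr01 sube0.
by rewrite -EFinM divff ?normr_eq0.
Qed.

Variable k : E -> E -> \bar R.
Hypothesis mk : measurable_fun setT (fun p : E * E => k p.1 p.2).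
Hypothesis k0 : forall y z, 0 <= k y z.

Let mk2 d (T : measurableType d) (f g : T -> E) :
  measurable_fun setT f -> measurable_fun setT g ->
  measurable_fun setT (fun t => k (f t) (g t)).
Proof.
by move=> mf mg; exact: (measurableT_comp mk (measurable_fun_pair mf mg)).
Qed.

(** The frame of the hyperplane depends on z in no controlled way; the smeared form of the integral
    no longer contains it, and Tonelli applies. *)
Lemma measurable_hyperplane_integral : measurable_fun setT
  (fun z : E => (enorm z)^-1%:E * \int[leb R m]_u k (hplane (normalize z) u) z).
Proof.
have mi : measurable_fun setT (fun x : R => (\1_(`[0%R, 1%R]%classic) x : R)%:E).
  by apply/measurable_EFinP; exact: measurable_indic.
rewrite (_ : (fun z : E => _) = (fun z : E => (enorm z)^-1%:E *
  \int[leb R m.+1]_x (k (x - dotp x (normalize z) *: normalize z)%R z *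
     (\1_(`[0%R, 1%R]%classic) (dotp x (normalize z)))%:E))); last first.
  apply/funext => z; have [->|z0] := eqVneq z 0%R.
    by rewrite enorm0 invr0 !mul0e.
  congr (_ * _); apply: (@ge0_integral_smear _ _ _ _ (fun y => k y z)).
  - exact: enorm_normalize.
  - by rewrite enorm1_dotp// enorm_normalize.
  - exact: mk2.
  - by move=> y; exact: k0.
apply: emeasurable_funM; first by measurability.
have mn : measurable_fun setT (fun p : E * E => normalize p.1).
  by apply: measurable_normalize; measurability.
apply: (@measurable_integral_param _ _ _ _ _ (fun z x : E =>
    k (x - dotp x (normalize z) *: normalize z)%R z *
     (\1_(`[0%R, 1%R]%classic) (dotp x (normalize z)))%:E)).
  apply: emeasurable_funM; first by apply: mk2; measurability.
  by apply: (measurableT_comp mi); measurability.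
by move=> x y; rewrite mule_ge0// lee_fin.
Qed.

(** With z = (a, w) the orthogonal vectors are (-<v,w>/a, v). The factor 1/|z| and the Jacobian
    |z|/|a| of the graph combine into 1/|a|, so that a is integrated against the invariant measure
    of the multiplicative group. *)
Lemma hyperplane_integral_coords :
  \int[leb R m.+1]_z
    ((enorm z)^-1%:E * \int[leb R m]_u k (hplane (normalize z) u) z) =
  \int[leb R m]_w \int[leb R m]_v \int[mu]_a
    (k (cons_rv (- (dotp v w / a))%R v) (cons_rv a w) * (`|a|^-1)%:E).
Proof.
pose e0 : E := delta_mx ord0 ord0.
have e0E x : dotp e0 x = x ord0 ord0.
  rewrite /dotp big_ord_recl big1 => [|i _]; rewrite !mxE/= ?mul0r//.
  by rewrite mul1r addr0.
have e00 : e0 != 0%R.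
  apply/eqP => /matrixP/(_ ord0 ord0); rewrite !mxE !eqxx => /eqP.
  by rewrite oner_eq0.
have [mN N0] := leb_hyperplane_null e00.
pose K (z : E) (v : 'rV[R]_m) :=
  k (cons_rv (- (dotp v (tail_rv z) / z ord0 ord0))%R v) z.
have mK : measurable_fun setT (fun p : E * 'rV[R]_m => K p.1 p.2).
  have mt : measurable_fun setT (fun p : E * 'rV[R]_m => tail_rv p.1).
    by apply: measurable_tail_rv; measurability.
  apply: mk2; last by measurability.
  apply: measurable_cons_rv; last by measurability.
  by apply: measurable_funN; measurability.
have K0 z v : 0 <= K z v by exact: k0.
have mIK : measurable_fun setT
    (fun z : E => (`|z ord0 ord0|^-1)%:E * \int[leb R m]_v K z v).
  apply: emeasurable_funM; last exact: measurable_integral_param.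
  apply/measurable_EFinP; apply: measurable_invr_fun.
  by apply: (measurableT_comp (@normr_measurable _ setT)); measurability.
have IK0 : forall z : E, 0 <= (`|z ord0 ord0|^-1)%:E * \int[leb R m]_v K z v.
  by move=> z; rewrite mule_ge0// ?lee_fin ?invr_ge0//; exact: integral_ge0.
transitivity (\int[leb R m.+1]_z
    ((`|z ord0 ord0|^-1)%:E * \int[leb R m]_v K z v)).
  apply: (ge0_eq_integral_off mN N0).
  - exact: measurable_hyperplane_integral.
  - move=> z; rewrite mule_ge0// ?lee_fin ?invr_ge0 ?enorm_ge0//.
    by apply: integral_ge0 => u _; exact: k0.
  - exact: mIK.
  - exact: IK0.
  move=> z /=; rewrite e0E => /eqP z0.
  have zn0 : z != 0%R by apply: contra z0 => /eqP ->; rewrite mxE.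
  have ez : (0 < enorm z)%R by rewrite enorm_gt0.
  have cE : normalize z ord0 ord0 = ((enorm z)^-1 * z ord0 ord0)%R by rewrite mxE.
  rewrite (@ge0_integral_graph _ (fun y => k y z)); last 4 first.
  - exact: enorm_normalize.
  - by rewrite cE mulf_neq0// invr_eq0 gt_eqF.
  - exact: mk2.
  - by move=> y; exact: k0.
  rewrite muleA -EFinM cE; congr ((_)%:E * _).
    by rewrite normrM gtr0_norm ?invr_gt0//; field; rewrite normr_eq0 z0 gt_eqF.
  apply: eq_integral => v _; congr (k (cons_rv (- _)%R _) _).
  have -> : tail_rv (normalize z) = ((enorm z)^-1 *: tail_rv z)%R.
    by apply/rowP => j; rewrite !mxE.
  by rewrite dotpZr; field; rewrite z0 gt_eqF.
rewrite ge0_integral_leb_cons; last 2 first.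
- exact: mIK.
- exact: IK0.
pose G a w v := k (cons_rv (- (dotp v w / a))%R v) (cons_rv a w) * (`|a|^-1)%:E.
have G0 a w v : 0 <= G a w v by rewrite mule_ge0// lee_fin invr_ge0.
have mG d (T : measurableType d) (fa : T -> R) (fw fv : T -> 'rV[R]_m) :
    measurable_fun setT fa -> measurable_fun setT fw -> measurable_fun setT fv ->
    measurable_fun setT (fun t => G (fa t) (fw t) (fv t)).
  move=> ma mw mv; apply: emeasurable_funM; last first.
    apply/measurable_EFinP; apply: measurable_invr_fun.
    exact: (measurableT_comp (@normr_measurable _ setT)).
  apply: mk2; last exact: measurable_cons_rv.
  apply: measurable_cons_rv => //.
  by apply: measurable_funN; measurability.
transitivity (\int[mu]_a \int[leb R m]_w \int[leb R m]_v G a w v).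
  apply: eq_integral => a _; apply: eq_integral => w _.
  rewrite cons_rv0 muleC -ge0_integralZr; last 4 first.
  - by [].
  - apply: mk2; last by measurability.
    apply: measurable_cons_rv; last by measurability.
    by apply: measurable_funN; measurability.
  - by move=> v _; exact: k0.
  - by rewrite lee_fin invr_ge0.
  by apply: eq_integral => v _; rewrite /G /K cons_rv0 tail_cons.
rewrite fubini_tonelli_leb1; last 2 first.
- apply: (@measurable_integral_param _ _ _ _ _
      (fun (q : R * 'rV[R]_m) v => G q.1 q.2 v)).
    by apply: (mG _ _ (fun p : (R * 'rV[R]_m) * 'rV[R]_m => p.1.1)
      (fun p => p.1.2) (fun p => p.2)); measurability.
  by move=> q v; exact: G0.
- by move=> a w; apply: integral_ge0 => v _; exact: G0.
apply: eq_integral => w _; rewrite fubini_tonelli_leb1//.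
by apply: (mG _ _ _ (fun=> w)); measurability.
Qed.

End graph.

End Duality.

Section Duality2.
Context {R : realType} {m : nat}.
Local Notation mu := (@lebesgue_measure R).
Local Notation E := 'rV[R]_m.+2.
Local Open Scope ereal_scope.

(** The relation <y,z> = 0 is symmetric. In coordinates, y = (r, v) and z = (a, w) satisfy r a =
    -<v,w>, so exchanging the roles of y and z is the substitution a -> -<v,w>/a, under which da/|a|
    is invariant. *)
Lemma hyperplane_integral_sym (k : E -> E -> \bar R) :
  measurable_fun setT (fun p : E * E => k p.1 p.2) -> (forall y z, 0 <= k y z) ->
  \int[leb R m.+2]_z
    ((enorm z)^-1%:E * \int[leb R m.+1]_u k (hplane (normalize z) u) z) =
  \int[leb R m.+2]_y
    ((enorm y)^-1%:E * \int[leb R m.+1]_u k y (hplane (normalize y) u)).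
Proof.
move=> mk k0.
have mkT : measurable_fun setT (fun p : E * E => k p.2 p.1).
  exact: (measurableT_comp mk (measurable_fun_pair measurable_snd measurable_fst)).
apply: (eq_trans (hyperplane_integral_coords mk k0)); apply/esym.
apply: (eq_trans (@hyperplane_integral_coords R m.+1 (fun y z => k z y) mkT
  (fun y z => k0 z y))); apply/esym.
set Phi := fun w v => \int[mu]_a
  (k (cons_rv (- (dotp v w / a))%R v) (cons_rv a w) * (`|a|^-1)%:E).
set Psi := fun w v => \int[mu]_a
  (k (cons_rv a w) (cons_rv (- (dotp v w / a))%R v) * (`|a|^-1)%:E).
have mk2 d (T : measurableType d) (f g : T -> E) :
    measurable_fun setT f -> measurable_fun setT g ->
    measurable_fun setT (fun t => k (f t) (g t)).
  by move=> mf mg; exact: (measurableT_comp mk (measurable_fun_pair mf mg)).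
have mna d (T : measurableType d) (a : T -> R) : measurable_fun setT a ->
    measurable_fun setT (fun t => (`|a t|^-1)%:E).
  move=> ma; apply/measurable_EFinP; apply: measurable_invr_fun.
  exact: (measurableT_comp (@normr_measurable _ setT)).
have mc d (T : measurableType d) (fa : T -> R) (fv fw : T -> 'rV[R]_m.+1) :
    measurable_fun setT fa -> measurable_fun setT fw -> measurable_fun setT fv ->
    measurable_fun setT (fun t => cons_rv (- (dotp (fv t) (fw t) / fa t))%R (fv t)).
  move=> ma mw mv; apply: measurable_cons_rv => //.
  by apply: measurable_funN; measurability.
have P0 w v : 0 <= Phi w v.
  by apply: integral_ge0 => a _; rewrite mule_ge0// lee_fin invr_ge0.
have Q0 w v : 0 <= Psi w v.
  by apply: integral_ge0 => a _; rewrite mule_ge0// lee_fin invr_ge0.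
have mP : measurable_fun setT (fun q : 'rV[R]_m.+1 * 'rV[R]_m.+1 => Phi q.1 q.2).
  apply: (@measurable_integral_param _ _ _ _ _ mu
    (fun (q : 'rV[R]_m.+1 * 'rV[R]_m.+1) (a : measurableTypeR R) =>
    k (cons_rv (- (dotp q.2 q.1 / a))%R q.2) (cons_rv a q.1) * (`|a|^-1)%:E)).
    apply: emeasurable_funM; last by apply: mna; measurability.
    apply: mk2; last by measurability.
    by apply: (mc _ _ (fun t => t.2) (fun t => t.1.2) (fun t => t.1.1)); measurability.
  by move=> q a; rewrite mule_ge0// lee_fin invr_ge0.
have mQ : measurable_fun setT (fun q : 'rV[R]_m.+1 * 'rV[R]_m.+1 => Psi q.1 q.2).
  apply: (@measurable_integral_param _ _ _ _ _ mu
    (fun (q : 'rV[R]_m.+1 * 'rV[R]_m.+1) (a : measurableTypeR R) =>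
    k (cons_rv a q.1) (cons_rv (- (dotp q.2 q.1 / a))%R q.2) * (`|a|^-1)%:E)).
    apply: emeasurable_funM; last by apply: mna; measurability.
    apply: mk2; first by measurability.
    by apply: (mc _ _ (fun t => t.2) (fun t => t.1.2) (fun t => t.1.1)); measurability.
  by move=> q a; rewrite mule_ge0// lee_fin invr_ge0.
rewrite [RHS]fubini_tonelli_leb; last 2 first.
- exact: mQ.
- exact: Q0.
have [m0 N0] := @leb_set0_null R m.
have mPw w : measurable_fun setT (Phi w) by exact: measurable_fun_pair2 mP.
have mQw w : measurable_fun setT (fun v => Psi v w) by exact: measurable_fun_pair1 mQ.
apply: (ge0_eq_integral_off m0 N0).
- exact: measurable_integral_param.
- by move=> w; apply: integral_ge0 => v _; exact: P0.
- apply: (@measurable_integral_param _ _ _ _ _ (leb R m.+1) (fun w v => Psi v w)) => //.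
  exact: (measurableT_comp mQ (measurable_fun_pair measurable_snd measurable_fst)).
- by move=> w; apply: integral_ge0 => v _; exact: Q0.
move=> w /= /eqP w0.
(* The inversion requires <v,w> nonzero, which for w nonzero excludes only a null set of v. *)
have [mN NN] := leb_hyperplane_null w0.
apply: (ge0_eq_integral_off mN NN).
- exact: mPw.
- by move=> v; exact: P0.
- exact: mQw.
- by move=> v; exact: Q0.
move=> v /=; rewrite dotpC => /eqP wv0.
rewrite /Phi /Psi.
pose f (r : R) := k (cons_rv r v) (cons_rv (- (dotp v w / r))%R w).
have mf : measurable_fun setT f.
  apply: mk2; first by measurability.
  apply: measurable_cons_rv; last by measurability.
  by apply: measurable_funN; measurability.
have f0 r : 0 <= f r by exact: k0.
have q0 : (- dotp v w != 0)%R by rewrite oppr_eq0.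
transitivity (\int[mu]_r (f r * (`|r|^-1)%:E)); last first.
  by apply: eq_integral => a _; rewrite /f dotpC.
rewrite -(ge0_integral_inversion q0 mf f0).
apply: eq_integral => a _; have [->|a0] := eqVneq a 0%R.
  by rewrite normr0 invr0 !mule0.
rewrite /f; congr (k (cons_rv _ _) (cons_rv _ _) * _); first by rewrite mulNr.
by field; rewrite ?oppr_eq0 wv0 a0.
Qed.

(** The symmetry for k(y,z) = |y| g(y) |z| on |z| <= 1. On one side the factor |z| cancels 1/|z| and
    leaves the cone integral over the sphere; on the other |y| cancels 1/|y|, and the integral of
    |z| over the unit ball of the hyperplane of y is [ball_moment], whatever y. *)
Lemma sphere_hyperplane_integral (g : E -> \bar R) :
  measurable_fun setT g -> (forall y, 0 <= g y) ->
  \int[leb R m.+2]_z ((0 < enorm z <= 1)%R%:R%:E *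
    \int[leb R m.+1]_u ((enorm u)%:E * g (hplane (normalize z) u))) =
  ball_moment m * \int[leb R m.+2]_y g y.
Proof.
move=> mg g0.
have mle1 d (T : measurableType d) (f : T -> R) :
    measurable_fun setT f -> measurable_fun setT (fun x => ((f x <= 1)%R%:R : R)).
  by move=> mf; apply: measurable_bool_natr; apply: measurable_fun_ler.
have en0 n (y : 'rV[R]_n) : 0 <= (enorm y)%:E by rewrite lee_fin enorm_ge0.
pose b n (z : 'rV[R]_n) : R := (enorm z * (enorm z <= 1)%R%:R)%R.
have b0 n z : (0 <= @b n z)%R by rewrite mulr_ge0 ?enorm_ge0.
have mb n : measurable_fun setT (@b n).
  apply: measurable_funM; first by measurability.
  by apply: mle1; measurability.
pose k (y z : E) : \bar R := (enorm y)%:E * g y * (b _ z)%:E.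
have mk : measurable_fun setT (fun p : E * E => k p.1 p.2).
  apply: emeasurable_funM.
    apply: emeasurable_funM; first by measurability.
    by apply: (measurableT_comp mg); measurability.
  by apply/measurable_EFinP; apply: (measurableT_comp (mb _)); measurability.
have k0 y z : 0 <= k y z by rewrite !mule_ge0// lee_fin.
have := hyperplane_integral_sym mk k0.
rewrite [X in _ = X](_ : _ = ball_moment m * \int[leb R m.+2]_y g y); last first.
  have [m0 N0] := @leb_set0_null R m.+1.
  have bm0 : 0 <= @ball_moment R m by apply: integral_ge0 => u _; rewrite lee_fin b0.
  rewrite -ge0_integralZl//.
  apply: (ge0_eq_integral_off m0 N0).
  - exact: (@measurable_hyperplane_integral R m.+1 (fun y z => k z y)
      (measurableT_comp mk (measurable_fun_pair measurable_snd measurable_fst))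
      (fun y z => k0 z y)).
  - move=> y; rewrite mule_ge0// ?lee_fin ?invr_ge0 ?enorm_ge0//.
    by apply: integral_ge0 => u _; exact: k0.
  - exact: emeasurable_funM.
  - by move=> y; rewrite mule_ge0.
  move=> y /eqP y0; have yn := enorm_normalize y0.
  have ey : enorm y != 0%R by rewrite enorm_eq0.
  rewrite /k ge0_integralZl; last 4 first.
  - by [].
  - apply/measurable_EFinP; apply: (measurableT_comp (mb _)).
    by apply: measurable_hplane; measurability.
  - by move=> u _; rewrite lee_fin b0.
  - by rewrite mule_ge0.
  rewrite muleA muleA -EFinM mulVf// mul1e muleC; congr (_ * _).
  by apply: eq_integral => u _; rewrite /b !enorm_hplane.
move=> <-; have [m0 N0] := @leb_set0_null R m.+1.
have E z : z != 0%R ->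
  (0 < enorm z <= 1)%R%:R%:E *
     \int[leb R m.+1]_u ((enorm u)%:E * g (hplane (normalize z) u)) =
  (enorm z)^-1%:E * \int[leb R m.+1]_u k (hplane (normalize z) u) z.
  move=> z0; have zn := enorm_normalize z0.
  have ez : enorm z != 0%R by rewrite enorm_eq0.
  rewrite /k ge0_integralZr; last 4 first.
  - by [].
  - apply: emeasurable_funM.
      apply/measurable_EFinP; apply: measurable_enorm.
      by apply: measurable_hplane; measurability.
    by apply: (measurableT_comp mg); apply: measurable_hplane; measurability.
  - by move=> u _; rewrite mule_ge0.
  - by rewrite lee_fin b0.
  rewrite muleCA -EFinM [RHS]muleC /b mulrA mulVf// mul1r enorm_gt0 z0/=.
  congr (_ * _).
  by apply: eq_integral => u _; rewrite enorm_hplane.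
apply: eq_integral => z _; have [->|/E//] := eqVneq z 0%R.
by rewrite enorm0 invr0 ltxx !mul0e.
Qed.

End Duality2.

(** * Integration over the tangent bundle of the sphere *)

Section BundleIntegral.
Context {R : realType} {m : nat}.
Local Notation E := 'rV[R]_m.+1.
Implicit Types (G H : E * E -> R).

Lemma retract_bundle (p : E * E) : bundle p -> retract p = p.
Proof.
case: p => x xi [/= xi1 x0].
by rewrite /retract/= x0 mul0r scale0r subr0 xi1 invr1 scale1r.
Qed.

Lemma retractE (x z : E) : z != 0 ->
  retract (x, z) = (x - dotp x (normalize z) *: normalize z, normalize z).
Proof.
move=> z0; rewrite /retract/= /normalize dotpZr scalerA -enorm_sqr.
congr (x - _ *: _, _); field; by rewrite enorm_eq0.
Qed.

Lemma bundle_hplane (xi : E) u : enorm xi = 1 -> bundle (hplane xi u, xi).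
Proof. by move=> xi1; split => //=; exact: hplane_orth. Qed.

Lemma retract_hplane (z : E) u : z != 0 ->
  retract (hplane (normalize z) u, z) = (hplane (normalize z) u, normalize z).
Proof.
move=> z0; rewrite retractE// hplane_orth ?enorm_normalize//.
by rewrite scale0r subr0.
Qed.

Lemma bundle_retract (p : E * E) : p.2 != 0 -> bundle (retract p).
Proof.
case: p => x z /= z0; rewrite retractE//; have zn := enorm_normalize z0.
by split => //=; rewrite dotpBl dotpZl enorm1_dotp// mulr1 subrr.
Qed.

(** For p.2 nonzero the retraction lies in the bundle, so this extension depends only on the values
    of G there. The factor removes p.2 = 0, where [retract] gives no point of the bundle. *)
Definition bundle_ext G (p : E * E) : R := (p.2 != 0)%:R * G (retract p).

Definition bundle_measurable G := measurable_fun setT (bundle_ext G).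

(** Fibre integrals bounded uniformly in xi, rather than a finite total integral: every fibre
    integral is then a real number and the outer integral, over the unit ball, is that of a bounded
    function. *)
Definition bundle_integrable G := bundle_measurable G /\
  exists M : R, forall xi : E, enorm xi = 1 ->
    (\int[leb R m]_u (`|G (hplane xi u, xi)|)%:E <= M%:E)%E.

Definition hyperplane_integral G (z : E) : R :=
  \int[leb R m]_u bundle_ext G (hplane (normalize z) u, z).

Lemma bundle_ext_hplane G (xi : E) u : enorm xi = 1 ->
  bundle_ext G (hplane xi u, xi) = G (hplane xi u, xi).
Proof.
move=> xi1; rewrite /bundle_ext/= -enorm_eq0 xi1 oner_eq0 mul1r.
by rewrite retract_bundle//; exact: bundle_hplane.
Qed.

Lemma bundle_ext_normalize G (z : E) u : z != 0 ->
  bundle_ext G (hplane (normalize z) u, z) =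
  G (hplane (normalize z) u, normalize z).
Proof. by move=> z0; rewrite /bundle_ext/= z0 mul1r retract_hplane. Qed.

Lemma hyperplane_integralE G (z : E) : z != 0 -> hyperplane_integral G z =
  \int[leb R m]_u G (hplane (normalize z) u, normalize z).
Proof. by move=> z0; apply: eq_Rintegral => u _; rewrite bundle_ext_normalize. Qed.

Lemma bundle_measurableD G H : bundle_measurable G -> bundle_measurable H ->
  bundle_measurable (fun p => G p + H p).
Proof.
move=> mG mH; rewrite /bundle_measurable.
rewrite (_ : bundle_ext _ = bundle_ext G \+ bundle_ext H).
  exact: measurable_funD.
by apply/funext => p; rewrite /bundle_ext/= mulrDr.
Qed.

Lemma bundle_measurableM G H : bundle_measurable G -> bundle_measurable H ->
  bundle_measurable (fun p => G p * H p).
Proof.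
move=> mG mH; rewrite /bundle_measurable.
rewrite (_ : bundle_ext _ = bundle_ext G \* bundle_ext H).
  exact: measurable_funM.
apply/funext => p; rewrite /bundle_ext/=.
by case: (p.2 != 0); rewrite ?mul0r// !mul1r.
Qed.

Lemma bundle_measurable_fun G : measurable_fun setT G -> bundle_measurable G.
Proof.
move=> mG; apply: measurable_funM.
  apply: measurable_bool_natr.
  have m2 : measurable_fun setT (fun p : E * E => enorm p.2) by measurability.
  rewrite (_ : (fun p => _) = (fun p : E * E => ~~ (enorm p.2 == 0))); last first.
    by apply/funext => p; rewrite enorm_eq0.
  by apply: measurable_neg; exact: measurable_fun_eqr.
apply: (measurableT_comp mG); rewrite /retract.
have mx : measurable_fun setT (fun p : E * E => p.1) by measurability.
apply: measurable_fun_pair; last by measurability.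
by measurability.
Qed.

Lemma bundle_measurable_cst c : bundle_measurable (fun=> c).
Proof. by apply: bundle_measurable_fun; measurability. Qed.

Lemma bundle_measurable_abs G : bundle_measurable G ->
  bundle_measurable (fun p => `|G p|).
Proof.
move=> mG; rewrite /bundle_measurable.
rewrite (_ : bundle_ext _ = fun p => `|bundle_ext G p|).
  exact: (measurableT_comp (@normr_measurable _ setT)).
by apply/funext => p; rewrite /bundle_ext normrM normr_nat.
Qed.

Local Open Scope ereal_scope.

Lemma measurable_slice G (z : E) : bundle_measurable G ->
  measurable_fun setT (fun u => bundle_ext G (hplane (normalize z) u, z)).
Proof.
move=> mG; apply: (measurableT_comp mG); apply: measurable_fun_pair => //.
by apply: measurable_hplane; measurability.
Qed.

Lemma measurable_slice1 G (xi : E) : enorm xi = 1%R -> bundle_measurable G ->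
  measurable_fun setT (fun u => G (hplane xi u, xi)).
Proof.
move=> xi1 mG; have := measurable_slice xi mG.
have -> : normalize xi = xi by rewrite /normalize xi1 invr1 scale1r.
by under eq_fun do rewrite bundle_ext_hplane//.
Qed.

(** As before the smeared form eliminates the frame. The parameter will be the frequency of a
    Fourier transform. *)
Lemma measurable_ge0_hyperplane_integral_param d (T : measurableType d)
    (F : T -> E * E -> R) :
  measurable_fun setT (fun q : T * (E * E) => bundle_ext (F q.1) q.2) ->
  (forall t p, 0 <= F t p)%R ->
  measurable_fun setT (fun q : T * E =>
    \int[leb R m]_u (bundle_ext (F q.1) (hplane (normalize q.2) u, q.2))%:E).
Proof.
move=> mF F0.
have e0 t p : (0 <= bundle_ext (F t) p)%R by rewrite mulr_ge0.
have mF2 d' (T' : measurableType d') (f : T' -> T) (x z : T' -> E) :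
    measurable_fun setT f -> measurable_fun setT x -> measurable_fun setT z ->
    measurable_fun setT (fun t => (bundle_ext (F (f t)) (x t, z t))%:E).
  move=> mf mx mz; apply/measurable_EFinP.
  exact: (measurableT_comp mF (measurable_fun_pair mf (measurable_fun_pair mx mz))).
have mi : measurable_fun setT (fun x : R => (\1_(`[0%R, 1%R]%classic) x : R)%:E).
  by apply/measurable_EFinP; exact: measurable_indic.
rewrite (_ : (fun q : T * E => _) = (fun q : T * E => \int[leb R m.+1]_x
  ((bundle_ext (F q.1) (x - dotp x (normalize q.2) *: normalize q.2, q.2)%R)%:E *
     (\1_(`[0%R, 1%R]%classic) (dotp x (normalize q.2)))%:E))); last first.
  apply/funext => -[t z] /=; have [->|z0] := eqVneq z 0%R.
    by rewrite !integral0_eq// => x _; rewrite /bundle_ext/= eqxx mul0r ?mul0e.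
  apply: (@ge0_integral_smear _ _ _ _ (fun y => (bundle_ext (F t) (y, z))%:E)).
  - exact: enorm_normalize.
  - by rewrite enorm1_dotp// enorm_normalize.
  - by apply: mF2; measurability.
  - by move=> y; rewrite lee_fin.
have mn : measurable_fun setT (fun p : T * E * E => normalize p.1.2).
  by apply: measurable_normalize; measurability.
apply: (@measurable_integral_param _ _ _ _ _ (leb R m.+1) (fun (q : T * E) (x : E) =>
  (bundle_ext (F q.1) (x - dotp x (normalize q.2) *: normalize q.2, q.2)%R)%:E *
     (\1_(`[0%R, 1%R]%classic) (dotp x (normalize q.2)))%:E)).
  apply: emeasurable_funM; last by apply: (measurableT_comp mi); measurability.
  apply: (mF2 _ _ (fun p : T * E * E => p.1.1)
    (fun p => p.2 - dotp p.2 (normalize p.1.2) *: normalize p.1.2)%R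
    (fun p => p.1.2)); by measurability.
by move=> x y; rewrite mule_ge0// lee_fin.
Qed.

Lemma measurable_ge0_hyperplane_integral G : bundle_measurable G ->
  (forall p, 0 <= G p)%R ->
  measurable_fun setT
    (fun z : E => \int[leb R m]_u (bundle_ext G (hplane (normalize z) u, z))%:E).
Proof.
move=> mG G0.
have mF := @measurable_ge0_hyperplane_integral_param _ E (fun=> G)
  (measurableT_comp mG measurable_snd) (fun=> G0).
exact: (measurableT_comp mF (measurable_fun_pair (@measurable_cst _ _ _ _ _ (0%R : E))
  (@measurable_id _ _ setT))).
Qed.

Lemma bundle_integrable_slice G (xi : E) : bundle_integrable G -> enorm xi = 1%R ->
  (leb R m).-integrable setT (fun u => (G (hplane xi u, xi))%:E).
Proof.
move=> [mG [M HM]] xi1; apply/integrableP; split.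
  by apply/measurable_EFinP; exact: measurable_slice1.
by apply: (le_lt_trans (HM _ xi1)); rewrite ltry.
Qed.

Lemma bundle_integrable_ext_slice G (z : E) : bundle_integrable G ->
  (leb R m).-integrable setT
    (fun u => (bundle_ext G (hplane (normalize z) u, z))%:E).
Proof.
move=> iG; have [->|z0] := eqVneq z 0%R.
  apply: (eq_integrable _ (cst 0)) => //; last exact: integrable0.
  by move=> u _; rewrite /bundle_ext/= eqxx mul0r.
apply: (eq_integrable _ (fun u => (G (hplane (normalize z) u, normalize z))%:E)) => //.
  by move=> u _; rewrite bundle_ext_normalize.
by apply: bundle_integrable_slice => //; exact: enorm_normalize.
Qed.

Lemma hyperplane_integral_EFin G (z : E) : bundle_integrable G ->
  \int[leb R m]_u (bundle_ext G (hplane (normalize z) u, z))%:E =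
  (hyperplane_integral G z)%:E.
Proof.
move=> iG; rewrite /hyperplane_integral /Rintegral fineK//.
by apply: integrable_fin_num => //; exact: bundle_integrable_ext_slice.
Qed.

End BundleIntegral.

Section BundleIntegralLinear.
Context {R : realType} {m : nat}.
Local Notation E := 'rV[R]_m.+2.
Implicit Types (G H : E * E -> R).

Let D : set E := [set z | (0 < enorm z <= 1)%R].

Let mD : measurable D.
Proof.
have mb : measurable_fun setT (fun z : E => (0 < enorm z <= 1)%R).
  by apply: measurable_and; [apply: measurable_fun_ltr|apply: measurable_fun_ler];
    measurability.
by have := mb measurableT [set true]; rewrite setTI; exact.
Qed.

Let D0 z : D z -> z != 0.
Proof. by case/andP; rewrite enorm_gt0. Qed.

Let leb_D : (leb R m.+2 D < +oo)%E.
Proof.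
rewrite -[X in leb R m.+2 X]setIT -integral_indic//.
(* On the unit ball 1 <= e^(1 - |x|^2), and the Gaussian is integrable. *)
apply: (@le_lt_trans _ _ (\int[leb R m.+2]_x ((expR 1)%:E * (expR (- dotp x x))%:E))%E).
  apply: ge0_le_integral.
  - by [].
  - by move=> x _; rewrite lee_fin.
  - by apply/measurable_EFinP; exact: measurable_indic.
  - by measurability.
  move=> x _; rewrite -EFinM lee_fin indicE -expRD.
  case: (boolP (x \in D)) => xD; last by rewrite expR_ge0.
  rewrite -[X in X <= _]expR0 ler_expR subr_ge0 -enorm_sqr expr_le1 ?enorm_ge0//.
  by move: xD; rewrite inE => /andP[].
rewrite ge0_integralZl_EFin ?expR_ge0//; last by measurability.
by rewrite gauss_integral_leb -EFinM ltry.
Qed.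

Let bound G : bundle_integrable G -> exists M : R, 0 <= M /\ forall z : E,
  (\int[leb R m.+1]_u (`|bundle_ext G (hplane (normalize z) u, z)|)%:E <= M%:E)%E.
Proof.
move=> [_ [M HM]]; exists (Num.max M 0); split; first by rewrite le_max lexx orbT.
move=> z; have [->|z0] := eqVneq z 0.
  rewrite integral0_eq; first by rewrite lee_fin le_max lexx orbT.
  by move=> u _; rewrite /bundle_ext/= eqxx mul0r normr0.
have zn := enorm_normalize z0.
apply: (@le_trans _ _ M%:E); last by rewrite lee_fin le_max lexx.
apply: le_trans (HM _ zn).
by under eq_integral do rewrite bundle_ext_normalize//.
Qed.

Lemma bundle_integrableD G H : bundle_integrable G -> bundle_integrable H ->
  bundle_integrable (fun p => G p + H p).
Proof.
move=> iG iH; have [mG [M HM]] := iG; have [mH [N HN]] := iH.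
split; first exact: bundle_measurableD.
exists (M + N) => xi xi1; rewrite EFinD.
apply: le_trans (leeD (HM _ xi1) (HN _ xi1)).
have mna K : bundle_measurable K ->
    measurable_fun setT (fun u : 'rV[R]_m.+1 => (`|K (hplane xi u, xi)|)%:E).
  move=> mK; apply/measurable_EFinP.
  exact: (measurable_slice1 xi1 (bundle_measurable_abs mK)).
rewrite -ge0_integralD; last 5 first.
- by [].
- by move=> u _; rewrite lee_fin.
- exact: (mna _ mG).
- by move=> u _; rewrite lee_fin.
- exact: (mna _ mH).
apply: ge0_le_integral.
- by [].
- by move=> u _; rewrite lee_fin.
- exact: (mna _ (bundle_measurableD mG mH)).
- exact: (emeasurable_funD (mna _ mG) (mna _ mH)).
- by move=> u _; rewrite -EFinD lee_fin ler_normD.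
Qed.

Lemma bundle_integrable_dominated G H : bundle_measurable G ->
  (forall p, bundle p -> `|G p| <= H p) -> bundle_integrable H -> bundle_integrable G.
Proof.
move=> mG GH iH; have [mH [M HM]] := iH; split => //; exists M => xi xi1.
apply: le_trans (HM _ xi1).
apply: ge0_le_integral.
- by [].
- by move=> u _; rewrite lee_fin.
- by apply/measurable_EFinP; exact: (measurable_slice1 xi1 (bundle_measurable_abs mG)).
- by apply/measurable_EFinP; exact: (measurable_slice1 xi1 (bundle_measurable_abs mH)).
move=> u _; rewrite lee_fin (le_trans (GH _ (bundle_hplane _ _)))//.
exact: ler_norm.
Qed.

Lemma bundle_integrableZ G (c : R) : bundle_integrable G ->
  bundle_integrable (fun p => c * G p).
Proof.
move=> iG; have [mG [M HM]] := iG.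
split; first by apply: bundle_measurableM => //; exact: bundle_measurable_cst.
exists (`|c| * M) => xi xi1.
under eq_integral do rewrite normrM EFinM.
rewrite ge0_integralZl_EFin//; last first.
  by apply/measurable_EFinP; exact: (measurable_slice1 xi1 (bundle_measurable_abs mG)).
by rewrite EFinM; apply: lee_wpmul2l; [rewrite lee_fin|exact: HM].
Qed.

Lemma bundle_integrable_abs G : bundle_integrable G ->
  bundle_integrable (fun p => `|G p|).
Proof.
move=> iG; have [mG [M HM]] := iG; split; first exact: bundle_measurable_abs.
by exists M => xi xi1; under eq_integral do rewrite normr_id; exact: HM.
Qed.

Let hintD G H z : bundle_integrable G -> bundle_integrable H ->
  hyperplane_integral (fun p => G p + H p) z =
  hyperplane_integral G z + hyperplane_integral H z.
Proof.
move=> iG iH; rewrite /hyperplane_integral -RintegralD//.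
- by apply: eq_Rintegral => u _; rewrite /bundle_ext/= mulrDr.
- exact: bundle_integrable_ext_slice.
- exact: bundle_integrable_ext_slice.
Qed.

Let hintZ G c z : bundle_integrable G ->
  hyperplane_integral (fun p => c * G p) z = c * hyperplane_integral G z.
Proof.
move=> iG; rewrite /hyperplane_integral -RintegralZl//.
- by apply: eq_Rintegral => u _; rewrite /bundle_ext/= mulrCA.
- exact: bundle_integrable_ext_slice.
Qed.

Let measurable_hint G : bundle_integrable G ->
  measurable_fun setT (hyperplane_integral G).
Proof.
move=> iG; have iA := bundle_integrable_abs iG; have iS := bundle_integrableD iG iA.
(* Measurability in z is known for nonnegative functions; G is the difference of G + |G| and |G|. *)
rewrite (_ : hyperplane_integral G = fun z =>
    hyperplane_integral (fun p => G p + `|G p|) z -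
    hyperplane_integral (fun p => `|G p|) z); last first.
  by apply/funext => z; rewrite hintD// addrK.
have mh K : bundle_integrable K -> (forall p, 0 <= K p) ->
    measurable_fun setT (hyperplane_integral K).
  move=> [mK _] K0; apply: (measurableT_comp (@fine_measurable _ setT _)) => //.
  exact: measurable_ge0_hyperplane_integral.
have s0 p : 0 <= G p + `|G p| by have := ler_norm (- G p); rewrite normrN; lra.
exact: (measurable_funB (mh _ _ _ iS s0) (mh _ _ _ iA (fun p => normr_ge0 (G p)))).
Qed.

Let integrable_hint G : bundle_integrable G ->
  (leb R m.+2).-integrable D (EFin \o hyperplane_integral G).
Proof.
move=> iG; apply: measurable_bounded_integrable => //.
  by apply: measurable_funTS; exact: measurable_hint.
have [M [M0 HM]] := bound iG.
exists M; split; first exact: num_real.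
move=> B MB z _; apply: le_trans (ltW MB).
have iz := bundle_integrable_ext_slice z iG.
rewrite (le_trans (le_normr_Rintegral _ iz))//.
rewrite -lee_fin /Rintegral fineK; first exact: HM.
rewrite ge0_fin_numE; first by apply: (le_lt_trans (HM z)); rewrite ltry.
by apply: integral_ge0 => u _; rewrite lee_fin.
Qed.

Definition bint G : R := fine (bundle_integral G).

Let bundle_integralE_gen G : bundle_integrable G ->
  bundle_integral G =
  (m.+2%:R%:E * \int[leb R m.+2]_(z in D) (hyperplane_integral G z)%:E)%E.
Proof.
move=> iG; rewrite /bundle_integral /sphere_integral; congr (_ * _)%E.
rewrite integral_restrict_bool [RHS]integral_restrict_bool integral_leb; last first.
  apply: emeasurable_funM; first by apply/measurable_EFinP; exact: measurable_hint.
  apply/measurable_EFinP; apply: measurable_bool_natr.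
  apply: (measurable_fun_bool true); rewrite setTI.
  by rewrite (_ : _ @^-1` _ = D)//; apply/seteqP; split => z; [exact: set_mem|exact: mem_set].
apply: eq_integral => x _.
have -> : (x \in [set x0 : m.+2.-tuple R | (0 < enorm (vec_of x0) <= 1)%R]) =
    (vec_of x \in D) by apply/idP/idP; rewrite !inE.
have [xD|] := boolP (vec_of x \in D); last by rewrite !mule0.
congr (_ * _)%E; have x0 : vec_of x != 0 by apply: D0; rewrite inE in xD.
rewrite -hyperplane_integral_EFin// integral_leb; last first.
  by apply/measurable_EFinP; exact: measurable_slice iG.1.
by apply: eq_integral => u _; rewrite bundle_ext_normalize.
Qed.

Let bintE G : bundle_integrable G ->
  bint G = m.+2%:R * \int[leb R m.+2]_(z in D) hyperplane_integral G z.
Proof.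
move=> iG; rewrite /bint bundle_integralE_gen// fineM//.
by apply: integrable_fin_num => //; exact: integrable_hint.
Qed.

Lemma bintD G H : bundle_integrable G -> bundle_integrable H ->
  bint (fun p => G p + H p) = bint G + bint H.
Proof.
move=> iG iH; rewrite !bintE//; last exact: bundle_integrableD.
rewrite -mulrDr; congr (_ * _); rewrite -RintegralD//.
- by apply: eq_Rintegral => z _; rewrite hintD.
- exact: integrable_hint.
- exact: integrable_hint.
Qed.

Lemma bintZ G c : bundle_integrable G -> bint (fun p => c * G p) = c * bint G.
Proof.
move=> iG; rewrite !bintE//; last exact: bundle_integrableZ.
rewrite mulrCA; congr (_ * _); rewrite -RintegralZl//.
  by apply: eq_Rintegral => z _; rewrite hintZ.
exact: integrable_hint.
Qed.

(* The section p.1 = 0 is negligible: the weights |y|^(2t) may be singular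
   there. *)
Lemma le_bint G H : bundle_integrable G -> bundle_integrable H ->
  (forall p, bundle p -> p.1 != 0 -> G p <= H p) -> bint G <= bint H.
Proof.
move=> iG iH GH; rewrite !bintE// ler_pM2l//.
apply: le_Rintegral => //; try exact: integrable_hint.
move=> z /D0 z0; rewrite !hyperplane_integralE//; have zn := enorm_normalize z0.
have [m0 N0] := @leb_set0_null R m.
have iGz := bundle_integrable_slice iG zn.
have iHz := bundle_integrable_slice iH zn.
rewrite /Rintegral (negligible_integral m0 _ iGz)// (negligible_integral m0 _ iHz)//.
have sub : [set: 'rV[R]_m.+1] `\` [set 0] `<=` setT by [].
apply: le_Rintegral.
- exact: measurableD.
- by apply: (integrableS _ _ sub iGz) => //; exact: measurableD.
- by apply: (integrableS _ _ sub iHz) => //; exact: measurableD.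
move=> u [_ /eqP u0]; apply: GH; first exact: bundle_hplane.
by rewrite /= -enorm_eq0 enorm_hplane// enorm_eq0.
Qed.

Lemma eq_bint G H : bundle_integrable G -> bundle_integrable H ->
  (forall p, bundle p -> p.1 != 0 -> G p = H p) -> bint G = bint H.
Proof.
by move=> iG iH GH; apply/eqP; rewrite eq_le !le_bint// => p p1 p2; rewrite GH.
Qed.

Lemma bint_ge0 G : (forall p, bundle p -> 0 <= G p) -> 0 <= bint G.
Proof.
move=> G0; rewrite /bint fine_ge0// /bundle_integral /sphere_integral.
rewrite mule_ge0//; apply: integral_ge0 => x /= xD; apply: integral_ge0 => u _.
rewrite lee_fin; apply: G0; apply: bundle_hplane; apply: enorm_normalize.
exact: D0.
Qed.

Lemma bint_eval G : bundle_integrable G -> (forall p, 0 <= G p) ->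
  (bint G)%:E = (m.+2%:R%:E * \int[leb R m.+2]_z ((0 < enorm z <= 1)%R%:R%:E *
    \int[leb R m.+1]_u (G (hplane (normalize z) u, normalize z))%:E))%E.
Proof.
move=> iG G0; rewrite /bint bundle_integralE_gen// fineK; last first.
  by rewrite fin_numM// integrable_fin_num//; exact: integrable_hint.
congr (_ * _)%E; rewrite integral_restrict_bool; apply: eq_integral => z _.
rewrite muleC; have -> : (z \in D) = (0 < enorm z <= 1).
  by apply/idP/idP; rewrite inE.
have [/andP[z0 _]|] := boolP (0 < enorm z <= 1); last by rewrite !mul0e.
rewrite enorm_gt0 in z0; rewrite -hyperplane_integral_EFin//; congr (_ * _)%E.
by apply: eq_integral => u _; rewrite bundle_ext_normalize.
Qed.

End BundleIntegralLinear.

(** * Integrability of the weights *)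

Section RadialIntegrals.
Context {R : realType} (m : nat).
Local Notation mu := (@lebesgue_measure R).
Local Open Scope ereal_scope.

Let bm0 : 0 <= @ball_moment R m.
Proof. by apply: integral_ge0 => u _; rewrite lee_fin mulr_ge0 ?enorm_ge0. Qed.

Let gamma_ge0 z : 0 <= @gamma_integral R z.
Proof.
by apply: integral_ge0 => u _; rewrite lee_fin mulr_ge0 ?expR_ge0 ?powR_ge0.
Qed.

Let sqrtpi_gt0 : (0 < 2 * Num.sqrt pi ^+ m.+1 :> R)%R.
Proof. by rewrite mulr_gt0// exprn_gt0// sqrtr_gt0 pi_gt0. Qed.

(** Two elements of [0, +oo] whose product is a positive real are both positive reals. *)
Lemma ball_moment_gamma_fin : exists b g : R, [/\ (0 < b)%R, (0 < g)%R,
  @ball_moment R m = b%:E & @gamma_integral R (m.+1%:R / 2) = g%:E].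
Proof.
have := @ball_moment_gamma R m; move: bm0 (gamma_ge0 (m.+1%:R / 2)) sqrtpi_gt0.
have n0 : (0 < m.+2%:R :> R)%R by [].
case: ball_moment => [b| |]; case: gamma_integral => [g| |] //.
- rewrite !lee_fin => b0 g0 s0; rewrite -!EFinM => -[E].
  have bg : (b * g != 0)%R.
    by apply/eqP => bg; move: E s0; rewrite bg mulr0 => <-; rewrite ltxx.
  exists b, g; split => //; rewrite lt_neqAle eq_sym.
    by rewrite b0 andbT; apply: contraNneq bg => ->; rewrite mul0r.
  by rewrite g0 andbT; apply: contraNneq bg => ->; rewrite mulr0.
- rewrite lee_fin le_eqVlt => /predU1P[<- _ s0|b0 _ _].
    by rewrite mul0e mule0 => -[E]; rewrite -E ltxx in s0.
  by rewrite gt0_muley ?lte_fin// gt0_muley ?lte_fin.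
- rewrite lee_fin => _; rewrite le_eqVlt => /predU1P[<- s0|g0 _].
    by rewrite mule0 mule0 => -[E]; rewrite -E ltxx in s0.
  by rewrite gt0_mulye ?lte_fin// gt0_muley ?lte_fin.
- by rewrite mulyy gt0_muley ?lte_fin.
Qed.

(** With |u| = e^x the integrand, Jacobian included, is at most e^(dl x) times a negative power of 1
    + e^x, where dl = 2t + m + 1. The hypothesis on t says dl > 0, which is integrability at the
    origin of the fibre; the decay at infinity is a matter of taking N large. *)
Lemma weight_decay (s t : R) : (- (m.+1%:R / 2) < t)%R ->
  exists N : nat, (\int[leb R m.+1]_u
    (weight s t u * ((1 + enorm u) ^+ N)^-1)%:E < +oo).
Proof.
move=> tm.
pose dl : R := (2 * t + m.+1%:R)%R.
have dl0 : (0 < dl)%R by rewrite /dl; lra.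
(* K powers of 1 + |u| absorb the factor (1 + |u|^2)^(s-t), and N' more bring e^(dl x) below e^(-x)
   for x > 0. *)
have [K HK] : exists K : nat, (2 * `|s - t|%R <= K%:R :> R)%R.
  by exists (Num.bound (2 * `|s - t|)%R); rewrite ltW// archi_boundP// mulr_ge0.
have [N' HN'] : exists N' : nat, (dl + 1 <= N'%:R :> R)%R.
  by exists (Num.bound (dl + 1)%R); rewrite ltW// archi_boundP//; lra.
exists (K + N')%N.
pose F (r : R) : \bar R := (`|r| `^ (2 * t) * (1 + `|r| ^+ 2) `^ (s - t) *
  ((1 + `|r|) ^+ (K + N'))^-1)%:E.
have mF : measurable_fun setT F.
  have ma : measurable_fun setT (fun r : R => `|r|%R) by [].
  apply/measurable_EFinP; apply: measurable_funM; last first.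
    by apply: measurable_invr_fun; measurability.
  apply: measurable_funM.
    exact: (measurableT_comp (measurable_powR (2 * t)) ma).
  have m2 : measurable_fun setT (fun r : R => 1 + `|r| ^+ 2)%R by measurability.
  exact: (measurableT_comp (measurable_powR (s - t)) m2).
have F0 r : 0 <= F r.
  by rewrite lee_fin !mulr_ge0 ?powR_ge0// invr_ge0 exprn_ge0// addr_ge0.
have -> : \int[leb R m.+1]_u (weight s t u * ((1 + enorm u) ^+ (K + N'))^-1)%:E =
    \int[leb R m.+1]_u F (enorm u).
  by apply: eq_integral => u _; rewrite /F ger0_norm ?enorm_ge0.
rewrite (ge0_integral_radial _ mF F0).
have [b [_ [b0 _ -> _]]] := ball_moment_gamma_fin.
suff : \int[mu]_x (F (expR x) * (expR x ^+ m.+1)%:E) < +oo.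
  have : 0 <= \int[mu]_x (F (expR x) * (expR x ^+ m.+1)%:E).
    by apply: integral_ge0 => x _; rewrite mule_ge0// lee_fin exprn_ge0 ?expR_ge0.
  by case: (integral _ _ _) => // r _ _; rewrite -!EFinM ltry.
apply: (@le_lt_trans _ _ (\int[mu]_x ((expR (dl * x) * (x <= 0)%R%:R)%:E +
    (expR (1 * - x) * (- x <= 0)%R%:R)%:E))).
  have mb d (T : measurableType d) (f : T -> R) : measurable_fun setT f ->
      measurable_fun setT (fun x => (f x <= 0)%R%:R : R).
    by move=> mf; apply: measurable_bool_natr; apply: measurable_fun_ler.
  apply: ge0_le_integral.
  - by [].
  - by move=> x _; rewrite mule_ge0// lee_fin exprn_ge0 ?expR_ge0.
  - apply: emeasurable_funM; first by apply: (measurableT_comp mF); measurability.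
    by measurability.
  - apply: emeasurable_funD; apply/measurable_EFinP; apply: measurable_funM;
      by [measurability|apply: mb; measurability].
  move=> x _; rewrite -EFinM -EFinD lee_fin ger0_norm ?expR_ge0//.
  have e0 := expR_gt0 x; have e1 : (1 <= 1 + expR x)%R by rewrite lerDl ltW.
  have e1p : (0 < 1 + expR x)%R by lra.
  have s1 : ((1 + expR x ^+ 2) `^ (s - t) <= (1 + expR x) ^+ K)%R.
    have b1 : (1 <= 1 + expR x ^+ 2)%R by rewrite lerDl sqr_ge0.
    apply: (@le_trans _ _ ((1 + expR x ^+ 2) `^ `|s - t|)%R).
      by rewrite ler_powR// ler_norm.
    apply: (@le_trans _ _ (((1 + expR x) ^+ 2) `^ `|s - t|)%R).
      by rewrite ge0_ler_powR// ?nnegrE; nra.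
    rewrite -powR_mulrn ?(ltW e1p)// -powRrM -powR_mulrn ?(ltW e1p)//.
    by rewrite ler_powR.
  have s2 : (expR x `^ (2 * t) * expR x ^+ m.+1 = expR (dl * x))%R.
    rewrite /powR gt_eqF ?expR_gt0// expRK -expRM_natl -expRD; congr expR.
    by rewrite /dl; ring.
  set e := expR x in e0 e1 e1p s1 s2 *.
  have D1 : (1 <= (1 + e) ^+ N')%R by rewrite exprn_ege1.
  have DD : (0 < (1 + e) ^+ N')%R by rewrite exprn_gt0.
  have CC : (0 < (1 + e) ^+ K)%R by rewrite exprn_gt0.
  apply: (@le_trans _ _ (expR (dl * x) / (1 + e) ^+ N')%R).
    rewrite -s2 exprD invfM.
    rewrite [leLHS](_ : _ = (e `^ (2 * t) * e ^+ m.+1 / (1 + e) ^+ N') *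
      ((1 + e ^+ 2) `^ (s - t) / (1 + e) ^+ K))%R; last by ring.
    rewrite -[leRHS]mulr1 ler_wpM2l// ?ler_pdivrMr ?mul1r//.
    by rewrite !mulr_ge0 ?powR_ge0 ?exprn_ge0 ?invr_ge0 ?(ltW DD)// ltW.
  have [x0|x0] := leP x 0%R.
    apply: (@le_trans _ _ (expR (dl * x))).
      by rewrite ler_pdivrMr// ler_peMr// expR_ge0.
    by rewrite mulr1 lerDl mulr_ge0 ?expR_ge0.
  rewrite mulr0 add0r oppr_le0 (ltW x0) mulr1 mul1r ler_pdivrMr//.
  apply: (@le_trans _ _ (expR (- x) * e ^+ N')%R).
    rewrite /e -expRM_natl -expRD ler_expR -mulN1r -mulrDl ler_pM2r//.
    by rewrite -lerBlDl opprK.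
  by rewrite ler_pM2l ?expR_gt0// lerXn2r ?nnegrE ?lerDr// ltW.
have mb d (T : measurableType d) (f : T -> R) : measurable_fun setT f ->
    measurable_fun setT (fun x => (f x <= 0)%R%:R : R).
  by move=> mf; apply: measurable_bool_natr; apply: measurable_fun_ler.
have mA : measurable_fun setT (fun x : R => (expR (dl * x) * (x <= 0)%R%:R)%:E).
  apply/measurable_EFinP; apply: measurable_funM; first by measurability.
  by apply: mb; measurability.
have mB : measurable_fun setT (fun x : R => (expR (1 * x) * (x <= 0)%R%:R)%:E).
  apply/measurable_EFinP; apply: measurable_funM; first by measurability.
  by apply: mb; measurability.
rewrite ge0_integralD; last 5 first.
- by [].
- by move=> x _; rewrite lee_fin mulr_ge0 ?expR_ge0.
- exact: mA.
- by move=> x _; rewrite lee_fin mulr_ge0 ?expR_ge0.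
- by apply: (measurableT_comp mB); measurability.
rewrite (ge0_integral_opp1 (f := fun x => (expR (1 * x) * (x <= 0)%R%:R)%:E)); last 2 first.
- exact: mB.
- by move=> x; rewrite lee_fin mulr_ge0 ?expR_ge0.
by rewrite !ge0_integral_expRM// -EFinD ltry.
Qed.

End RadialIntegrals.

(** * Rapid decay on the bundle *)

Section Fast.
Context {R : realType} {m : nat}.
Local Notation E := 'rV[R]_m.+2.
Implicit Types (G H a b : E * E -> R).

Definition fast G := forall N : nat, exists M : R, forall p, bundle p ->
  (1 + enorm p.1) ^+ N * `|G p| <= M.

Let one_enorm (x : E) : 1 <= 1 + enorm x.
Proof. by rewrite lerDl enorm_ge0. Qed.

Let one_enorm_gt0 (x : E) : 0 < 1 + enorm x.
Proof. by rewrite (lt_le_trans ltr01). Qed.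

Lemma fast_dominated C K G H :
  (forall p, bundle p -> `|G p| <= C * (1 + enorm p.1) ^+ K * `|H p|) ->
  fast H -> fast G.
Proof.
move=> GH fH N; have [M HM] := fH (N + K)%N.
exists (`|C| * M) => p bp.
apply: (@le_trans _ _ (`|C| * ((1 + enorm p.1) ^+ (N + K) * `|H p|))).
  rewrite exprD -!mulrA mulrCA ler_wpM2l ?exprn_ge0 ?(ltW (one_enorm_gt0 _))//.
  apply: le_trans (GH _ bp) _; rewrite -mulrA ler_wpM2r// ?ler_norm//.
  by rewrite mulr_ge0// exprn_ge0// (ltW (one_enorm_gt0 _)).
by rewrite ler_wpM2l// HM.
Qed.

Lemma fastD G H : fast G -> fast H -> fast (fun p => G p + H p).
Proof.
move=> fG fH N; have [M HM] := fG N; have [M' HM'] := fH N.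
exists (M + M') => p bp; apply: le_trans (lerD (HM _ bp) (HM' _ bp)).
by rewrite -mulrDr ler_wpM2l ?ler_normD// exprn_ge0// (ltW (one_enorm_gt0 _)).
Qed.

Lemma fast_ext G H : (forall p, bundle p -> G p = H p) -> fast G -> fast H.
Proof. by move=> GH fG N; have [M HM] := fG N; exists M => p bp; rewrite -GH// HM. Qed.

Lemma fastZ c G : fast G -> fast (fun p => c * G p).
Proof.
apply: (@fast_dominated `|c| 0) => p _.
by rewrite expr0 mulr1 normrM.
Qed.

Lemma bundle_coord2_le1 (p : E * E) i : bundle p -> `|p.2 0 i| <= 1.
Proof. by case=> p2 _; rewrite -p2 normr_coord_le. Qed.

Lemma fast_coord1 i G : fast G -> fast (fun p => p.1 0 i * G p).
Proof.
apply: (@fast_dominated 1 1) => p _.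
rewrite mul1r expr1 normrM ler_wpM2r//.
by rewrite (le_trans (normr_coord_le _ _))// lerDr.
Qed.

Lemma fast_coord2 i G : fast G -> fast (fun p => p.2 0 i * G p).
Proof.
apply: (@fast_dominated 1 0) => p bp.
by rewrite expr0 mul1r mul1r normrM ler_piMl// bundle_coord2_le1.
Qed.

Lemma fastM G H : fast G -> fast H -> fast (fun p => G p * H p).
Proof.
move=> fG; have [M HM] := fG 0%N.
apply: (@fast_dominated M 0) => p bp.
by rewrite expr0 mulr1 normrM ler_wpM2r//; have := HM _ bp; rewrite expr0 mul1r.
Qed.

Lemma fast_sum I (s : seq I) (F : I -> E * E -> R) : (forall i, fast (F i)) ->
  fast (fun p => \sum_(i <- s) F i p).
Proof.
move=> fF; elim: s => [N|i s IH].
  by exists 0 => p _; rewrite big_nil normr0 mulr0.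
by apply: (fast_ext _ (fastD (fF i) IH)) => p _; rewrite big_cons.
Qed.

Lemma bundle_measurable_weight (s t : R) :
  bundle_measurable (fun p : E * E => weight s t p.1).
Proof.
apply: bundle_measurable_fun.
have me : measurable_fun setT (fun p : E * E => enorm p.1) by measurability.
apply: measurable_funM; first exact: (measurableT_comp (measurable_powR (2 * t)) me).
have m2 : measurable_fun setT (fun p : E * E => 1 + enorm p.1 ^+ 2) by measurability.
exact: (measurableT_comp (measurable_powR (s - t)) m2).
Qed.

Lemma weight_ge0 n (s t : R) (y : 'rV[R]_n) : 0 <= weight s t y.
Proof. by rewrite mulr_ge0 ?powR_ge0. Qed.

(** Every fibre is isometric to R^(m+1), so the bound given by [weight_decay] is the same for all
    xi. *)
Lemma fast_weight_integrable (s t : R) G : - (m.+1%:R / 2) < t ->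
  bundle_measurable G -> fast G ->
  bundle_integrable (fun p => weight s t p.1 * G p).
Proof.
move=> tm mG fG; split.
  by apply: bundle_measurableM => //; exact: bundle_measurable_weight.
have [N HN] := weight_decay s tm; have [M HM] := fG N.
have M0 : 0 <= M.
  pose x0 : E := delta_mx 0 0.
  have x00 : x0 != 0.
    apply/eqP => /matrixP/(_ 0 0); rewrite !mxE !eqxx => /eqP.
    by rewrite oner_eq0.
  apply: le_trans (HM (hplane (normalize x0) 0, normalize x0) _).
    by rewrite mulr_ge0// exprn_ge0// (ltW (one_enorm_gt0 _)).
  by apply: bundle_hplane; exact: enorm_normalize.
have mw : measurable_fun setT (fun u : 'rV[R]_m.+1 =>
    (weight s t u * ((1 + enorm u) ^+ N)^-1)%:E).
  apply/measurable_EFinP; apply: measurable_funM; last by measurability.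
  have me : measurable_fun setT (fun u : 'rV[R]_m.+1 => enorm u) by measurability.
  apply: measurable_funM; first exact: (measurableT_comp (measurable_powR (2 * t)) me).
  have m2 : measurable_fun setT (fun u : 'rV[R]_m.+1 => 1 + enorm u ^+ 2) by measurability.
  exact: (measurableT_comp (measurable_powR (s - t)) m2).
have w0 (u : 'rV[R]_m.+1) : 0 <= weight s t u * ((1 + enorm u) ^+ N)^-1.
  by rewrite mulr_ge0 ?weight_ge0// invr_ge0 exprn_ge0// addr_ge0// enorm_ge0.
set I := (\int[leb R m.+1]_u _)%E in HN.
exists (M * fine I) => xi xi1.
have -> : ((M * fine I)%:E = M%:E * I)%E.
  rewrite EFinM fineK// ge0_fin_numE//.
  by apply: integral_ge0 => u _; rewrite lee_fin.
rewrite -ge0_integralZl_EFin//; last by move=> u _; rewrite lee_fin.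
apply: ge0_le_integral.
- by [].
- by move=> u _; rewrite lee_fin.
- apply/measurable_EFinP; exact: (measurable_slice1 xi1 (bundle_measurable_abs
    (bundle_measurableM (bundle_measurable_weight s t) mG))).
- exact: emeasurable_funM.
move=> u _; rewrite -EFinM lee_fin normrM ger0_norm ?weight_ge0//= mulrCA.
rewrite /weight enorm_hplane// -/(weight s t u) ler_wpM2l ?weight_ge0//.
rewrite ler_pdivlMr; last by rewrite exprn_gt0// ltr_pwDl// enorm_ge0.
by rewrite mulrC; have := HM _ (bundle_hplane u xi1); rewrite /= enorm_hplane.
Qed.

Lemma fast_integrable G : bundle_measurable G -> fast G -> bundle_integrable G.
Proof.
move=> mG fG.
have t0 : - (m.+1%:R / 2) < 0 :> R by rewrite oppr_lt0 divr_gt0.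
have iG := fast_weight_integrable 0 t0 mG fG.
apply: bundle_integrable_dominated (bundle_integrable_abs iG) => // p _.
by rewrite /weight mulr0 subr0 !powRr0 !mul1r.
Qed.

End Fast.

Lemma measurable_Rintegral_param {R : realType} d (T : measurableType d)
    d2 (T2 : measurableType d2) (M : {sigma_finite_measure set T2 -> \bar R})
    (F : T -> T2 -> R) :
  measurable_fun setT (fun p : T * T2 => F p.1 p.2) ->
  measurable_fun setT (fun x => \int[M]_y F x y).
Proof.
move=> mF; apply: (measurableT_comp (@fine_measurable _ setT _)) => //.
rewrite (_ : (fun x => _) = (fun x =>
    \int[M]_y (Num.max (F x y) 0)%:E - \int[M]_y (Num.max (- F x y) 0)%:E)%E); last first.
  apply/funext => x; rewrite integralE; congr (_ - _)%E.
    by apply: eq_integral => y _; rewrite funeposE EFin_max.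
  by apply: eq_integral => y _; rewrite funenegE EFin_max.
by apply: emeasurable_funB; apply: measurable_integral_param;
  [apply/measurable_EFinP; apply: measurable_maxr => //
  |move=> x y; rewrite lee_fin le_max lexx orbT
  |apply/measurable_EFinP; apply: measurable_maxr => //; exact: measurable_funN
  |move=> x y; rewrite lee_fin le_max lexx orbT].
Qed.

Lemma measurable_cos_fun {R : realType} d (T : measurableType d) (f : T -> R) :
  measurable_fun setT f -> measurable_fun setT (fun x => cos (f x)).
Proof.
by apply: measurableT_comp; apply: continuous_measurable_fun; exact: continuous_cos.
Qed.

(** * Fourier transforms over the fibres *)

Section PhaseTransform.
Context {R : realType} {m : nat}.
Local Notation E := 'rV[R]_m.+2.
Implicit Types (G H a b : E * E -> R).

(* The Fourier transform over the fibres, up to a constant factor and in real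
   terms: the cosine transform is th = 0 and the sine transform th = pi / 2. *)
Definition phase_transform (th : R) a (p : E * E) : R :=
  \int[leb R m.+1]_u (cos (dotp p.1 (hplane p.2 u) - th) * a (hplane p.2 u, p.2)).

Lemma normr_cos_le1 (x : R) : `|cos x| <= 1.
Proof. by rewrite ler_norml cos_geN1 cos_le1. Qed.

Lemma phase_integrable th a (y xi : E) : bundle_integrable a -> enorm xi = 1 ->
  (leb R m.+1).-integrable setT
    (fun u => (cos (dotp y (hplane xi u) - th) * a (hplane xi u, xi))%:E).
Proof.
move=> ia xi1; have ix := bundle_integrable_slice ia xi1.
apply: (le_integrable _ _ _ ix) => //.
  apply/measurable_EFinP; apply: measurable_funM; last exact: measurable_slice1 xi1 ia.1.
  apply: measurable_cos_fun.
  have mh : measurable_fun setT (fun u => hplane xi u).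
    by apply: measurable_hplane; measurability.
  by measurability.
by move=> u _; rewrite lee_fin normrM ler_piMl// normr_cos_le1.
Qed.

Lemma phase_transformD th a b p : bundle_integrable a -> bundle_integrable b ->
  bundle p -> phase_transform th (fun p => a p + b p) p =
  phase_transform th a p + phase_transform th b p.
Proof.
case: p => y xi ia ib [/= xi1 _]; rewrite /phase_transform -RintegralD//.
- by apply: eq_Rintegral => u _; rewrite mulrDr.
- exact: phase_integrable.
- exact: phase_integrable.
Qed.

Lemma phase_transformZ th c a p : bundle_integrable a -> bundle p ->
  phase_transform th (fun p => c * a p) p = c * phase_transform th a p.
Proof.
case: p => y xi ia [/= xi1 _]; rewrite /phase_transform -RintegralZl//.
  by apply: eq_Rintegral => u _; rewrite mulrCA.
exact: phase_integrable.
Qed.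

Lemma cosDpi_shift (x th : R) : cos (x - (th + pi)) = - cos (x - th).
Proof.
have -> : x - (th + pi) = (x - th) - pi by ring.
by rewrite (cosB (x - th) pi) cospi sinpi mulr0 addr0 mulrN1.
Qed.

Lemma phase_transform_pi th a p : bundle_integrable a -> bundle p ->
  phase_transform (th + pi) a p = - phase_transform th a p.
Proof.
case: p => y xi ia [/= xi1 _].
rewrite /phase_transform -[RHS]mulN1r -RintegralZl//; last exact: phase_integrable.
by apply: eq_Rintegral => u _; rewrite cosDpi_shift mulNr mulN1r.
Qed.

Lemma phase_transform_ext th a b p : bundle p ->
  (forall q, bundle q -> a q = b q) ->
  phase_transform th a p = phase_transform th b p.
Proof.
case: p => y xi [/= xi1 _] ab; apply: eq_Rintegral => u _.
by rewrite ab//; exact: bundle_hplane.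
Qed.

Lemma normr_phase_transform_le th a (M : R) p : bundle_integrable a -> bundle p ->
  (\int[leb R m.+1]_u (`|a (hplane p.2 u, p.2)|)%:E <= M%:E)%E ->
  `|phase_transform th a p| <= M.
Proof.
case: p => y xi ia [/= xi1 _] HM.
have ip := phase_integrable th y ia xi1.
rewrite -lee_fin; apply: le_trans HM.
apply: (@le_trans _ _ (\int[leb R m.+1]_u
    `|(cos (dotp y (hplane xi u) - th) * a (hplane xi u, xi))%:E|)%E).
  rewrite /phase_transform EFin_normr_Rintegral//.
  by apply: le_abse_integral => //; case/integrableP: ip.
apply: ge0_le_integral.
- by [].
- by move=> u _; rewrite lee_fin.
- by case/integrableP: ip => mp _; exact: (measurableT_comp (@abse_measurable _ setT) mp).
- by apply/measurable_EFinP; exact: (measurable_slice1 xi1 (bundle_measurable_abs ia.1)).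
by move=> u _; rewrite lee_fin normrM ler_piMl// normr_cos_le1.
Qed.

(** Adding |a| makes the integrand nonnegative, the case in which fibre integrals are known to be
    measurable. The frequency y is first a free parameter, then set to the projection of q.1 on the
    hyperplane. *)
Lemma bundle_measurable_phase_transform th a : bundle_integrable a ->
  bundle_measurable (phase_transform th a).
Proof.
move=> ia; have iA := bundle_integrable_abs ia.
pose F (y : E) (p : E * E) := cos (dotp y p.1 - th) * a p + `|a p|.
have F0 y p : 0 <= F y p.
  rewrite /F -lerBlDr sub0r -[X in - X]mul1r.
  have := normr_cos_le1 (dotp y p.1 - th); rewrite ler_norml => /andP[c1 c2].
  have : `|cos (dotp y p.1 - th) * a p| <= `|a p|.
    by rewrite normrM ler_piMl// normr_cos_le1.
  by rewrite ler_norml mul1r => /andP[].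
have mF : measurable_fun setT
    (fun q : E * (E * E) => bundle_ext (F q.1) q.2).
  have mr : measurable_fun setT (fun q : E * (E * E) => bundle_ext a q.2).
    by apply: (measurableT_comp ia.1); measurability.
  rewrite (_ : (fun q => _) = (fun q : E * (E * E) =>
      cos (dotp q.1 (retract q.2).1 - th) * bundle_ext a q.2 + `|bundle_ext a q.2|)).
    apply: measurable_funD; last first.
      exact: (measurableT_comp (@normr_measurable _ setT)).
    apply: measurable_funM => //; apply: measurable_cos_fun; rewrite /retract/=.
    have mq : measurable_fun setT (fun q : E * (E * E) => q.2.1) by measurability.
    by measurability.
  apply/funext => q; rewrite /bundle_ext /F mulrDr mulrCA normrM normr_nat.
  by [].
have mI := measurable_ge0_hyperplane_integral_param mF F0.
have mA := measurable_ge0_hyperplane_integral iA.1 (fun p => normr_ge0 (a p)).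
have mfine (T' := E * E : Type) (f : E * E -> \bar R) : measurable_fun setT f ->
    measurable_fun setT (fun q => fine (f q)).
  exact: (measurableT_comp (@fine_measurable _ setT _)).
rewrite /bundle_measurable (_ : bundle_ext _ = fun q : E * E =>
    fine (\int[leb R m.+1]_u
      (bundle_ext (F (q.1 - dotp q.1 (normalize q.2) *: normalize q.2)) (hplane (normalize q.2) u, q.2))%:E) -
    fine (\int[leb R m.+1]_u
      (bundle_ext (fun p => `|a p|) (hplane (normalize q.2) u, q.2))%:E)).
  apply: measurable_funB; apply: mfine.
    have mr : measurable_fun setT (fun q : E * E =>
        (q.1 - dotp q.1 (normalize q.2) *: normalize q.2, q.2)).
      have mq : measurable_fun setT (fun q : E * E => normalize q.2).
        by apply: measurable_normalize.
      apply: measurable_fun_pair; last by [].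
      by apply: measurable_rvB => //; apply: measurable_rvZ => //; apply: measurable_dotp.
    exact: (measurableT_comp mI mr).
  by apply: (measurableT_comp mA); measurability.
apply/funext => -[y z] /=; rewrite /bundle_ext/=.
have [->|z0] := eqVneq z 0.
  by rewrite mul0r !integral0_eq ?subrr// => u _; rewrite mul0r.
have zn := enorm_normalize z0.
rewrite mul1r /phase_transform retractE//=.
under eq_integral do rewrite mul1r retract_hplane//.
under [X in _ - fine X]eq_integral do rewrite mul1r retract_hplane//.
set y' := y - _.
have ip := phase_integrable th y' ia zn.
have ib := bundle_integrable_slice iA zn.
apply: eq_trans (RintegralB measurableT _ ib); last first.
  have iS := integrableD measurableT ip ib.
  by apply: (eq_integrable measurableT _ _ _ iS) => u _; rewrite /= -EFinD.
by apply: eq_Rintegral => u _; rewrite /F addrK.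
Qed.

End PhaseTransform.

(** * Fibrewise Fourier transforms and the fields Xi *)

Section LineDerivative.
Context {R : realType} {V : normedModType R}.
Implicit Types (f : V -> R) (x v w : V).

Let lineE f x v s (h : R) :
  h^-1 *: (((fun s : R => f (x + s *: v)) \o shift s) (h *: 1) - f (x + s *: v)) =
  h^-1 *: ((f \o shift (x + s *: v)) (h *: v) - f (x + s *: v)).
Proof.
rewrite /= [_ *: 1]mulr1 scalerDl; congr (_ *: (f _ - _)).
by rewrite addrCA.
Qed.

(** Restricting to a line makes the one-variable chain rule, mean value theorem and differentiation
    under the integral available for directional derivatives. *)
Lemma derivable_line f x v (s : R) :
  derivable (fun s : R => f (x + s *: v)) s 1 <-> derivable f (x + s *: v) v.
Proof. by rewrite /derivable; under eq_fun do rewrite lineE. Qed.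

Lemma derive_line f x v (s : R) :
  'D_1 (fun s : R => f (x + s *: v)) s = 'D_v f (x + s *: v).
Proof. by rewrite /derive; under eq_fun do rewrite lineE. Qed.

Lemma is_derive_line f x v (s d : R) :
  is_derive s 1 (fun s : R => f (x + s *: v)) d <-> is_derive (x + s *: v) v f d.
Proof.
split=> -[df <-]; split.
- exact/derivable_line.
- by rewrite -derive_line.
- exact/derivable_line.
- exact: derive_line.
Qed.

Lemma is_derive_line0 f x v (d : R) :
  is_derive (0 : R) 1 (fun s : R => f (x + s *: v)) d <-> is_derive x v f d.
Proof. by have := is_derive_line f x v 0 d; rewrite scale0r addr0. Qed.

Lemma is_derive_dirZ f x v (c : R) : derivable f x v ->
  is_derive x (c *: v) f (c * 'D_v f x).
Proof.
move=> dv; apply/is_derive_line0.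
have d1 : is_derive (c * 0) 1 (fun s : R => f (x + s *: v)) ('D_v f x).
  by rewrite mulr0; apply/is_derive_line0; exact: DeriveDef.
have d2 : is_derive (0 : R) 1 (fun s : R => c * s) c.
  by apply: is_derive_eq; rewrite [LHS]mulr1.
have := is_derive1_comp d1 d2; rewrite mulrC.
rewrite (_ : _ \o _ = (fun s : R => f (x + s *: (c *: v))))//.
by apply/funext => s /=; rewrite scalerA mulrC.
Qed.

Lemma line_MVT f x v (h : R) : (forall s : R, 0 <= s <= 1 -> derivable f (x + (s * h) *: v) v) ->
  exists2 c : R, 0 < c < 1 & f (x + h *: v) - f x = h * 'D_v f (x + (c * h) *: v).
Proof.
move=> df.
pose g (s : R) := f (x + (s * h) *: v).
have dg (s : R) : 0 <= s <= 1 -> is_derive s 1 g (h * 'D_v f (x + (s * h) *: v)).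
  move=> s01.
  have d1 : is_derive (s * h) 1 (fun s : R => f (x + s *: v)) ('D_v f (x + (s * h) *: v)).
    by apply/is_derive_line; exact: (DeriveDef (df _ s01)).
  have d2 : is_derive s 1 (fun s : R => s * h) h.
    rewrite (_ : (fun s : R => s * h) = (fun s => h * s)); last first.
      by apply/funext => r; rewrite mulrC.
    by apply: is_derive_eq; rewrite [LHS]mulr1.
  rewrite [h * _]mulrC.
  exact: (@is_derive1_comp _ (fun s => f (x + s *: v)) (fun s => s * h) s _ _ d1 d2).
have [] := @MVT _ g (fun s => h * 'D_v f (x + (s * h) *: v)) 0 1 ltr01.
- by move=> s; rewrite in_itv/= => /andP[s0 s1]; apply: dg; rewrite !ltW.
- apply: derivable_within_continuous => s; rewrite in_itv/= => s01.
  by have [] := dg _ s01.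
move=> c; rewrite in_itv/= => c01; rewrite subr0 mulr1 /g mul1r mul0r scale0r addr0.
by exists c.
Qed.

(** [smooth_on] speaks of directional derivatives only, so their additivity in the direction has to
    be proved: the increment along v + w is one along v followed by one along w, and the mean value
    theorem with the continuity of 'D_w f handles the second. *)
Lemma is_derive_dirD f (U : set V) x v w : open U -> U x ->
  (forall z, U z -> derivable f z v) -> (forall z, U z -> derivable f z w) ->
  {for x, continuous ('D_w f)} -> is_derive x (v + w) f ('D_v f x + 'D_w f x).
Proof.
move=> oU Ux dv dw cw.
suff H : (fun h : R => h^-1 *: ((f \o shift x) (h *: (v + w)) - f x)) @ 0^' -->
    ('D_v f x + 'D_w f x).
  by apply: DeriveDef; [apply/cvg_ex; eexists; exact: H|exact: cvg_lim].
rewrite (_ : (fun h : R => _) = (fun h : R =>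
   h^-1 *: ((f \o shift x) (h *: v) - f x) +
   h^-1 *: (f (h *: (v + w) + x) - f (h *: v + x)))); last first.
  by apply/funext => h /=; rewrite -scalerDr; congr (_ *: _); ring.
apply: cvgD; first exact: dv.
apply/cvgrPdist_lt => e e0.
have /cvgrPdist_lt/(_ e e0) /nbhs_ballP[d /= d0 dU] := cw.
have /nbhs_ballP[d' /= d'0 dU'] : nbhs x U by exact: open_nbhs_nbhs.
pose M := `|v| + `|w| + 1.
have M0 : 0 < M by rewrite ltr_wpDl// addr_ge0.
near=> h.
have h0 : h != 0 by near: h; exact: nbhs_dnbhs_neq.
have hM r : 0 < r -> `|h| < r / M -> forall c : R, 0 <= c <= 1 ->
    ball x r (h *: v + x + (c * h) *: w).
  move=> r0 hr c /andP[c0 c1]; rewrite -ball_normE/= opprD addrA opprD addrCA subrr addr0.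
  rewrite -opprD normrN; apply: le_lt_trans (ler_normD _ _) _; rewrite !normrZ.
  apply: (@le_lt_trans _ _ (`|h| * M)); last by rewrite -ltr_pdivlMr.
  rewrite (ger0_norm c0) /M !mulrDr mulr1 -addrA lerD2l.
  apply: (@le_trans _ _ (`|h| * `|w|)); last by rewrite lerDl.
  by rewrite ler_wpM2r// ler_piMl.
have hd : `|h| < d / M by near: h; apply: dnbhs0_lt; rewrite divr_gt0.
have hd' : `|h| < d' / M by near: h; apply: dnbhs0_lt; rewrite divr_gt0.
have [s s01|c c01] := @line_MVT f (h *: v + x) w h.
  by apply: dw; apply: dU'; exact: hM.
have -> : h *: (v + w) + x = h *: v + x + h *: w by rewrite scalerDr addrAC.
move=> ->; rewrite -[_ *: _]/(h^-1 * _) mulrA mulVf// mul1r.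
by apply: dU; apply: hM => //; case/andP: c01 => ? ?; rewrite !ltW.
Unshelve. all: by end_near. Qed.

End LineDerivative.

Section UnderIntegral.
Context {R : realType} d (T : measurableType d) (mu : {measure set T -> \bar R}).

Lemma is_derive_Rintegral (f f' : R -> T -> R) (G : T -> R) (r : R) : 0 < r ->
  (forall s, `|s| < r -> mu.-integrable setT (EFin \o f s)) ->
  (forall (s : R) y, `|s| < r -> is_derive s 1 (f ^~ y) (f' s y)) ->
  mu.-integrable setT (EFin \o G) ->
  (forall s y, `|s| < r -> `|f' s y| <= G y) ->
  is_derive (0 : R) 1 (fun s : R => \int[mu]_y f s y) (\int[mu]_y f' 0 y).
Proof.
move=> r0 intf df intG fG.
have I0 : `](- r), r[%classic (0 : R) by rewrite /= in_itv/=; lra.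
have Ir s : `](- r), r[%classic s -> `|s| < r by rewrite /= in_itv/= ltr_norml.
have r00 : `|0 : R| < r by rewrite normr0.
have d1 x y : `|x| < r -> (partial1of2 f) x y = f' x y.
  by move=> xr; rewrite partial1of2E; have [_ <-] := df x y xr.
have G0 y : 0 <= G y by exact: le_trans (fG 0 y r00).
have A1 s : `](- r), r[%classic s -> mu.-integrable setT (EFin \o f s).
  by move=> /Ir; exact: intf.
have A2 s y : `](- r), r[%classic s -> setT y -> derivable (f ^~ y) s 1.
  by move=> /Ir sr _; have [] := df s y sr.
have A3 s y : `](- r), r[%classic s -> setT y -> `|partial1of2 f s y| <= G y.
  by move=> /Ir sr _; rewrite d1// fG.
apply: DeriveDef.
  exact: (@derivable_under_integral _ _ _ mu f setT measurableT 0 (- r) r I0 A1 A2 G G0 intG A3).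
rewrite -derive1E.
rewrite (@differentiation_under_integral _ _ _ mu f setT measurableT 0 (- r) r I0 A1 A2 G G0 intG A3).
by apply: eq_Rintegral => y _; rewrite d1.
Qed.

End UnderIntegral.

Section IntegrationByParts.
Context {R : realType} {k : nat}.

Lemma Rintegral_leb_shift (h : 'rV[R]_k -> R) (c : 'rV[R]_k) : measurable_fun setT h ->
  \int[leb R k]_u h (u + c) = \int[leb R k]_u h u.
Proof.
move=> mh; congr fine; rewrite integralE [RHS]integralE.
have mE : measurable_fun setT (EFin \o h) by exact/measurable_EFinP.
congr (_ - _)%E.
  rewrite -[RHS](@ge0_integral_leb_shift _ _ _ c)//; last exact: measurable_funepos.
  by apply: eq_integral => u _; rewrite !funeposE.
rewrite -[RHS](@ge0_integral_leb_shift _ _ _ c)//; last exact: measurable_funeneg.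
by apply: eq_integral => u _; rewrite !funenegE.
Qed.

Lemma integrable_leb_shift (h : 'rV[R]_k -> R) (c : 'rV[R]_k) :
  (leb R k).-integrable setT (EFin \o h) ->
  (leb R k).-integrable setT (EFin \o (fun u => h (u + c))).
Proof.
move=> /integrableP[mh ih]; apply/integrableP; split.
  by apply: (measurableT_comp mh); measurability.
rewrite (@ge0_integral_leb_shift _ _ (fun u => `|(h u)%:E|)%E)//.
exact: (measurableT_comp (@abse_measurable _ setT) mh).
Qed.

(* The integral over the translates u + s b does not depend on s. *)
Lemma integral_directional_derivative (h h' : 'rV[R]_k -> R) (b : 'rV[R]_k)
    (G : 'rV[R]_k -> R) :
  (leb R k).-integrable setT (EFin \o h) ->
  (forall u, is_derive u b h (h' u)) ->
  (leb R k).-integrable setT (EFin \o G) ->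
  (forall u s, `|s| < 1 -> `|h' (u + s *: b)| <= G u) ->
  \int[leb R k]_u h' u = 0.
Proof.
move=> ih dh iG hG.
have D : is_derive (0 : R) 1 (fun s : R => \int[leb R k]_u h (u + s *: b))
    (\int[leb R k]_u h' (u + 0 *: b)).
  have := @is_derive_Rintegral R _ _ (leb R k) (fun (s : R) u => h (u + s *: b))
    (fun (s : R) u => h' (u + s *: b)) G 1 ltr01.
  apply.
  - by move=> s _; exact: integrable_leb_shift.
  - by move=> s u _; apply/is_derive_line; exact: dh.
  - exact: iG.
  - by move=> s u s1; exact: hG.
have mh : measurable_fun setT h by case/integrableP: ih => /measurable_EFinP.
have [_] := D; under eq_Rintegral do rewrite scale0r addr0.
move=> <-; rewrite (_ : (fun s => _) = cst (\int[leb R k]_u h u)).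
  by rewrite derive_cst.
by apply/funext => s /=; rewrite Rintegral_leb_shift.
Qed.

End IntegrationByParts.

(** * Rapid decay and integration by parts in Euclidean space *)

Section Rapid.
Context {R : realType}.

Lemma one_enorm_gt0 n (x : 'rV[R]_n) : 0 < 1 + enorm x.
Proof. by rewrite ltr_pwDl// enorm_ge0. Qed.

Lemma one_enorm_ge1 n (x : 'rV[R]_n) : 1 <= 1 + enorm x.
Proof. by rewrite lerDl enorm_ge0. Qed.

Lemma enorm_le_sum n (y : 'rV[R]_n) : enorm y <= \sum_i `|y 0 i|.
Proof.
rewrite -(@ler_pXn2r _ 2) ?nnegrE ?enorm_ge0 ?sumr_ge0// enorm_sqr /dotp.
rewrite expr2 mulr_suml; apply: ler_sum => i _.
apply: (@le_trans _ _ (`|y 0 i| * `|y 0 i|)).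
  by rewrite -normrM ler_norm.
by rewrite ler_wpM2l// (bigD1 i)//= lerDl sumr_ge0.
Qed.

Lemma sum_pow_le n (F : 'I_n -> R) N : (forall i, 0 <= F i) ->
  (\sum_i F i) ^+ N <= n%:R ^+ N * (1 + \sum_i F i ^+ N).
Proof.
case: n F => [|n] F F0; first by rewrite !big_ord0 addr0 mulr1.
pose i0 := [arg max_(i > ord0) F i]%O.
have Fi0 i : F i <= F i0 by rewrite /i0; case: Order.TotalTheory.arg_maxP => // j _; exact.
apply: (@le_trans _ _ ((n.+1%:R * F i0) ^+ N)).
  rewrite lerXn2r ?nnegrE ?sumr_ge0 ?mulr_ge0//.
  apply: (@le_trans _ _ (\sum_(i < n.+1) F i0)); first exact: ler_sum.
  by rewrite sumr_const card_ord mulr_natl.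
rewrite exprMn ler_wpM2l ?exprn_ge0// (bigD1 i0)//= addrCA lerDl.
by rewrite addr_ge0// sumr_ge0// => j _; rewrite exprn_ge0.
Qed.

(** Reduces the decay of a transform to bounds on its products with powers of single coordinates,
    which integration by parts provides. *)
Lemma pow_enorm_le n N : exists C : R, 0 <= C /\ forall y : 'rV[R]_n,
  (1 + enorm y) ^+ N <= C * (1 + \sum_i `|y 0 i| ^+ N).
Proof.
exists (2 ^+ N * (1 + n%:R ^+ N)); split.
  by rewrite mulr_ge0 ?addr_ge0 ?exprn_ge0.
move=> y; have e0 := enorm_ge0 y.
apply: (@le_trans _ _ (2 ^+ N * (1 + enorm y ^+ N))).
  have [e1|e1] := leP (enorm y) 1.
    apply: (@le_trans _ _ (2 ^+ N)); first by rewrite lerXn2r ?nnegrE//; lra.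
    by rewrite ler_peMr ?exprn_ge0// lerDl exprn_ge0.
  apply: (@le_trans _ _ ((2 * enorm y) ^+ N)).
    by rewrite lerXn2r ?nnegrE//; lra.
  by rewrite exprMn ler_wpM2l ?exprn_ge0// lerDr.
rewrite -mulrA ler_wpM2l ?exprn_ge0// mulrDl mul1r lerD//.
  by rewrite lerDl sumr_ge0// => i _; rewrite exprn_ge0.
apply: le_trans (sum_pow_le N (fun i => normr_ge0 (y 0 i))).
by rewrite lerXn2r ?nnegrE ?sumr_ge0// enorm_le_sum.
Qed.

Definition rapid n (f : 'rV[R]_n -> R) := forall N : nat, exists M : R, forall x,
  (1 + enorm x) ^+ N * `|f x| <= M.

Lemma rapid_dominated n C K (f g : 'rV[R]_n -> R) :
  (forall x, `|f x| <= C * (1 + enorm x) ^+ K * `|g x|) -> rapid g -> rapid f.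
Proof.
move=> fg rg N; have [M HM] := rg (N + K)%N.
exists (`|C| * M) => x; have p0 := ltW (one_enorm_gt0 x).
apply: (@le_trans _ _ (`|C| * ((1 + enorm x) ^+ (N + K) * `|g x|))); last first.
  by rewrite ler_wpM2l// HM.
rewrite exprD -!mulrA mulrCA ler_wpM2l ?exprn_ge0//.
apply: le_trans (fg x) _; rewrite -mulrA ler_wpM2r// ?ler_norm//.
by rewrite mulr_ge0// exprn_ge0.
Qed.

Lemma rapidD n (f g : 'rV[R]_n -> R) : rapid f -> rapid g -> rapid (fun x => f x + g x).
Proof.
move=> rf rg N; have [M HM] := rf N; have [M' HM'] := rg N.
exists (M + M') => x; apply: le_trans (lerD (HM x) (HM' x)).
by rewrite -mulrDr ler_wpM2l ?ler_normD// exprn_ge0// (ltW (one_enorm_gt0 _)).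
Qed.

Lemma rapidZ n c (f : 'rV[R]_n -> R) : rapid f -> rapid (fun x => c * f x).
Proof.
by apply: (@rapid_dominated _ `|c| 0) => x; rewrite expr0 mulr1 normrM.
Qed.

Lemma rapid_abs n (f : 'rV[R]_n -> R) : rapid f -> rapid (fun x => `|f x|).
Proof. by apply: (@rapid_dominated _ 1 0) => x; rewrite expr0 mulr1 mul1r normr_id. Qed.

Lemma rapid_dotp n (w : 'rV[R]_n) (f : 'rV[R]_n -> R) :
  rapid f -> rapid (fun x => dotp w x * f x).
Proof.
apply: (@rapid_dominated _ (enorm w) 1) => x.
rewrite expr1 normrM ler_wpM2r// (le_trans (normr_dotp_le _ _))//.
by rewrite ler_wpM2l ?enorm_ge0// lerDr.
Qed.

Lemma rapid_sum n I (s : seq I) (F : I -> 'rV[R]_n -> R) : (forall i, rapid (F i)) ->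
  rapid (fun x => \sum_(i <- s) F i x).
Proof.
move=> rF; elim: s => [N|i s IH].
  by exists 0 => p; rewrite big_nil normr0 mulr0.
move: (rapidD (rF i) IH); congr rapid; apply/funext => x; by rewrite big_cons.
Qed.

(** The case s = t = 0 of [weight_decay], where the weight is 1. *)
Lemma rapid_bound_integrable n (M : R) : exists N : nat,
  (leb R n.+1).-integrable setT (fun u => (M * ((1 + enorm u) ^+ N)^-1)%:E).
Proof.
have t0 : - (n.+1%:R / 2) < 0 :> R by rewrite oppr_lt0 divr_gt0.
have [N HN] := weight_decay 0 t0; exists N.
have mN : measurable_fun setT (fun u : 'rV[R]_n.+1 => ((1 + enorm u) ^+ N)^-1).
  by measurability.
under eq_fun do rewrite EFinM.
apply: integrableZl => //; apply/integrableP; split; first exact/measurable_EFinP.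
apply: le_lt_trans HN; apply: ge0_le_integral => //.
- by apply: (measurableT_comp (@abse_measurable _ setT)); exact/measurable_EFinP.
- apply/measurable_EFinP; apply: measurable_funM => //.
  by rewrite /weight mulr0 subr0; under eq_fun do rewrite !powRr0 mulr1; measurability.
move=> u _; rewrite /weight mulr0 subr0 !powRr0 !mul1r lee_fin ger0_norm//.
by rewrite invr_ge0 exprn_ge0// (ltW (one_enorm_gt0 _)).
Qed.

Lemma rapid_le n (f : 'rV[R]_n -> R) N : rapid f ->
  exists M, forall x, `|f x| <= M * ((1 + enorm x) ^+ N)^-1.
Proof.
move=> rf; have [M HM] := rf N; exists M => x.
by rewrite ler_pdivlMr ?exprn_gt0 ?one_enorm_gt0// mulrC HM.
Qed.

Lemma rapid_integrable n (f : 'rV[R]_n.+1 -> R) : measurable_fun setT f -> rapid f ->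
  (leb R n.+1).-integrable setT (EFin \o f).
Proof.
move=> mf rf; have [N HN] := @rapid_bound_integrable n 1.
have [M HM] := rapid_le N rf.
have iM := integrableZl measurableT M HN.
apply: (le_integrable measurableT _ _ iM) => //; first exact/measurable_EFinP.
move=> x _ /=; rewrite lee_fin mul1r (le_trans (HM x))// ler_norm//.
Qed.

(** Peetre's inequality: decay bounds survive bounded translations, up to a constant factor. *)
Lemma one_enorm_shift n (u c : 'rV[R]_n) : 1 + enorm u <= (1 + enorm (u + c)) * (1 + enorm c).
Proof.
have := enormD (u + c) (- c); rewrite addrK enormN.
have := mulr_ge0 (enorm_ge0 (u + c)) (enorm_ge0 c).
by rewrite mulrDl mul1r mulrDr mulr1; lra.
Qed.

Lemma rapid_integral_derivative n (h h' : 'rV[R]_n.+1 -> R) (b : 'rV[R]_n.+1) :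
  measurable_fun setT h -> rapid h -> rapid h' ->
  (forall u, is_derive u b h (h' u)) -> \int[leb R n.+1]_u h' u = 0.
Proof.
move=> mh rh rh' dh; have [N HN] := @rapid_bound_integrable n 1.
have [M HM] := rapid_le N rh'.
(* By Peetre's inequality this constant makes the bound on h' valid at all u + s b with |s| < 1, as
   domination requires. *)
pose c := `|M| * (1 + enorm b) ^+ N.
have iG := integrableZl measurableT c HN.
apply: (@integral_directional_derivative _ _ h h' b
  (fun u => c * (1 * ((1 + enorm u) ^+ N)^-1))) => //.
  exact: rapid_integrable.
move=> u s s1; apply: (le_trans (HM _)).
have p1 := one_enorm_gt0 (u + s *: b).
apply: (@le_trans _ _ (`|M| * ((1 + enorm (u + s *: b)) ^+ N)^-1)).
  by rewrite ler_wpM2r ?ler_norm// invr_ge0 exprn_ge0// ltW.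
rewrite mul1r /c -mulrA ler_wpM2l// ler_pdivlMr ?exprn_gt0 ?one_enorm_gt0//.
rewrite ler_pdivrMl ?exprn_gt0// -exprMn lerXn2r ?nnegrE ?mulr_ge0//;
  rewrite ?(ltW (one_enorm_gt0 _))// ?(ltW p1)//.
apply: le_trans (one_enorm_shift u (s *: b)) _.
rewrite ler_wpM2l ?(ltW p1)// lerD2l enormZ ler_piMl ?enorm_ge0//.
exact: ltW.
Qed.

(** The integral of the derivative along b of cos(<c,u> - th) f(u) vanishes, and sin(q - th) = cos(q
    - (th + pi/2)). This is the real form of the rule that a derivative becomes multiplication by
    i<c,b>, the factor i being the quarter turn of the phase. *)
Lemma phase_by_parts n (c b : 'rV[R]_n.+1) (f f' : 'rV[R]_n.+1 -> R) (th : R) :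
  measurable_fun setT f -> rapid f -> measurable_fun setT f' -> rapid f' ->
  (forall u, is_derive u b f (f' u)) ->
  dotp c b * (\int[leb R n.+1]_u (cos (dotp c u - (th + pi / 2)) * f u)) =
  \int[leb R n.+1]_u (cos (dotp c u - th) * f' u).
Proof.
move=> mf rf mf' rf' df.
have rcos (g : 'rV[R]_n.+1 -> R) (q : 'rV[R]_n.+1 -> R) : rapid g -> rapid (fun u => cos (q u) * g u).
  apply: (@rapid_dominated _ 1 0) => x.
  by rewrite expr0 !mul1r normrM ler_piMl// normr_cos_le1.
have mcos (g : 'rV[R]_n.+1 -> R) t : measurable_fun setT g ->
    measurable_fun setT (fun u => cos (dotp c u - t) * g u).
  by move=> mg; apply: measurable_funM => //; apply: measurable_cos_fun; measurability.
have cosE t : cos (t - (th + pi / 2)) = sin (t - th).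
  by rewrite opprD addrA cosB cos_pihalf sin_pihalf mulr0 add0r mulr1.
pose h u := cos (dotp c u - th) * f u.
pose h' u := cos (dotp c u - th) * f' u - dotp c b * (cos (dotp c u - (th + pi / 2)) * f u).
have dh u : is_derive u b h (h' u).
  have dq : is_derive u b (fun u => dotp c u - th) (dotp c b).
    apply/is_derive_line0.
    rewrite (_ : (fun s : R => _) = (fun s => (dotp c u - th) + dotp c b * s)); last first.
      by apply/funext => s; rewrite dotpDr dotpZr; ring.
    by apply: is_derive_eq; rewrite add0r mul1r [LHS]mulr1.
  have dcq : is_derive u b (fun u => cos (dotp c u - th)) (- sin (dotp c u - th) * dotp c b).
    apply/is_derive_line0; move/is_derive_line0 : dq => dq.
    have d1 : is_derive ((fun s : R => dotp c (u + s *: b) - th) 0) 1 cos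
       (- sin (dotp c u - th)).
      by rewrite scale0r addr0; exact: is_derive_cos.
    exact: (@is_derive1_comp _ cos (fun s : R => dotp c (u + s *: b) - th) 0 _ _ d1 dq).
  have D := is_deriveM dcq (df u).
  apply: (is_derive_eq D).
  rewrite /h' cosE -!/(_ * _) /=.
  by rewrite -[_ *: f' u]/(_ * f' u) -[f u *: _]/(f u * _); ring.
have I0 : \int[leb R n.+1]_u h' u = 0.
  apply: (rapid_integral_derivative _ _ _ dh).
  - exact: mcos.
  - exact: rcos.
  - apply: rapidD; first exact: rcos.
    move: (rapidZ (- dotp c b) (rcos _ (fun u => dotp c u - (th + pi / 2)) rf)).
    by congr rapid; apply/funext => u; rewrite mulNr.
have i1 := rapid_integrable (mcos f' th mf') (rcos _ (fun u => dotp c u - th) rf').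
have i2 := rapid_integrable (mcos f (th + pi / 2) mf)
  (rcos _ (fun u => dotp c u - (th + pi / 2)) rf).
have i3 : (leb R n.+1).-integrable setT (EFin \o (fun u => dotp c b *
    (cos (dotp c u - (th + pi / 2)) * f u))).
  exact: (integrableZl measurableT (dotp c b) i2).
move: I0; rewrite /h' RintegralB// RintegralZl// => /eqP.
by rewrite subr_eq0 eq_sym => /eqP.
Qed.

End Rapid.

Lemma normr_Rintegral_cos_le {R : realType} d (T : measurableType d)
    (mu : {measure set T -> \bar R}) (q g : T -> R) :
  measurable_fun setT q -> mu.-integrable setT (EFin \o g) ->
  `|\int[mu]_x (cos (q x) * g x)| <= \int[mu]_x `|g x|.
Proof.
move=> mq ig.
have mg : measurable_fun setT g by case/integrableP: ig => /measurable_EFinP.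
have ic : mu.-integrable setT (EFin \o (fun x => cos (q x) * g x)).
  apply: (le_integrable measurableT _ _ ig).
    by apply/measurable_EFinP; apply: measurable_funM => //; exact: measurable_cos_fun.
  by move=> x _; rewrite lee_fin normrM ler_piMl// normr_cos_le1.
have ia (f : T -> R) : mu.-integrable setT (EFin \o f) ->
    mu.-integrable setT (EFin \o (fun x => `|f x|)).
  by move=> iF; exact: (integrable_norm iF).
apply: le_trans (le_normr_Rintegral measurableT ic) _.
apply: le_Rintegral => //; try exact: ia.
by move=> x _; rewrite normrM ler_piMl// normr_cos_le1.
Qed.

Section FullTransform.
Context {R : realType} {n : nat}.
Local Notation E := 'rV[R]_n.+1.
Implicit Types (f g : E -> R).

Definition full_transform (th : R) f (y : E) : R :=
  \int[leb R n.+1]_x (cos (dotp y x - th) * f x).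

Lemma dotp_basis (y : E) i : dotp y (basis_vec R i) = y 0 i.
Proof.
rewrite /dotp (bigD1 i)//= big1 => [|j ji]; rewrite /basis_vec !mxE ?eqxx ?mulr1 ?addr0//.
by rewrite (negbTE ji) mulr0.
Qed.

Lemma rapid_cos (q : E -> R) f : rapid f -> rapid (fun u => cos (q u) * f u).
Proof.
apply: (@rapid_dominated _ _ 1 0) => x.
by rewrite expr0 !mul1r normrM ler_piMl// normr_cos_le1.
Qed.

Lemma full_transform_integrable th f y : measurable_fun setT f -> rapid f ->
  (leb R n.+1).-integrable setT (EFin \o (fun x => cos (dotp y x - th) * f x)).
Proof.
move=> mf rf; apply: rapid_integrable; last exact: rapid_cos.
by apply: measurable_funM => //; apply: measurable_cos_fun; measurability.
Qed.

Lemma full_transformD th f g y :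
  measurable_fun setT f -> rapid f -> measurable_fun setT g -> rapid g ->
  full_transform th (fun x => f x + g x) y =
  full_transform th f y + full_transform th g y.
Proof.
move=> mf rf mg rg; rewrite -[RHS]RintegralD//.
- by apply: eq_Rintegral => x _; rewrite mulrDr.
- exact: full_transform_integrable.
- exact: full_transform_integrable.
Qed.

Lemma full_transformZ th c f y : measurable_fun setT f -> rapid f ->
  full_transform th (fun x => c * f x) y = c * full_transform th f y.
Proof.
move=> mf rf; rewrite -[RHS]RintegralZl//; last exact: full_transform_integrable.
by apply: eq_Rintegral => x _; rewrite mulrCA.
Qed.

Lemma full_transform_sum th I (s : seq I) (F : I -> E -> R) y :
  (forall i, measurable_fun setT (F i)) -> (forall i, rapid (F i)) ->
  full_transform th (fun x => \sum_(i <- s) F i x) y =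
  \sum_(i <- s) full_transform th (F i) y.
Proof.
move=> mF rF; elim: s => [|i s IH].
  rewrite big_nil /full_transform /Rintegral integral0_eq// => x _.
  by rewrite big_nil mulr0.
rewrite big_cons -IH -full_transformD//; last 2 first.
- exact: measurable_sum.
- exact: rapid_sum.
by apply: eq_Rintegral => x _; rewrite big_cons.
Qed.

Lemma full_transform_derivative th f f' (y : E) i :
  measurable_fun setT f -> rapid f -> measurable_fun setT f' -> rapid f' ->
  (forall u, is_derive u (basis_vec R i) f (f' u)) ->
  y 0 i * full_transform (th + pi / 2) f y = full_transform th f' y.
Proof.
by move=> mf rf mf' rf' df; rewrite -[y 0 i]dotp_basis; exact: phase_by_parts.
Qed.

Lemma rapidly_decreasing_iter f vs : rapidly_decreasing f ->
  rapidly_decreasing (iter_derive vs f).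
Proof.
move=> [sf rf]; have E ws : iter_derive ws (iter_derive vs f) = iter_derive (ws ++ vs) f.
  by rewrite /iter_derive foldr_cat.
split; first by move=> ws x Ux; rewrite E; exact: sf.
by move=> N ws; rewrite E; exact: rf.
Qed.

Lemma rapidly_decreasing_measurable f : rapidly_decreasing f -> measurable_fun setT f.
Proof.
move=> [sf _]; apply: continuous_measurable_rv => x.
by have [] := sf [::] x Logic.I.
Qed.

Lemma rapidly_decreasing_rapid f : rapidly_decreasing f -> rapid f.
Proof. by move=> [_ rf] N; have [M HM] := rf N [::]; exists M. Qed.

Lemma rapidly_decreasing_derive f v x : rapidly_decreasing f ->
  is_derive x v f ('D_v f x).
Proof.
by move=> [sf _]; apply: DeriveDef => //; have [_] := sf [::] x Logic.I; apply.
Qed.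

End FullTransform.

(** * Decay of the fibrewise transforms of Schwartz functions *)

Section BundleDecay.
Context {R : realType} {m : nat}.
Local Notation E := 'rV[R]_m.+2.
Implicit Types (a : E * E -> R).

Let D : set (E * E) := [set p | p.2 != 0].

Lemma open_slit : open D.
Proof.
rewrite (_ : D = snd @^-1` ~` [set 0]).
  apply: open_comp => [p _|]; first exact: cvg_snd.
    apply: closed_openC; apply: accessible_closed_set1; apply: hausdorff_accessible.
    exact: norm_hausdorff.
by apply/seteqP; split => p /=; move/eqP.
Qed.

Lemma retract_idem (p : E * E) : p.2 != 0 -> retract (retract p) = retract p.
Proof. by move=> p0; rewrite retract_bundle//; exact: bundle_retract. Qed.

Lemma retract_snd_neq0 (p : E * E) : p.2 != 0 -> (retract p).2 != 0.
Proof. by case/bundle_retract=> p1 _; rewrite -enorm_eq0 p1 oner_eq0. Qed.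

Lemma bundle_measurable_on a : measurable_fun D a -> bundle_measurable a.
Proof.
move=> ma.
have mD : measurable D by exact: open_measurable_rv2 open_slit.
have mr : measurable_fun setT (fun p : E * E => retract p).
  rewrite /retract; apply: measurable_fun_pair; last by measurability.
  have mq : measurable_fun setT (fun q : E * E => q.1) by measurability.
  by measurability.
rewrite /bundle_measurable (_ : bundle_ext a = (a \o @retract R m.+2) \_ D).
  apply/(measurable_restrict _ mD measurableT); rewrite setTI.
  apply: (measurable_comp mD _ ma); last exact: measurable_funTS.
  by move=> _ [p Dp <-]; exact: retract_snd_neq0.
apply/funext => p; rewrite /bundle_ext patchE.
case: ifPn => [/set_mem/= ->|nD]; first by rewrite mul1r.
have -> : (p.2 != 0) = false by apply/negbTE; apply: contra nD => p0; exact: mem_set.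
by rewrite mul0r.
Qed.

Lemma bundle_measurable_retract a : bundle_measurable (a \o @retract R m.+2) ->
  bundle_measurable a.
Proof.
rewrite /bundle_measurable (_ : bundle_ext (a \o _) = bundle_ext a)//.
apply/funext => -[x z]; rewrite /bundle_ext /=.
have [->|z0] := eqVneq z 0; first by rewrite !mul0r.
by rewrite (@retract_idem (x, z)).
Qed.

Lemma retract_fiber (p : E * E) c : retract (p.1 + c *: p.2, p.2) = retract p.
Proof.
have [p0|p0] := eqVneq p.2 0; first by rewrite p0 scaler0 addr0 -p0; case: p {p0}.
rewrite /retract/= dotpDl dotpZl mulrDl mulfK ?dotp_eq0// scalerDl.
by rewrite opprD addrACA subrr addr0.
Qed.

(** The retraction forgets the component of x along xi, hence so do all derivatives in x of the
    extended function. A derivative along any vector of R^n may then be replaced by one along its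
    projection on the hyperplane. *)
Lemma iter_derive_fiber a (vs : seq E) (p : E * E) c :
  iter_derive [seq (v, 0) | v <- vs] (a \o @retract R m.+2) (p.1 + c *: p.2, p.2) =
  iter_derive [seq (v, 0) | v <- vs] (a \o @retract R m.+2) p.
Proof.
elim: vs p => [|v vs IH] p; first by rewrite /= retract_fiber.
set G := iter_derive _ _ in IH; rewrite [LHS]/= [RHS]/= -/G.
suff E : (fun h : R => h^-1 *: ((G \o shift (p.1 + c *: p.2, p.2)) (h *: (v, 0)) -
      G (p.1 + c *: p.2, p.2))) =
    (fun h : R => h^-1 *: ((G \o shift p) (h *: (v, 0)) - G p)) by rewrite /derive E.
apply/funext => h; rewrite IH; congr (_ *: (_ - _)) => /=.
rewrite -[in RHS](IH (h *: (v, 0) + p)) /=; congr (G (_, _)).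
  by rewrite scaler0 add0r addrA.
Qed.

Lemma bundle_measurable_smooth a : smooth_on D (a \o @retract R m.+2) ->
  forall vs, bundle_measurable (iter_derive vs (a \o @retract R m.+2)).
Proof.
move=> sa vs; apply: bundle_measurable_on.
apply: continuous_on_measurable_rv2 => [|p Dp]; first exact: open_slit.
by have [] := sa vs p Dp.
Qed.

Lemma bundle_rapidly_decreasing_fast a vs : bundle_rapidly_decreasing a ->
  fast (iter_derive vs (a \o @retract R m.+2)).
Proof. by case=> _ fa N; have [M HM] := fa N vs; exists M. Qed.

Lemma fast_slice a (xi : E) : enorm xi = 1 -> fast a ->
  rapid (fun u => a (hplane xi u, xi)).
Proof.
move=> xi1 fa N; have [M HM] := fa N; exists M => u.
by have := HM _ (bundle_hplane u xi1); rewrite /= enorm_hplane.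
Qed.

(** Repeated integration by parts within the fibre. The vector e_i is not tangent to the fibre, but
    its projection e_i - xi_i xi is: along it the extended function has the same derivative, and its
    product with y is still y_i because <y,xi> = 0. *)
Lemma phase_transform_power a i k th (p : E * E) :
  bundle_rapidly_decreasing a -> bundle p ->
  p.1 0 i ^+ k * phase_transform (th + k%:R * (pi / 2)) a p =
  phase_transform th
    (iter_derive [seq (v, 0) | v <- nseq k (basis_vec R i)] (a \o @retract R m.+2)) p.
Proof.
move=> ra [xi1 y0]; case: p => y xi /= in xi1 y0 *.
pose F k := iter_derive [seq (v, 0) | v <- nseq k (basis_vec R i)] (a \o @retract R m.+2).
have mF l : measurable_fun setT (fun u => F l (hplane xi u, xi)).
  by apply: measurable_slice1 => //; apply: bundle_measurable_smooth; case: ra.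
have rF l : rapid (fun u => F l (hplane xi u, xi)).
  by apply: fast_slice => //; exact: bundle_rapidly_decreasing_fast.
pose B := hyperplane_frame xi.
have yE u : dotp y (hplane xi u) = dotp (y *m B^T) u.
  by rewrite dotpC [RHS]dotpC; exact: dotp_mulmxl.
have bE : hplane xi (basis_vec R i *m B^T) = basis_vec R i - xi 0 i *: xi.
  have [|u Eu] := @hplane_surj0 _ _ xi (basis_vec R i - xi 0 i *: xi) xi1.
    by rewrite dotpBl dotpZl enorm1_dotp// dotpC dotp_basis mulr1 subrr.
  have -> : basis_vec R i = hplane xi u + xi 0 i *: xi by rewrite -Eu subrK.
  have [BB Bx] := hyperplane_frameP xi1.
  rewrite addrK mulmxDl /hplane -scalemxAl.
  have -> : xi *m B^T = 0 by rewrite -[xi]trmxK -trmx_mul Bx trmx0.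
  by rewrite scaler0 addr0 -[u *m _ *m B^T]mulmxA BB mulmx1.
have cE : dotp (y *m B^T) (basis_vec R i *m B^T) = y 0 i.
  by rewrite -yE bE dotpBr dotpZr y0 mulr0 subr0 dotp_basis.
have dF l u : is_derive u (basis_vec R i *m B^T) (fun u => F l (hplane xi u, xi))
    (F l.+1 (hplane xi u, xi)).
  apply/is_derive_line0.
  rewrite (_ : (fun s : R => _) = fun s : R => F l ((hplane xi u, xi) + s *: (basis_vec R i, 0))).
    apply/is_derive_line0; have [sa _] := ra.
    have xi0 : D (hplane xi u, xi) by rewrite /D/= -enorm_eq0 xi1 oner_eq0.
    have [_ da] := sa [seq (v, 0) | v <- nseq l (basis_vec R i)] _ xi0.
    exact: DeriveDef (da _) erefl.
  apply/funext => s; rewrite hplaneD hplaneZ bE.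
  rewrite /F -[RHS](iter_derive_fiber _ _ _ (- (s * xi 0 i))) /=.
  congr (iter_derive _ _ (_, _)); last by rewrite scaler0 addr0.
  by rewrite scaler0 addr0 scalerBr scalerA scaleNr addrA.
have main t l : y 0 i * phase_transform (t + pi / 2) (F l) (y, xi) =
    phase_transform t (F l.+1) (y, xi).
  rewrite /phase_transform /= -cE.
  under eq_Rintegral do rewrite yE.
  under [RHS]eq_Rintegral do rewrite yE.
  exact: phase_by_parts.
have -> : phase_transform (th + k%:R * (pi / 2)) a (y, xi) =
    phase_transform (th + k%:R * (pi / 2)) (F 0%N) (y, xi).
  apply: phase_transform_ext => // q bq.
  by rewrite /F /= retract_bundle.
elim: k th => [|k IH] th; first by rewrite expr0 mul1r mul0r addr0.
rewrite exprS -mulrA.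
have -> : th + k.+1%:R * (pi / 2) = (th + pi / 2) + k%:R * (pi / 2).
  by rewrite -natr1; ring.
by rewrite IH main.
Qed.

Lemma bundle_rapidly_decreasing_integrable a vs : bundle_rapidly_decreasing a ->
  bundle_integrable (iter_derive vs (a \o @retract R m.+2)).
Proof.
move=> ra; apply: fast_integrable; last exact: bundle_rapidly_decreasing_fast.
by apply: bundle_measurable_smooth; case: ra.
Qed.

Lemma fast_phase_transform a th : bundle_rapidly_decreasing a ->
  fast (phase_transform th a).
Proof.
move=> ra N; have [C [C0 HC]] := @pow_enorm_le R m.+2 N.
have bd vs : exists M, forall t p, bundle p ->
    `|phase_transform t (iter_derive vs (a \o @retract R m.+2)) p| <= M.
  have iv := bundle_rapidly_decreasing_integrable vs ra.
  have [_ [M HM]] := iv; exists M => t p bp.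
  by apply: normr_phase_transform_le => //; apply: HM; case: bp.
have /choice[M HM] : forall i : 'I_m.+2, exists M, forall t p, bundle p ->
    `|p.1 0 i| ^+ N * `|phase_transform t a p| <= M.
  move=> i; have [M HM] := bd [seq (v, 0) | v <- nseq N (basis_vec R i)].
  exists M => t p bp; rewrite -normrX -normrM.
  (* The bound holds for every phase, so the N quarter turns can be subtracted beforehand. *)
  have -> : t = (t - N%:R * (pi / 2)) + N%:R * (pi / 2) by rewrite subrK.
  by rewrite phase_transform_power// HM.
have [M0 HM0] := bd [::].
exists (C * (M0 + \sum_i M i)) => p bp.
apply: (@le_trans _ _ (C * (1 + \sum_i `|p.1 0 i| ^+ N) * `|phase_transform th a p|)).
  by rewrite ler_wpM2r.
rewrite -mulrA ler_wpM2l// mulrDl mul1r mulr_suml; apply: lerD.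
  rewrite (_ : phase_transform th a p = phase_transform th (iter_derive [::] (a \o @retract R m.+2)) p).
    exact: HM0.
  by apply: phase_transform_ext => // q bq; rewrite /= retract_bundle.
by apply: ler_sum => i _; exact: HM.
Qed.

End BundleDecay.

Lemma derive_line_eq {R : realType} {V W : normedModType R} (f : V -> R) (g : W -> R)
    x v y w : (forall s : R, f (x + s *: v) = g (y + s *: w)) ->
  'D_v f x = 'D_w g y.
Proof.
move=> fg; rewrite -[x]addr0 -[y]addr0 -(scale0r v) -(scale0r w) -!derive_line.
by congr ('D_(1 : R) _ _); apply/funext.
Qed.

Lemma pair_linE {R : realType} {V W : normedModType R} (c : R) (x x' : V) (y y' : W) :
  c *: (x, y) + (x', y') = (c *: x + x', c *: y + y').
Proof. by []. Qed.

Lemma pair_scaleE {R : realType} {V W : normedModType R} (c : R) (x : V) (y : W) :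
  c *: (x, y) = (c *: x, c *: y).
Proof. by []. Qed.

Lemma pair_lineE {R : realType} {V W : normedModType R} (c : R) (x x' : V) (y y' : W) :
  (x, y) + c *: (x', y') = (x + c *: x', y + c *: y').
Proof. by []. Qed.

(** * First order calculus on the bundle *)

Section BundleC1.
Context {R : realType} {m : nat}.
Local Notation E := 'rV[R]_m.+2.
Implicit Types (a b : E * E -> R) (p q : E * E).

(** The first order regularity under which a fibre integral can be differentiated in xi. Schwartz
    functions have it, and so has I^0 f, for which the derivatives are explicit; it passes to
    differences. *)
Definition bundle_C1 a :=
  [/\ forall (p v : E * E), p.2 != 0 -> derivable (a \o @retract R m.+2) p v,
    forall (p v w : E * E) (c : R), p.2 != 0 ->
      'D_(c *: v + w) (a \o @retract R m.+2) p =
      c * 'D_v (a \o @retract R m.+2) p + 'D_w (a \o @retract R m.+2) p,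
    bundle_measurable a /\ fast a &
    forall v : E * E, bundle_measurable ('D_v (a \o @retract R m.+2)) /\
      fast ('D_v (a \o @retract R m.+2))].

Lemma bundle_rapidly_decreasing_C1 a : bundle_rapidly_decreasing a -> bundle_C1 a.
Proof.
move=> ra; have [sa fa] := ra.
have da p v : p.2 != 0 -> derivable (a \o @retract R m.+2) p v.
  by move=> p0; have [_ ] := sa [::] p p0; apply.
split => // [p v w c p0||v].
- have dp u : derivable (a \o @retract R m.+2) p u by exact: da.
  have D : is_derive p (c *: v + w) (a \o @retract R m.+2)
      ('D_(c *: v) (a \o @retract R m.+2) p + 'D_w (a \o @retract R m.+2) p).
    apply: (@is_derive_dirD _ _ _ [set q | q.2 != 0]) => //.
    - exact: open_slit.
    - by move=> z z0; exact: da.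
    - by move=> z z0; exact: da.
    - by have [] := sa [:: w] p p0.
  rewrite (@derive_val _ _ _ _ _ _ _ D); congr (_ + _).
  exact: (@derive_val _ _ _ _ _ _ _ (is_derive_dirZ c (dp v))).
- split; last first.
    apply: (fast_ext _ (bundle_rapidly_decreasing_fast [::] ra)) => q bq.
    by rewrite /= retract_bundle //.
  exact: bundle_measurable_retract (bundle_measurable_smooth sa [::]).
- split; first exact: (bundle_measurable_smooth sa [:: v]).
  exact: (bundle_rapidly_decreasing_fast [:: v] ra).
Qed.

Lemma bundle_C1_sub a b : bundle_C1 a -> bundle_C1 b -> bundle_C1 (fun p => a p - b p).
Proof.
move=> [da la [ma fa] Da] [db lb [mb fb] Db].
have DE p v : p.2 != 0 -> 'D_v ((fun p => a p - b p) \o @retract R m.+2) p =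
    'D_v (a \o @retract R m.+2) p - 'D_v (b \o @retract R m.+2) p.
  by move=> p0; rewrite -deriveB//; [exact: da|exact: db].
have fN (g : E * E -> R) : fast g -> fast (fun p => - g p).
  by move=> fg; apply: (fast_ext _ (fastZ (-1) fg)) => q _; rewrite mulN1r.
have mN (g : E * E -> R) : bundle_measurable g -> bundle_measurable (fun p => - g p).
  move=> mg; have := bundle_measurableM (bundle_measurable_cst (-1)) mg.
  by congr bundle_measurable; apply/funext => q; rewrite mulN1r.
split => [p v p0|p v w c p0||v].
- by apply: (@derivableB _ _ _ (a \o @retract R m.+2) (b \o @retract R m.+2));
    [exact: da|exact: db].
- rewrite !DE// la// lb//.
  move: ('D_v _ p) ('D_v _ p) ('D_w _ p) ('D_w _ p) => x1 x2 x3 x4.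
  by rewrite mulrBr opprD addrACA.
- by split; [exact: bundle_measurableD ma (mN _ mb)|exact: fastD fa (fN _ fb)].
- have [mDa fDa] := Da v; have [mDb fDb] := Db v; split; last first.
    apply: (fast_ext _ (fastD fDa (fN _ fDb))) => q [q1 _].
    by rewrite DE// -enorm_eq0 q1 oner_eq0.
  have := bundle_measurableD mDa (mN _ mDb); rewrite /bundle_measurable.
  congr (measurable_fun setT _); apply/funext => -[x z]; rewrite /bundle_ext/=.
  have [->|z0] := eqVneq z 0; first by rewrite !mul0r.
  by rewrite DE//; exact: retract_snd_neq0.
Qed.

Lemma retract_scale (c : R) (x z : E) : 0 < c -> retract (x, c *: z) = retract (x, z).
Proof.
move=> c0; have [->|z0] := eqVneq z 0; first by rewrite scaler0.
rewrite !retractE// ?scaler_eq0 ?negb_or ?gt_eqF//.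
suff -> : normalize (c *: z) = normalize z by [].
rewrite /normalize enormZ gtr0_norm// scalerA invfM mulrAC mulVf ?mul1r//.
by rewrite gt_eqF.
Qed.

Variable a : E * E -> R.
Hypothesis Ca : bundle_C1 a.
Let A := a \o @retract R m.+2.

Let AF x z c : A (x + c *: z, z) = A (x, z).
Proof. by rewrite /A /= (@retract_fiber _ _ (x, z)). Qed.

Let D0 (z : E * E) : z.2 != 0 -> 'D_(0 : E * E) A z = 0.
Proof.
have [_ la _ _] := Ca => z0; have := la z 0 0 1 z0.
by rewrite scaler0 addr0 mul1r -[X in X = _]addr0 => /addrI.
Qed.

Lemma bundle_C1_sum (p : E * E) (v : E) : p.2 != 0 ->
  'D_(0, v) A p = \sum_j v 0 j * 'D_(0, basis_vec R j) A p.
Proof.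
have [_ la _ _] := Ca => p0.
rewrite {1}(row_sum_delta v).
have : forall s : seq 'I_m.+2, 'D_(0 : E, \sum_(j <- s) v 0 j *: basis_vec R j) A p =
    \sum_(j <- s) v 0 j * 'D_(0, basis_vec R j) A p.
  elim=> [|j s IH]; first by rewrite !big_nil; exact: D0.
  rewrite !big_cons -IH -[RHS](la _ (0, basis_vec R j)%R (0, \sum_(j <- s) v 0 j *: basis_vec R j)%R).
    by rewrite pair_linE scaler0 addr0.
  exact: p0.
exact.
Qed.

Lemma bundle_C1_sum1 (p : E * E) (v : E) : p.2 != 0 ->
  'D_(v, 0) A p = \sum_j v 0 j * 'D_(basis_vec R j, 0) A p.
Proof.
have [_ la _ _] := Ca => p0.
rewrite {1}(row_sum_delta v).
have : forall s : seq 'I_m.+2, 'D_(\sum_(j <- s) v 0 j *: basis_vec R j, 0 : E) A p =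
    \sum_(j <- s) v 0 j * 'D_(basis_vec R j, 0) A p.
  elim=> [|j s IH]; first by rewrite !big_nil; exact: D0.
  rewrite !big_cons -IH -[RHS](la _ (basis_vec R j, 0)%R (\sum_(j <- s) v 0 j *: basis_vec R j, 0)%R).
    by rewrite pair_linE scaler0 addr0.
  exact: p0.
exact.
Qed.

Lemma derive_fiber0 (p : E * E) : 'D_(p.2, 0) A p = 0.
Proof.
case: p => x z; rewrite -[RHS](derive_cst (A (x, z)) (0 : R) (1 : R)).
apply: derive_line_eq => s.
by rewrite pair_lineE scaler0 addr0 AF.
Qed.

(** The extension by [retract] is homogeneous of degree 0 in xi, hence constant along (1 + s) xi for
    |s| < 1. *)
Lemma derive_radial0 (p : E * E) : p.2 != 0 -> 'D_(0, p.2) A p = 0.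
Proof.
case: p => x z /= z0.
have -> : 'D_(0, z) A (x, z) = 'D_(1 : R) (fun s : R => A (x, z + s *: z)) 0.
  apply: derive_line_eq => s.
  by rewrite pair_lineE scaler0 addr0 add0r [s *: 1]mulr1.
rewrite -[RHS](derive_cst (A (x, z)) (0 : R) (1 : R)); apply: near_eq_derive.
exists 1 => //= s; rewrite /ball_ /= sub0r normrN ltr_norml => /andP[s1 _].
have -> : z + s *: z = (1 + s) *: z by rewrite scalerDl scale1r.
by rewrite /A/= retract_scale//; lra.
Qed.

(** Up to a translation along the fibre direction and a dilation, neither of which changes A, the
    line (x, z + s w) is a line through the retracted point with direction (-b w, w/|z|).
    Derivatives at arbitrary points are thereby controlled by derivatives on the bundle, where decay
    is known. *)
Lemma derive_retract (p : E * E) (w : E) : p.2 != 0 ->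
  'D_(0, w) A p = - (dotp p.1 p.2 / dotp p.2 p.2) * 'D_(w, 0) A (retract p) +
    (enorm p.2)^-1 * 'D_(0, w) A (retract p).
Proof.
case: p => x z /= z0; have [_ la _ _] := Ca.
have r0 := @retract_snd_neq0 _ _ (x, z) z0.
set b := dotp x z / dotp z z; set c := enorm z.
have c0 : 0 < c by rewrite enorm_gt0.
have AS x' z' : A (x', c *: z') = A (x', z') by rewrite /A/= retract_scale.
transitivity ('D_(- b *: w, c^-1 *: w) A (retract (x, z))).
  apply: derive_line_eq => s; rewrite !pair_lineE scaler0 addr0 -/b -/c /=.
  rewrite -(AF x (z + s *: w) (- b)) -[RHS]AS; congr (A (_, _)).
    by rewrite scalerDr scalerA [- b * s]mulrC -scalerA scaleNr addrA.
  rewrite scalerDr !scalerA divff ?gt_eqF// scale1r; congr (_ + _ *: _).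
  by field; rewrite gt_eqF.
transitivity ('D_(- b *: (w, 0) + (c^-1 *: (0, w) + 0)) A (retract (x, z))).
  by rewrite addr0 pair_scaleE pair_linE !scaler0 add0r addr0.
apply: (eq_trans (la _ (w, 0) (c^-1 *: (0, w) + 0) _ r0)); apply: f_equal.
apply: (eq_trans (la _ (0, w) 0 _ r0)).
by apply: (eq_trans (f_equal _ (D0 r0))); exact: addr0.
Qed.

Definition real_Xi i (p : E * E) : R :=
  'D_(0, basis_vec R i) A p
  - p.1 0 i * \sum_j p.2 0 j * 'D_(basis_vec R j, 0) A p
  - p.2 0 i * \sum_j p.2 0 j * 'D_(0, basis_vec R j) A p.

(** The two correction terms of the field differentiate along (xi, 0) and (0, xi), directions in
    which the extension by [retract] is constant. *)
Lemma real_Xi_bundle i (p : E * E) : p.2 != 0 ->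
  real_Xi i p = 'D_(0, basis_vec R i) A p.
Proof.
move=> p0; rewrite /real_Xi.
rewrite -[RHS]subr0 -[X in _ = X - 0]subr0; congr (_ - _ - _).
  rewrite -[RHS](mulr0 (p.1 0 i)); congr (_ * _).
  by apply: eq_trans (derive_fiber0 p); apply: esym; exact: bundle_C1_sum1.
rewrite -[RHS](mulr0 (p.2 0 i)); congr (_ * _).
by apply: eq_trans (derive_radial0 p0); apply: esym; exact: bundle_C1_sum.
Qed.
End BundleC1.

Section PhaseSum.
Context {R : realType} {m : nat}.
Local Notation E := 'rV[R]_m.+2.
Implicit Types (a b : E * E -> R) (p q : E * E).

Lemma bundle_integrable_sum I (s : seq I) (F : I -> E * E -> R) :
  (forall i, bundle_integrable (F i)) ->
  bundle_integrable (fun q => \sum_(i <- s) F i q).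
Proof.
move=> iF; elim: s => [|i s IH].
  have -> : (fun q => \sum_(i <- [::]) F i q) = fun=> 0 by apply/funext => q; rewrite big_nil.
  split; first exact: bundle_measurable_cst.
  by exists 0 => xi _; rewrite integral0_eq// => u _; rewrite normr0.
have -> : (fun q => \sum_(i <- i :: s) F i q) = fun q => F i q + \sum_(i <- s) F i q.
  by apply/funext => q; rewrite big_cons.
exact: bundle_integrableD.
Qed.

Lemma phase_transform_sum th I (s : seq I) (F : I -> E * E -> R) p :
  (forall i, bundle_integrable (F i)) -> bundle p ->
  phase_transform th (fun q => \sum_(i <- s) F i q) p =
  \sum_(i <- s) phase_transform th (F i) p.
Proof.
move=> iF bp; elim: s => [|i s IH].
  rewrite big_nil /phase_transform /Rintegral integral0_eq// => u _.
  by rewrite big_nil mulr0.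
rewrite big_cons -IH -phase_transformD//; last exact: bundle_integrable_sum.
by apply: phase_transform_ext => // q _; rewrite big_cons.
Qed.

Lemma phase_transform_coord2 th a i p : bundle_integrable a -> bundle p ->
  phase_transform th (fun q => q.2 0 i * a q) p = p.2 0 i * phase_transform th a p.
Proof.
move=> ia bp; rewrite -phase_transformZ//; apply: eq_Rintegral => u _.
Qed.

Lemma fast_dotp (v : E) a : fast a -> fast (fun q => dotp v q.1 * a q).
Proof.
apply: (@fast_dominated _ _ (enorm v) 1) => q _.
rewrite expr1 normrM ler_wpM2r// (le_trans (normr_dotp_le _ _))//.
by rewrite ler_wpM2l ?enorm_ge0// lerDr.
Qed.

Lemma bundle_measurable_dotp (v : E) a : bundle_measurable a ->
  bundle_measurable (fun q => dotp v q.1 * a q).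
Proof.
move=> ma; apply: bundle_measurableM => //; apply: bundle_measurable_fun.
by apply: measurable_dotp; measurability.
Qed.

Lemma phase_transform_retract th a (y z : E) : z != 0 ->
  phase_transform th a (retract (y, z)) =
  \int[leb R m.+1]_u (cos (dotp y (hplane (normalize z) u) - th) *
    a (hplane (normalize z) u, normalize z)).
Proof.
move=> z0; rewrite retractE//; apply: eq_Rintegral => u _ /=.
by rewrite dotpBl dotpZl [dotp (normalize z) _]dotpC hplane_orth ?enorm_normalize// mulr0 subr0.
Qed.

Lemma is_derive_phase_base th a v p : bundle_measurable a -> fast a -> bundle p ->
  is_derive p (v, 0) (phase_transform th a \o @retract R m.+2)
    (phase_transform (th - pi / 2) (fun q => dotp v q.1 * a q) p).
Proof.
case: p => y xi ma fa [/= xi1 y0].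
have xi0 : xi != 0 by rewrite -enorm_eq0 xi1 oner_eq0.
have xiE : normalize xi = xi by rewrite /normalize xi1 invr1 scale1r.
have ib : bundle_integrable (fun q => dotp v q.1 * a q).
  by apply: fast_integrable; [exact: bundle_measurable_dotp|exact: fast_dotp].
have ia : bundle_integrable a by exact: fast_integrable.
pose f (s : R) u := cos (dotp (y + s *: v) (hplane xi u) - th) * a (hplane xi u, xi).
pose f' (s : R) u := - sin (dotp (y + s *: v) (hplane xi u) - th) *
  (dotp v (hplane xi u) * a (hplane xi u, xi)).
have -> : phase_transform (th - pi / 2) (fun q => dotp v q.1 * a q) (y, xi) =
    \int[leb R m.+1]_u f' 0 u.
  apply: eq_Rintegral => u _; rewrite /f' scale0r addr0 /=; congr (_ * _).
  (* Differentiating the cosine advances its argument by a quarter turn, which lowers the phase. *)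
  have -> : forall t : R, t - (th - pi / 2) = (t - th) + pi / 2 by move=> t; ring.
  by rewrite cosDpihalf.
apply/is_derive_line0.
rewrite (_ : (fun s : R => _) = fun s : R => \int[leb R m.+1]_u f s u); last first.
  apply/funext => s; rewrite pair_lineE scaler0 addr0 /=.
  by rewrite phase_transform_retract// xiE.
apply: (@is_derive_Rintegral _ _ _ _ f f' (fun u => `|dotp v (hplane xi u) * a (hplane xi u, xi)|) 1) => //.
- by move=> s _; exact: (phase_integrable th (y + s *: v) ia xi1).
- move=> s u _; rewrite /f /f'.
  have dq : is_derive s 1 (fun s : R => dotp (y + s *: v) (hplane xi u) - th)
      (dotp v (hplane xi u)).
    rewrite (_ : (fun s : R => _) = (fun s => (dotp y (hplane xi u) - th) + dotp v (hplane xi u) * s)); last first.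
      by apply/funext => t; rewrite dotpDl dotpZl; ring.
    by apply: is_derive_eq; rewrite add0r mul1r [LHS]mulr1.
  have dc := @is_derive1_comp _ cos (fun s : R => dotp (y + s *: v) (hplane xi u) - th) s _ _
    (is_derive_cos _) dq.
  have dk := is_derive_cst (a (hplane xi u, xi)) s (1 : R).
  apply: (is_derive_eq (is_deriveM dc dk)).
  by rewrite scaler0 add0r mulrA [LHS]mulrC.
- exact: (integrable_norm (bundle_integrable_slice ib xi1)).
- move=> s u _; rewrite /f' normrM ler_piMl// normrN.
  by rewrite ler_norml sin_geN1 sin_le1.
Qed.

(** For the transform, linearity of the derivative in its direction is not at hand, so the
    coordinate derivatives are added one by one: the result is the transform of <xi,x> a, and <xi,x>
    = 0 on the fibre. *)
Lemma phase_fiber_sum0 th a p : bundle_measurable a -> fast a -> bundle p ->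
  \sum_j p.2 0 j * 'D_(basis_vec R j, 0) (phase_transform th a \o @retract R m.+2) p = 0.
Proof.
move=> ma fa bp.
have ib j : bundle_integrable (fun q : E * E => dotp (basis_vec R j) q.1 * a q).
  by apply: fast_integrable; [exact: bundle_measurable_dotp|exact: fast_dotp].
have ic j : bundle_integrable (fun q : E * E => q.2 0 j * (dotp (basis_vec R j) q.1 * a q)).
  apply: bundle_integrable_dominated (bundle_integrable_abs (ib j)) => [|q bq].
    apply: bundle_measurableM; last by have [] := ib j.
    by apply: bundle_measurable_fun; measurability.
  by rewrite normrM ler_piMl// bundle_coord2_le1.
transitivity (\sum_j phase_transform (th - pi / 2)
    (fun q : E * E => q.2 0 j * (dotp (basis_vec R j) q.1 * a q)) p).
  apply: eq_bigr => j _; rewrite phase_transform_coord2//; congr (_ * _).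
  exact: (@derive_val _ _ _ _ _ _ _ (is_derive_phase_base th (basis_vec R j) ma fa bp)).
rewrite -phase_transform_sum//.
rewrite -[RHS](mul0r (phase_transform (th - pi / 2) a p)) -phase_transformZ//; last first.
  exact: fast_integrable.
apply: phase_transform_ext => // q [_ q0]; rewrite mul0r.
rewrite -[RHS](mul0r (a q)) -[in RHS]q0 /dotp mulr_suml; apply: eq_bigr => j _.
by rewrite -/(dotp _ _) dotpC dotp_basis; ring.
Qed.

End PhaseSum.

(** * Gaussian smearing of hyperplane integrals *)

Section GaussSmear.
Context {R : realType} {m : nat}.
Local Notation E := 'rV[R]_m.+1.
Local Notation mu := (@lebesgue_measure R).

(** To be evaluated at squares: the integral of gauss(a^2) over the line is 1. *)
Definition gauss (t : R) : R := expR (- t) / Num.sqrt pi.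

Lemma gauss_ge0 t : 0 <= gauss t.
Proof. by rewrite divr_ge0 ?expR_ge0 ?sqrtr_ge0. Qed.

Lemma measurable_gauss d (T : measurableType d) (f : T -> R) :
  measurable_fun setT f -> measurable_fun setT (fun x => gauss (f x)).
Proof. by move=> mf; rewrite /gauss; measurability. Qed.

Lemma integral_gauss1 : (\int[mu]_a (gauss (a * a))%:E)%E = 1%E.
Proof.
have s0 : 0 < Num.sqrt pi :> R by rewrite sqrtr_gt0 pi_gt0.
transitivity ((Num.sqrt pi)^-1%:E * \int[mu]_a (expR (- (a * a)))%:E)%E.
  rewrite -ge0_integralZl_EFin//.
  - by apply: eq_integral => a _; rewrite -EFinM [in RHS]mulrC.
  - by measurability.
by rewrite integralT_gauss -EFinM mulVf// gt_eqF.
Qed.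

(** From e^(t^2) = (e^(t^2/N))^N >= (1 + t^2/N)^N and 1 + |t| <= 2 (1 + t^2) <= 2 (N+1) (1 + t^2/N),
    which gives the constant K. *)
Lemma gauss_decay N : exists2 C : R, 0 <= C & forall t : R, (1 + `|t|) ^+ N * gauss (t ^+ 2) <= C.
Proof.
have s0 : 0 < Num.sqrt pi :> R by rewrite sqrtr_gt0 pi_gt0.
pose K : R := (2 * N.+1%:R) ^+ N.
have K0 : 0 <= K by rewrite exprn_ge0// mulr_ge0.
exists (K / Num.sqrt pi) => [|t]; first by rewrite divr_ge0// ltW.
rewrite /gauss mulrA ler_pM2r ?invr_gt0// expRN ler_pdivrMr ?expR_gt0//.
have t2 : 0 <= t ^+ 2 by exact: sqr_ge0.
have [N0|N0] := eqVneq N 0%N.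
  by rewrite /K N0 !expr0 mul1r (le_trans _ (expR_ge1Dx _))// lerDl.
have NR : 0 < N%:R :> R by rewrite ltr0n lt0n.
have e1 : 1 + t ^+ 2 / N%:R <= expR (t ^+ 2 / N%:R) by exact: expR_ge1Dx.
have -> : expR (t ^+ 2) = expR (t ^+ 2 / N%:R) ^+ N.
  by rewrite -expRM_natl; congr expR; field; rewrite gt_eqF.
have q0 : 0 <= t ^+ 2 / N%:R by rewrite divr_ge0// ltW.
rewrite /K -exprMn lerXn2r ?nnegrE ?addr_ge0 ?mulr_ge0 ?expR_ge0//.
apply: (@le_trans _ _ (2 * N.+1%:R * (1 + t ^+ 2 / N%:R))); last first.
  by rewrite ler_pM2l// mulr_gt0.
apply: (@le_trans _ _ (2 * (1 + t ^+ 2))).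
  have : 0 <= (`|t| - 1) ^+ 2 by exact: sqr_ge0.
  by rewrite -(real_normK (num_real t)) !expr2; nra.
rewrite -mulrA ler_pM2l// mulrDr mulr1 lerD ?ler1n//.
rewrite mulrCA ler_peMr// ler_pdivlMr// mul1r ler_nat//.
Qed.

Local Open Scope ereal_scope.

(** Same principle as the smearing over an interval, with a smooth profile: the integrand has now to
    be differentiated in xi, which an indicator would forbid. *)
Lemma ge0_integral_gauss_smear (xi : E) (k : E -> \bar R) : enorm xi = 1%R ->
  measurable_fun setT k -> (forall x, 0 <= k x) ->
  \int[leb R m.+1]_x (k (x - dotp x xi *: xi)%R *
    (gauss (dotp x xi * dotp x xi))%:E) =
  \int[leb R m]_u k (hplane xi u).
Proof.
move=> xi1 mk k0.
have mk' : measurable_fun setT (fun x : E => k (x - dotp x xi *: xi)%R).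
  by apply: (measurableT_comp mk); measurability.
have mg d (T : measurableType d) (f : T -> R) : measurable_fun setT f ->
    measurable_fun setT (fun x => (gauss (f x))%:E).
  by move=> mf; apply/measurable_EFinP; exact: measurable_gauss.
rewrite (ge0_integral_frame xi1); last 2 first.
- apply: emeasurable_funM => //; apply: mg; by measurability.
- by move=> x; rewrite mule_ge0// lee_fin gauss_ge0.
have mh : measurable_fun setT (fun u : 'rV[R]_m => k (hplane xi u)).
  by apply: (measurableT_comp mk); apply: measurable_hplane; measurability.
have h0 : 0 <= \int[leb R m]_u k (hplane xi u) by apply: integral_ge0.
transitivity (\int[mu]_a ((\int[leb R m]_u k (hplane xi u)) * (gauss (a * a))%:E)).
  apply: eq_integral => a _.
  have ga : 0 <= (gauss (a * a))%:E by rewrite lee_fin gauss_ge0.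
  rewrite -(ge0_integralZr (leb R m) measurableT mh (fun u _ => k0 _) ga).
  apply: eq_integral => u _.
  rewrite !dotpDl !dotpZl hplane_orth// enorm1_dotp// add0r mulr1.
  by rewrite addrK.
rewrite ge0_integralZl//.
- by rewrite integral_gauss1 mule1.
- by apply: mg; measurability.
- by move=> a _; rewrite lee_fin gauss_ge0.
Qed.
Local Close Scope ereal_scope.

Lemma Rintegral_gauss_smear (xi : E) (K : E -> R) : enorm xi = 1 ->
  measurable_fun setT K ->
  \int[leb R m.+1]_x (K (x - dotp x xi *: xi) * gauss (dotp x xi * dotp x xi)) =
  \int[leb R m]_u K (hplane xi u).
Proof.
move=> xi1 mK; rewrite /Rintegral; congr fine; rewrite integralE [RHS]integralE.
congr (_ - _)%E.
- transitivity (\int[leb R m]_u ((EFin \o K)^\+ (hplane xi u)))%E; last first.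
    by apply: eq_integral => u _; rewrite !funeposE.
  rewrite -(ge0_integral_gauss_smear xi1); last 2 first.
  + by apply: measurable_funepos; exact/measurable_EFinP.
  + by move=> x; exact: funepos_ge0.
  apply: eq_integral => x _; rewrite !funeposE /= -!EFin_max -EFinM.
  by rewrite maxr_pMl ?gauss_ge0// mul0r.
- transitivity (\int[leb R m]_u ((EFin \o K)^\- (hplane xi u)))%E; last first.
    by apply: eq_integral => u _; rewrite !funenegE.
  rewrite -(ge0_integral_gauss_smear xi1); last 2 first.
  + by apply: measurable_funeneg; exact/measurable_EFinP.
  + by move=> x; exact: funeneg_ge0.
  apply: eq_integral => x _; rewrite !funenegE /= -!EFin_max -EFinM -mulNr.
  by rewrite maxr_pMl ?gauss_ge0// mul0r.
Qed.

(** The reflection in the hyperplane of xi is orthogonal and exchanges the positive and negative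
    parts of h. *)
Lemma Rintegral_odd (xi : E) (h : E -> R) : enorm xi = 1 -> measurable_fun setT h ->
  (forall x, h (x - (2 * dotp x xi) *: xi) = - h x) -> \int[leb R m.+1]_x h x = 0.
Proof.
move=> xi1 mh oddh; pose O : 'M[R]_m.+1 := 1%:M - 2 *: (xi^T *m xi).
have xO x : x *m O = x - (2 * dotp x xi) *: xi.
  rewrite mulmxBr mulmx1 -scalemxAr mulmxA [x *m xi^T]mx11_scalar mul_scalar_mx.
  by rewrite -dotpE scalerA.
have OT : O^T = O by rewrite /O linearB/= linearZ/= trmx1 trmx_mul trmxK.
have OO : O *m O^T = 1%:M.
  rewrite OT {1}/O mulmxBl mul1mx -scalemxAl -mulmxA xO enorm1_dotp// mulr1.
  rewrite (_ : xi - 2 *: xi = - xi); last by rewrite scaler_nat mulr2n opprD addNKr.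
  by rewrite mulmxN scalerN opprK subrK.
have E1 : (\int[leb R m.+1]_x ((EFin \o h)^\+ x) = \int[leb R m.+1]_x ((EFin \o h)^\- x))%E.
  rewrite -(ge0_integral_leb_rot OO); last 2 first.
  - by apply: measurable_funepos; exact/measurable_EFinP.
  - by move=> x; exact: funepos_ge0.
  by apply: eq_integral => x _; rewrite funeposE funenegE /= xO oddh.
rewrite /Rintegral integralE E1.
(* If both parts have infinite integral, their difference is infinite and its real value is 0 by
   convention. *)
by case: (\int[_]_x _)%E => [r| |] //=; rewrite subrr.
Qed.

End GaussSmear.

Lemma scale_regularE {R : realType} (x y : R) : x *: y = x * y.
Proof. by []. Qed.

Lemma is_derive_gauss {R : realType} (f : R -> R) (s df : R) :
  is_derive s 1 f df -> is_derive s 1 (fun t => gauss (f t)) (- df * gauss (f s)).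
Proof.
move=> Df; have De := @is_derive1_comp _ expR (fun t => - f t) s _ _
  (is_derive_expR _) (is_deriveN Df).
have Dk := is_derive_cst (Num.sqrt pi)^-1 s (1 : R).
apply: (is_derive_eq (is_deriveM De Dk)).
by rewrite scaler0 add0r /gauss -[LHS]/(_ * _) /=; ring.
Qed.

Lemma is_derive_quot {R : realType} (f g : R -> R) (s df dg : R) : g s != 0 ->
  is_derive s 1 f df -> is_derive s 1 g dg ->
  is_derive s 1 (fun t => f t / g t) (df / g s - f s * dg / g s ^+ 2).
Proof.
move=> g0 Df Dg; have Dv := is_deriveV g0 Dg.
apply: (is_derive_eq (is_deriveM Df Dv)).
rewrite -[_ *: df]/(_ * _) -[_ *: dg]/(_ * _) -[f s *: _]/(_ * _) -exprVn.
by rewrite /=; ring.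
Qed.

Lemma ler_normM {R : numDomainType} (a b c d : R) :
  `|a| <= c -> `|b| <= d -> `|a * b| <= c * d.
Proof. by move=> ac bd; rewrite normrM ler_pM. Qed.

Lemma normr_inv_le {R : realType} (v c : R) : 0 < c -> c^-1 <= v -> `|v^-1| <= c.
Proof.
move=> c0 cv; have c1 : 0 < c^-1 by rewrite invr_gt0.
have v0 : 0 < v by exact: lt_le_trans cv.
have v1 : 0 <= v^-1 by rewrite invr_ge0 ltW.
by rewrite ger0_norm// -[leRHS]invrK lef_pV2.
Qed.

(** Bookkeeping for the domination below: X, Y, W stand for 1 + |x|, 1 + |y|, 1 + |w| and V for the
    decay in x. The derivative costs at most X^2, which is charged to V. *)
Lemma bound_poly {R : realType} (K X Y W M V : R) : 0 <= K -> 1 <= X -> 0 <= W -> 0 <= Y -> 0 <= M * V ->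
  K * (X * Y * W) * (M * V) + ((8 * X + 2) * (M * V) + K * (X ^+ 2 * W) * (M * V)) <=
  M * (K * Y * W + 10 + K * W) * (V * X ^+ 2).
Proof.
move=> K0 X1 W0 Y0 P0; rewrite -!mulrDl.
have -> : M * (K * Y * W + 10 + K * W) * (V * X ^+ 2) =
  (K * (X ^+ 2 * (Y * W)) + (10 * X ^+ 2 + K * (X ^+ 2 * W))) * (M * V) by ring.
rewrite ler_wpM2r//; have X2 : X <= X ^+ 2 by rewrite expr2; nra.
apply: lerD; last by rewrite lerD2r; lra.
by rewrite ler_wpM2l// -mulrA ler_wpM2r// mulr_ge0.
Qed.

Lemma bound_poly1 {R : realType} (K X Y W M V : R) : 0 <= K -> 1 <= X -> 0 <= W -> 0 <= Y -> 0 <= M * V ->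
  M * V <= M * (K * Y * W + 10 + K * W) * (V * X ^+ 2).
Proof.
move=> K0 X1 W0 Y0 P0; apply: le_trans (bound_poly K0 X1 W0 Y0 P0).
have h1 : 0 <= K * (X * Y * W) * (M * V).
  rewrite mulr_ge0// mulr_ge0// mulr_ge0// mulr_ge0//; exact: le_trans ler01 X1.
have h2 : 0 <= K * (X ^+ 2 * W) * (M * V).
  by rewrite mulr_ge0// mulr_ge0// mulr_ge0// sqr_ge0.
have h3 : M * V <= (8 * X + 2) * (M * V) by rewrite ler_peMl//; lra.
by move: h1 h2 h3; move: (_ * (M * V)) => u; lra.
Qed.

(** * Differentiating a fibre integral in the direction xi *)

Section PhaseDirection.
Context {R : realType} {m : nat}.
Local Notation E := 'rV[R]_m.+2.
Implicit Types (a B : E * E -> R).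

(** The part of x tangent to the hyperplane is controlled by the decay of B on the bundle, the part
    t = <x,z>/|z| normal to it by the Gaussian; moreover 1 + |x| is at most the product of 1 +
    |tangent part| and 1 + |t|. *)
Lemma fast_gauss B N : fast B -> exists2 M : R, 0 <= M & forall x z : E, z != 0 ->
  `|B (retract (x, z))| * gauss (dotp x z ^+ 2 / dotp z z) <= M * ((1 + enorm x) ^+ N)^-1.
Proof.
move=> fB; have [M HM] := fB N; have [C C0 HC] := gauss_decay (R := R) N.
exists (`|M| * C) => [|x z z0]; first by rewrite mulr_ge0.
have ez : 0 < enorm z by rewrite enorm_gt0.
pose t := dotp x z / enorm z.
have -> : dotp x z ^+ 2 / dotp z z = t ^+ 2 by rewrite -enorm_sqr expr_div_n.
set p := retract (x, z).
have bp : bundle p by exact: bundle_retract.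
have px : enorm x <= enorm p.1 + `|t|.
  rewrite -{1}(subrK ((dotp x z / dotp z z) *: z) x).
  apply: (le_trans (enormD _ _)); rewrite lerD2l enormZ -enorm_sqr /t !normrM !normfV.
  rewrite !normrX !(gtr0_norm ez) le_eqVlt; apply/orP; left; apply/eqP; field; by rewrite gt_eqF.
have X1 : 1 + enorm x <= (1 + enorm p.1) * (1 + `|t|).
  have := enorm_ge0 p.1; have := normr_ge0 t; nra.
rewrite ler_pdivlMr ?exprn_gt0 ?one_enorm_gt0//.
move: (gauss _) (gauss_ge0 (t ^+ 2)) (HC t) => g g0 HCt.
apply: (@le_trans _ _ (`|B p| * g * ((1 + enorm p.1) * (1 + `|t|)) ^+ N)).
  rewrite ler_wpM2l ?mulr_ge0// lerXn2r ?nnegrE ?mulr_ge0 ?addr_ge0 ?enorm_ge0//.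
rewrite exprMn mulrACA [`|B p| * _]mulrC [g * _]mulrC.
apply: ler_pM => //.
- by rewrite mulr_ge0 ?exprn_ge0 ?addr_ge0 ?enorm_ge0.
- by rewrite mulr_ge0 ?exprn_ge0 ?addr_ge0.
- exact: le_trans (HM _ bp) (ler_norm _).
Qed.

Lemma measurable_retract_slice B (z : E) : z != 0 -> bundle_measurable B ->
  measurable_fun setT (fun x : E => B (retract (x, z))).
Proof.
move=> z0 mB; rewrite (_ : (fun x => _) = fun x => bundle_ext B (x, z)); last first.
  by apply/funext => x; rewrite /bundle_ext/= z0 mul1r.
by apply: (measurableT_comp mB); apply: measurable_fun_pair; measurability.
Qed.

Variable a : E * E -> R.
Hypothesis Ca : bundle_C1 a.
Let A := a \o @retract R m.+2.

Section point.
Variables (th : R) (w y xi : E).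
Hypotheses (xi1 : enorm xi = 1) (yxi : dotp y xi = 0).

(** The smeared integrand along xi + s w. Here q is the product of x with the projection of y on the
    moving hyperplane, [kap] the square of the normal component of x, and primes denote derivatives
    in s. *)
Let z (s : R) := xi + s *: w.
Let bz s := dotp (z s) (z s).
Let q s x := dotp y x - dotp y (z s) * dotp x (z s) / bz s.
Let kap s x := dotp x (z s) ^+ 2 / bz s.
Let q' s x := - ((dotp y w * dotp x (z s) + dotp y (z s) * dotp x w) / bz s -
  dotp y (z s) * dotp x (z s) * (2 * dotp (z s) w) / bz s ^+ 2).
Let kap' s x := 2 * dotp x (z s) * dotp x w / bz s -
  dotp x (z s) ^+ 2 * (2 * dotp (z s) w) / bz s ^+ 2.
Let f s x := cos (q s x - th) * (A (x, z s) * gauss (kap s x)).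
Let f' s x := - sin (q s x - th) * q' s x * (A (x, z s) * gauss (kap s x)) +
  cos (q s x - th) * ('D_(0, w) A (x, z s) * gauss (kap s x) +
    A (x, z s) * (- kap' s x * gauss (kap s x))).
(** For |s| < r one has |s w| <= 1/2, so that z(s) stays between the spheres of radius 1/2 and 2. *)
Let r := (2 * (1 + enorm w))^-1.

Let r0 : 0 < r.
Proof. by rewrite invr_gt0 mulr_gt0// one_enorm_gt0. Qed.

Let z_bounds (s : R) : `|s| < r -> 1 / 2 <= enorm (z s) <= 2.
Proof.
move=> sr; have w0 := enorm_ge0 w.
have sw : enorm (s *: w) <= 1 / 2.
  rewrite enormZ; apply: (@le_trans _ _ (r * (1 + enorm w))).
    apply: ler_pM; [exact: normr_ge0|exact: w0|exact: ltW|by rewrite lerDr].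
  by rewrite /r; rewrite le_eqVlt; apply/orP; left; apply/eqP; field; rewrite gt_eqF// one_enorm_gt0.
have h1 := enormD xi (s *: w); have h2 := enormD (z s) (- (s *: w)).
move: h2; rewrite /z addrK enormN xi1 => h2; rewrite xi1 in h1.
by apply/andP; split; lra.
Qed.

Let z_neq0 (s : R) : `|s| < r -> z s != 0.
Proof. by move=> /z_bounds/andP[h _]; rewrite -enorm_gt0; lra. Qed.

Let bz_inv (s : R) : `|s| < r -> `|(bz s)^-1| <= 4.
Proof.
move=> sr; have /andP[h _] := z_bounds sr.
have b0 : 1 / 4 <= bz s by rewrite /bz -enorm_sqr expr2; nra.
by move: b0 {h}; move: (bz s) => b b0; apply: normr_inv_le; lra.
Qed.

Let bz_neq0 (s : R) : `|s| < r -> bz s != 0.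
Proof. by move=> sr; rewrite dotp_eq0; exact: z_neq0. Qed.

Let d_dotp (v : E) (s : R) : is_derive s 1 (fun s => dotp v (z s)) (dotp v w).
Proof.
rewrite (_ : (fun s : R => _) = fun s => dotp v xi + dotp v w * s); last first.
  by apply/funext => t; rewrite dotpDr dotpZr; ring.
by apply: is_derive_eq; rewrite add0r mul1r [LHS]mulr1.
Qed.

Let d_bz (s : R) : is_derive s 1 bz (2 * dotp (z s) w).
Proof.
rewrite (_ : bz = fun s => dotp xi xi + (2 * dotp xi w) * s + dotp w w * s ^+ 2); last first.
  apply/funext => t; rewrite /bz /z !dotpDl !dotpDr !dotpZl !dotpZr (dotpC w xi); ring.
apply: is_derive_eq; rewrite /z dotpDl dotpZl.
by rewrite !scale_regularE; ring.
Qed.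

Let d_q x (s : R) : `|s| < r -> is_derive s 1 (fun s => q s x - th) (q' s x).
Proof.
move=> sr; have D := is_derive_quot (bz_neq0 sr) (is_deriveM (d_dotp y s) (d_dotp x s)) (d_bz s).
have D2 := is_deriveD (is_derive_cst (dotp y x - th) s (1 : R)) (is_deriveN D).
rewrite (_ : (fun s : R => _) = (cst (dotp y x - th) + - (fun t => ((fun s => dotp y (z s)) * (fun s => dotp x (z s))) t / bz t))); last first.
  apply/funext => t.
  by transitivity (dotp y x - th + - (dotp y (z t) * dotp x (z t) / bz t)) => //; rewrite /q; ring.
apply: (is_derive_eq D2); rewrite add0r /q'; congr (- (_ / _ - _)).
by rewrite -![_ *: (_ : R)]/(_ * _); ring.
Qed.

Let d_kap x (s : R) : `|s| < r -> is_derive s 1 (fun s => kap s x) (kap' s x).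
Proof.
move=> sr; have D := is_derive_quot (bz_neq0 sr) (is_deriveM (d_dotp x s) (d_dotp x s)) (d_bz s).
rewrite (_ : (fun s : R => _) = (fun t => ((fun s => dotp x (z s)) * (fun s => dotp x (z s))) t / bz t)); last first.
  by apply/funext => t; rewrite /kap expr2.
apply: (is_derive_eq D); rewrite /kap'; congr (_ / _ - _ * _ / _).
by rewrite -![_ *: (_ : R)]/(_ * _); ring.
Qed.

Let d_A x (s : R) : `|s| < r -> is_derive s 1 (fun s => A (x, z s)) ('D_(0, w) A (x, z s)).
Proof.
move=> sr; have [da _ _ _] := Ca.
rewrite (_ : (fun s : R => _) = fun s : R => A ((x, xi) + s *: (0, w))); last first.
  by apply/funext => t; rewrite pair_lineE scaler0 addr0.
apply/is_derive_line; rewrite pair_lineE scaler0 addr0.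
by apply: DeriveDef => //; apply: da; exact: z_neq0.
Qed.

Let d_f x (s : R) : `|s| < r -> is_derive s 1 (f ^~ x) (f' s x).
Proof.
move=> sr; have Dc := @is_derive1_comp _ cos (fun s => q s x - th) s _ _
  (is_derive_cos _) (d_q x sr).
have Dg := is_deriveM (d_A x sr) (is_derive_gauss (d_kap x sr)).
apply: (is_derive_eq (is_deriveM Dc Dg)).
rewrite -[LHS]/(cos (q s x - th) * (A (x, z s) * (- kap' s x * gauss (kap s x)) +
  gauss (kap s x) * 'D_(0, w) A (x, z s)) +
  A (x, z s) * gauss (kap s x) * (- sin (q s x - th) * q' s x)) /f'.
move: ('D_ _ A _) (A _) (gauss _) (sin _) (cos _) => c1 c2 c3 c4 c5; ring.
Qed.

Let dominated : exists2 G : E -> R, (leb R m.+2).-integrable setT (EFin \o G) &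
  forall s x, `|s| < r -> `|f s x| <= G x /\ `|f' s x| <= G x.
Proof.
have [N HN] := @rapid_bound_integrable R m.+1 1.
have [_ _ [_ fa] fD] := Ca.
have [M1 M10 H1] := fast_gauss N.+2 fa.
have [M2 M20 H2] := fast_gauss N.+2 (fD (w, 0)).2.
have [M3 M30 H3] := fast_gauss N.+2 (fD (0, w)).2.
pose M := M1 + M2 + M3.
pose Y := 1 + enorm y; pose W := 1 + enorm w.
have Y1 : 1 <= Y by exact: one_enorm_ge1.
have W1 : 1 <= W by exact: one_enorm_ge1.
(* With |z| <= 2 and 1/|z|^2 <= 4, the bounds on q' and kap' are 272 X Y W and 272 X^2 W (272 = 16 +
   256, from the two terms of a quotient rule), and [derive_retract] contributes 8 X + 2 <= 10 X^2.
   The exponent N + 2 of the decay pays for X^2. *)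
pose K := M * (272 * Y * W + 10 + 272 * W).
have M0 : 0 <= M by rewrite !addr_ge0.
exists (fun x => K * (1 * ((1 + enorm x) ^+ N)^-1)).
  exact: (integrableZl measurableT K HN).
move=> s x sr.
set X := 1 + enorm x; have X1 : 1 <= X by exact: one_enorm_ge1.
have Xg : 0 < X by rewrite one_enorm_gt0.
pose V := (X ^+ N.+2)^-1.
have V0 : 0 <= V by rewrite invr_ge0 exprn_ge0// ltW.
have VE : 1 * (X ^+ N)^-1 = V * X ^+ 2.
  by rewrite /V !exprS; field; rewrite expf_neq0 gt_eqF.
rewrite VE.
have zs := z_neq0 sr; have /andP[zl zu] := z_bounds sr.
set g := gauss (kap s x); have g0 : 0 <= g by exact: gauss_ge0.
have sub M' : 0 <= M' -> M' <= M -> M' * V <= M * V by move=> _ h; rewrite ler_wpM2r.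
have a1 : `|A (x, z s)| * g <= M * V.
  by apply: (le_trans (H1 _ _ zs)); apply: sub => //; rewrite /M; lra.
have a2 : `|'D_(w, 0) A (retract (x, z s))| * g <= M * V.
  by apply: (le_trans (H2 _ _ zs)); apply: sub => //; rewrite /M; lra.
have a3 : `|'D_(0, w) A (retract (x, z s))| * g <= M * V.
  by apply: (le_trans (H3 _ _ zs)); apply: sub => //; rewrite /M; lra.
have fE : f s x = cos (q s x - th) * (A (x, z s) * g) by [].
have f'E : f' s x = - sin (q s x - th) * q' s x * (A (x, z s) * g) +
  cos (q s x - th) * ('D_(0, w) A (x, z s) * g + A (x, z s) * (- kap' s x * g)) by [].
clearbody g.
have MV0 : 0 <= M * V by exact: mulr_ge0.
have nx : enorm x <= X by rewrite lerDr.
have ny : enorm y <= Y by rewrite lerDr.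
have nw : enorm w <= W by rewrite lerDr.
have dp (u v : E) c d : enorm u <= c -> enorm v <= d -> `|dotp u v| <= c * d.
  by move=> uc vd; apply: (le_trans (normr_dotp_le _ _)); rewrite ler_pM ?enorm_ge0.
have bi := bz_inv sr.
have n2 : `|2| <= 2 :> R by rewrite normr_nat.
have hq : `|q' s x| <= 272 * (X * Y * W).
  rewrite normrN; apply: (le_trans (ler_normB _ _)).
  rewrite (_ : 272 * _ = (Y * W * (X * 2) + Y * 2 * (X * W)) * 4 +
    Y * 2 * (X * 2) * (2 * (2 * W)) * (4 * 4)); last by ring.
  apply: lerD.
    apply: ler_normM => //; apply: (le_trans (ler_normD _ _)).
    by apply: lerD; apply: ler_normM; exact: dp.
  rewrite expr2 invfM; apply: ler_normM; last by apply: ler_normM.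
  by apply: ler_normM; [apply: ler_normM; exact: dp|apply: ler_normM => //; exact: dp].
have hk : `|kap' s x| <= 272 * (X ^+ 2 * W).
  apply: (le_trans (ler_normB _ _)).
  rewrite (_ : 272 * _ = 2 * (X * 2) * (X * W) * 4 +
    (X * 2) * (X * 2) * (2 * (2 * W)) * (4 * 4)); last by ring.
  apply: lerD.
    by apply: ler_normM => //; apply: ler_normM; [apply: ler_normM => //|]; exact: dp.
  rewrite expr2 invfM; apply: ler_normM; last by apply: ler_normM.
  by apply: ler_normM; [apply: ler_normM; exact: dp|apply: ler_normM => //; exact: dp].
have hD : `|'D_(0, w) A (x, z s)| * g <= (8 * X + 2) * (M * V).
  have F (d1 d2 : R) : `|d1| * g <= M * V -> `|d2| * g <= M * V ->
      `|- (dotp x (z s) / bz s) * d1 + (enorm (z s))^-1 * d2| * g <= (8 * X + 2) * (M * V).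
    move=> b1 b2.
    have -> : (8 * X + 2) * (M * V) = (X * 2) * 4 * (M * V) + 2 * (M * V) by ring.
    apply: (@le_trans _ _ (`|dotp x (z s) / bz s| * (`|d1| * g) +
       `|(enorm (z s))^-1| * (`|d2| * g))).
      rewrite !mulrA -mulrDl; apply: ler_wpM2r => //.
      by apply: (le_trans (ler_normD _ _)); rewrite !normrM normrN normrM.
    apply: lerD; apply: ler_pM => //; try by rewrite mulr_ge0.
      by apply: ler_normM => //; exact: dp.
    by apply: normr_inv_le; lra.
  have E : 'D_(0, w) A (x, z s) = - (dotp x (z s) / bz s) * 'D_(w, 0) A (retract (x, z s)) +
      (enorm (z s))^-1 * 'D_(0, w) A (retract (x, z s)).
    exact: (@derive_retract _ _ _ Ca (x, z s) w zs).
  by rewrite E; exact: (F _ _ a2 a3).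
have C1 := normr_cos_le1 (q s x - th).
have S1 : `|sin (q s x - th)| <= 1 by rewrite ler_norml sin_geN1 sin_le1.
have hA : `|A (x, z s) * g| <= M * V by rewrite normrM (ger0_norm g0).
have W0 : 0 <= W by exact: le_trans ler01 W1.
have Y0 : 0 <= Y by exact: le_trans ler01 Y1.
split.
  rewrite fE; apply: (le_trans (ler_normM C1 hA)); rewrite mul1r.
  exact: (bound_poly1 (ler0n R 272) X1 W0 Y0 MV0).
apply: le_trans (bound_poly (ler0n R 272) X1 W0 Y0 MV0).
rewrite f'E; apply: (le_trans (ler_normD _ _)); apply: lerD.
  apply: ler_normM hA; rewrite -[leRHS]mul1r; apply: ler_normM => //.
  by rewrite normrN.
rewrite -[leRHS]mul1r; apply: ler_normM => //.
apply: (le_trans (ler_normD _ _)); apply: lerD.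
  by rewrite normrM (ger0_norm g0).
rewrite mulrCA; apply: ler_normM => //; by rewrite normrN.
Qed.

Let phase_f s : `|s| < r ->
  phase_transform th a (retract (y, z s)) = \int[leb R m.+2]_x f s x.
Proof.
move=> sr; have zs := z_neq0 sr; have [_ _ [ma _] _] := Ca.
have n1 := enorm_normalize zs; rewrite phase_transform_retract//.
pose K (x : E) := cos (dotp y x - th) * bundle_ext a (x, z s).
have mK : measurable_fun setT K.
  apply: measurable_funM; first by apply: measurable_cos_fun; measurability.
  by apply: (measurableT_comp ma); apply: measurable_fun_pair; measurability.
transitivity (\int[leb R m.+1]_u K (hplane (normalize (z s)) u)).
  by apply: eq_Rintegral => u _; rewrite /K bundle_ext_normalize.
rewrite -(Rintegral_gauss_smear n1 mK); apply: eq_Rintegral => x _.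
have e0 : enorm (z s) != 0 by rewrite enorm_eq0.
have xn : dotp x (normalize (z s)) = dotp x (z s) / enorm (z s).
  by rewrite /normalize dotpZr mulrC.
have xp : dotp x (normalize (z s)) *: normalize (z s) = (dotp x (z s) / bz s) *: z s.
  by rewrite xn /normalize scalerA /bz -enorm_sqr; congr (_ *: _); field.
rewrite xp xn /K /f -mulrA; congr (_ * (_ * _)).
- by congr (cos (_ - _)); rewrite dotpBr dotpZr /q; ring.
- rewrite /bundle_ext/= zs mul1r -scaleNr; congr a.
  exact: (@retract_fiber _ _ (x, z s)).
- by congr gauss; rewrite /kap /bz -enorm_sqr; field.
Qed.

Let measurable_f s : `|s| < r -> measurable_fun setT (f s).
Proof.
move=> sr; have [_ _ [ma _] _] := Ca.
apply: measurable_funM.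
  by apply: measurable_cos_fun; rewrite /q; measurability.
apply: measurable_funM; first exact: (measurable_retract_slice (z_neq0 sr) ma).
by apply: measurable_gauss; rewrite /kap; measurability.
Qed.

Let tau (x : E) := dotp x xi.
(** At s = 0 the derivative of the phase, that of the Gaussian and the fibre displacement in
    [derive_retract] all contain the factor <x,xi>. Their other factors depend on x through
    <x,xi>^2, <y,x> and the projection of x, all unchanged by the reflection; this uses <y,xi> =
    0. *)
Let odd_part (x : E) := tau x * (gauss (tau x * tau x) *
  (sin (dotp y x - th) * dotp y w * A (x, xi) -
   cos (dotp y x - th) * ('D_(w, 0) A (retract (x, xi)) +
     A (x, xi) * (2 * dotp (x - tau x *: xi) w)))).
Let even_part (x : E) := cos (dotp y x - th) *
  ('D_(0, w) A (retract (x, xi)) * gauss (tau x * tau x)).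

Let xi0 : xi != 0.
Proof. by rewrite -enorm_eq0 xi1 oner_eq0. Qed.

Let f'0E x : f' 0 x = odd_part x + even_part x.
Proof.
have z0 : z 0 = xi by rewrite /z scale0r addr0.
have b0 : bz 0 = 1 by rewrite /bz z0 enorm1_dotp.
have E : 'D_(0, w) A (x, xi) = - tau x * 'D_(w, 0) A (retract (x, xi)) +
    'D_(0, w) A (retract (x, xi)).
  have := @derive_retract _ _ _ Ca (x, xi) w xi0.
  by rewrite /= enorm1_dotp// xi1 divr1 invr1 mul1r.
rewrite /f' /q /q' /kap /kap' b0 z0 yxi E /odd_part /even_part dotpBl dotpZl -/(tau x).
rewrite !expr2 !mulr1 !divr1 !mul0r subr0 addr0.
move: ('D_(w, 0) A (retract (x, xi))) ('D_(0, w) A (retract (x, xi))) (A (x, xi))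
  (gauss (tau x * tau x)) (sin (dotp y x - th)) (cos (dotp y x - th)) (tau x)
  (dotp x w) (dotp xi w) (dotp y w) => c1 c2 c3 c4 c5 c6 c7 c8 c9 c10.
by ring.
Qed.

Let m_even : measurable_fun setT even_part.
Proof.
have [_ _ _ mD] := Ca.
apply: measurable_funM; first by apply: measurable_cos_fun; measurability.
apply: measurable_funM; first exact: (measurable_retract_slice xi0 (mD _).1).
by apply: measurable_gauss; rewrite /tau; measurability.
Qed.

Let m_odd : measurable_fun setT odd_part.
Proof.
have [_ _ [ma _] mD] := Ca.
have mt : measurable_fun setT tau by rewrite /tau; measurability.
have mA : measurable_fun setT (fun x => A (x, xi)) by exact: (measurable_retract_slice xi0 ma).
have md : measurable_fun setT (fun x => 'D_(w, 0) A (retract (x, xi))).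
  exact: (measurable_retract_slice xi0 (mD _).1).
have mq : measurable_fun setT (fun x : E => dotp y x - th) by measurability.
have mc := measurable_cos_fun mq.
have ms : measurable_fun setT (fun x : E => sin (dotp y x - th)).
  by apply: (measurableT_comp _ mq); apply: continuous_measurable_fun; exact: continuous_sin.
have mg : measurable_fun setT (fun x => gauss (tau x * tau x)).
  by apply: measurable_gauss; measurability.
by rewrite /odd_part; measurability.
Qed.

Let i_even : (leb R m.+2).-integrable setT (EFin \o even_part).
Proof.
have [N HN] := @rapid_bound_integrable R m.+1 1.
have [_ _ _ fD] := Ca.
have [M M0 H] := fast_gauss N (fD (0, w)).2.
apply: (le_integrable measurableT _ _ (integrableZl measurableT M HN)).
  exact/measurable_EFinP.
move=> x _; rewrite lee_fin mul1r [leRHS]ger0_norm; last first.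
  by rewrite mulr_ge0// invr_ge0 exprn_ge0// ltW// one_enorm_gt0.
apply: (@le_trans _ _ (1 * (`|'D_(0, w) A (retract (x, xi))| * gauss (tau x * tau x)))).
  apply: ler_normM; first exact: normr_cos_le1.
  by rewrite normrM (ger0_norm (gauss_ge0 _)).
rewrite !mul1r; have := H x xi xi0.
by rewrite enorm1_dotp// divr1 expr2.
Qed.

Let int_f'0 : \int[leb R m.+2]_x f' 0 x = phase_transform th ('D_(0, w) A) (y, xi).
Proof.
have [_ _ _ mD] := Ca.
have [G iG HG] := dominated.
have n0 : `|0 : R| < r by rewrite normr0.
have i_f' : (leb R m.+2).-integrable setT (EFin \o (fun x => odd_part x + even_part x)).
  apply: (le_integrable measurableT _ _ iG).
    by apply/measurable_EFinP; exact: measurable_funD.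
  move=> x _; rewrite lee_fin -f'0E (le_trans (HG 0 x n0).2)//.
  exact: ler_norm.
have i_odd : (leb R m.+2).-integrable setT (EFin \o odd_part).
  have := integrableB measurableT i_f' i_even.
  by apply: eq_integrable => // x _; rewrite /= -EFinB addrK.
transitivity (\int[leb R m.+2]_x (odd_part x + even_part x)).
  by apply: eq_Rintegral => x _; exact: f'0E.
rewrite (RintegralD measurableT i_odd i_even) -[RHS]add0r; congr (_ + _).
  apply: (Rintegral_odd xi1 m_odd) => x.
  have tN : tau (x - (2 * tau x) *: xi) = - tau x.
    by rewrite /tau dotpBl dotpZl enorm1_dotp//; ring.
  have yN : dotp y (x - (2 * tau x) *: xi) = dotp y x.
    by rewrite dotpBr dotpZr yxi mulr0 subr0.
  have rN : retract (x - (2 * tau x) *: xi, xi) = retract (x, xi).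
    by rewrite -scaleNr; exact: (@retract_fiber _ _ (x, xi)).
  have pN : x - (2 * tau x) *: xi - - tau x *: xi = x - tau x *: xi.
    by rewrite -addrA -opprD -scalerDl; congr (_ - _ *: _); ring.
  by rewrite /odd_part /A /= tN yN rN pN !mulrNN !mulNr.
pose K (x : E) := cos (dotp y x - th) * bundle_ext ('D_(0, w) A) (x, xi).
have mK : measurable_fun setT K.
  apply: measurable_funM; first by apply: measurable_cos_fun; measurability.
  by apply: (measurableT_comp (mD _).1); apply: measurable_fun_pair; measurability.
transitivity (\int[leb R m.+1]_u K (hplane xi u)); last first.
  by apply: eq_Rintegral => u _; rewrite /K bundle_ext_hplane.
rewrite -(Rintegral_gauss_smear xi1 mK); apply: eq_Rintegral => x _.
rewrite /K /even_part -mulrA; congr (_ * (_ * _)).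
  by congr (cos (_ - _)); rewrite dotpBr dotpZr yxi mulr0 subr0.
have bE B (u : E) : bundle_ext B (u, xi) = B (retract (u, xi)).
  by rewrite /bundle_ext/= xi0 mul1r.
have rE : retract (x, xi) = retract (x - dotp x xi *: xi, xi).
  by rewrite -scaleNr (@retract_fiber _ _ (x, xi)).
by rewrite rE; apply: esym; exact: bE.
Qed.

(** The derivative in xi passes under the fibre integral although the fibre moves: of the
    differentiated smeared integral only the even part remains, and it is itself a smeared fibre
    integral. *)
Lemma is_derive_phase_direction :
  is_derive (y, xi) (0, w) (phase_transform th a \o @retract R m.+2)
    (phase_transform th ('D_(0, w) A) (y, xi)).
Proof.
have [G iG HG] := dominated.
apply/is_derive_line0; rewrite -int_f'0.
have D : is_derive (0 : R) 1 (fun s : R => \int[leb R m.+2]_x f s x)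
    (\int[leb R m.+2]_x f' 0 x).
  apply: (is_derive_Rintegral r0 _ _ iG).
  - move=> s sr; apply: (le_integrable measurableT _ _ iG).
      by apply/measurable_EFinP; exact: measurable_f.
    by move=> x _; rewrite lee_fin (le_trans (HG s x sr).1)// ler_norm.
  - by move=> s x sr; exact: d_f.
  - by move=> s x sr; exact: (HG s x sr).2.
apply: near_eq_is_derive D; exists r => //= s; rewrite /ball_ /= sub0r normrN => sr.
by rewrite pair_lineE scaler0 addr0 -phase_f.
Qed.

End point.
End PhaseDirection.

Section PhaseXi.
Context {R : realType} {m : nat}.
Local Notation E := 'rV[R]_m.+2.
Variable a : E * E -> R.
Hypothesis Ca : bundle_C1 a.
Let A := a \o @retract R m.+2.

Lemma bundle_C1_integrable : bundle_integrable a.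
Proof. by have [_ _ [ma fa] _] := Ca; exact: fast_integrable. Qed.

Lemma bundle_C1_derive_integrable v : bundle_integrable ('D_v A).
Proof. by have [_ _ _ D] := Ca; have [mD fD] := D v; exact: fast_integrable. Qed.

Let phase_radial_sum0 th (p : E * E) : bundle p ->
  \sum_j p.2 0 j * 'D_(0, basis_vec R j) (phase_transform th a \o @retract R m.+2) p = 0.
Proof.
case: p => y xi bp; have [xi1 yxi] := bp.
have ic (j : 'I_m.+2) : bundle_integrable (fun q : E * E => q.2 0 j * 'D_(0, basis_vec R j) A q).
  have id := bundle_C1_derive_integrable (0, basis_vec R j).
  apply: bundle_integrable_dominated (bundle_integrable_abs id) => [|q bq].
    apply: bundle_measurableM; last by case: id.
    by apply: bundle_measurable_fun; measurability.
  by rewrite normrM ler_piMl// bundle_coord2_le1.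
transitivity (\sum_j phase_transform th (fun q : E * E => q.2 0 j * 'D_(0, basis_vec R j) A q) (y, xi)).
  apply: eq_bigr => j _; rewrite phase_transform_coord2//; last exact: bundle_C1_derive_integrable.
  congr (_ * _).
  exact: (@derive_val _ _ _ _ _ _ _ (is_derive_phase_direction Ca th (basis_vec R j) xi1 yxi)).
rewrite -phase_transform_sum// -[RHS](mul0r (phase_transform th a (y, xi))) -phase_transformZ//; last first.
  exact: bundle_C1_integrable.
apply: phase_transform_ext => // q [q1 _]; rewrite mul0r.
have q0 : q.2 != 0 by rewrite -enorm_eq0 q1 oner_eq0.
by rewrite -(bundle_C1_sum Ca _ q0); exact: derive_radial0.
Qed.

(** On both sides only the derivative in xi_i survives: the corrections vanish on a by invariance of
    its extension, and on the transform by the two sum lemmas. *)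
Lemma real_Xi_phase_transform th i (p : E * E) : bundle p ->
  real_Xi (phase_transform th a) i p = phase_transform th (real_Xi a i) p.
Proof.
move=> bp; have [_ _ [ma fa] _] := Ca.
transitivity (phase_transform th ('D_(0, basis_vec R i) A) p); last first.
  apply: phase_transform_ext => // q [q1 _].
  have q0 : q.2 != 0 by rewrite -enorm_eq0 q1 oner_eq0.
  by apply: esym; exact: real_Xi_bundle.
transitivity ('D_(0, basis_vec R i) (phase_transform th a \o @retract R m.+2) p).
  rewrite /real_Xi -[RHS]subr0 -[X in _ = X - 0]subr0; congr (_ - _ - _).
    rewrite -[RHS](mulr0 (p.1 0 i)); congr (_ * _).
    exact: phase_fiber_sum0.
  rewrite -[RHS](mulr0 (p.2 0 i)); congr (_ * _).
  exact: phase_radial_sum0.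
case: p bp => y xi [xi1 yxi].
exact: (@derive_val _ _ _ _ _ _ _ (is_derive_phase_direction Ca th (basis_vec R i) xi1 yxi)).
Qed.

End PhaseXi.

Lemma Rintegral_finsum {R : realType} d (T : measurableType d)
    (mu : {measure set T -> \bar R}) I (s : seq I) (F : I -> T -> R) :
  (forall i, mu.-integrable setT (EFin \o F i)) ->
  \int[mu]_x (\sum_(i <- s) F i x) = \sum_(i <- s) \int[mu]_x F i x.
Proof.
move=> iF; elim: s => [|i s IH].
  by rewrite big_nil /Rintegral integral0_eq// => x _; rewrite big_nil.
have iS : mu.-integrable setT (EFin \o (fun x => \sum_(i <- s) F i x)).
  have := @integrable_sum _ _ _ mu setT measurableT _ s xpredT (fun i => EFin \o F i) (fun i _ => iF i).
  by apply: eq_integrable => // x _; rewrite /= sumEFin.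
rewrite big_cons -IH -(RintegralD measurableT (iF i) iS).
by apply: eq_Rintegral => x _; rewrite big_cons.
Qed.

(** * Ray transforms *)

Section Rays.
Context {R : realType} {n : nat}.
Local Notation E := 'rV[R]_n.+1.
Local Notation mu := (@lebesgue_measure R).
Implicit Types (h : E -> R) (p : E * E).

Lemma integrable_decay : exists N : nat,
  mu.-integrable setT (fun t : R => (((1 + `|t|) ^+ N)^-1)%:E).
Proof.
have [N HN] := @rapid_bound_integrable R 0 1; exists N.
have m1 : measurable_fun setT (fun t : R => (((1 + `|t|) ^+ N)^-1)%:E).
  apply/measurable_EFinP; apply: measurable_invr_fun; apply: measurable_funX.
  by apply: measurable_funD => //; exact: normr_measurable.
have p0 (t : R) : 0 <= ((1 + `|t|) ^+ N)^-1.
  by rewrite invr_ge0 exprn_ge0// addr_ge0.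
apply/integrableP; split => //.
have [m2] := integrableP _ _ _ HN; congr (_ < _)%E.
transitivity (\int[leb R 1]_u (((1 + enorm u) ^+ N)^-1)%:E)%E.
  apply: eq_integral => u _; rewrite mul1r /= ger0_norm// invr_ge0 exprn_ge0//.
  exact: ltW (one_enorm_gt0 u).
rewrite ge0_integral_leb_cons; last 2 first.
- by apply/measurable_EFinP; measurability.
- by move=> u; rewrite lee_fin invr_ge0 exprn_ge0//; exact: ltW (one_enorm_gt0 u).
apply: eq_integral => t _; rewrite ge0_integral_leb0; last 2 first.
- by apply/measurable_EFinP; measurability.
- by move=> u; rewrite lee_fin invr_ge0 exprn_ge0//; exact: ltW (one_enorm_gt0 _).
by rewrite /= ger0_norm// /enorm dotp_cons dotp0l addr0 -expr2 sqrtr_sqr.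
Qed.

Definition ray (k : nat) h p : R := \int[mu]_t (t ^+ k * h (p.1 + t *: p.2)).

Lemma line_growth (x z v w : E) : z != 0 -> exists r K : R, [/\ 0 < r, 1 <= K &
  forall s : R, `|s| < r -> forall t : R,
    1 + `|t| <= K * (1 + enorm (x + s *: v + t *: (z + s *: w)))].
Proof.
move=> z0; have ez : 0 < enorm z by rewrite enorm_gt0.
pose r := enorm z / (2 * (1 + enorm w)).
have w1 := one_enorm_gt0 w.
have r0 : 0 < r by rewrite divr_gt0// mulr_gt0.
have v0 := enorm_ge0 v; have x0 := enorm_ge0 x.
pose C := enorm x + r * enorm v.
have C0 : 0 <= C by rewrite addr_ge0// mulr_ge0// ltW.
pose c := 2 / enorm z; have c0 : 0 < c by rewrite divr_gt0.
exists r, (1 + c * (1 + C)); split => //; first by rewrite lerDl mulr_ge0 ?(ltW c0)// addr_ge0.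
move=> s sr t; set X := x + _ + _; have X0 := enorm_ge0 X.
have sv : enorm (s *: v) <= r * enorm v by rewrite enormZ ler_wpM2r// ltW.
have sw : enorm (s *: w) <= enorm z / 2.
  rewrite enormZ; apply: (@le_trans _ _ (r * (1 + enorm w))).
    by apply: ler_pM; [exact: normr_ge0|exact: enorm_ge0|exact: ltW|rewrite lerDr].
  by rewrite /r le_eqVlt; apply/orP; left; apply/eqP; field; rewrite gt_eqF.
have zw : enorm z / 2 <= enorm (z + s *: w).
  have := enormD (z + s *: w) (- (s *: w)); rewrite addrK enormN; lra.
have tb : `|t| * (enorm z / 2) <= enorm X + C.
  apply: (@le_trans _ _ (enorm (t *: (z + s *: w)))); first by rewrite enormZ ler_wpM2l.
  have -> : t *: (z + s *: w) = X - (x + s *: v) by rewrite /X addrAC subrr add0r.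
  apply: (le_trans (enormD _ _)); rewrite enormN lerD2l.
  by apply: (le_trans (enormD _ _)); rewrite lerD2l.
have tc : `|t| <= c * (enorm X + C).
  have -> : `|t| = c * (`|t| * (enorm z / 2)) by rewrite /c; field; rewrite gt_eqF.
  by rewrite ler_pM2l.
apply: (@le_trans _ _ (1 + c * (enorm X + C))); first by rewrite lerD2l.
have h1 : 0 <= c * enorm X by rewrite mulr_ge0// ltW.
have h2 : 0 <= c * C * enorm X by rewrite mulr_ge0// mulr_ge0// ltW.
have -> : (1 + c * (1 + C)) * (1 + enorm X) =
  1 + c * (enorm X + C) + (c + enorm X + c * C * enorm X) by ring.
by rewrite lerDl addr_ge0// addr_ge0// ltW.
Qed.

Lemma rapid_line h (x z v w : E) k : rapid h -> z != 0 ->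
  exists r : R, exists G : R -> R, [/\ 0 < r, mu.-integrable setT (EFin \o G) &
    forall s t : R, `|s| < r ->
      (1 + `|t|) ^+ k * `|h (x + s *: v + t *: (z + s *: w))| <= G t].
Proof.
move=> rh z0; have [N HN] := integrable_decay.
have [r [K [r0 K1 HK]]] := line_growth x v w z0.
have [M HM] := rh (N + k)%N.
have K0 : 0 <= K by exact: le_trans ler01 K1.
pose c := K ^+ (N + k) * M.
exists r, (fun t => c * ((1 + `|t|) ^+ N)^-1); split => //.
  exact: (integrableZl measurableT c HN).
move=> s t sr; set X := x + _ + _.
have t0 : 0 < 1 + `|t| by rewrite ltr_pwDl.
rewrite ler_pdivlMr ?exprn_gt0// mulrAC -exprD addnC.
apply: (@le_trans _ _ ((K * (1 + enorm X)) ^+ (N + k) * `|h X|)).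
  by rewrite ler_wpM2r// lerXn2r ?nnegrE ?(ltW t0)// ?mulr_ge0 ?(ltW (one_enorm_gt0 _))//; exact: HK.
by rewrite exprMn -mulrA ler_wpM2l ?exprn_ge0.
Qed.

Lemma rapid_line0 h (x z : E) k : rapid h -> z != 0 ->
  exists2 G : R -> R, mu.-integrable setT (EFin \o G) &
    forall t : R, (1 + `|t|) ^+ k * `|h (x + t *: z)| <= G t.
Proof.
move=> rh z0; have [r [G [r0 iG HG]]] := rapid_line x 0 0 k rh z0.
exists G => // t; have := HG 0 t; rewrite normr0 => /(_ r0).
by rewrite !scale0r !addr0.
Qed.

Lemma ray_integrable k h (x z : E) : measurable_fun setT h -> rapid h -> z != 0 ->
  mu.-integrable setT (EFin \o (fun t => t ^+ k * h (x + t *: z))).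
Proof.
move=> mh rh z0; have [G iG HG] := rapid_line0 x k rh z0.
apply: (le_integrable measurableT _ _ iG).
  apply/measurable_EFinP; apply: measurable_funM; first by measurability.
  by apply: (measurableT_comp mh); measurability.
move=> t _; rewrite lee_fin (le_trans _ (ler_norm _))//.
apply: le_trans (HG t); rewrite normrM ler_wpM2r// normrX lerXn2r ?nnegrE ?addr_ge0//.
by rewrite lerDr.
Qed.

Lemma measurable_ray k h : measurable_fun setT h -> measurable_fun setT (ray k h).
Proof.
move=> mh; apply: (@measurable_Rintegral_param _ _ _ _ _ mu
  (fun p t => t ^+ k * h (p.1 + t *: p.2))).
apply: measurable_funM; first by measurability.
by apply: (measurableT_comp mh); measurability.
Qed.

Lemma Rintegral_mu_shift (f : R -> R) c : measurable_fun setT f ->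
  \int[mu]_t f (t + c) = \int[mu]_t f t.
Proof.
move=> mf; rewrite /Rintegral; congr fine; rewrite integralE [RHS]integralE.
congr (_ - _)%E.
- rewrite -[RHS](@ge0_integral_shift1 _ _ c).
  + by apply: eq_integral => t _; rewrite !funeposE.
  + by apply: measurable_funepos; exact/measurable_EFinP.
  + by move=> t; exact: funepos_ge0.
- rewrite -[RHS](@ge0_integral_shift1 _ _ c).
  + by apply: eq_integral => t _; rewrite !funenegE.
  + by apply: measurable_funeneg; exact/measurable_EFinP.
  + by move=> t; exact: funeneg_ge0.
Qed.

Let fine_scale (c : R) (x y : \bar R) : 0 < c ->
  fine (c%:E * x - c%:E * y)%E = c * fine (x - y)%E.
Proof.
move=> c0; case: x => [x| |]; case: y => [y| |];
  rewrite ?gt0_muley ?gt0_muleNy ?lte_fin//= ?mulr0// -?EFinM/=; ring.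
Qed.

Lemma Rintegral_mu_scale (f : R -> R) c : 0 < c -> measurable_fun setT f ->
  c * \int[mu]_t f (c * t) = \int[mu]_t f t.
Proof.
move=> c0 mf; have cn : `|c| = c by rewrite gtr0_norm.
have c00 : c != 0 by rewrite gt_eqF.
rewrite /Rintegral integralE [in RHS]integralE -fine_scale//; congr (fine (_ - _))%E.
- rewrite -[RHS](@ge0_integral_scale1 _ _ c c00) ?cn.
  + by congr (_ * _)%E; apply: eq_integral => t _; rewrite !funeposE.
  + by apply: measurable_funepos; exact/measurable_EFinP.
  + by move=> t; exact: funepos_ge0.
- rewrite -[RHS](@ge0_integral_scale1 _ _ c c00) ?cn.
  + by congr (_ * _)%E; apply: eq_integral => t _; rewrite !funenegE.
  + by apply: measurable_funeneg; exact/measurable_EFinP.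
  + by move=> t; exact: funeneg_ge0.
Qed.

(** Moving the origin along the ray is a translation of t, and rescaling the direction a dilation,
    whose Jacobian makes the integral homogeneous of degree -1 in xi. *)
Lemma ray_retract h p : measurable_fun setT h -> p.2 != 0 ->
  ray 0 h (retract p) = enorm p.2 * ray 0 h p.
Proof.
case: p => x z mh /= z0; have ez : 0 < enorm z by rewrite enorm_gt0.
rewrite /ray /retract /=; set b := dotp x z / dotp z z.
have mq (q : R -> E) : measurable_fun setT q -> measurable_fun setT (fun t : R => t ^+ 0 * h (q t)).
  by move=> m; apply: measurable_funM => //; exact: (measurableT_comp mh m).
have m1 : measurable_fun setT (fun t : R => t ^+ 0 * h (x + t *: z)) by apply: mq; measurability.
rewrite -(Rintegral_mu_shift (- b) m1) -[LHS](Rintegral_mu_scale ez); last first.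
  by apply: mq; measurability.
congr (_ * _); apply: eq_Rintegral => t _; rewrite !expr0 !mul1r; congr h.
have -> : (enorm z * t) *: ((enorm z)^-1 *: z) = t *: z.
  by rewrite scalerA mulrAC divff ?mul1r// gt_eqF.
by rewrite scalerDl scaleNr addrA addrAC.
Qed.

Lemma derive_coord_sum h x v : rapidly_decreasing h ->
  'D_v h x = \sum_i v 0 i * 'D_(basis_vec R i) h x.
Proof.
move=> rh; have [sh _] := rh.
have dh u y : derivable h y u by have [_] := sh [::] y Logic.I; apply.
have D0 : 'D_0 h x = 0.
  have := @derive_val _ _ _ _ _ _ _ (is_derive_dirZ 0 (dh 0 x)).
  by rewrite scale0r mul0r.
rewrite {1}(row_sum_delta v).
elim: (index_enum _) => [|i s IH]; first by rewrite !big_nil; exact: D0.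
rewrite !big_cons -IH.
have D := @is_derive_dirD _ _ h setT x (v 0 i *: basis_vec R i)
  (\sum_(j <- s) v 0 j *: basis_vec R j) openT Logic.I (fun y _ => dh _ y) (fun y _ => dh _ y).
rewrite [LHS](@derive_val _ _ _ _ _ _ _ (D _)); last first.
  by have [] := sh [:: \sum_(j <- s) v 0 j *: basis_vec R j] x Logic.I.
congr (_ + _); exact: (@derive_val _ _ _ _ _ _ _ (is_derive_dirZ (v 0 i) (dh _ x))).
Qed.

Lemma rapidly_decreasing_D h v : rapidly_decreasing h -> rapidly_decreasing ('D_v h).
Proof. exact: (@rapidly_decreasing_iter _ _ h [:: v]). Qed.

(** A change w of the direction displaces the point at time t by t w, so a derivative in xi raises
    the moment by one: this is how I^1 enters the derivatives of I^0. The constant C majorises all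
    coordinates of v and w. *)
Lemma is_derive_ray h (x z v w : E) : rapidly_decreasing h -> z != 0 ->
  is_derive (x, z) (v, w) (ray 0 h)
    (\sum_i (v 0 i * ray 0 ('D_(basis_vec R i) h) (x, z) +
              w 0 i * ray 1 ('D_(basis_vec R i) h) (x, z))).
Proof.
move=> rh z0.
pose d i := 'D_(basis_vec R i) h.
have rd i : rapidly_decreasing (d i) by exact: rapidly_decreasing_D.
have md i : measurable_fun setT (d i) by exact: rapidly_decreasing_measurable.
have qd i : rapid (d i) by exact: rapidly_decreasing_rapid.
have mh := rapidly_decreasing_measurable rh.
have qh := rapidly_decreasing_rapid rh.
pose C := \sum_i (`|v 0 i| + `|w 0 i|).
pose S (y : E) := \sum_i `|d i y|.
have rS : rapid S by apply: rapid_sum => i; exact: rapid_abs.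
have [r [G [r0 iG HG]]] := rapid_line x v w 1 rS z0.
have [r1 [G1 [r10 iG1 HG1]]] := rapid_line x v w 0 qh z0.
pose X (s t : R) := x + s *: v + t *: (z + s *: w).
pose f (s t : R) := t ^+ 0 * h (X s t).
pose f' (s t : R) := \sum_i (v 0 i + t * w 0 i) * d i (X s t).
have D : is_derive (0 : R) 1 (fun s : R => \int[mu]_t f s t) (\int[mu]_t f' 0 t).
  apply: (@is_derive_Rintegral _ _ _ mu f f' (fun t => C * G t) (Num.min r r1)).
  - by rewrite lt_min r0.
  - move=> s; rewrite lt_min => /andP[_ sr].
    apply: (le_integrable measurableT _ _ iG1).
      apply/measurable_EFinP; apply: measurable_funM; first by measurability.
      by apply: (measurableT_comp mh); rewrite /X; measurability.
    move=> t _; rewrite lee_fin /f expr0 mul1r (le_trans _ (ler_norm _))//.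
    by have := HG1 s t sr; rewrite expr0 mul1r.
  - move=> s t _.
    have E1 : f^~ t = fun s : R => h ((x + t *: z) + s *: (v + t *: w)).
      apply/funext => u; rewrite /f expr0 mul1r; congr h.
      by rewrite /X !scalerDr !scalerA [u * t]mulrC addrACA.
    rewrite E1; apply/is_derive_line.
    have E2 : x + t *: z + s *: (v + t *: w) = X s t.
      by rewrite /X !scalerDr !scalerA [s * t]mulrC addrACA.
    rewrite E2; apply: is_derive_eq (rapidly_decreasing_derive _ _ rh) _.
    by rewrite derive_coord_sum//; apply: eq_bigr => i _; rewrite !mxE.
  - exact: (integrableZl measurableT C iG).
  - move=> s t; rewrite lt_min => /andP[sr _].
    have C0 : 0 <= C by apply: sumr_ge0 => i _; rewrite addr_ge0.
    apply: (@le_trans _ _ (C * ((1 + `|t|) ^+ 1 * `|S (X s t)|))); last first.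
      by rewrite ler_wpM2l//; exact: HG.
    apply: (le_trans (ler_norm_sum _ _ _)).
    rewrite expr1 [`|S _|]ger0_norm; last by apply: sumr_ge0.
    rewrite mulrA mulr_sumr; apply: ler_sum => i _; rewrite normrM ler_wpM2r//.
    apply: (le_trans (ler_normD _ _)); rewrite normrM.
    have hi : `|v 0 i| + `|w 0 i| <= C.
      rewrite /C (bigD1 i)//= lerDl; apply: sumr_ge0 => j _; exact: addr_ge0.
    have vi := normr_ge0 (v 0 i); have wi := normr_ge0 (w 0 i); have ti := normr_ge0 t.
    have h1 : (`|v 0 i| + `|w 0 i|) * (1 + `|t|) <= C * (1 + `|t|).
      by rewrite ler_wpM2r// addr_ge0.
    apply: le_trans h1; move: `|v 0 i| `|w 0 i| `|t| vi wi ti => p q u *; nra.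
apply/is_derive_line0.
rewrite (_ : (fun s : R => _) = (fun s : R => \int[mu]_t f s t)); last first.
  by apply/funext => s; rewrite pair_lineE.
apply: (is_derive_eq D).
have iT k i c : mu.-integrable setT (EFin \o (fun t => c * (t ^+ k * d i (x + t *: z)))).
  exact: (integrableZl measurableT c (ray_integrable k x (md i) (qd i) z0)).
transitivity (\int[mu]_t \sum_i (v 0 i * (t ^+ 0 * d i (x + t *: z)) +
    w 0 i * (t ^+ 1 * d i (x + t *: z)))).
  apply: eq_Rintegral => t _; apply: eq_bigr => i _.
  by rewrite /X !scale0r !addr0 expr0 expr1; ring.
rewrite Rintegral_finsum; last by move=> i; exact: (integrableD measurableT (iT _ _ _) (iT _ _ _)).
apply: eq_bigr => i _; rewrite (RintegralD measurableT (iT _ _ _) (iT _ _ _)).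
congr (_ + _); rewrite RintegralZl//; exact: (ray_integrable _ x (md i) (qd i) z0).
Qed.

End Rays.

(** * Ray transforms on the bundle and the slice theorem *)

Section RayBundle.
Context {R : realType} {m : nat}.
Local Notation E := 'rV[R]_m.+2.
Local Notation mu := (@lebesgue_measure R).
Implicit Types (h : E -> R) (p : E * E).

(** Pythagoras: |x + t xi|^2 = |x|^2 + t^2 on the bundle. *)
Lemma bundle_line_le (p : E * E) t : bundle p ->
  enorm p.1 <= enorm (p.1 + t *: p.2) /\ `|t| <= enorm (p.1 + t *: p.2).
Proof.
case: p => x z [/= z1 xz].
have E1 : dotp (x + t *: z) (x + t *: z) = dotp x x + t ^+ 2.
  rewrite !dotpDl !dotpDr !dotpZl !dotpZr (dotpC z x) xz (enorm1_dotp z1); ring.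
rewrite /enorm E1 -sqrtr_sqr; split; rewrite ler_wsqrtr//.
  by rewrite lerDl sqr_ge0.
by rewrite lerDr dotp_ge0.
Qed.

Lemma fast_ray k h : measurable_fun setT h -> rapid h -> fast (ray k h).
Proof.
move=> mh rh N; have [D iD] := @integrable_decay R.
have [M HM] := rh (N + (D + k))%N.
exists (\int[mu]_t (M * ((1 + `|t|) ^+ D)^-1)) => p bp.
have z0 : p.2 != 0 by case: bp => z1 _; rewrite -enorm_eq0 z1 oner_eq0.
have x0 := one_enorm_gt0 p.1.
have xN : 0 <= (1 + enorm p.1) ^+ N by rewrite exprn_ge0// ltW.
rewrite -[X in X * _](ger0_norm xN) -normrM.
have ir := ray_integrable k p.1 mh rh z0.
rewrite -RintegralZl//.
have iz : mu.-integrable setT (EFin \o (fun t => (1 + enorm p.1) ^+ N * (t ^+ k * h (p.1 + t *: p.2)))).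
  exact: (integrableZl measurableT _ ir).
apply: (le_trans (le_normr_Rintegral measurableT iz)).
apply: le_Rintegral => //.
- exact: (integrable_norm iz).
- exact: (integrableZl measurableT M iD).
move=> t _; set X := p.1 + t *: p.2.
have [hx ht] := bundle_line_le t bp; rewrite -/X in hx ht.
have t0 : 0 < 1 + `|t| by rewrite ltr_pwDl.
rewrite ler_pdivlMr ?exprn_gt0// !normrM (ger0_norm xN) normrX.
apply: le_trans (HM X).
have -> : (1 + enorm p.1) ^+ N * (`|t| ^+ k * `|h X|) * (1 + `|t|) ^+ D =
    ((1 + enorm p.1) ^+ N * ((1 + `|t|) ^+ D * `|t| ^+ k)) * `|h X| by ring.
rewrite ler_wpM2r// !exprD.
have X0 := one_enorm_gt0 X.
have tX : `|t| <= 1 + enorm X by rewrite (le_trans ht)// lerDr.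
have e (a b : R) j : 0 <= a -> a <= b -> a ^+ j <= b ^+ j.
  by move=> a0 ab; rewrite lerXn2r ?nnegrE// (le_trans a0).
apply: ler_pM; rewrite ?mulr_ge0 ?exprn_ge0 ?(ltW t0) ?(ltW x0)//.
  by apply: e; [exact: ltW|rewrite lerD2l].
apply: ler_pM; rewrite ?exprn_ge0 ?(ltW t0)//.
  by apply: e; [exact: ltW|rewrite lerD2l].
by apply: e.
Qed.

Lemma bundle_measurable_ray k h : measurable_fun setT h -> bundle_measurable (ray k h).
Proof. by move=> mh; apply: bundle_measurable_fun; exact: measurable_ray. Qed.

Lemma bundle_integrable_ray k h : measurable_fun setT h -> rapid h ->
  bundle_integrable (ray k h).
Proof.
by move=> mh rh; apply: fast_integrable; [exact: bundle_measurable_ray|exact: fast_ray].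
Qed.

Lemma ray0B (f g : E -> R) p : measurable_fun setT f -> rapid f ->
  measurable_fun setT g -> rapid g -> p.2 != 0 ->
  ray 0 (fun x => f x - g x) p = ray 0 f p - ray 0 g p.
Proof.
move=> mf rf mg rg p0; have i1 := ray_integrable 0 p.1 mf rf p0.
have i2 := ray_integrable 0 p.1 mg rg p0.
rewrite -[RHS](RintegralB measurableT i1 i2); apply: eq_Rintegral => t _.
by rewrite mulrBr.
Qed.

Let ge0_frame_ray (xi : E) (P : E -> R) : enorm xi = 1 ->
  measurable_fun setT P -> rapid P -> (forall x, 0 <= P x) ->
  \int[leb R m.+2]_x P x = \int[leb R m.+1]_u ray 0 P (hplane xi u, xi).
Proof.
move=> xi1 mP rP P0; have xi0 : xi != 0 by rewrite -enorm_eq0 xi1 oner_eq0.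
rewrite /Rintegral; congr fine.
have mE : measurable_fun setT (fun x : E => (P x)%:E) by exact/measurable_EFinP.
rewrite (ge0_integral_frame xi1 mE); last by move=> x; rewrite lee_fin.
rewrite fubini_tonelli_leb1; last 2 first.
- apply: (measurableT_comp mE); apply: measurable_rvD; last by measurability.
  by apply: measurable_hplane; measurability.
- by move=> a u; rewrite lee_fin.
apply: eq_integral => u _; rewrite /ray /Rintegral fineK; last first.
  apply: integrable_fin_num => //.
  exact: (ray_integrable 0 (hplane xi u) mP rP xi0).
by apply: eq_integral => t _; rewrite mul1r.
Qed.

(** Integration over the space as integration over the rays orthogonal to a hyperplane. Tonelli
    covers the nonnegative functions H + |H| and |H|. *)
Lemma Rintegral_frame_ray (xi : E) (H : E -> R) : enorm xi = 1 ->
  measurable_fun setT H -> rapid H ->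
  \int[leb R m.+2]_x H x = \int[leb R m.+1]_u ray 0 H (hplane xi u, xi).
Proof.
move=> xi1 mH rH; have xi0 : xi != 0 by rewrite -enorm_eq0 xi1 oner_eq0.
pose Q x := `|H x|; pose P x := H x + Q x.
have mQ : measurable_fun setT Q by exact: (measurableT_comp (@normr_measurable _ setT) mH).
have rQ : rapid Q by exact: rapid_abs.
have mP : measurable_fun setT P by exact: measurable_funD.
have rP : rapid P by exact: rapidD.
have P0 x : 0 <= P x by rewrite /P /Q; have := ler_normr (- H x) 0; have := ler_norm (- H x); rewrite normrN; lra.
have Q0 x : 0 <= Q x by exact: normr_ge0.
have HE x : H x = P x - Q x by rewrite /P addrK.
have iray F : measurable_fun setT F -> rapid F ->
    (leb R m.+1).-integrable setT (EFin \o (fun u => ray 0 F (hplane xi u, xi))).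
  by move=> mF rF; exact: (bundle_integrable_slice (bundle_integrable_ray 0 mF rF) xi1).
transitivity (\int[leb R m.+2]_x (P x - Q x)); first by apply: eq_Rintegral => x _; exact: HE.
rewrite (RintegralB measurableT (rapid_integrable mP rP) (rapid_integrable mQ rQ)).
rewrite (ge0_frame_ray xi1 mP rP P0) (ge0_frame_ray xi1 mQ rQ Q0).
rewrite -(RintegralB measurableT (iray _ mP rP) (iray _ mQ rQ)).
apply: eq_Rintegral => u _; rewrite -ray0B//; apply: eq_Rintegral => t _.
by rewrite HE.
Qed.

Lemma rapid_dotp_pow k (xi : E) h : rapid h -> rapid (fun x => dotp x xi ^+ k * h x).
Proof.
apply: (@rapid_dominated _ _ (enorm xi ^+ k) k) => x.
rewrite normrM ler_wpM2r// normrX -exprMn lerXn2r ?nnegrE ?mulr_ge0 ?enorm_ge0 ?(ltW (one_enorm_gt0 _))//.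
by rewrite (le_trans (normr_dotp_le _ _))// mulrC ler_wpM2l ?enorm_ge0// lerDr.
Qed.

(** The Fourier slice theorem. On the ray through a point of the hyperplane, <y,x> is constant
    because <y,xi> = 0, and the parameter t equals <x,xi>, so the moment becomes a factor of h. *)
Lemma phase_transform_ray th k h p : measurable_fun setT h -> rapid h -> bundle p ->
  phase_transform th (ray k h) p = full_transform th (fun x => dotp x p.2 ^+ k * h x) p.1.
Proof.
case: p => y xi mh rh [/= xi1 yxi].
have xi0 : xi != 0 by rewrite -enorm_eq0 xi1 oner_eq0.
rewrite /full_transform [RHS](Rintegral_frame_ray xi1); last 2 first.
- apply: measurable_funM; first by apply: measurable_cos_fun; measurability.
  by measurability.
- by apply: rapid_cos; exact: rapid_dotp_pow.
apply: eq_Rintegral => u _ /=; rewrite /ray /=.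
rewrite -RintegralZl//; last exact: (ray_integrable k (hplane xi u) mh rh xi0).
apply: eq_Rintegral => t _; rewrite expr0 mul1r.
rewrite !dotpDr !dotpDl !dotpZl !dotpZr hplane_orth// yxi enorm1_dotp//.
by rewrite mulr0 addr0 add0r mulr1.
Qed.

Variable g : 'I_m.+2 -> E -> R.
Hypothesis rg : forall j, rapidly_decreasing (g j).

Let mg j : measurable_fun setT (g j).
Proof. exact: rapidly_decreasing_measurable. Qed.
Let qg j : rapid (g j).
Proof. exact: rapidly_decreasing_rapid. Qed.

Let d i j := 'D_(basis_vec R i) (g j).
Let rd i j : rapidly_decreasing (d i j).
Proof. exact: rapidly_decreasing_D. Qed.
Let md i j : measurable_fun setT (d i j).
Proof. exact: rapidly_decreasing_measurable. Qed.
Let qd i j : rapid (d i j).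
Proof. exact: rapidly_decreasing_rapid. Qed.

Definition ray_field k p : R := \sum_j p.2 0 j * ray k (g j) p.

Let A := ray_field 0 \o @retract R m.+2.

(** The factor xi_j has degree 1 in xi and the integral degree -1. Thus the zeroth moment coincides
    with its extension by [retract] off xi = 0, and its derivatives can be computed directly. *)
Lemma ray_field_retract p : p.2 != 0 -> A p = ray_field 0 p.
Proof.
move=> p0; have e0 : enorm p.2 != 0 by rewrite enorm_eq0.
apply: eq_bigr => j _; rewrite ray_retract//.
by rewrite /retract/= mxE; field.
Qed.

Let dR (v : E * E) p := \sum_j (v.2 0 j * ray 0 (g j) p +
  p.2 0 j * \sum_i (v.1 0 i * ray 0 (d i j) p + v.2 0 i * ray 1 (d i j) p)).

Let is_derive_A p v : p.2 != 0 -> is_derive p v A (dR v p).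
Proof.
case: p v => x z [v w] /= z0.
have Dj j : is_derive (x, z) (v, w) (fun q : E * E => q.2 0 j * ray 0 (g j) q)
    (w 0 j * ray 0 (g j) (x, z) + z 0 j *
      \sum_i (v 0 i * ray 0 (d i j) (x, z) + w 0 i * ray 1 (d i j) (x, z))).
  have Dc : is_derive (x, z) (v, w) (fun q : E * E => q.2 0 j) (w 0 j).
    apply/is_derive_line0; rewrite (_ : (fun s : R => _) = fun s => z 0 j + w 0 j * s); last first.
      by apply/funext => s; rewrite pair_lineE /= !mxE [s * _]mulrC.
    by apply: is_derive_eq; rewrite add0r mul1r [LHS]mulr1.
  have Dr := is_derive_ray x v w (rg j) z0.
  apply: (is_derive_eq (is_deriveM Dc Dr)).
  by rewrite !scale_regularE /= addrC [_ * w 0 j]mulrC.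
have D := is_derive_sum Dj.
have D2 : is_derive (x, z) (v, w) (ray_field 0) (dR (v, w) (x, z)).
  rewrite (_ : ray_field 0 = \sum_(j < m.+2) (fun q : E * E => q.2 0 j * ray 0 (g j) q)); last first.
    by apply/funext => q; rewrite fct_sumE.
  exact: D.
have N : nbhs ((x, z) : E * E) [set q : E * E | q.2 != 0].
  by apply: open_nbhs_nbhs; split; [exact: open_slit|exact: z0].
apply: near_eq_is_derive D2; apply: filterS N => q q0.
by rewrite ray_field_retract.
Qed.

Let DA p v : p.2 != 0 -> 'D_v A p = dR v p.
Proof. by move=> p0; exact: (@derive_val _ _ _ _ _ _ _ (is_derive_A v p0)). Qed.

Let measurable_coord2 j : measurable_fun setT (fun q : E * E => q.2 0 j).
Proof. by measurability. Qed.

Let measurable_dR v : measurable_fun setT (dR v).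
Proof.
apply: measurable_sum => j; apply: measurable_funD.
  by apply: measurable_funM => //; exact: measurable_ray.
apply: measurable_funM => //; apply: measurable_sum => i; apply: measurable_funD.
  by apply: measurable_funM => //; exact: measurable_ray.
by apply: measurable_funM => //; exact: measurable_ray.
Qed.

Let fast_dR v : fast (dR v).
Proof.
apply: fast_sum => j; apply: fastD; first by apply: fastZ; exact: fast_ray.
apply: fast_coord2; apply: fast_sum => i.
by apply: fastD; apply: fastZ; exact: fast_ray.
Qed.

Lemma bundle_measurable_ray_field k : bundle_measurable (ray_field k).
Proof.
apply: bundle_measurable_fun; apply: measurable_sum => j.
by apply: measurable_funM => //; exact: measurable_ray.
Qed.

Lemma fast_ray_field k : fast (ray_field k).
Proof. by apply: fast_sum => j; apply: fast_coord2; exact: fast_ray. Qed.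

Lemma bundle_C1_ray_field : bundle_C1 (ray_field 0).
Proof.
split => [p v p0|p v w c p0||v].
- by have [] := is_derive_A v p0.
- rewrite -/A !DA// /dR mulr_sumr -big_split; apply: eq_bigr => j _ /=.
  have -> : \sum_i ((c *: v + w).1 0 i * ray 0 (d i j) p + (c *: v + w).2 0 i * ray 1 (d i j) p) =
    c * \sum_i (v.1 0 i * ray 0 (d i j) p + v.2 0 i * ray 1 (d i j) p) +
    \sum_i (w.1 0 i * ray 0 (d i j) p + w.2 0 i * ray 1 (d i j) p).
    by rewrite mulr_sumr -big_split; apply: eq_bigr => i _ /=; rewrite !mxE; ring.
  by rewrite /= !mxE; ring.
- by split; [exact: bundle_measurable_ray_field|exact: fast_ray_field].
- split; last first.
    apply: (fast_ext _ (fast_dR v)) => q [q1 _].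
    by rewrite -/A DA// -enorm_eq0 q1 oner_eq0.
  have := bundle_measurable_fun (measurable_dR v); rewrite /bundle_measurable.
  congr (measurable_fun setT _); apply/funext => -[x z]; rewrite /bundle_ext/=.
  have [->|z0] := eqVneq z 0; first by rewrite !mul0r.
  by rewrite -/A DA//; exact: (@retract_snd_neq0 _ _ (x, z)).
Qed.

Lemma bundle_measurable_coord2 j (B : E * E -> R) : bundle_measurable B ->
  bundle_measurable (fun q => q.2 0 j * B q).
Proof.
by move=> mB; apply: bundle_measurableM => //; exact: bundle_measurable_fun.
Qed.

Let bundle_integrable_coord2 j (B : E * E -> R) : bundle_measurable B -> fast B ->
  bundle_integrable (fun q => q.2 0 j * B q).
Proof.
move=> mB fB; apply: fast_integrable; last exact: fast_coord2.
exact: bundle_measurable_coord2.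
Qed.

Lemma phase_ray_field th k p : bundle p ->
  phase_transform th (ray_field k) p =
  \sum_j p.2 0 j * full_transform th (fun x => dotp x p.2 ^+ k * g j x) p.1.
Proof.
move=> bp; rewrite /ray_field phase_transform_sum//; last first.
  by move=> j; apply: bundle_integrable_coord2; [exact: bundle_measurable_ray|exact: fast_ray].
apply: eq_bigr => j _; rewrite phase_transform_coord2 ?phase_transform_ray//.
exact: bundle_integrable_ray.
Qed.

Let dotp_derive (xi : E) j i u : is_derive u (basis_vec R i) (fun x => dotp x xi * g j x)
  (xi 0 i * g j u + dotp u xi * d i j u).
Proof.
have Dc : is_derive u (basis_vec R i) (fun x => dotp x xi) (xi 0 i).
  apply/is_derive_line0; rewrite (_ : (fun s : R => _) = fun s => dotp u xi + xi 0 i * s); last first.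
    by apply/funext => s; rewrite dotpDl dotpZl (dotpC (basis_vec R i)) dotp_basis [s * _]mulrC.
  by apply: is_derive_eq; rewrite add0r mul1r [LHS]mulr1.
apply: (is_derive_eq (is_deriveM Dc (rapidly_decreasing_derive _ _ (rg j)))).
by rewrite !scale_regularE addrC [g j u * _]mulrC.
Qed.

(** Differentiating I^0 in xi_i gives the ray integral of g_i plus the first moments of the fields
    d_i g_j contracted with xi. By the slice theorem the latter are transforms of <x,xi> d_i g_j
    over the whole space, and integrating by parts there produces y_i times the transform of I^1,
    minus the component of the field along xi. *)
Lemma phase_real_Xi_ray_field th i p : bundle p ->
  phase_transform th (real_Xi (ray_field 0) i) p =
  p.1 0 i * phase_transform (th + pi / 2) (ray_field 1) p + full_transform th (g i) p.1 -
  p.2 0 i * \sum_j p.2 0 j * full_transform th (g j) p.1.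
Proof.
move=> bp; have [xi1 _] := bp; have p0 : p.2 != 0 by rewrite -enorm_eq0 xi1 oner_eq0.
pose B (q : E * E) := ray 0 (g i) q + \sum_j q.2 0 j * ray 1 (d i j) q.
have ic j : bundle_integrable (fun q : E * E => q.2 0 j * ray 1 (d i j) q).
  by apply: bundle_integrable_coord2; [exact: bundle_measurable_ray|exact: fast_ray].
transitivity (phase_transform th B p).
  apply: phase_transform_ext => // q [q1 _].
  have q0 : q.2 != 0 by rewrite -enorm_eq0 q1 oner_eq0.
  rewrite (real_Xi_bundle bundle_C1_ray_field)// -/A DA// /dR /B big_split /=; congr (_ + _).
    rewrite (bigD1 i)//= /basis_vec mxE !eqxx mul1r big1 ?addr0// => j ji.
    by rewrite mxE (negbTE ji) mul0r.
  apply: eq_bigr => j _; congr (_ * _).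
  rewrite (bigD1 i)//= /basis_vec !mxE !eqxx mul1r mul0r add0r big1 ?addr0// => k ki.
  by rewrite !mxE (negbTE ki) !mul0r addr0.
rewrite phase_transformD//; last 2 first.
- exact: bundle_integrable_ray.
- exact: bundle_integrable_sum.
rewrite phase_transform_ray// phase_transform_sum//.
have -> : full_transform th (fun x => dotp x p.2 ^+ 0 * g i x) p.1 = full_transform th (g i) p.1.
  by apply: eq_Rintegral => x _; rewrite expr0 mul1r.
rewrite phase_ray_field// -addrA [RHS]addrC -addrA; congr (_ + _).
rewrite !mulr_sumr -sumrN -big_split; apply: eq_bigr => j _ /=.
rewrite phase_transform_coord2 ?phase_transform_ray//; last exact: bundle_integrable_ray.
(* Integration by parts for <x,xi> g_j, whose derivative in x_i is xi_i g_j + <x,xi> d_i g_j. *)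
have F : p.1 0 i * full_transform (th + pi / 2) (fun x => dotp x p.2 ^+ 1 * g j x) p.1 =
    p.2 0 i * full_transform th (g j) p.1 + full_transform th (fun x => dotp x p.2 ^+ 1 * d i j x) p.1.
  have mdot (h : E -> R) : measurable_fun setT h -> measurable_fun setT (fun x => dotp x p.2 * h x).
    by move=> mh; measurability.
  have rdot (h : E -> R) : rapid h -> rapid (fun x => dotp x p.2 * h x) by exact: (rapid_dotp_pow 1).
  rewrite -(full_transformZ th (p.2 0 i) p.1 (mg j) (qg j)) -full_transformD; last 4 first.
  - exact: measurable_funM.
  - exact: rapidZ.
  - exact: mdot.
  - exact: rdot.
  apply: full_transform_derivative.
  - exact: mdot.
  - exact: rdot.
  - by apply: measurable_funD; [exact: measurable_funM|exact: mdot].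
  - by apply: rapidD; [exact: rapidZ|exact: rdot].
  - by move=> u; exact: dotp_derive.
rewrite [p.1 0 i * (p.2 0 j * _)]mulrCA F; ring.
Qed.

End RayBundle.

(** The right side of the hypothesis is least at e = c/b, where it is (b + c)^2. As b or c may
    vanish, both are first increased by d/2, and d then tends to 0. *)
Lemma sqrt_triangle {R : realType} (A B C : R) : 0 <= B -> 0 <= C ->
  (forall e, 0 < e -> A <= (1 + e) * B + (1 + e^-1) * C) ->
  Num.sqrt A <= Num.sqrt B + Num.sqrt C.
Proof.
move=> B0 C0 H; set b := Num.sqrt B; set c := Num.sqrt C.
have b0 : 0 <= b by exact: sqrtr_ge0.
have c0 : 0 <= c by exact: sqrtr_ge0.
have BE : B = b ^+ 2 by rewrite sqr_sqrtr.
have CE : C = c ^+ 2 by rewrite sqr_sqrtr.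
apply/ler_addgt0Pr => d d0.
pose b' := b + d / 2; pose c' := c + d / 2.
have b'0 : 0 < b' by rewrite ltr_wpDl// divr_gt0.
have c'0 : 0 < c' by rewrite ltr_wpDl// divr_gt0.
have e0 : 0 < c' / b' by rewrite divr_gt0.
have -> : b + c + d = b' + c' by rewrite /b' /c'; field.
have s0 : 0 <= b' + c' by rewrite addr_ge0 ?ltW.
rewrite -(ger0_norm s0) -sqrtr_sqr ler_wsqrtr//.
apply: (le_trans (H _ e0)).
have -> : (b' + c') ^+ 2 = (1 + c' / b') * b' ^+ 2 + (1 + (c' / b')^-1) * c' ^+ 2.
  by field; rewrite !gt_eqF.
have h : 0 <= d / 2 by rewrite divr_ge0// ltW.
have bb : B <= b' ^+ 2 by rewrite BE lerXn2r ?nnegrE ?(ltW b'0)// lerDl.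
have cc : C <= c' ^+ 2 by rewrite CE lerXn2r ?nnegrE ?(ltW c'0)// lerDl.
have e1 : 0 <= 1 + c' / b' by rewrite addr_ge0// ltW.
have e2 : 0 <= 1 + (c' / b')^-1 by rewrite addr_ge0// invr_ge0 ltW.
by apply: lerD; rewrite ler_wpM2l.
Qed.

(** * Weighted norms on the bundle *)

Section CompletionNorm.
Context {R : realType} {V : zmodType} (D : set V) (N : V -> R).
Hypothesis N0 : forall x, D x -> N (x - x) = 0.
Hypothesis NC : forall x y, D x -> D y -> N (x - y) = N (y - x).
Hypothesis NT : forall x y, D x -> D y -> N x <= N y + N (x - y).

Let N_dist x y : D x -> D y -> `|N x - N y| <= N (x - y).
Proof.
move=> Dx Dy; have h1 := NT Dx Dy; have h2 := NT Dy Dx.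
by rewrite ler_norml; rewrite (NC Dy Dx) in h2; lra.
Qed.

Lemma cauchy_norm_cvg u : cauchy_seq D N u -> cvgn (N \o u).
Proof.
move=> [Du cu]; apply: cauchy_cvg; apply: cauchy_exP => e e0.
have [K HK] := cu e e0; exists (N (u K)); exists K => // k /= Kk.
rewrite -ball_normE /=; apply: le_lt_trans (HK _ _ (leqnn K) Kk).
exact: N_dist.
Qed.

Lemma class_norm_cvg (u w : nat -> V) (l : R) : cauchy_seq D N u -> class_of_seq D N u w ->
  (N \o u) @ \oo --> l -> (N \o w) @ \oo --> l.
Proof.
move=> [Du _] [[Dw _] wu] ul.
have d0 : (fun k => N (w k) - N (u k)) @ \oo --> (0 : R).
  apply: norm_cvg0.
  apply: (@squeeze_cvgr _ _ _ _ (fun=> 0) (fun k => N (w k - u k))) => //; last exact: cvg_cst.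
  by near=> k; rewrite normr_ge0 N_dist.
have E : N \o w = (fun k => N (w k) - N (u k)) \+ (N \o u).
  by apply/funext => k /=; rewrite subrK.
by rewrite E -[l]add0r; exact: cvgD d0 ul.
Unshelve. all: by end_near. Qed.

(** [completion_norm] chooses a limit of the norms along some sequence of the class; all these
    sequences give the same limit, so the choice is forced. [N0] puts u in its own class. *)
Lemma completion_norm_class (u : nat -> V) (l : R) : cauchy_seq D N u -> (N \o u) @ \oo --> l ->
  completion_norm N (class_of_seq D N u) = l.
Proof.
move=> cu ul; apply: xget_unique.
  exists u => //; split => //.
  rewrite (_ : (fun k => N (u k - u k)) = cst 0); first exact: cvg_cst.
  by apply/funext => k; rewrite N0//; case: cu.
move=> l' [w cw wl']; apply: (@cvg_unique _ (@Rhausdorff R) _ _ _ _ wl').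
exact: class_norm_cvg cw ul.
Qed.

End CompletionNorm.

(** * Weighted square norms on the bundle *)

Section WeightedNorm.
Context {R : realType} {m : nat}.
Local Notation E := 'rV[R]_m.+2.
Implicit Types (v a b : E * E -> R).

Lemma bundle_ext_eq a b : (forall p, bundle p -> a p = b p) -> bundle_ext a = bundle_ext b.
Proof.
move=> ab; apply/funext => -[x z]; rewrite /bundle_ext/=.
have [->|z0] := eqVneq z 0; first by rewrite !mul0r.
by rewrite ab//; exact: (@bundle_retract _ _ (x, z)).
Qed.

(** A class stable under sums, products and the coordinates of y, all of whose members are
    integrable against the admissible weights. *)
Definition tame v := bundle_measurable v /\ fast v.

Lemma tame_ext a b : (forall p, bundle p -> a p = b p) -> tame a -> tame b.
Proof.
move=> ab [ma fa]; split; last exact: fast_ext ab fa.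
by rewrite /bundle_measurable -(bundle_ext_eq ab).
Qed.

Lemma tameD a b : tame a -> tame b -> tame (fun p => a p + b p).
Proof.
by move=> [ma fa] [mb fb]; split; [exact: bundle_measurableD|exact: fastD].
Qed.

Lemma tameZ c a : tame a -> tame (fun p => c * a p).
Proof.
move=> [ma fa]; split; last exact: fastZ.
by apply: bundle_measurableM => //; exact: bundle_measurable_cst.
Qed.

Lemma tameM a b : tame a -> tame b -> tame (fun p => a p * b p).
Proof.
by move=> [ma fa] [mb fb]; split; [exact: bundle_measurableM|exact: fastM].
Qed.

Lemma tameB a b : tame a -> tame b -> tame (fun p => a p - b p).
Proof.
move=> ta tb; apply: (tame_ext _ (tameD ta (tameZ (-1) tb))) => p _.
by rewrite mulN1r.
Qed.

Lemma tame_coord1 i a : tame a -> tame (fun p => p.1 0 i * a p).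
Proof.
move=> [ma fa]; split; last exact: fast_coord1.
by apply: bundle_measurableM => //; apply: bundle_measurable_fun; measurability.
Qed.

Lemma tame0 : tame (fun=> 0).
Proof.
split; first exact: bundle_measurable_cst.
by move=> N; exists 0 => p _; rewrite normr0 mulr0.
Qed.

Lemma tame_sum I (s : seq I) (F : I -> E * E -> R) : (forall i, tame (F i)) ->
  tame (fun p => \sum_(i <- s) F i p).
Proof.
move=> tF; elim: s => [|i s IH].
  by apply: (tame_ext _ tame0) => p _; rewrite big_nil.
by apply: (tame_ext _ (tameD (tF i) IH)) => p _; rewrite big_cons.
Qed.

Lemma tame_integrable a : tame a -> bundle_integrable a.
Proof. by case; exact: fast_integrable. Qed.

Lemma tame_weight_integrable s t a : - (m.+1%:R / 2) < t -> tame a ->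
  bundle_integrable (fun p => weight s t p.1 * a p).
Proof. by move=> ht [ma fa]; exact: fast_weight_integrable. Qed.

Lemma eq_bint_bundle a b : (forall p, bundle p -> a p = b p) -> bint a = bint b.
Proof.
move=> ab; rewrite /bint /bundle_integral /sphere_integral; congr (fine (_ * _)).
apply: eq_integral => x; rewrite inE /= => /andP[x0 _].
apply: eq_integral => u _; rewrite ab//; split => /=; last first.
  by rewrite hyperplane_pointE hplane_orth// enorm_normalize// -enorm_gt0.
by apply: enorm_normalize; rewrite -enorm_gt0.
Qed.

Lemma bint_sum I (r : seq I) (F : I -> E * E -> R) : (forall i, bundle_integrable (F i)) ->
  bint (fun p => \sum_(i <- r) F i p) = \sum_(i <- r) bint (F i).
Proof.
move=> iF; elim: r => [|i r IH].
  rewrite big_nil; transitivity (bint (fun _ : E * E => 0 * 0 : R)).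
    by apply: eq_bint_bundle => p _; rewrite big_nil mul0r.
  by rewrite (@bintZ _ _ (fun=> 0) 0) ?mul0r//; exact: tame_integrable tame0.
rewrite big_cons -IH -bintD//; last exact: bundle_integrable_sum.
by apply: eq_bint_bundle => p _; rewrite big_cons.
Qed.

Definition weighted_normsq (s t : R) (I : finType) (F : I -> E * E -> R) : R :=
  bint (fun p => weight s t p.1 * \sum_i F i p ^+ 2).

Lemma weighted_normsq_ge0 s t (I : finType) (F : I -> E * E -> R) :
  0 <= weighted_normsq s t F.
Proof.
apply: bint_ge0 => p _; rewrite mulr_ge0 ?weight_ge0//.
by apply: sumr_ge0 => i _; exact: sqr_ge0.
Qed.

Lemma tame_sumsq (I : finType) (F : I -> E * E -> R) : (forall i, tame (F i)) ->
  tame (fun p => \sum_i F i p ^+ 2).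
Proof. by move=> tF; apply: tame_sum => i; exact: tameM. Qed.

(** The form of Minkowski's inequality with a free parameter e. It holds pointwise, hence integrates
    by monotonicity and linearity. *)
Lemma weighted_normsq_triangle s t (I : finType) (F G H : I -> E * E -> R) e :
  - (m.+1%:R / 2) < t -> 0 < e ->
  (forall i, tame (F i)) -> (forall i, tame (G i)) -> (forall i, tame (H i)) ->
  (forall i p, bundle p -> F i p = G i p + H i p) ->
  weighted_normsq s t F <=
    (1 + e) * weighted_normsq s t G + (1 + e^-1) * weighted_normsq s t H.
Proof.
move=> ht e0 tF tG tH FE.
have iF := tame_weight_integrable s ht (tame_sumsq tF).
have iG := tame_weight_integrable s ht (tame_sumsq tG).
have iH := tame_weight_integrable s ht (tame_sumsq tH).
rewrite /weighted_normsq -!bintZ// -bintD; last 2 first.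
- exact: bundle_integrableZ.
- exact: bundle_integrableZ.
apply: le_bint => //.
  by apply: bundle_integrableD; exact: bundle_integrableZ.
move=> p bp _.
rewrite mulrCA [X in _ + X]mulrCA -mulrDr ler_wpM2l ?weight_ge0//.
rewrite !mulr_sumr -big_split; apply: ler_sum => i _ /=; rewrite FE//.
move: (G i p) (H i p) => x y.
have h : 0 <= e^-1 * (e * x - y) ^+ 2 by rewrite mulr_ge0 ?sqr_ge0// invr_ge0 ltW.
(* The gap in the pointwise inequality is exactly the square (e x - y)^2 / e. *)
have E1 : (1 + e) * x ^+ 2 + (1 + e^-1) * y ^+ 2 = (x + y) ^+ 2 + e^-1 * (e * x - y) ^+ 2.
  by field; rewrite gt_eqF.
by rewrite E1 lerDl.
Qed.

End WeightedNorm.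

Local Open Scope complex_scope.
Local Notation Re := complex.Re.
Local Notation Im := complex.Im.

Section ComplexParts.
Context {R : realType}.
Implicit Types (x y : R[i]).

Lemma ReD x y : Re (x + y) = Re x + Re y.
Proof. by case: x y => [a b] [c d]. Qed.
Lemma ImD x y : Im (x + y) = Im x + Im y.
Proof. by case: x y => [a b] [c d]. Qed.
Lemma ReB x y : Re (x - y) = Re x - Re y.
Proof. by case: x y => [a b] [c d]. Qed.
Lemma ImB x y : Im (x - y) = Im x - Im y.
Proof. by case: x y => [a b] [c d]. Qed.
Lemma ReZ (c : R) x : Re (c%:C * x) = c * Re x.
Proof. by case: x => [a b] /=; rewrite mul0r subr0. Qed.
Lemma ImZ (c : R) x : Im (c%:C * x) = c * Im x.
Proof. by case: x => [a b] /=; rewrite mul0r addr0. Qed.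
Lemma Re_sum I (s : seq I) (F : I -> R[i]) :
  Re (\sum_(i <- s) F i) = \sum_(i <- s) Re (F i).
Proof. by apply: (big_morph _ ReD). Qed.
Lemma Im_sum I (s : seq I) (F : I -> R[i]) :
  Im (\sum_(i <- s) F i) = \sum_(i <- s) Im (F i).
Proof. by apply: (big_morph _ ImD). Qed.
Lemma Re_expi_mul (q : R) x : Re (expi (- q) * x) = cos q * Re x + sin q * Im x.
Proof. by case: x => [a b] /=; rewrite cosN sinN mulNr opprK. Qed.
Lemma Im_expi_mul (q : R) x : Im (expi (- q) * x) = cos q * Im x - sin q * Re x.
Proof. by case: x => [a b] /=; rewrite cosN sinN mulNr. Qed.
Lemma complexE x (a b : R) : Re x = a -> Im x = b -> x = a +i* b.
Proof. by case: x => [u v] /= -> ->. Qed.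
Lemma Re_mulJ x y : Re (x * y^*) = Re x * Re y + Im x * Im y.
Proof. by case: x y => [a b] [c d] /=; rewrite mulrN opprK. Qed.

End ComplexParts.

(** * Complex functions through their real and imaginary parts *)

Section FourierParts.
Context {R : realType} {m : nat}.
Local Notation E := 'rV[R]_m.+2.
Implicit Types (a b f g : E * E -> R) (phi : E * E -> R[i]) (p : E * E).

Definition re_part phi p : R := Re (phi p).
Definition im_part phi p : R := Im (phi p).

Definition fiber_const : R := (2 * pi) `^ (- ((m.+2%:R - 1) / 2)).

(** For phi = a + i b, the product e^(-iq) phi has real part a cos q + b sin q and imaginary part b
    cos q - a sin q. As sin q = cos(q - pi/2) and -sin q = cos(q - (pi/2 + pi)), both parts of the
    transform have this form, for th = pi/2 and, with a and b exchanged, for th = pi/2 + pi. *)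
Definition fourier_part th a b p : R :=
  fiber_const * (phase_transform 0 a p + phase_transform th b p).

Let sin_phase (q : R) : sin q = cos (q - pi / 2).
Proof. by rewrite cosB cos_pihalf sin_pihalf mulr0 add0r mulr1. Qed.

Let tuple_integral (f : 'rV[R]_m.+1 -> R) : measurable_fun setT f ->
  \int[lebesgue_tuple R m.+1]_u f (vec_of u) = \int[leb R m.+1]_u f u.
Proof.
by move=> mf; rewrite /Rintegral; congr fine; rewrite integral_leb//; exact/measurable_EFinP.
Qed.

Lemma bundle_fourierE phi p : bundle p -> tame (re_part phi) -> tame (im_part phi) ->
  bundle_fourier phi p = fourier_part (pi / 2) (re_part phi) (im_part phi) p
    +i* fourier_part (pi / 2 + pi) (im_part phi) (re_part phi) p.
Proof.
case: p => y xi bp ta tb; have [/= xi1 _] := bp.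
have ia := tame_integrable ta; have ib := tame_integrable tb.
have mq : measurable_fun setT (fun u : 'rV[R]_m.+1 => dotp y (hplane xi u)).
  by apply: measurable_dotp; [exact: measurable_cst|apply: measurable_hplane; measurability].
have ms (f : 'rV[R]_m.+1 -> R) : measurable_fun setT f -> measurable_fun setT (fun u => sin (f u)).
  by move=> mf; apply: (measurableT_comp _ mf); apply: continuous_measurable_fun; exact: continuous_sin.
have ma : measurable_fun setT (fun u => re_part phi (hplane xi u, xi)) by exact: measurable_slice1 xi1 ta.1.
have mb : measurable_fun setT (fun u => im_part phi (hplane xi u, xi)) by exact: measurable_slice1 xi1 tb.1.
have mc := measurable_cos_fun mq; have msq := ms _ mq.
apply: complexE.
- rewrite /bundle_fourier ReZ /cintegral /=; congr (_ * _).
  transitivity (\int[leb R m.+1]_u (cos (dotp y (hplane xi u) - 0) * re_part phi (hplane xi u, xi) +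
     cos (dotp y (hplane xi u) - pi / 2) * im_part phi (hplane xi u, xi))); last first.
    by rewrite RintegralD//; exact: phase_integrable.
  rewrite -tuple_integral; last first.
    apply: measurable_funD; apply: measurable_funM => //; apply: measurable_cos_fun; measurability.
  apply: eq_Rintegral => u _.
  by rewrite hyperplane_pointE Re_expi_mul subr0 sin_phase.
- rewrite /bundle_fourier ImZ /cintegral /=; congr (_ * _).
  transitivity (\int[leb R m.+1]_u (cos (dotp y (hplane xi u) - 0) * im_part phi (hplane xi u, xi) +
     cos (dotp y (hplane xi u) - (pi / 2 + pi)) * re_part phi (hplane xi u, xi))); last first.
    by rewrite RintegralD//; exact: phase_integrable.
  rewrite -tuple_integral; last first.
    apply: measurable_funD; apply: measurable_funM => //; apply: measurable_cos_fun; measurability.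
  apply: eq_Rintegral => u _.
  by rewrite hyperplane_pointE Im_expi_mul subr0 cosDpi_shift -sin_phase mulNr.
Qed.

Let Re_field n (z : R[i]) (u v : R) (c : 'I_n -> R) (F G : 'I_n -> R[i]) :
  Re (z - u%:C * \sum_j (c j)%:C * F j - v%:C * \sum_j (c j)%:C * G j) =
  Re z - u * \sum_j c j * Re (F j) - v * \sum_j c j * Re (G j).
Proof.
rewrite !ReB !ReZ !Re_sum; congr (_ - _ * _ - _ * _);
  by apply: eq_bigr => j _; rewrite ReZ.
Qed.

Let Im_field n (z : R[i]) (u v : R) (c : 'I_n -> R) (F G : 'I_n -> R[i]) :
  Im (z - u%:C * \sum_j (c j)%:C * F j - v%:C * \sum_j (c j)%:C * G j) =
  Im z - u * \sum_j c j * Im (F j) - v * \sum_j c j * Im (G j).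
Proof.
rewrite !ImB !ImZ !Im_sum; congr (_ - _ * _ - _ * _);
  by apply: eq_bigr => j _; rewrite ImZ.
Qed.

Lemma XiE i phi p : Xi i phi p = real_Xi (re_part phi) i p +i* real_Xi (im_part phi) i p.
Proof.
apply: complexE; rewrite /Xi /tXi; [exact: Re_field|exact: Im_field].
Qed.

Lemma derive_retract_ext f g v p : (forall q, bundle q -> f q = g q) -> p.2 != 0 ->
  'D_v (f \o @retract R m.+2) p = 'D_v (g \o @retract R m.+2) p.
Proof.
move=> fg p0.
have N : nbhs p [set q : E * E | q.2 != 0].
  by apply: open_nbhs_nbhs; split; [exact: open_slit|exact: p0].
apply: near_eq_derive; apply: filterS N => q q0.
by apply: fg; exact: bundle_retract.
Qed.

Lemma real_Xi_ext f g i p : (forall q, bundle q -> f q = g q) -> p.2 != 0 ->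
  real_Xi f i p = real_Xi g i p.
Proof.
move=> fg p0; rewrite /real_Xi; congr (_ - _ * _ - _ * _).
- exact: derive_retract_ext.
- by apply: eq_bigr => j _; congr (_ * _); exact: derive_retract_ext.
- by apply: eq_bigr => j _; congr (_ * _); exact: derive_retract_ext.
Qed.

Lemma bundle_C1_ext a b : (forall q, bundle q -> a q = b q) -> bundle_C1 a -> bundle_C1 b.
Proof.
move=> ab [da la ta Da].
have DE v p : p.2 != 0 -> 'D_v (b \o @retract R m.+2) p = 'D_v (a \o @retract R m.+2) p.
  by move=> p0; apply: esym; exact: derive_retract_ext.
split => [p v p0|p v w c p0||v].
- have N : nbhs p [set q : E * E | q.2 != 0].
    by apply: open_nbhs_nbhs; split; [exact: open_slit|exact: p0].
  have D := DeriveDef (da p v p0) erefl.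
  have D2 : is_derive p v (b \o @retract R m.+2) ('D_v (a \o @retract R m.+2) p).
    apply: near_eq_is_derive D; apply: filterS N => q q0.
    by apply: ab; exact: bundle_retract.
  by have [] := D2.
- by rewrite (DE _ _ p0) (DE _ _ p0) (DE _ _ p0); exact: la.
- exact: (tame_ext ab).
- apply: (tame_ext _ (Da v)) => q [q1 _]; apply: esym; apply: DE.
  by rewrite -enorm_eq0 q1 oner_eq0.
Qed.

Let field_lin (c x1 x2 u v s1 s2 t1 t2 : R) :
  c * (x1 + x2) - u * (c * (s1 + s2)) - v * (c * (t1 + t2)) =
  c * (x1 - u * s1 - v * t1 + (x2 - u * s2 - v * t2)).
Proof. by ring. Qed.

Lemma real_Xi_lin c f g i p :
  (forall j, derivable (f \o @retract R m.+2) p (basis_vec R j, 0)) ->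
  (forall j, derivable (f \o @retract R m.+2) p (0, basis_vec R j)) ->
  (forall j, derivable (g \o @retract R m.+2) p (basis_vec R j, 0)) ->
  (forall j, derivable (g \o @retract R m.+2) p (0, basis_vec R j)) ->
  real_Xi (fun q => c * (f q + g q)) i p = c * (real_Xi f i p + real_Xi g i p).
Proof.
move=> f1 f2 g1 g2.
have DE v : derivable (f \o @retract R m.+2) p v -> derivable (g \o @retract R m.+2) p v ->
    'D_v ((fun q => c * (f q + g q)) \o @retract R m.+2) p =
    c * ('D_v (f \o @retract R m.+2) p + 'D_v (g \o @retract R m.+2) p).
  move=> df dg.
  have D := is_deriveZ c (is_deriveD (DeriveDef df erefl) (DeriveDef dg erefl)).
  exact: (@derive_val _ _ _ _ _ _ _ D).
rewrite /real_Xi DE//.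
have S1 : \sum_j p.2 0 j * 'D_(basis_vec R j, 0) ((fun q => c * (f q + g q)) \o @retract R m.+2) p =
   c * (\sum_j p.2 0 j * 'D_(basis_vec R j, 0) (f \o @retract R m.+2) p +
        \sum_j p.2 0 j * 'D_(basis_vec R j, 0) (g \o @retract R m.+2) p).
  by rewrite -big_split mulr_sumr; apply: eq_bigr => j _ /=; rewrite DE// -mulrDr mulrCA.
have S2 : \sum_j p.2 0 j * 'D_(0, basis_vec R j) ((fun q => c * (f q + g q)) \o @retract R m.+2) p =
   c * (\sum_j p.2 0 j * 'D_(0, basis_vec R j) (f \o @retract R m.+2) p +
        \sum_j p.2 0 j * 'D_(0, basis_vec R j) (g \o @retract R m.+2) p).
  by rewrite -big_split mulr_sumr; apply: eq_bigr => j _ /=; rewrite DE// -mulrDr mulrCA.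
rewrite -[RHS]field_lin; congr (_ - _ * _ - _ * _); [exact: S1|exact: S2].
Qed.

Let phase_derivable th a p j : bundle_C1 a -> bundle p ->
  derivable (phase_transform th a \o @retract R m.+2) p (basis_vec R j, 0) /\
  derivable (phase_transform th a \o @retract R m.+2) p (0, basis_vec R j).
Proof.
move=> Ca bp; have [_ _ [ma fa] _] := Ca; split.
  by have [] := is_derive_phase_base th (basis_vec R j) ma fa bp.
case: p bp => y xi [xi1 yxi].
by have [] := is_derive_phase_direction Ca th (basis_vec R j) xi1 yxi.
Qed.

Lemma real_Xi_fourier_part th a b i p : bundle_C1 a -> bundle_C1 b -> bundle p ->
  real_Xi (fourier_part th a b) i p = fourier_part th (real_Xi a i) (real_Xi b i) p.
Proof.
move=> Ca Cb bp; rewrite /fourier_part real_Xi_lin.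
- by rewrite !real_Xi_phase_transform.
- by move=> j; exact: (phase_derivable _ _ Ca bp).1.
- by move=> j; exact: (phase_derivable _ _ Ca bp).2.
- by move=> j; exact: (phase_derivable _ _ Cb bp).1.
- by move=> j; exact: (phase_derivable _ _ Cb bp).2.
Qed.

Lemma Xi_bundle_fourier phi i p : bundle p ->
  bundle_C1 (re_part phi) -> bundle_C1 (im_part phi) ->
  Xi i (bundle_fourier phi) p =
    fourier_part (pi / 2) (real_Xi (re_part phi) i) (real_Xi (im_part phi) i) p
    +i* fourier_part (pi / 2 + pi) (real_Xi (im_part phi) i) (real_Xi (re_part phi) i) p.
Proof.
move=> bp Ca Cb; have [xi1 _] := bp; have p0 : p.2 != 0 by rewrite -enorm_eq0 xi1 oner_eq0.
have [_ _ ta _] := Ca; have [_ _ tb _] := Cb.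
rewrite XiE; congr (_ +i* _).
- rewrite -(real_Xi_fourier_part _ _ Ca Cb bp); apply: real_Xi_ext => // q bq.
  by rewrite /re_part bundle_fourierE.
- rewrite -(real_Xi_fourier_part _ _ Cb Ca bp); apply: real_Xi_ext => // q bq.
  by rewrite /im_part bundle_fourierE.
Qed.

(** Decay of the transforms is part of the definition because it has two different sources:
    integration by parts in the fibre for Schwartz functions, the slice theorem for ray
    transforms. *)
Definition good_field a := [/\ bundle_C1 a, forall th, tame (phase_transform th a) &
  forall th i, tame (phase_transform th (real_Xi a i))].

Definition good_scalar a := tame a /\ forall th, tame (phase_transform th a).

Lemma tame_phase th a : tame a -> fast (phase_transform th a) -> tame (phase_transform th a).
Proof.
by move=> ta f; split => //; apply: bundle_measurable_phase_transform; exact: tame_integrable.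
Qed.

Lemma real_Xi_tame a i : bundle_C1 a -> tame (real_Xi a i).
Proof.
move=> Ca; have [_ _ _ D] := Ca.
apply: (tame_ext _ (D (0, basis_vec R i))) => q [q1 _].
by apply: esym; apply: real_Xi_bundle => //; rewrite -enorm_eq0 q1 oner_eq0.
Qed.

Lemma bundle_rapidly_decreasing_good a : bundle_rapidly_decreasing a -> good_scalar a.
Proof.
move=> ra; have [_ _ ta _] := bundle_rapidly_decreasing_C1 ra; split => // th.
by apply: tame_phase => //; exact: fast_phase_transform.
Qed.

Lemma bundle_rapidly_decreasing_good_field a : bundle_rapidly_decreasing a ->
  (forall i, bundle_rapidly_decreasing (real_Xi a i)) -> good_field a.
Proof.
move=> ra rX; split; first exact: bundle_rapidly_decreasing_C1.
  by have [] := bundle_rapidly_decreasing_good ra.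
by move=> th i; have [] := bundle_rapidly_decreasing_good (rX i).
Qed.

Lemma phase_transformB th a b p : tame a -> tame b -> bundle p ->
  phase_transform th (fun q => a q - b q) p = phase_transform th a p - phase_transform th b p.
Proof.
move=> ta tb bp; have ia := tame_integrable ta; have ib := tame_integrable tb.
have -> : (fun q => a q - b q) = fun q => a q + -1 * b q.
  by apply/funext => q; rewrite mulN1r.
rewrite phase_transformD// ?phase_transformZ// ?mulN1r//.
exact: bundle_integrableZ.
Qed.

Lemma good_scalarB a b : good_scalar a -> good_scalar b -> good_scalar (fun p => a p - b p).
Proof.
move=> [ta pa] [tb pb]; split; first exact: tameB.
move=> th; apply: (tame_ext _ (tameB (pa th) (pb th))) => q bq.
by rewrite phase_transformB.
Qed.

Lemma real_XiB a b i p : bundle_C1 a -> bundle_C1 b -> p.2 != 0 ->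
  real_Xi (fun q => a q - b q) i p = real_Xi a i p - real_Xi b i p.
Proof.
move=> Ca Cb p0; rewrite (real_Xi_bundle (bundle_C1_sub Ca Cb))//.
rewrite (real_Xi_bundle Ca)// (real_Xi_bundle Cb)//.
have [da _ _ _] := Ca; have [db _ _ _] := Cb.
exact: deriveB (da _ _ p0) (db _ _ p0).
Qed.

Lemma good_fieldB a b : good_field a -> good_field b -> good_field (fun p => a p - b p).
Proof.
move=> [Ca pa Xa] [Cb pb Xb]; split; first exact: bundle_C1_sub.
  have [_ _ ta _] := Ca; have [_ _ tb _] := Cb => th.
  apply: (tame_ext _ (tameB (pa th) (pb th))) => q bq.
  by rewrite phase_transformB.
move=> th i; apply: (tame_ext _ (tameB (Xa th i) (Xb th i))) => q bq.
rewrite -phase_transformB//; [|exact: real_Xi_tame|exact: real_Xi_tame].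
apply: phase_transform_ext => // r [r1 _]; apply: esym; apply: real_XiB => //.
by rewrite -enorm_eq0 r1 oner_eq0.
Qed.

Lemma good_scalar_ext a b : (forall p, bundle p -> a p = b p) -> good_scalar a -> good_scalar b.
Proof.
move=> ab [ta pa]; split; first exact: tame_ext ab ta.
by move=> th; apply: (tame_ext _ (pa th)) => q bq; exact: phase_transform_ext.
Qed.

Lemma good_field_ext a b : (forall p, bundle p -> a p = b p) -> good_field a -> good_field b.
Proof.
move=> ab [Ca pa Xa]; split; first exact: bundle_C1_ext ab Ca.
  by move=> th; apply: (tame_ext _ (pa th)) => q bq; exact: phase_transform_ext.
move=> th i; apply: (tame_ext _ (Xa th i)) => q bq.
apply: phase_transform_ext => // r [r1 _]; apply: real_Xi_ext => //.
by rewrite -enorm_eq0 r1 oner_eq0.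
Qed.

End FourierParts.

(** Raising both indices by 1/2 multiplies the weight by |y|, which brings norms of different orders
    to a common weight. The point y = 0 is excluded because of the convention 0^0 = 1: the two sides
    differ there when t = -1/2. *)
Lemma weight_half {R : realType} n (s t : R) (y : 'rV[R]_n) : y != 0 ->
  weight (s + 1 / 2) (t + 1 / 2) y = enorm y * weight s t y.
Proof.
move=> y0; have e0 : enorm y != 0 by rewrite enorm_eq0.
rewrite /weight mulrA; congr (_ * _ `^ _); last by ring.
have -> : 2 * (t + 1 / 2) = 1 + 2 * t by field.
by rewrite powRD ?e0 ?implybT// powRr1 ?enorm_ge0.
Qed.

Section WeightedIntegral.
Context {R : realType} {m : nat}.
Local Notation E := 'rV[R]_m.+2.
Implicit Types (f g : E * E -> R).

Definition wbint (s t : R) f : R := bint (fun p => weight s t p.1 * f p).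

Variables (s t : R).
Hypothesis ht : - (m.+1%:R / 2) < t.

Lemma wbintD f g : tame f -> tame g ->
  wbint s t (fun p => f p + g p) = wbint s t f + wbint s t g.
Proof.
move=> tf tg; rewrite /wbint -bintD; [|exact: tame_weight_integrable|exact: tame_weight_integrable].
by apply: eq_bint_bundle => p _; rewrite mulrDr.
Qed.

Lemma wbintZ c f : tame f -> wbint s t (fun p => c * f p) = c * wbint s t f.
Proof.
move=> tf; rewrite /wbint -bintZ; last exact: tame_weight_integrable.
by apply: eq_bint_bundle => p _; rewrite mulrCA.
Qed.

Lemma wbint_sum I (r : seq I) (F : I -> E * E -> R) : (forall i, tame (F i)) ->
  wbint s t (fun p => \sum_(i <- r) F i p) = \sum_(i <- r) wbint s t (F i).
Proof.
move=> tF; rewrite -bint_sum; last by move=> i; exact: tame_weight_integrable.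
by apply: eq_bint_bundle => p _; rewrite mulr_sumr.
Qed.

Lemma le_wbint f g : tame f -> tame g -> (forall p, bundle p -> f p <= g p) ->
  wbint s t f <= wbint s t g.
Proof.
move=> tf tg fg; apply: le_bint.
- exact: tame_weight_integrable.
- exact: tame_weight_integrable.
by move=> p bp _; rewrite ler_wpM2l ?weight_ge0// fg.
Qed.

Lemma eq_wbint f g : (forall p, bundle p -> f p = g p) -> wbint s t f = wbint s t g.
Proof. by move=> fg; apply: eq_bint_bundle => p bp; rewrite fg. Qed.

End WeightedIntegral.

(** * Completing the square *)

Section ShiftedSquares.
Context {R : realType} {m : nat}.
Local Notation E := 'rV[R]_m.+2.
Implicit Types (f g : E * E -> R) (p : E * E).

Definition sumsq2 f g p : R := f p ^+ 2 + g p ^+ 2.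

Lemma tame_sumsq2 f g : tame f -> tame g -> tame (sumsq2 f g).
Proof. by move=> tf tg; exact: tameD (tameM tf tf) (tameM tg tg). Qed.

Variables (XR XI : 'I_m.+2 -> E * E -> R) (PR PI SR SI : E * E -> R).

(** Real and imaginary parts of X_i - i y_i S and of P, where X, P and S are the transforms of Xi_i
    phi, phi and psi. *)
Definition shifted_vec (k : 'I_m.+2 * bool + bool) p : R :=
  match k with
  | inl (i, true) => XR i p + p.1 0 i * SI p
  | inl (i, false) => XI i p - p.1 0 i * SR p
  | inr true => PR p
  | inr false => PI p
  end.

Definition cross_term p : R := \sum_i p.1 0 i * (XR i p * SI p - XI i p * SR p).
Definition scaled_sq p : R := \sum_i p.1 0 i * (p.1 0 i * sumsq2 SR SI p).
Definition total_sq p : R :=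
  \sum_i sumsq2 (XR i) (XI i) p + sumsq2 PR PI p + scaled_sq p.

Lemma sum_shifted_vec p : \sum_k shifted_vec k p ^+ 2 = total_sq p + 2 * cross_term p.
Proof.
rewrite big_sumType /= big_bool /=.
rewrite (eq_bigr (fun k : 'I_m.+2 * bool => (fun i j => shifted_vec (inl (i, j)) p ^+ 2) k.1 k.2)); last first.
  by move=> [i j] _.
rewrite -(pair_bigA _ (fun i j => shifted_vec (inl (i, j)) p ^+ 2)) /=.
have E1 : \sum_i \sum_j (if j then XR i p + p.1 0 i * SI p else XI i p - p.1 0 i * SR p) ^+ 2 =
    \sum_i sumsq2 (XR i) (XI i) p + scaled_sq p + 2 * cross_term p.
  rewrite /scaled_sq /cross_term mulr_sumr -!big_split; apply: eq_bigr => i _ /=.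
  by rewrite big_bool /= /sumsq2; ring.
rewrite E1 /total_sq -/(sumsq2 PR PI p).
move: (cross_term p) (scaled_sq p) (sumsq2 PR PI p) (\sum_i _) => x1 x2 x3 x4; ring.
Qed.

(** Nonnegativity of |X_i + i y_i S|^2, the square with the opposite sign. This is the origin of the
    factor 2 in the estimate. *)
Lemma cross_term_le p : 2 * cross_term p <= total_sq p.
Proof.
suff h : 2 * cross_term p <= \sum_i sumsq2 (XR i) (XI i) p + scaled_sq p.
  have P0 : 0 <= sumsq2 PR PI p by rewrite addr_ge0 ?sqr_ge0.
  by apply: (le_trans h); rewrite /total_sq addrAC lerDl.
rewrite /cross_term /scaled_sq mulr_sumr -big_split; apply: ler_sum => i _ /=.
rewrite /sumsq2; move: (XR i p) (XI i p) (SR p) (SI p) (p.1 0 i) => x1 x2 x3 x4 x5.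
have h1 : 0 <= (x1 - x5 * x4) ^+ 2 by exact: sqr_ge0.
have h2 : 0 <= (x2 + x5 * x3) ^+ 2 by exact: sqr_ge0.
rewrite -subr_ge0; apply: le_trans (addr_ge0 h1 h2) _.
by rewrite le_eqVlt; apply/orP; left; apply/eqP; ring.
Qed.

Hypotheses (tXR : forall i, tame (XR i)) (tXI : forall i, tame (XI i))
  (tPR : tame PR) (tPI : tame PI) (tSR : tame SR) (tSI : tame SI).

Lemma tame_shifted_vec k : tame (shifted_vec k).
Proof.
case: k => [[i []]|[]] //=.
  exact: tameD (tXR i) (tame_coord1 i tSI).
exact: tameB (tXI i) (tame_coord1 i tSR).
Qed.

Let tX i : tame (sumsq2 (XR i) (XI i)).
Proof. exact: tame_sumsq2. Qed.
Let tP : tame (sumsq2 PR PI).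
Proof. exact: tame_sumsq2. Qed.
Let tS : tame (sumsq2 SR SI).
Proof. exact: tame_sumsq2. Qed.
Let tcross : tame cross_term.
Proof.
apply: tame_sum => i; apply: tame_coord1.
exact: tameB (tameM (tXR i) tSI) (tameM (tXI i) tSR).
Qed.
Let tscaled : tame scaled_sq.
Proof. by apply: tame_sum => i; exact: tame_coord1 (tame_coord1 i tS). Qed.
Let tsumX : tame (fun p => \sum_i sumsq2 (XR i) (XI i) p).
Proof. exact: tame_sum. Qed.
Let ttotal : tame total_sq.
Proof. exact: tameD (tameD tsumX tP) tscaled. Qed.

Variables (s t : R).
Hypothesis ht : - (m.+1%:R / 2) < t + 1 / 2.

(** The sum of the y_i^2 is |y|^2, which raises both indices of the weight from 1/2 to 3/2. The
    equality is needed only for y nonzero, the zero section being negligible. *)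
Let scaled_norm : wbint (s + 3 / 2) (t + 3 / 2) (sumsq2 SR SI) =
  wbint (s + 1 / 2) (t + 1 / 2) scaled_sq.
Proof.
apply: eq_bint.
- by apply: tame_weight_integrable => //; move: ht; lra.
- exact: tame_weight_integrable.
move=> [y xi] _ /= y0.
have -> : s + 3 / 2 = (s + 1 / 2 + 1 / 2) + 1 / 2 by field.
have -> : t + 3 / 2 = (t + 1 / 2 + 1 / 2) + 1 / 2 by field.
rewrite !weight_half// /scaled_sq /=.
have -> : \sum_i y 0 i * (y 0 i * sumsq2 SR SI (y, xi)) = enorm y ^+ 2 * sumsq2 SR SI (y, xi).
  by rewrite enorm_sqr /dotp mulr_suml; apply: eq_bigr => i _; rewrite mulrA.
by move: (sumsq2 _ _ _) => x; ring.
Qed.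

Lemma wbint_total_sq :
  \sum_i wbint (s + 1 / 2) (t + 1 / 2) (sumsq2 (XR i) (XI i)) +
  wbint (s + 1 / 2) (t + 1 / 2) (sumsq2 PR PI) +
  wbint (s + 3 / 2) (t + 3 / 2) (sumsq2 SR SI) =
  wbint (s + 1 / 2) (t + 1 / 2) total_sq.
Proof.
rewrite scaled_norm; apply: esym.
apply: (eq_trans (wbintD (s + 1 / 2) ht (tameD tsumX tP) tscaled)); congr (_ + _).
apply: (eq_trans (wbintD (s + 1 / 2) ht tsumX tP)); congr (_ + _).
exact: (wbint_sum (s + 1 / 2) ht _ tX).
Qed.

Lemma weighted_normsq_shifted_vec :
  weighted_normsq (s + 1 / 2) (t + 1 / 2) shifted_vec =
  wbint (s + 1 / 2) (t + 1 / 2) total_sq + 2 * wbint (s + 1 / 2) (t + 1 / 2) cross_term.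
Proof.
rewrite -(wbintZ (s + 1 / 2) ht 2 tcross).
rewrite -(wbintD (s + 1 / 2) ht ttotal (tameZ 2 tcross)).
by apply: eq_wbint => p bp; rewrite sum_shifted_vec.
Qed.

Lemma weighted_normsq_shifted_vec_le :
  weighted_normsq (s + 1 / 2) (t + 1 / 2) shifted_vec <=
  2 * wbint (s + 1 / 2) (t + 1 / 2) total_sq.
Proof.
rewrite -(wbintZ (s + 1 / 2) ht 2 ttotal); apply: le_wbint => //.
- by apply: tame_sumsq => k; exact: tame_shifted_vec.
- exact: tameZ.
by move=> p _; rewrite sum_shifted_vec; have := cross_term_le p; lra.
Qed.

(** The denominator |y| of Z lowers the weight of indices (s + 1, t + 1) by half a step; at y = 0
    both integrands vanish. *)
Lemma weighted_cross_term :
  bint (fun p => weight (s + 1) (t + 1) p.1 *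
    \sum_i (p.1 0 i / enorm p.1) * (XR i p * SI p - XI i p * SR p)) =
  wbint (s + 1 / 2) (t + 1 / 2) cross_term.
Proof.
apply: eq_bint_bundle => p bp; rewrite /cross_term !mulr_sumr; apply: eq_bigr => i _.
case: p bp => y xi bp /=; move: (XR i _ * _ - _) => x.
have [->|y0] := eqVneq y 0; first by rewrite mxE !mul0r !mulr0.
have -> : s + 1 = (s + 1 / 2) + 1 / 2 by field.
have -> : t + 1 = (t + 1 / 2) + 1 / 2 by field.
rewrite weight_half//; field; by rewrite enorm_eq0.
Qed.

End ShiftedSquares.

(** * The norm of the pair space as a weighted square norm *)

Section PairNorm.
Context {R : realType} {m : nat}.
Local Notation E := 'rV[R]_m.+2.
Local Notation F := (E * E -> R[i]).
Implicit Types (a b c d : E * E -> R) (phi : F) (w : F * F) (p : E * E).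

Lemma fourier_part_ext th a b a' b' p : bundle p ->
  (forall q, bundle q -> a q = a' q) -> (forall q, bundle q -> b q = b' q) ->
  fourier_part th a b p = fourier_part th a' b' p.
Proof.
by move=> bp aa bb; congr (_ * (_ + _)); exact: phase_transform_ext.
Qed.

Lemma fourier_partB th a b a' b' p : bundle p -> tame a -> tame b -> tame a' -> tame b' ->
  fourier_part th (fun q => a q - a' q) (fun q => b q - b' q) p =
  fourier_part th a b p - fourier_part th a' b' p.
Proof.
move=> bp ta tb ta' tb'; rewrite /fourier_part !phase_transformB// -mulrBr.
by congr (_ * _); rewrite opprD addrACA.
Qed.

Lemma tame_fourier_part th a b : tame (phase_transform 0 a) ->
  tame (phase_transform th b) -> tame (fourier_part th a b).
Proof. by move=> ta tb; apply: tameZ; exact: tameD. Qed.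

(* The cross term of the norm of [(phi, psi)] makes it the norm of the functions
   [(Xi_i phi)^ - i y_i psi^] and [phi^]. *)
Definition pair_component w :=
  let a := re_part w.1 in let b := im_part w.1 in
  let c := re_part w.2 in let d := im_part w.2 in
  shifted_vec (fun i => fourier_part (pi / 2) (real_Xi a i) (real_Xi b i))
    (fun i => fourier_part (pi / 2 + pi) (real_Xi b i) (real_Xi a i))
    (fourier_part (pi / 2) a b) (fourier_part (pi / 2 + pi) b a)
    (fourier_part (pi / 2) c d) (fourier_part (pi / 2 + pi) d c).

Definition good_pair w := [/\ good_field (re_part w.1), good_field (im_part w.1),
  good_scalar (re_part w.2) & good_scalar (im_part w.2)].

Lemma tame_pair_component w k : good_pair w -> tame (pair_component w k).
Proof.
move=> [[_ pa Xa] [_ pb Xb] [_ pc] [_ pd]].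
by apply: tame_shifted_vec => [i|i||||]; exact: tame_fourier_part.
Qed.

Lemma re_partB phi phi' : re_part (phi - phi') = fun p => re_part phi p - re_part phi' p.
Proof. by apply/funext => p; rewrite /re_part -ReB. Qed.

Lemma im_partB phi phi' : im_part (phi - phi') = fun p => im_part phi p - im_part phi' p.
Proof. by apply/funext => p; rewrite /im_part -ImB. Qed.

Lemma good_pairB w w' : good_pair w -> good_pair w' -> good_pair (w - w').
Proof.
move=> [a b c d] [a' b' c' d']; split => /=; rewrite ?re_partB ?im_partB.
- exact: good_fieldB.
- exact: good_fieldB.
- exact: good_scalarB.
- exact: good_scalarB.
Qed.

Let subD (x1 x2 y z1 z2 : R) : x1 - x2 + y * (z1 - z2) = (x1 + y * z1) - (x2 + y * z2).
Proof. by ring. Qed.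

Let subB (x1 x2 y z1 z2 : R) : x1 - x2 - y * (z1 - z2) = (x1 - y * z1) - (x2 - y * z2).
Proof. by ring. Qed.

Lemma pair_componentB w w' k p : good_pair w -> good_pair w' -> bundle p ->
  pair_component (w - w') k p = pair_component w k p - pair_component w' k p.
Proof.
move=> [[Ca pa Xa] [Cb pb Xb] [tc pc] [td pd]] [[Ca' pa' Xa'] [Cb' pb' Xb'] [tc' pc'] [td' pd']] bp.
have [_ _ ta _] := Ca; have [_ _ ta' _] := Ca'; have [_ _ tb _] := Cb; have [_ _ tb' _] := Cb'.
have X (a a' : E * E -> R) i : bundle_C1 a -> bundle_C1 a' -> forall q, bundle q ->
    real_Xi (fun p => a p - a' p) i q = real_Xi a i q - real_Xi a' i q.
  by move=> C C' q [q1 _]; apply: real_XiB => //; rewrite -enorm_eq0 q1 oner_eq0.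
rewrite /pair_component !re_partB !im_partB; case: k => [[i []]|[]] /=.
- rewrite (fourier_part_ext _ bp (X _ _ i Ca Ca') (X _ _ i Cb Cb')).
  rewrite (fourier_partB (pi / 2) bp (real_Xi_tame i Ca) (real_Xi_tame i Cb) (real_Xi_tame i Ca') (real_Xi_tame i Cb')).
  by rewrite (fourier_partB (pi / 2 + pi) bp td tc td' tc'); exact: subD.
- rewrite (fourier_part_ext _ bp (X _ _ i Cb Cb') (X _ _ i Ca Ca')).
  rewrite (fourier_partB (pi / 2 + pi) bp (real_Xi_tame i Cb) (real_Xi_tame i Ca) (real_Xi_tame i Cb') (real_Xi_tame i Ca')).
  by rewrite (fourier_partB (pi / 2) bp tc td tc' td'); exact: subB.
- by rewrite fourier_partB.
- by rewrite fourier_partB.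
Qed.

Lemma bundle_normsqE s t phi : tame (re_part phi) -> tame (im_part phi) ->
  bundle_normsq s t phi = (2 * pi)^-1 * wbint s t
    (sumsq2 (fourier_part (pi / 2) (re_part phi) (im_part phi))
      (fourier_part (pi / 2 + pi) (im_part phi) (re_part phi))).
Proof.
move=> ta tb; rewrite /bundle_normsq /fourier_ip ReZ; congr (_ * _).
rewrite -[LHS]/(bint (fun p => Re ((weight s t p.1)%:C *
  (bundle_fourier phi p * (bundle_fourier phi p)^*)))).
apply: eq_bint_bundle => p bp; rewrite ReZ; congr (_ * _).
by rewrite Re_mulJ (bundle_fourierE bp ta tb).
Qed.

Lemma re_part_Xi i phi : re_part (Xi i phi) = real_Xi (re_part phi) i.
Proof. by apply/funext => p; rewrite /re_part XiE. Qed.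

Lemma im_part_Xi i phi : im_part (Xi i phi) = real_Xi (im_part phi) i.
Proof. by apply/funext => p; rewrite /im_part XiE. Qed.

Variables (s t : R).
Hypothesis ht : - (m.+2%:R / 2) < t.

(** The condition t > -n/2 on R^n is exactly the integrability of the weight of index t + 1/2 on
    fibres of dimension n - 1. *)
Let ht1 : - (m.+1%:R / 2) < t + 1 / 2.
Proof. by move: ht; rewrite -natr1; lra. Qed.

Let distr3 (k x y z : R) : k * (x + y + z) = k * x + k * y + k * z.
Proof. by ring. Qed.

Let scale_sum (x y k : R) : k * x + 2 * (k * y) = k * (x + 2 * y).
Proof. by ring. Qed.

Let le_scaled (x y k l : R) : 0 <= l -> 0 <= k -> x <= 2 * y -> l * (k * x) <= 2 * l * (k * y).
Proof.
move=> l0 k0 xy; have -> : 2 * l * (k * y) = l * (k * (2 * y)) by ring.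
by rewrite !ler_wpM2l.
Qed.

Section pair.
Variable w : F * F.
Hypothesis gw : good_pair w.
Let a := re_part w.1.
Let b := im_part w.1.
Let c := re_part w.2.
Let d := im_part w.2.
Let XR i := fourier_part (pi / 2) (real_Xi a i) (real_Xi b i).
Let XI i := fourier_part (pi / 2 + pi) (real_Xi b i) (real_Xi a i).
Let SR := fourier_part (pi / 2) c d.
Let SI := fourier_part (pi / 2 + pi) d c.
Let PR := fourier_part (pi / 2) a b.
Let PI := fourier_part (pi / 2 + pi) b a.

Let tXR i : tame (XR i).
Proof. by have [[_ pa Xa] [_ pb Xb] _ _] := gw; exact: tame_fourier_part. Qed.
Let tXI i : tame (XI i).
Proof. by have [[_ pa Xa] [_ pb Xb] _ _] := gw; exact: tame_fourier_part. Qed.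
Let tPR : tame PR.
Proof. by have [[_ pa Xa] [_ pb Xb] _ _] := gw; exact: tame_fourier_part. Qed.
Let tPI : tame PI.
Proof. by have [[_ pa Xa] [_ pb Xb] _ _] := gw; exact: tame_fourier_part. Qed.
Let tSR : tame SR.
Proof. by have [_ _ [_ pc] [_ pd]] := gw; exact: tame_fourier_part. Qed.
Let tSI : tame SI.
Proof. by have [_ _ [_ pc] [_ pd]] := gw; exact: tame_fourier_part. Qed.

Let imul_conj (z y : R[i]) : Re ('i%C * z * y^*) = Re z * Im y - Im z * Re y.
Proof. by case: z y => [z1 z2] [y1 y2] /=; ring. Qed.

Let Z_fourierE p (x y : R) : bundle p ->
  Re (Z_fourier w.1 p) * x - Im (Z_fourier w.1 p) * y =
  \sum_i (p.1 0 i / enorm p.1) * (XR i p * x - XI i p * y).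
Proof.
move=> bp; have [[Ca _ _] [Cb _ _] _ _] := gw.
rewrite /Z_fourier Re_sum Im_sum !mulr_suml -sumrB; apply: eq_bigr => i _.
rewrite ReZ ImZ (Xi_bundle_fourier i bp Ca Cb) -/a -/b.
rewrite -[Re (_ +i* _)]/(XR i p) -[Im (_ +i* _)]/(XI i p).
by move: (XR i p) (XI i p) (p.1 0 i / enorm p.1) => c1 c2 c3; ring.
Qed.

Let cross_ip : Re (fourier_ip (s + 1) (t + 1) (fun p => 'i%C * Z_fourier w.1 p) (bundle_fourier w.2)) =
  (2 * pi)^-1 * wbint (s + 1 / 2) (t + 1 / 2) (cross_term XR XI SR SI).
Proof.
have [_ _ [tc _] [td _]] := gw.
rewrite /fourier_ip ReZ; congr (_ * _); rewrite -weighted_cross_term.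
rewrite -[LHS]/(bint (fun p => Re ((weight (s + 1) (t + 1) p.1)%:C *
  ('i%C * Z_fourier w.1 p * (bundle_fourier w.2 p)^*)))).
apply: eq_bint_bundle => p bp; rewrite ReZ; congr (_ * _).
by rewrite imul_conj (bundle_fourierE bp tc td); exact: Z_fourierE.
Qed.

Let main_norm :
  \sum_i bundle_normsq (s + 1 / 2) (t + 1 / 2) (Xi i w.1)
   + bundle_normsq (s + 1 / 2) (t + 1 / 2) w.1
   + bundle_normsq (s + 3 / 2) (t + 3 / 2) w.2 =
  (2 * pi)^-1 * wbint (s + 1 / 2) (t + 1 / 2) (total_sq XR XI PR PI SR SI).
Proof.
have [[Ca _ _] [Cb _ _] [tc _] [td _]] := gw.
have [_ _ ta _] := Ca; have [_ _ tb _] := Cb.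
rewrite -wbint_total_sq//; apply: eq_trans (esym (distr3 _ _ _ _)); congr (_ + _ + _).
- rewrite mulr_sumr; apply: eq_bigr => i _.
  have tr : tame (re_part (Xi i w.1)) by rewrite re_part_Xi; exact: real_Xi_tame.
  have ti : tame (im_part (Xi i w.1)) by rewrite im_part_Xi; exact: real_Xi_tame.
  have := bundle_normsqE (s + 1 / 2) (t + 1 / 2) tr ti.
  by rewrite re_part_Xi im_part_Xi.
- exact: bundle_normsqE.
- exact: bundle_normsqE.
Qed.

(** The cross term, once brought to the weight of indices (s + 1/2, t + 1/2), completes the square.
    In particular the expression under the root is nonnegative and the norm is Euclidean in linear
    data. *)
Lemma pair_normsqE : pair_normsq s t w = a_const R m.+2 *
  ((2 * pi)^-1 * weighted_normsq (s + 1 / 2) (t + 1 / 2) (pair_component w)).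
Proof.
rewrite /pair_normsq; apply: f_equal.
apply: (eq_trans (f_equal2 (fun u v => u + 2 * v) main_norm cross_ip)).
apply: (eq_trans (scale_sum _ _ _)); apply: f_equal.
exact: (esym (weighted_normsq_shifted_vec tXR tXI tPR tPI tSR tSI s ht1)).
Qed.

Lemma pair_normsq_le : 0 <= a_const R m.+2 -> pair_normsq s t w <= 2 * a_const R m.+2 *
  (\sum_i bundle_normsq (s + 1 / 2) (t + 1 / 2) (Xi i w.1)
   + bundle_normsq (s + 1 / 2) (t + 1 / 2) w.1
   + bundle_normsq (s + 3 / 2) (t + 3 / 2) w.2).
Proof.
move=> a0; rewrite pair_normsqE.
apply: (@eq_ind_r _ _ (fun M => _ <= 2 * a_const R m.+2 * M) _ _ main_norm).
apply: le_scaled => //.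
  by rewrite invr_ge0 mulr_ge0// pi_ge0.
exact: (weighted_normsq_shifted_vec_le tXR tXI tPR tPI tSR tSI s ht1).
Qed.

End pair.
End PairNorm.

(** * Decay of Fourier transforms on Euclidean space *)

Section FullTransformDecay.
Context {R : realType} {n : nat}.
Local Notation E := 'rV[R]_n.+1.
Implicit Types (f g : E -> R).

(** Only the pure derivatives in each coordinate are used, and they are supplied as a family F. This
    also covers products with a linear form, whose derivatives are explicit. *)
Lemma rapid_full_transform_family th f (F : 'I_n.+1 -> nat -> E -> R) :
  (forall i, F i 0%N = f) -> (forall i k, measurable_fun setT (F i k)) ->
  (forall i k, rapid (F i k)) ->
  (forall i k u, is_derive u (basis_vec R i) (F i k) (F i k.+1 u)) ->
  rapid (full_transform th f).
Proof.
move=> F0 mF rF dF.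
have FE i k t (y : E) : y 0 i ^+ k * full_transform (t + k%:R * (pi / 2)) f y =
    full_transform t (F i k) y.
  elim: k t => [|k IH] t; first by rewrite expr0 mul1r mul0r addr0 F0.
  rewrite exprS -mulrA.
  have -> : t + k.+1%:R * (pi / 2) = (t + pi / 2) + k%:R * (pi / 2).
    by rewrite -natr1; ring.
  by rewrite IH; exact: full_transform_derivative.
have bd i k (y : E) t : `|full_transform t (F i k) y| <= \int[leb R n.+1]_x `|F i k x|.
  apply: normr_Rintegral_cos_le; first by measurability.
  exact: rapid_integrable.
move=> N; have [C [C0 HC]] := @pow_enorm_le R n.+1 N.
exists (C * ((\int[leb R n.+1]_x `|f x|) + \sum_i \int[leb R n.+1]_x `|F i N x|)) => y.
apply: (@le_trans _ _ (C * (1 + \sum_i `|y 0 i| ^+ N) * `|full_transform th f y|)).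
  by rewrite ler_wpM2r.
rewrite -mulrA ler_wpM2l// mulrDl mul1r mulr_suml; apply: lerD.
  by have := bd ord0 0%N y th; rewrite F0.
apply: ler_sum => i _; rewrite -normrX -normrM.
have -> : th = (th - N%:R * (pi / 2)) + N%:R * (pi / 2) by rewrite subrK.
by rewrite FE bd.
Qed.

Let D f i k := iter_derive (nseq k (basis_vec R i)) f.

Let DP f i k : rapidly_decreasing f -> [/\ measurable_fun setT (D f i k),
  rapid (D f i k) & forall u, is_derive u (basis_vec R i) (D f i k) (D f i k.+1 u)].
Proof.
move=> rf; have rD : rapidly_decreasing (D f i k) by exact: rapidly_decreasing_iter.
split; [exact: rapidly_decreasing_measurable|exact: rapidly_decreasing_rapid|].
by move=> u; exact: rapidly_decreasing_derive.
Qed.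

Lemma rapid_full_transform0 th f : rapidly_decreasing f -> rapid (full_transform th f).
Proof.
move=> rf; apply: (@rapid_full_transform_family th f (D f)) => //.
- by move=> i k; have [] := DP i k rf.
- by move=> i k; have [] := DP i k rf.
- by move=> i k; have [] := DP i k rf.
Qed.

Lemma rapid_full_transform_dotp th (w : E) f : rapidly_decreasing f ->
  rapid (full_transform th (fun x => dotp w x * f x)).
Proof.
move=> rf.
(* Leibniz's rule: the linear form is differentiated at most once. For k = 0 the index [k.-1] is a
   dummy, its coefficient being 0. *)
pose F i k (x : E) := dotp w x * D f i k x + (k%:R * w 0 i) * D f i k.-1 x.
apply: (@rapid_full_transform_family th _ F).
- by move=> i; apply/funext => x; rewrite /F /= !mul0r addr0.
- move=> i k; have [m1 _ _] := DP i k rf; have [m2 _ _] := DP i k.-1 rf.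
  apply: measurable_funD; last by apply: measurable_funM.
  by apply: measurable_funM => //; measurability.
- move=> i k; have [_ r1 _] := DP i k rf; have [_ r2 _] := DP i k.-1 rf.
  by apply: rapidD; [exact: rapid_dotp|exact: rapidZ].
- move=> i k u; have [_ _ d1] := DP i k rf; have [_ _ d2] := DP i k.-1 rf.
  have Dc : is_derive u (basis_vec R i) (dotp w) (w 0 i).
    apply/is_derive_line0; rewrite (_ : (fun s : R => _) = fun s => dotp w u + w 0 i * s); last first.
      by apply/funext => s; rewrite dotpDr dotpZr dotp_basis [s * _]mulrC.
    by apply: is_derive_eq; rewrite add0r mul1r [LHS]mulr1.
  apply: (is_derive_eq (is_deriveD (is_deriveM Dc (d1 u)) (is_deriveZ (k%:R * w 0 i) (d2 u)))).
  rewrite !scale_regularE /F; case: k {d1 d2} => [|k] /=; first by rewrite !mul0r addr0; ring.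
  by rewrite -(natr1 k.+1); ring.
Qed.

Lemma measurable_full_transform th f : measurable_fun setT f ->
  measurable_fun setT (full_transform th f).
Proof.
move=> mf; apply: (@measurable_Rintegral_param _ _ _ _ _ (leb R n.+1)
  (fun y x => cos (dotp y x - th) * f x)).
apply: measurable_funM; first by apply: measurable_cos_fun; measurability.
exact: (measurableT_comp mf measurable_snd).
Qed.

End FullTransformDecay.

Section RayGood.
Context {R : realType} {m : nat}.
Local Notation E := 'rV[R]_m.+2.
Variable g : 'I_m.+2 -> E -> R.
Hypothesis rg : forall j, rapidly_decreasing (g j).
Implicit Types (p : E * E).

Let mg j : measurable_fun setT (g j).
Proof. exact: rapidly_decreasing_measurable. Qed.
Let qg j : rapid (g j).
Proof. exact: rapidly_decreasing_rapid. Qed.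

Let fast_fst (F : E -> R) : rapid F -> fast (fun p => F p.1).
Proof. by move=> rF N; have [M HM] := rF N; exists M => p _. Qed.

Lemma phase_ray_field0 th p : bundle p -> phase_transform th (ray_field g 0) p =
  \sum_j p.2 0 j * full_transform th (g j) p.1.
Proof.
move=> bp; rewrite phase_ray_field//; apply: eq_bigr => j _; congr (_ * _).
by apply: eq_Rintegral => x _; rewrite expr0 mul1r.
Qed.

Let phase_ray_field1 th p : bundle p -> phase_transform th (ray_field g 1) p =
  \sum_j p.2 0 j * \sum_k p.2 0 k * full_transform th (fun x => dotp (basis_vec R k) x * g j x) p.1.
Proof.
move=> bp; rewrite phase_ray_field//; apply: eq_bigr => j _; congr (_ * _).
have mk k : measurable_fun setT (fun x => dotp (basis_vec R k) x * g j x) by measurability.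
have rk k : rapid (fun x => dotp (basis_vec R k) x * g j x) by exact: rapid_dotp.
transitivity (\sum_k full_transform th (fun x => p.2 0 k * (dotp (basis_vec R k) x * g j x)) p.1).
  rewrite -full_transform_sum; last 2 first.
  - by move=> k; exact: measurable_funM.
  - by move=> k; exact: rapidZ.
  apply: eq_Rintegral => x _; rewrite expr1 /dotp mulr_suml; congr (_ * _).
  apply: eq_bigr => k _; rewrite -/(dotp _ _) dotpC dotp_basis; ring.
by apply: eq_bigr => k _; rewrite full_transformZ.
Qed.

Let fast_phase0 th : fast (phase_transform th (ray_field g 0)).
Proof.
pose F p := \sum_j p.2 0 j * full_transform th (g j) p.1.
apply: (@fast_ext _ _ F) => [p bp|]; first by rewrite phase_ray_field0.
apply: fast_sum => j; apply: fast_coord2; apply: fast_fst.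
exact: rapid_full_transform0.
Qed.

Let fast_phase1 th : fast (phase_transform th (ray_field g 1)).
Proof.
pose F p := \sum_j p.2 0 j * \sum_k p.2 0 k * full_transform th (fun x => dotp (basis_vec R k) x * g j x) p.1.
apply: (@fast_ext _ _ F) => [p bp|]; first by rewrite phase_ray_field1.
apply: fast_sum => j; apply: fast_coord2; apply: fast_sum => k; apply: fast_coord2.
by apply: fast_fst; exact: rapid_full_transform_dotp.
Qed.

Let fast_phase_Xi th i : fast (phase_transform th (real_Xi (ray_field g 0) i)).
Proof.
pose F p := p.1 0 i * phase_transform (th + pi / 2) (ray_field g 1) p +
  (full_transform th (g i) p.1 + -1 * (p.2 0 i * \sum_j p.2 0 j * full_transform th (g j) p.1)).
apply: (@fast_ext _ _ F) => [p bp|].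
  by rewrite phase_real_Xi_ray_field// /F mulN1r addrA.
apply: fastD; first exact: fast_coord1.
apply: fastD; first by apply: fast_fst; exact: rapid_full_transform0.
apply: fastZ; apply: fast_coord2; apply: fast_sum => j; apply: fast_coord2.
by apply: fast_fst; exact: rapid_full_transform0.
Qed.

Let tame_ray_field k : tame (ray_field g k).
Proof. by split; [exact: bundle_measurable_ray_field|exact: fast_ray_field]. Qed.

Lemma good_field_ray : good_field (ray_field g 0).
Proof.
have C := bundle_C1_ray_field rg; split => // th; first exact: tame_phase.
by move=> i; apply: tame_phase => //; exact: real_Xi_tame.
Qed.

Lemma good_scalar_ray : good_scalar (ray_field g 1).
Proof. by split => // th; exact: tame_phase. Qed.

End RayGood.

(** * From the bundle to Euclidean space *)

Section SphereTransfer.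
Context {R : realType} {m : nat}.
Local Notation E := 'rV[R]_m.+2.
Variables (s t : R).
Hypothesis ht : - (m.+2%:R / 2) < t.

(** Raising the indices by 1/2 provides the factor |y| required by [sphere_hyperplane_integral]. The
    factor n comes from the definition of the sphere measure by cones. *)
Lemma wbint_sphere (G : E -> R) : measurable_fun setT G -> rapid G -> (forall y, 0 <= G y) ->
  exists b : R, [/\ 0 < b, @ball_moment R m = b%:E,
    (leb R m.+2).-integrable setT (EFin \o (fun y => weight s t y * G y)) &
    wbint (s + 1 / 2) (t + 1 / 2) (fun p => G p.1) =
      m.+2%:R * b * \int[leb R m.+2]_y (weight s t y * G y)].
Proof.
move=> mG rG G0; have [b [g [b0 _ bE _]]] := @ball_moment_gamma_fin R m.
have tG : tame (fun p : E * E => G p.1).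
  split; last by move=> N; have [M HM] := rG N; exists M => p _.
  by apply: bundle_measurable_fun; exact: (measurableT_comp mG measurable_fst).
have ht1 : - (m.+1%:R / 2) < t + 1 / 2 by move: ht; rewrite -natr1; lra.
have mw : measurable_fun setT (fun y : E => weight s t y).
  have me : measurable_fun setT (fun y : E => enorm y) by measurability.
  apply: measurable_funM; first exact: (measurableT_comp (measurable_powR (2 * t)) me).
  have m2 : measurable_fun setT (fun y : E => 1 + enorm y ^+ 2) by measurability.
  exact: (measurableT_comp (measurable_powR (s - t)) m2).
have iw := tame_weight_integrable (s + 1 / 2) ht1 tG.
pose H (p : E * E) := enorm p.1 * (weight s t p.1 * G p.1).
have H0 p : 0 <= H p by rewrite mulr_ge0 ?enorm_ge0// mulr_ge0 ?weight_ge0.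
have HE p : p.1 != 0 -> H p = weight (s + 1 / 2) (t + 1 / 2) p.1 * G p.1.
  by move=> p0; rewrite weight_half// /H mulrA.
have mH : measurable_fun setT H.
  apply: measurable_funM; first by measurability.
  by apply: (measurableT_comp (measurable_funM mw mG) measurable_fst).
have iH : bundle_integrable H.
  apply: bundle_integrable_dominated iw => [|p bp].
    exact: bundle_measurable_fun.
  rewrite ger0_norm//; have [p0|p0] := eqVneq p.1 0; last by rewrite HE.
  by rewrite /H p0 enorm0 mul0r mulr_ge0// weight_ge0.
have gm : measurable_fun setT (fun y : E => (weight s t y * G y)%:E).
  by apply/measurable_EFinP; exact: measurable_funM.
have g0 (y : E) : (0 <= (weight s t y * G y)%:E)%E.
  by rewrite lee_fin mulr_ge0 ?weight_ge0.
have E1 : (bint H)%:E = ((m.+2%:R * b)%:E * \int[leb R m.+2]_y (weight s t y * G y)%:E)%E.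
  rewrite (bint_eval iH H0) EFinM -muleA -bE -(sphere_hyperplane_integral gm g0).
  apply: f_equal; apply: eq_integral => z _.
  have [z0|z0] := boolP (0 < enorm z <= 1); last by rewrite !mul0e.
  apply: f_equal; apply: eq_integral => u _.
  rewrite /H /= enorm_hplane ?EFinM//; apply: enorm_normalize.
  by rewrite -enorm_gt0; case/andP: z0.
have c0 : 0 < m.+2%:R * b by rewrite mulr_gt0.
have I0 : (0 <= \int[leb R m.+2]_y (weight s t y * G y)%:E)%E by apply: integral_ge0.
(* The integral over the bundle is a real number by the decay of G on the fibres, and this forces
   integrability of the weighted function on R^n. *)
have fin : (\int[leb R m.+2]_y (weight s t y * G y)%:E)%E \is a fin_num.
  move: E1 I0; case: (\int[_]_y _)%E => [r| |] //.
  by rewrite gt0_muley ?lte_fin.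
exists b; split => //.
  apply/integrableP; split => //; rewrite ltey_eq.
  have -> : (\int[leb R m.+2]_y `|(EFin \o (fun y => weight s t y * G y)%R) y|)%E =
     (\int[leb R m.+2]_y (weight s t y * G y)%R%:E)%E.
    by apply: eq_integral => y _; rewrite gee0_abs//; exact: g0.
  by rewrite fin.
transitivity (bint H).
  apply: eq_bint => // -[y xi] _ /= y0; by rewrite HE.
apply: EFin_inj; rewrite E1 /Rintegral [RHS]EFinM fineK//.
Qed.

(** The product n * [ball_moment] is the area of the unit sphere of dimension n - 2, which
    [ball_moment_gamma] expresses by the Gamma function; a_n is its inverse. *)
Lemma a_const_ball (b : R) : @ball_moment R m = b%:E ->
  a_const R m.+2 * (m.+2%:R * b) = 1 /\ 0 <= a_const R m.+2.
Proof.
move=> bE; have [b' [g [b'0 g0 bE' gE]]] := @ball_moment_gamma_fin R m.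
have hE : (m.+2%:R - 1) / 2 = m.+1%:R / 2 :> R by rewrite -natr1 addrK.
have GE : Gamma (m.+1%:R / 2) = g :> R by rewrite /Gamma /Rintegral -/(gamma_integral _) gE.
have pE : pi `^ (m.+1%:R / 2) = Num.sqrt pi ^+ m.+1 :> R.
  by rewrite mulrC powRrM powR12_sqrt ?pi_ge0// powR_mulrn// sqrtr_ge0.
have s0 : 0 < Num.sqrt pi ^+ m.+1 :> R by rewrite exprn_gt0// sqrtr_gt0 pi_gt0.
have := @ball_moment_gamma R m; rewrite bE gE -!EFinM => -[E1].
rewrite /a_const hE GE pE; split; last first.
  by rewrite divr_ge0 ?(ltW g0)// mulr_ge0// ltW.
move: (Num.sqrt pi ^+ m.+1) s0 E1 => S s0 E1.
have -> : g / (2 * S) * (m.+2%:R * b) = (m.+2%:R * (b * g)) / (2 * S) by ring.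
by rewrite E1 divff// mulf_neq0// gt_eqF.
Qed.

End SphereTransfer.

(** * The isometry on Schwartz fields *)

Section Isometry.
Context {R : realType} {m : nat}.
Local Notation E := 'rV[R]_m.+2.
Local Notation F := (E * E -> R[i]).
Implicit Types (p : E * E).

Definition ray_pair (f : 'I_m.+2 -> E -> R[i]) : F * F :=
  (ray_transform 0 f, ray_transform 1 f).

Section field.
Variable f : 'I_m.+2 -> E -> R[i].
Hypothesis sf : schwartz_field f.
Let u j (x : E) := Re (f j x).
Let v j (x : E) := Im (f j x).

Let ru j : rapidly_decreasing (u j).
Proof. by have [] := sf j. Qed.
Let rv j : rapidly_decreasing (v j).
Proof. by have [] := sf j. Qed.

Let ray_sum (g : 'I_m.+2 -> E -> R) k p : (forall j, rapidly_decreasing (g j)) -> bundle p ->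
  \int[@lebesgue_measure R]_t (t ^+ k * \sum_j g j (p.1 + t *: p.2) * p.2 0 j) = ray_field g k p.
Proof.
move=> rg [p1 _]; have p0 : p.2 != 0 by rewrite -enorm_eq0 p1 oner_eq0.
have ig j : (@lebesgue_measure R).-integrable setT (EFin \o (fun t => t ^+ k * g j (p.1 + t *: p.2))).
  apply: ray_integrable => //; first exact: rapidly_decreasing_measurable.
  exact: rapidly_decreasing_rapid.
transitivity (\int[@lebesgue_measure R]_t \sum_j p.2 0 j * (t ^+ k * g j (p.1 + t *: p.2))).
  apply: eq_Rintegral => t _; rewrite mulr_sumr; apply: eq_bigr => j _.
  by rewrite mulrA mulrC.
rewrite Rintegral_finsum; last by move=> j; exact: (integrableZl measurableT (p.2 0 j) (ig j)).
by apply: eq_bigr => j _; rewrite RintegralZl.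
Qed.

Let ReMr (x : R[i]) (c : R) : Re (x * c%:C) = Re x * c.
Proof. by case: x => a b /=; rewrite mulr0 subr0. Qed.
Let ImMr (x : R[i]) (c : R) : Im (x * c%:C) = Im x * c.
Proof. by case: x => a b /=; rewrite mulr0 add0r. Qed.

Let re_ray k p : bundle p -> re_part (ray_transform k f) p = ray_field u k p.
Proof.
move=> bp; rewrite -ray_sum//; apply: eq_Rintegral => t _.
by rewrite ReZ Re_sum; congr (_ * _); apply: eq_bigr => j _; rewrite ReMr.
Qed.

Let im_ray k p : bundle p -> im_part (ray_transform k f) p = ray_field v k p.
Proof.
move=> bp; rewrite -ray_sum//; apply: eq_Rintegral => t _.
by rewrite ImZ Im_sum; congr (_ * _); apply: eq_bigr => j _; rewrite ImMr.
Qed.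

Lemma good_pair_ray : good_pair (ray_pair f).
Proof.
split => /=.
- by apply: good_field_ext (good_field_ray ru) => p bp; rewrite re_ray.
- by apply: good_field_ext (good_field_ray rv) => p bp; rewrite im_ray.
- by apply: good_scalar_ext (good_scalar_ray ru) => p bp; rewrite re_ray.
- by apply: good_scalar_ext (good_scalar_ray rv) => p bp; rewrite im_ray.
Qed.

Let fhat th (g h : 'I_m.+2 -> E -> R) j y := full_transform 0 (g j) y + full_transform th (h j) y.
Let ur := fhat (pi / 2) u v.
Let ui := fhat (pi / 2 + pi) v u.

Let real_Xi_ray i (q : E * E) : bundle q ->
  (real_Xi (re_part (ray_transform 0 f)) i q = real_Xi (ray_field u 0) i q) *
  (real_Xi (im_part (ray_transform 0 f)) i q = real_Xi (ray_field v 0) i q).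
Proof.
move=> [q1 _]; have q0 : q.2 != 0 by rewrite -enorm_eq0 q1 oner_eq0.
by split; apply: real_Xi_ext => // r br; rewrite (re_ray, im_ray).
Qed.

Let algebra_re (k c y A1 B C1 C2 r1 r2 : R) :
  k * (y * A1 + r1 - c * C1 + (y * - B + r2 - c * C2)) + y * (k * (B + - A1)) =
  k * (r1 + r2 - c * (C1 + C2)).
Proof. by ring. Qed.

Let algebra_im (k c y A1 B1 C1 C2 r1 r2 : R) :
  k * (y * A1 + r1 - c * C1 + (y * B1 + r2 - c * C2)) - y * (k * (B1 + A1)) =
  k * (r1 + r2 - c * (C1 + C2)).
Proof. by ring. Qed.

Let phase_2pi th a p : bundle_integrable a -> bundle p ->
  phase_transform (th + pi + pi) a p = phase_transform th a p.
Proof. by move=> ia bp; rewrite !phase_transform_pi// opprK. Qed.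

Let integrable_ray_field (g : 'I_m.+2 -> E -> R) k : (forall j, rapidly_decreasing (g j)) ->
  bundle_integrable (ray_field g k).
Proof.
move=> rg; apply: tame_integrable.
by split; [exact: bundle_measurable_ray_field|exact: fast_ray_field].
Qed.

(** In the transform of Xi_i I^0 f, the terms in I^1 f carry the phases pi/2 and pi; the added
    multiple of the transform of I^1 f carries 3 pi/2 and 0. Half a turn apart, they cancel, and the
    component of the transform of f tangent to the sphere at xi remains. *)
Let component_re i p : bundle p ->
  pair_component (ray_pair f) (inl (i, true)) p =
  (@fiber_const R m) * (ur i p.1 - p.2 0 i * \sum_j p.2 0 j * ur j p.1).
Proof.
move=> bp; rewrite /pair_component /=.
rewrite (fourier_part_ext _ bp (fun q bq => (real_Xi_ray i bq).1) (fun q bq => (real_Xi_ray i bq).2)).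
rewrite (fourier_part_ext _ bp (@im_ray 1%N) (@re_ray 1%N)).
rewrite /fourier_part !phase_real_Xi_ray_field//.
have iu := integrable_ray_field 1 ru; have iv := integrable_ray_field 1 rv.
have h2 : pi / 2 + pi / 2 = 0 + pi :> R by rewrite -splitr add0r.
have h1 : 0 + pi / 2 = pi / 2 :> R by rewrite add0r.
rewrite h1 h2 (phase_transform_pi 0 iv bp) (phase_transform_pi (pi / 2) iu bp).
rewrite algebra_re; congr (_ * (_ - _ * _)).
by rewrite -big_split; apply: eq_bigr => j _; rewrite /= -mulrDr.
Qed.

Let component_im i p : bundle p ->
  pair_component (ray_pair f) (inl (i, false)) p =
  (@fiber_const R m) * (ui i p.1 - p.2 0 i * \sum_j p.2 0 j * ui j p.1).
Proof.
move=> bp; rewrite /pair_component /=.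
rewrite (fourier_part_ext _ bp (fun q bq => (real_Xi_ray i bq).2) (fun q bq => (real_Xi_ray i bq).1)).
rewrite (fourier_part_ext _ bp (@re_ray 1%N) (@im_ray 1%N)).
rewrite /fourier_part !phase_real_Xi_ray_field//.
have iu := integrable_ray_field 1 ru; have iv := integrable_ray_field 1 rv.
have h2 : pi / 2 + pi + pi / 2 = 0 + pi + pi :> R by rewrite addrAC -splitr add0r.
rewrite h2 (phase_2pi _ iu bp) add0r.
rewrite algebra_im; congr (_ * (_ - _ * _)).
by rewrite -big_split; apply: eq_bigr => j _; rewrite /= -mulrDr.
Qed.

Let component_P (b : bool) p : bundle p ->
  pair_component (ray_pair f) (inr b) p =
  (@fiber_const R m) * \sum_j p.2 0 j * (if b then ur j p.1 else ui j p.1).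
Proof.
move=> bp; rewrite /pair_component; case: b => /=.
- rewrite (fourier_part_ext _ bp (@re_ray 0%N) (@im_ray 0%N)) /fourier_part.
  rewrite !phase_ray_field0//; congr (_ * _).
  by rewrite -big_split; apply: eq_bigr => j _; rewrite /= -mulrDr.
- rewrite (fourier_part_ext _ bp (@im_ray 0%N) (@re_ray 0%N)) /fourier_part.
  rewrite !phase_ray_field0//; congr (_ * _).
  by rewrite -big_split; apply: eq_bigr => j _; rewrite /= -mulrDr.
Qed.

(** Pythagoras for the decomposition of h along the unit vector z and orthogonally to it. The
    dependence on xi disappears, leaving a function of y alone. *)
Let projection_sq (z : E) (h : 'I_m.+2 -> R) : enorm z = 1 ->
  \sum_i (h i - z 0 i * \sum_j z 0 j * h j) ^+ 2 + (\sum_j z 0 j * h j) ^+ 2 = \sum_i h i ^+ 2.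
Proof.
move=> z1; have E1 (r : R) : \sum_i (h i - z 0 i * r) ^+ 2 =
    \sum_i h i ^+ 2 + (- 2 * r) * \sum_j z 0 j * h j + r ^+ 2 * dotp z z.
  by rewrite /dotp !mulr_sumr -!big_split; apply: eq_bigr => i _ /=; ring.
rewrite E1 (enorm1_dotp z1); move: (\sum_j z 0 j * h j) (\sum_i h i ^+ 2) => r x; ring.
Qed.

Let hat_sq i (y : E) := ur i y ^+ 2 + ui i y ^+ 2.

Let sum_component p : bundle p ->
  \sum_k pair_component (ray_pair f) k p ^+ 2 = (@fiber_const R m) ^+ 2 * \sum_i hat_sq i p.1.
Proof.
move=> bp; have [p1 _] := bp.
transitivity (\sum_(k : 'I_m.+2 * bool) pair_component (ray_pair f) (inl k) p ^+ 2 +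
  \sum_(b : bool) pair_component (ray_pair f) (inr b) p ^+ 2); first exact: big_sumType.
have S1 : \sum_(k : 'I_m.+2 * bool) pair_component (ray_pair f) (inl k) p ^+ 2 =
  (@fiber_const R m) ^+ 2 * (\sum_i (ur i p.1 - p.2 0 i * \sum_j p.2 0 j * ur j p.1) ^+ 2 +
    \sum_i (ui i p.1 - p.2 0 i * \sum_j p.2 0 j * ui j p.1) ^+ 2).
  rewrite (eq_bigr (fun k : 'I_m.+2 * bool => (fun i j => pair_component (ray_pair f) (inl (i, j)) p ^+ 2) k.1 k.2)); last first.
    by move=> [i j] _.
  rewrite -(pair_bigA _ (fun i j => pair_component (ray_pair f) (inl (i, j)) p ^+ 2)).
  rewrite -big_split mulr_sumr; apply: eq_bigr => i _.
  apply: (eq_trans (big_bool _ _)).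
  transitivity (pair_component (ray_pair f) (inl (i, true)) p ^+ 2 +
    pair_component (ray_pair f) (inl (i, false)) p ^+ 2); first by [].
  by rewrite (component_re i bp) (component_im i bp) !exprMn -mulrDr.
have S2 : \sum_(b : bool) pair_component (ray_pair f) (inr b) p ^+ 2 =
    pair_component (ray_pair f) (inr true) p ^+ 2 + pair_component (ray_pair f) (inr false) p ^+ 2.
  exact: big_bool.
rewrite S1 S2 (component_P true bp) (component_P false bp) !exprMn -!mulrDr; congr (_ * _).
by rewrite addrACA !projection_sq// -big_split.
Qed.

Let rapidM (g h : E -> R) : rapid g -> rapid h -> rapid (fun x => g x * h x).
Proof.
move=> rg; have [M HM] := rg 0%N; apply: (@rapid_dominated _ _ M 0) => x.
by rewrite expr0 mulr1 normrM ler_wpM2r//; have := HM x; rewrite expr0 mul1r.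
Qed.

Let hat_facts i : measurable_fun setT (hat_sq i) /\ rapid (hat_sq i).
Proof.
have mu j : measurable_fun setT (u j) by exact: rapidly_decreasing_measurable.
have mv j : measurable_fun setT (v j) by exact: rapidly_decreasing_measurable.
have m1 : measurable_fun setT (ur i) by apply: measurable_funD; exact: measurable_full_transform.
have m2 : measurable_fun setT (ui i) by apply: measurable_funD; exact: measurable_full_transform.
have r1 : rapid (ur i) by apply: rapidD; exact: rapid_full_transform0.
have r2 : rapid (ui i) by apply: rapidD; exact: rapid_full_transform0.
split; first by apply: measurable_funD; exact: measurable_funX.
by apply: rapidD; exact: rapidM.
Qed.

Variables (s t : R).
Hypothesis ht : - (m.+2%:R / 2) < t.

Let pair_normsq_hat : pair_normsq s t (ray_pair f) =
  (2 * pi)^-1 * (@fiber_const R m) ^+ 2 *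
  \sum_i \int[leb R m.+2]_y (weight s t y * hat_sq i y).
Proof.
have ht1 : - (m.+1%:R / 2) < t + 1 / 2 by move: ht; rewrite -natr1; lra.
have th i : tame (fun p : E * E => hat_sq i p.1).
  have [mh rh] := hat_facts i.
  split; last by move=> N; have [M HM] := rh N; exists M => p _.
  by apply: bundle_measurable_fun; exact: (measurableT_comp mh measurable_fst).
rewrite (pair_normsqE s ht good_pair_ray).
have W : weighted_normsq (s + 1 / 2) (t + 1 / 2) (pair_component (ray_pair f)) =
    (@fiber_const R m) ^+ 2 * \sum_i wbint (s + 1 / 2) (t + 1 / 2) (fun p => hat_sq i p.1).
  rewrite -(wbint_sum (s + 1 / 2) ht1 _ th) -(wbintZ (s + 1 / 2) ht1 _ (tame_sum _ th)).
  by apply: eq_wbint => p bp; exact: sum_component.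
have [b [_ [_ _ bE _]]] := @ball_moment_gamma_fin R m.
have [a1 _] := a_const_ball bE.
have wE i : wbint (s + 1 / 2) (t + 1 / 2) (fun p => hat_sq i p.1) =
    m.+2%:R * b * \int[leb R m.+2]_y (weight s t y * hat_sq i y).
  have [mh rh] := hat_facts i.
  have h0 y : 0 <= hat_sq i y by rewrite addr_ge0 ?sqr_ge0.
  have [b' [_ bE' _ ->]] := wbint_sphere s ht mh rh h0.
  by move: bE'; rewrite bE => -[->].
rewrite W (eq_bigr _ (fun i _ => wE i)) -mulr_sumr.
move: (\sum_i _) ((@fiber_const R m) ^+ 2) ((2 * pi)^-1) a1 => x k l a1.
have -> : a_const R m.+2 * (l * (k * (m.+2%:R * b * x))) =
  (a_const R m.+2 * (m.+2%:R * b)) * (l * k * x) by ring.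
by rewrite a1 mul1r.
Qed.

Let sin_phase (q : R) : sin q = cos (q - pi / 2).
Proof. by rewrite cosB cos_pihalf sin_pihalf mulr0 add0r mulr1. Qed.

Let full_const : R := (2 * pi) `^ (- (m.+2%:R / 2)).

Let tuple_integral (h : E -> R) : measurable_fun setT h ->
  \int[lebesgue_tuple R m.+2]_x h (vec_of x) = \int[leb R m.+2]_x h x.
Proof.
by move=> mh; rewrite /Rintegral; congr fine; rewrite integral_leb//; exact/measurable_EFinP.
Qed.

Let fourierE i (y : E) : fourier (f i) y = full_const * ur i y +i* (full_const * ui i y).
Proof.
have mu := rapidly_decreasing_measurable (ru i).
have mv := rapidly_decreasing_measurable (rv i).
have qu := rapidly_decreasing_rapid (ru i).
have qv := rapidly_decreasing_rapid (rv i).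
have mc th (h : E -> R) : measurable_fun setT h ->
    measurable_fun setT (fun x => cos (dotp y x - th) * h x).
  by move=> mh; apply: measurable_funM => //; apply: measurable_cos_fun; measurability.
apply: complexE.
- rewrite /fourier ReZ; congr (_ * _).
  rewrite /ur /fhat -[RHS](RintegralD measurableT (full_transform_integrable 0 y mu qu)
    (full_transform_integrable (pi / 2) y mv qv)).
  rewrite -tuple_integral; last by apply: measurable_funD; exact: mc.
  by apply: eq_Rintegral => x _; rewrite Re_expi_mul subr0 sin_phase.
- rewrite /fourier ImZ; congr (_ * _).
  rewrite /ui /fhat -[RHS](RintegralD measurableT (full_transform_integrable 0 y mv qv)
    (full_transform_integrable (pi / 2 + pi) y mu qu)).
  rewrite -tuple_integral; last by apply: measurable_funD; exact: mc.
  by apply: eq_Rintegral => x _; rewrite Im_expi_mul subr0 cosDpi_shift -sin_phase mulNr.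
Qed.

(** The factor 1/(2 pi) in the norms on the bundle compensates for the different normalisations of
    the Fourier transform in dimensions n and n - 1. *)
Let const_sq : full_const ^+ 2 = (2 * pi)^-1 * (@fiber_const R m) ^+ 2.
Proof.
have p0 : 0 < 2 * pi :> R by rewrite mulr_gt0// pi_gt0.
have sq x : (2 * pi) `^ x ^+ 2 = (2 * pi) `^ (x + x) :> R.
  by rewrite powRD// (gt_eqF p0) implybT.
rewrite /full_const /fiber_const !sq -(powR_inv1 (ltW p0)) -powRD; last by rewrite (gt_eqF p0) implybT.
by congr (_ `^ _); field.
Qed.

(** The isometry: a_n cancels the area left by the transfer to R^n, and the powers of 2 pi agree by
    [const_sq]. *)
Lemma pair_norm_ray : pair_norm s t (ray_pair f) = field_norm s t f.
Proof.
congr Num.sqrt; rewrite pair_normsq_hat -const_sq mulr_sumr; apply: eq_bigr => i _.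
have [mh rh] := hat_facts i.
have h0 y : 0 <= hat_sq i y by rewrite addr_ge0 ?sqr_ge0.
have [b [_ _ iw _]] := wbint_sphere s ht mh rh h0.
rewrite -RintegralZl// -tuple_integral; last first.
  by case/integrableP: iw => /measurable_EFinP mw _; exact: measurable_funM.
apply: eq_Rintegral => x _; rewrite Re_mulJ fourierE -[Re (_ +i* _)]/(full_const * ur i _).
rewrite -[Im (_ +i* _)]/(full_const * ui i _) /hat_sq.
move: (weight _ _ _) (ur i _) (ui i _) full_const => x1 x2 x3 x4; ring.
Qed.

End field.

(** Linearity on the bundle only: the ray integrals converge there because the direction is nonzero
    and the fields decay. *)
Lemma ray_transformB k (f g : 'I_m.+2 -> E -> R[i]) p :
  schwartz_field f -> schwartz_field g -> bundle p ->
  ray_transform k (f - g) p = ray_transform k f p - ray_transform k g p.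
Proof.
move=> sf sg [p1 _]; have p0 : p.2 != 0 by rewrite -enorm_eq0 p1 oner_eq0.
have iC (h : 'I_m.+2 -> E -> R[i]) : schwartz_field h ->
  (@lebesgue_measure R).-integrable setT (EFin \o (fun t => Re ((t ^+ k)%:C * \sum_i h i (p.1 + t *: p.2) * (p.2 0 i)%:C))) /\
  (@lebesgue_measure R).-integrable setT (EFin \o (fun t => Im ((t ^+ k)%:C * \sum_i h i (p.1 + t *: p.2) * (p.2 0 i)%:C))).
  move=> sh.
  have ir (h' : E -> R) (c : R) : rapidly_decreasing h' ->
      (@lebesgue_measure R).-integrable setT (EFin \o (fun t => c * (t ^+ k * h' (p.1 + t *: p.2)))).
    move=> rh; have i1 := ray_integrable k p.1 (rapidly_decreasing_measurable rh)
      (rapidly_decreasing_rapid rh) p0.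
    exact: (integrableZl measurableT c i1).
  split.
    have := @integrable_sum _ _ _ (@lebesgue_measure R) setT measurableT _ (index_enum 'I_m.+2) xpredT _
      (fun i _ => ir _ (p.2 0 i) (sh i).1).
    apply: eq_integrable => // t _; rewrite /= sumEFin; congr _%:E.
    rewrite ReZ Re_sum mulr_sumr; apply: eq_bigr => i _.
    by case: (h i _) => x y /=; rewrite mulr0 subr0; ring.
  have := @integrable_sum _ _ _ (@lebesgue_measure R) setT measurableT _ (index_enum 'I_m.+2) xpredT _
    (fun i _ => ir _ (p.2 0 i) (sh i).2).
  apply: eq_integrable => // t _; rewrite /= sumEFin; congr _%:E.
  rewrite ImZ Im_sum mulr_sumr; apply: eq_bigr => i _.
  by case: (h i _) => x y /=; rewrite mulr0 add0r; ring.
have [fr fi] := iC f sf; have [gr gi] := iC g sg.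
have E1 t : (t ^+ k)%:C * (\sum_i (f - g) i (p.1 + t *: p.2) * (p.2 0 i)%:C) =
  (t ^+ k)%:C * (\sum_i f i (p.1 + t *: p.2) * (p.2 0 i)%:C) -
  (t ^+ k)%:C * (\sum_i g i (p.1 + t *: p.2) * (p.2 0 i)%:C).
  by rewrite -mulrBr -sumrB; congr (_ * _); apply: eq_bigr => i _; rewrite -mulrBl.
apply: esym; rewrite /ray_transform /cintegral.
rewrite -[LHS]/((_ - _) +i* (_ - _)); congr (_ +i* _).
  by rewrite -RintegralB//; apply: eq_Rintegral => t _; rewrite E1 ReB.
by rewrite -RintegralB//; apply: eq_Rintegral => t _; rewrite E1 ImB.
Qed.

End Isometry.

(** * Passage to the completions *)

Section QuadraticNorm.
Context {R : realType} {m : nat}.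
Local Notation E := 'rV[R]_m.+2.
Variables (V : zmodType) (D : set V) (N : V -> R) (I : finType).
Variables (C : V -> I -> E * E -> R) (kappa s t : R).
Hypotheses (k0 : 0 <= kappa) (ht : - (m.+1%:R / 2) < t).
Hypothesis DB : forall x y, D x -> D y -> D (x - y).
Hypothesis NE : forall x, D x -> N x = Num.sqrt (kappa * weighted_normsq s t (C x)).
Hypothesis tC : forall x i, D x -> tame (C x i).
Hypothesis CB : forall x y i p, D x -> D y -> bundle p -> C (x - y) i p = C x i p - C y i p.

Lemma quadratic_norm0 x : D x -> N (x - x) = 0.
Proof.
move=> Dx; rewrite NE; last exact: DB.
have -> : weighted_normsq s t (C (x - x)) = 0.
  rewrite /weighted_normsq (@eq_bint_bundle _ _ _ (fun p => 0 * 0)).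
    by rewrite (@bintZ _ _ (fun=> 0) 0) ?mul0r//; exact: tame_integrable tame0.
  by move=> p bp; rewrite big1 ?mulr0 ?mul0r// => i _; rewrite CB// subrr expr0n.
by rewrite mulr0 sqrtr0.
Qed.

Lemma quadratic_normC x y : D x -> D y -> N (x - y) = N (y - x).
Proof.
move=> Dx Dy; rewrite !NE; [|exact: DB|exact: DB].
congr (Num.sqrt (_ * _)); apply: eq_bint_bundle => p bp; congr (_ * _).
by apply: eq_bigr => i _; rewrite !CB// -sqrrN opprB.
Qed.

(** Applied to both [bundle_norm] and [pair_norm]: the parametrised inequality for the components is
    turned into the triangle inequality by [sqrt_triangle]. *)
Lemma quadratic_norm_triangle x y : D x -> D y -> N x <= N y + N (x - y).
Proof.
move=> Dx Dy; have Dxy := DB Dx Dy; rewrite !NE//.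
apply: sqrt_triangle => [||e e0]; rewrite ?mulr_ge0 ?weighted_normsq_ge0//.
rewrite mulrCA [X in _ + X]mulrCA -mulrDr ler_wpM2l//.
apply: weighted_normsq_triangle => // i; [exact: tC|exact: tC|exact: tC|].
by move=> p bp; rewrite CB// addrC subrK.
Qed.

End QuadraticNorm.

Section NormTriangles.
Context {R : realType} {m : nat}.
Local Notation E := 'rV[R]_m.+2.
Local Notation F := (E * E -> R[i]).
Implicit Types (phi : F) (w : F * F) (f g : 'I_m.+2 -> E -> R[i]).
Variables (s t : R).

Definition good_function phi := good_scalar (re_part phi) /\ good_scalar (im_part phi).

Let fourier_pair phi (b : bool) : E * E -> R :=
  if b then fourier_part (pi / 2) (re_part phi) (im_part phi)
  else fourier_part (pi / 2 + pi) (im_part phi) (re_part phi).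

Let good_functionB phi phi' : good_function phi -> good_function phi' -> good_function (phi - phi').
Proof.
by move=> [a b] [a' b']; split; rewrite ?re_partB ?im_partB; exact: good_scalarB.
Qed.

Let tame_fourier_pair phi b : good_function phi -> tame (fourier_pair phi b).
Proof. by move=> [[_ pa] [_ pb]]; case: b; exact: tame_fourier_part. Qed.

Let fourier_pairB phi phi' b p : good_function phi -> good_function phi' -> bundle p ->
  fourier_pair (phi - phi') b p = fourier_pair phi b p - fourier_pair phi' b p.
Proof.
move=> [[ta _] [tb _]] [[ta' _] [tb' _]] bp; rewrite /fourier_pair re_partB im_partB.
by case: b; rewrite fourier_partB.
Qed.

Let bundle_normE phi : good_function phi ->
  bundle_norm s t phi = Num.sqrt ((2 * pi)^-1 * weighted_normsq s t (fourier_pair phi)).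
Proof.
move=> [[ta _] [tb _]]; rewrite /bundle_norm (bundle_normsqE s t ta tb).
apply: (f_equal (fun x => Num.sqrt ((2 * pi)^-1 * x))).
apply: eq_bint_bundle => p _; apply: f_equal; apply: esym; exact: big_bool.
Qed.

Let pi2_ge0 : 0 <= (2 * pi)^-1 :> R.
Proof. by rewrite invr_ge0 mulr_ge0// pi_ge0. Qed.

Section bundle_norm.
Hypothesis ht : - (m.+1%:R / 2) < t.

Lemma bundle_norm0 phi : good_function phi -> bundle_norm s t (phi - phi) = 0.
Proof. exact: (quadratic_norm0 good_functionB bundle_normE fourier_pairB). Qed.

Lemma bundle_normC phi phi' : good_function phi -> good_function phi' ->
  bundle_norm s t (phi - phi') = bundle_norm s t (phi' - phi).
Proof. exact: (quadratic_normC good_functionB bundle_normE fourier_pairB). Qed.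

Lemma bundle_norm_triangle phi phi' : good_function phi -> good_function phi' ->
  bundle_norm s t phi <= bundle_norm s t phi' + bundle_norm s t (phi - phi').
Proof.
exact: (quadratic_norm_triangle pi2_ge0 ht good_functionB bundle_normE tame_fourier_pair fourier_pairB).
Qed.

Lemma bundle_normsq_ge0 phi : good_function phi -> 0 <= bundle_normsq s t phi.
Proof.
move=> [[ta _] [tb _]]; rewrite bundle_normsqE// mulr_ge0//; apply: bint_ge0 => p _.
by rewrite mulr_ge0 ?weight_ge0// addr_ge0 ?sqr_ge0.
Qed.

End bundle_norm.

Hypothesis ht : - (m.+2%:R / 2) < t.

Let ht1 : - (m.+1%:R / 2) < t + 1 / 2.
Proof. by move: ht; rewrite -natr1; lra. Qed.

Lemma a_const_gt0 : 0 < a_const R m.+2.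
Proof.
have [b [_ [_ _ bE _]]] := @ball_moment_gamma_fin R m.
have [a1 a0] := a_const_ball bE; rewrite lt_def a0 andbT.
by apply/eqP => a00; move: a1; rewrite a00 mul0r => /eqP; rewrite eq_sym oner_eq0.
Qed.

Let kappa0 : 0 <= a_const R m.+2 * (2 * pi)^-1.
Proof. by rewrite mulr_ge0// ltW// a_const_gt0. Qed.

Let pair_normE w : good_pair w -> pair_norm s t w =
  Num.sqrt (a_const R m.+2 * (2 * pi)^-1 * weighted_normsq (s + 1 / 2) (t + 1 / 2) (pair_component w)).
Proof. by move=> gw; rewrite /pair_norm (pair_normsqE s ht gw) mulrA. Qed.

Let tame_component w k (gw : good_pair w) : tame (pair_component w k) := tame_pair_component k gw.

Let componentB w w' k p (gw : good_pair w) (gw' : good_pair w') (bp : bundle p) :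
  pair_component (w - w') k p = pair_component w k p - pair_component w' k p :=
  pair_componentB k gw gw' bp.

Lemma pair_norm0 w : good_pair w -> pair_norm s t (w - w) = 0.
Proof. exact: (quadratic_norm0 (@good_pairB R m) pair_normE componentB). Qed.

Lemma pair_normC w w' : good_pair w -> good_pair w' ->
  pair_norm s t (w - w') = pair_norm s t (w' - w).
Proof. exact: (quadratic_normC (@good_pairB R m) pair_normE componentB). Qed.

Lemma pair_norm_triangle w w' : good_pair w -> good_pair w' ->
  pair_norm s t w <= pair_norm s t w' + pair_norm s t (w - w').
Proof.
exact: (quadratic_norm_triangle kappa0 ht1 (@good_pairB R m) pair_normE tame_component componentB).
Qed.

Let pair_component_ext w w' k p : (forall q, bundle q -> w.1 q = w'.1 q) ->
  (forall q, bundle q -> w.2 q = w'.2 q) -> bundle p ->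
  pair_component w k p = pair_component w' k p.
Proof.
move=> w1 w2 bp.
have a q : bundle q -> re_part w.1 q = re_part w'.1 q by move=> bq; rewrite /re_part w1.
have b q : bundle q -> im_part w.1 q = im_part w'.1 q by move=> bq; rewrite /im_part w1.
have c q : bundle q -> re_part w.2 q = re_part w'.2 q by move=> bq; rewrite /re_part w2.
have d q : bundle q -> im_part w.2 q = im_part w'.2 q by move=> bq; rewrite /im_part w2.
have X (h h' : E * E -> R) i : (forall q, bundle q -> h q = h' q) ->
    forall q, bundle q -> real_Xi h i q = real_Xi h' i q.
  by move=> hh q [q1 _]; apply: real_Xi_ext => //; rewrite -enorm_eq0 q1 oner_eq0.
rewrite /pair_component; case: k => [[i []]|[]] /=.
- exact: (f_equal2 (fun x y => x + p.1 0 i * y)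
    (fourier_part_ext (pi / 2) bp (X _ _ i a) (X _ _ i b)) (fourier_part_ext (pi / 2 + pi) bp d c)).
- exact: (f_equal2 (fun x y => x - p.1 0 i * y)
    (fourier_part_ext (pi / 2 + pi) bp (X _ _ i b) (X _ _ i a)) (fourier_part_ext (pi / 2) bp c d)).
- exact: fourier_part_ext.
- exact: fourier_part_ext.
Qed.

(** The ray pair of f - g and the difference of the ray pairs agree on the bundle, not everywhere;
    the norm sees only the bundle, through [pair_component_ext]. *)
Lemma field_normB f g : schwartz_field f -> schwartz_field g -> schwartz_field (f - g) ->
  field_norm s t (f - g) = pair_norm s t (ray_pair f - ray_pair g).
Proof.
move=> sf sg sfg; have gf := good_pair_ray sf; have gg := good_pair_ray sg.
rewrite -(pair_norm_ray sfg s ht) (pair_normE (good_pair_ray sfg)) (pair_normE (good_pairB gf gg)).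
have W : weighted_normsq (s + 1 / 2) (t + 1 / 2) (pair_component (ray_pair (f - g))) =
    weighted_normsq (s + 1 / 2) (t + 1 / 2) (pair_component (ray_pair f - ray_pair g)).
  apply: eq_bint_bundle => p bp; apply: f_equal; apply: eq_bigr => k _.
  apply: (f_equal (fun x => x ^+ 2)).
  by apply: pair_component_ext => // q bq; exact: ray_transformB.
exact: (f_equal (fun x => Num.sqrt (a_const R m.+2 * (2 * pi)^-1 * x)) W).
Qed.

End NormTriangles.

(** * The stability estimate *)

Section Stability.
Context {R : realType} {m : nat}.
Local Notation E := 'rV[R]_m.+2.
Local Notation F := (E * E -> R[i]).
Variables (s t : R).
Hypothesis ht : - (m.+2%:R / 2) < t.

Let ht1 : - (m.+1%:R / 2) < t + 1 / 2.
Proof. by move: ht; rewrite -natr1; lra. Qed.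
Let ht3 : - (m.+1%:R / 2) < t + 3 / 2.
Proof. by move: ht1; lra. Qed.

Let rapidly_decreasingB (h h' : E -> R) : rapidly_decreasing h -> rapidly_decreasing h' ->
  rapidly_decreasing (fun x => h x - h' x).
Proof.
move=> rh rh'; have [sh fh] := rh; have [sh' fh'] := rh'.
have IE vs : iter_derive vs (fun x => h x - h' x) =
    fun x => iter_derive vs h x - iter_derive vs h' x.
  elim: vs => [|v vs IH] //=; rewrite IH; apply/funext => x.
  have [_ d1] := sh vs x Logic.I; have [_ d2] := sh' vs x Logic.I.
  exact: deriveB.
split=> [vs x Ux|N vs]; rewrite IE.
  have [c1 d1] := sh vs x Ux; have [c2 d2] := sh' vs x Ux; split.
    exact: continuousB.
  by move=> v; exact: derivableB.
have [M HM] := fh N vs; have [M' HM'] := fh' N vs; exists (M + M') => x.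
apply: le_trans (lerD (HM x) (HM' x)); rewrite -mulrDr ler_wpM2l ?ler_normB//.
by rewrite exprn_ge0// ltW// one_enorm_gt0.
Qed.

Let schwartz_fieldB (f g : 'I_m.+2 -> E -> R[i]) : schwartz_field f -> schwartz_field g ->
  schwartz_field (f - g).
Proof.
move=> sf sg i; have [f1 f2] := sf i; have [g1 g2] := sg i; split.
  rewrite (_ : (fun x => _) = fun x => Re (f i x) - Re (g i x)); first exact: rapidly_decreasingB.
  by apply/funext => x; rewrite -ReB.
rewrite (_ : (fun x => _) = fun x => Im (f i x) - Im (g i x)); first exact: rapidly_decreasingB.
by apply/funext => x; rewrite -ImB.
Qed.

(** The seminorm properties of [field_norm] are read off from those of [pair_norm] through the
    isometry. *)
Let field0 (f : 'I_m.+2 -> E -> R[i]) : schwartz_field f -> field_norm s t (f - f) = 0.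
Proof.
move=> sf; rewrite field_normB//; last exact: schwartz_fieldB.
exact: (pair_norm0 s ht (good_pair_ray sf)).
Qed.

Let fieldC (f g : 'I_m.+2 -> E -> R[i]) : schwartz_field f -> schwartz_field g ->
  field_norm s t (f - g) = field_norm s t (g - f).
Proof.
move=> sf sg; rewrite (field_normB s ht sf sg (schwartz_fieldB sf sg)).
rewrite (field_normB s ht sg sf (schwartz_fieldB sg sf)).
exact: (pair_normC s ht (good_pair_ray sf) (good_pair_ray sg)).
Qed.

Let fieldT (f g : 'I_m.+2 -> E -> R[i]) : schwartz_field f -> schwartz_field g ->
  field_norm s t f <= field_norm s t g + field_norm s t (f - g).
Proof.
move=> sf sg; rewrite field_normB//; last exact: schwartz_fieldB.
rewrite -(pair_norm_ray sf s ht) -(pair_norm_ray sg s ht).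
exact: (pair_norm_triangle s ht (good_pair_ray sf) (good_pair_ray sg)).
Qed.

Let schwartz_good (phi : F) : bundle_schwartz phi -> good_function phi.
Proof. by move=> [a b]; split; exact: bundle_rapidly_decreasing_good. Qed.

Let bundle_limit s' t' (v : nat -> F) : - (m.+1%:R / 2) < t' ->
  bundle_cauchy s' t' v ->
  (bundle_norm s' t' \o v) @ \oo --> bundle_limit_norm s' t' v.
Proof.
move=> ht' cv.
have N0 (phi : F) : bundle_schwartz phi -> bundle_norm s' t' (phi - phi) = 0.
  by move=> sp; apply: bundle_norm0; exact: schwartz_good.
have NC (phi phi' : F) : bundle_schwartz phi -> bundle_schwartz phi' ->
    bundle_norm s' t' (phi - phi') = bundle_norm s' t' (phi' - phi).
  by move=> sp sp'; apply: bundle_normC; exact: schwartz_good.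
have NT (phi phi' : F) : bundle_schwartz phi -> bundle_schwartz phi' ->
    bundle_norm s' t' phi <= bundle_norm s' t' phi' + bundle_norm s' t' (phi - phi').
  by move=> sp sp'; apply: bundle_norm_triangle => //; exact: schwartz_good.
have cc := cauchy_norm_cvg NC NT cv.
rewrite /bundle_limit_norm (completion_norm_class N0 NC NT cv cc).
exact: cc.
Qed.

Let cvg_finsum I (r : seq I) (v : I -> nat -> R) (l : I -> R) :
  (forall i, v i @ \oo --> l i) -> (fun k => \sum_(i <- r) v i k) @ \oo --> \sum_(i <- r) l i.
Proof.
move=> vl; elim: r => [|i r IH].
  by rewrite big_nil; under eq_fun do rewrite big_nil; exact: cvg_cst.
by rewrite big_cons; under eq_fun do rewrite big_cons; exact: cvgD (vl i) IH.
Qed.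

Let cvg_sq (u : nat -> R) (l : R) : u @ \oo --> l -> (fun k => u k ^+ 2) @ \oo --> l ^+ 2.
Proof. by move=> ul; rewrite expr2; under eq_fun do rewrite expr2; exact: cvgM. Qed.

(** The estimate for one admissible sequence w: it holds for each w k by the bound on the cross
    term, and all quantities converge. *)
Let stability_element (f : set (nat -> 'I_m.+2 -> E -> R[i])) (w : nat -> F * F) :
  field_space s t f -> ray_pair_ext s t f w ->
  (forall i, bundle_cauchy (s + 1 / 2) (t + 1 / 2) (fun k => Xi i (w k).1)) ->
  bundle_cauchy (s + 1 / 2) (t + 1 / 2) (fun k => (w k).1) ->
  bundle_cauchy (s + 3 / 2) (t + 3 / 2) (fun k => (w k).2) ->
  field_space_norm s t f ^+ 2 <= 2 * a_const R m.+2 *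
    (\sum_i bundle_limit_norm (s + 1 / 2) (t + 1 / 2) (fun k => Xi i (w k).1) ^+ 2
     + bundle_limit_norm (s + 1 / 2) (t + 1 / 2) (fun k => (w k).1) ^+ 2
     + bundle_limit_norm (s + 3 / 2) (t + 3 / 2) (fun k => (w k).2) ^+ 2).
Proof.
(* u0 is a Cauchy sequence of which f is the class; u is the member of f whose ray pairs are
   equivalent to w. *)
move=> [u0 cu0 fE] [u fu [[Dw _] wu]] cX c1 c2.
have cc := cauchy_norm_cvg fieldC fieldT cu0.
have LE : field_space_norm s t f = limn (field_norm s t \o u0).
  by rewrite /field_space_norm fE; exact: (completion_norm_class field0 fieldC fieldT cu0 cc).
have cu : class_of_seq (@schwartz_field R m.+2) (field_norm s t) u0 u by rewrite -fE.
have uL : (field_norm s t \o u) @ \oo --> field_space_norm s t f.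
  by rewrite LE; exact: (class_norm_cvg fieldC fieldT cu0 cu cc).
have Du k : schwartz_field (u k) by have [[D _] _] := cu.
have gT k := good_pair_ray (Du k).
have gw k : good_pair (w k).
  have [[r1 i1] [r2 i2]] := Dw k.
  (* A Cauchy sequence of Schwartz functions consists of Schwartz functions: the decay of the
     transforms of Xi_i phi comes from here. *)
  have X i : bundle_schwartz (Xi i (w k).1) by have [D _] := cX i; exact: D.
  split.
  - apply: bundle_rapidly_decreasing_good_field => // i; have [h _] := X i.
    by rewrite -re_part_Xi.
  - apply: bundle_rapidly_decreasing_good_field => // i; have [_ h] := X i.
    by rewrite -im_part_Xi.
  - exact: bundle_rapidly_decreasing_good.
  - exact: bundle_rapidly_decreasing_good.
pose S k := 2 * a_const R m.+2 * (\sum_i bundle_norm (s + 1 / 2) (t + 1 / 2) (Xi i (w k).1) ^+ 2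
   + bundle_norm (s + 1 / 2) (t + 1 / 2) (w k).1 ^+ 2 + bundle_norm (s + 3 / 2) (t + 3 / 2) (w k).2 ^+ 2).
have a0 : 0 <= a_const R m.+2 by exact: ltW (a_const_gt0 (m := m)).
have sq s' t' (phi : F) : bundle_schwartz phi -> bundle_norm s' t' phi ^+ 2 = bundle_normsq s' t' phi.
  by move=> sp; rewrite sqr_sqrtr//; apply: bundle_normsq_ge0; exact: schwartz_good.
have SE k : S k = 2 * a_const R m.+2 *
    (\sum_i bundle_normsq (s + 1 / 2) (t + 1 / 2) (Xi i (w k).1)
     + bundle_normsq (s + 1 / 2) (t + 1 / 2) (w k).1 + bundle_normsq (s + 3 / 2) (t + 3 / 2) (w k).2).
  have [sw1 sw2] := Dw k.
  have e1 : \sum_i bundle_norm (s + 1 / 2) (t + 1 / 2) (Xi i (w k).1) ^+ 2 =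
      \sum_i bundle_normsq (s + 1 / 2) (t + 1 / 2) (Xi i (w k).1).
    by apply: eq_bigr => i _; have [D _] := cX i; exact: (sq _ _ _ (D k)).
  exact: (f_equal (fun x => 2 * a_const R m.+2 * x)
    (f_equal2 +%R (f_equal2 +%R e1 (sq _ _ _ sw1)) (sq _ _ _ sw2))).
have wS k : pair_norm s t (w k) <= Num.sqrt (S k).
  by apply: ler_wsqrtr; rewrite SE; exact: (pair_normsq_le s ht (gw k) a0).
set L := field_space_norm s t f.
set T := \sum_i _ ^+ 2 + _ + _.
have SL : S @ \oo --> 2 * a_const R m.+2 * T.
  apply: cvgM; first exact: cvg_cst.
  apply: cvgD; first apply: cvgD.
  - apply: (cvg_finsum (v := fun i k => bundle_norm (s + 1 / 2) (t + 1 / 2) (Xi i (w k).1) ^+ 2)) => i.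
    by apply: cvg_sq; exact: (bundle_limit ht1 (cX i)).
  - by apply: cvg_sq; exact: (bundle_limit ht1 c1).
  - by apply: cvg_sq; exact: (bundle_limit ht3 c2).
(* The norm of u k is that of its ray pair, hence at most the norm of w k plus a distance that tends
   to 0 because w lies in the class of the ray pairs. *)
have rL : (fun k => Num.sqrt (S k) + pair_norm s t (w k - ray_pair (u k))) @ \oo -->
    Num.sqrt (2 * a_const R m.+2 * T).
  rewrite -[X in _ --> X]addr0; apply: cvgD; last exact: wu.
  by apply: continuous_cvg => //; exact: sqrt_continuous.
have LT : L <= Num.sqrt (2 * a_const R m.+2 * T).
  apply: (ler_cvg_to uL rL); near=> k.
  rewrite /= -(pair_norm_ray (Du k) s ht).
  apply: (le_trans (pair_norm_triangle s ht (gT k) (gw k))).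
  by rewrite (pair_normC s ht (gT k) (gw k)) lerD2r.
have L0 : 0 <= L.
  have c0 : (fun _ : nat => 0 : R) @ \oo --> (0 : R) by exact: cvg_cst.
  by apply: (ler_cvg_to c0 uL); near=> k; exact: sqrtr_ge0.
have T0 : 0 <= 2 * a_const R m.+2 * T.
  apply: mulr_ge0; first exact: mulr_ge0.
  by apply: addr_ge0; [apply: addr_ge0; [apply: sumr_ge0 => i _|]|]; exact: sqr_ge0.
by rewrite -(sqr_sqrtr T0) lerXn2r ?nnegrE ?sqrtr_ge0.
Unshelve. all: by end_near. Qed.

(** The right side is an infimum over admissible w, so a lower bound valid for each is enough; it
    covers the empty case, where the infimum is +oo. Dividing by 2 a_n requires a_n > 0. *)
Lemma stability_estimate (f : set (nat -> 'I_m.+2 -> E -> R[i])) : field_space s t f ->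
  ((field_space_norm s t f ^+ 2)%:E
     <= (2 * a_const R m.+2)%:E * stability_sum s t (ray_pair_ext s t f))%E.
Proof.
move=> ff; have a0 : 0 < 2 * a_const R m.+2 by rewrite mulr_gt0// a_const_gt0.
have lb : ((field_space_norm s t f ^+ 2 / (2 * a_const R m.+2))%:E <=
    stability_sum s t (ray_pair_ext s t f))%E.
  apply: le_ereal_inf_tmp => _ [w [cw cX c1 c2] <-].
  by rewrite lee_fin ler_pdivrMr// mulrC; exact: stability_element.
rewrite -[X in X%:E](@divfK _ (2 * a_const R m.+2)) ?gt_eqF// mulrC EFinM.
by rewrite lee_pmul2l// lte_fin.
Qed.

End Stability.

Theorem corollary4p7 (R : realType) (n : nat) (s t : R)
    (f : set (nat -> 'I_n -> 'rV[R]_n -> R[i])) :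
  (2 <= n)%N -> - (n%:R / 2) < t -> field_space s t f ->
  ((field_space_norm s t f ^+ 2)%:E
     <= (2 * a_const R n)%:E * stability_sum s t (ray_pair_ext s t f))%E.
Proof.
(* With n = m + 2 the fibres have dimension m + 1, which is positive. *)
by case: n f => [|[|m]] f // _ ht ff; exact: (stability_estimate ht ff).
Qed.
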